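(* Let $\Lambda$ be the functor from nonempty finite sets and all maps to graded $\mathbb{Q}$-algebras defined as follows: $\Lambda(S)$ is the supercommutative algebra generated by degree-one elements $\omega_{ijkl}$, $i,j,k,l\in S$, antisymmetric in the indices, with relations $\omega_{ijkl}+\omega_{jklm}+\omega_{klmi}+\omega_{lmij}+\omega_{mijk}=0$ and $\omega_{ijkl}\omega_{ijkm}=0$ for distinct $i,j,k,l,m$, and $\Lambda(f)(\omega_{ijkl})=\omega_{f(i)f(j)f(k)f(l)}$ (zero if two indices coincide). Then its extended cycle index is \[ Z^+_\Lambda=\frac{-p_1t+\operatorname{Cosh}^\sim\bigl[\operatorname{Arcsinh}^\sim[t^{1/2}p_1]\bigr]}{1-t}\,\operatorname{Exp}\bigl[t^{-1/2}\operatorname{Arcsinh}^\sim[t^{1/2}p_1]\bigr]. \] In particular $C_\Lambda=1/(1-t)$.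
   Context: Cycle index of a graded representation $R$ restricted to bijections: $Z_R=\sum_{n\ge1}\frac1{n!}\sum_{\pi\in S_n}\sum_k(-t)^k\operatorname{Tr}(\pi\mid R(\{1,\dots,n\})_k)\prod_ip_i^{n_i(\pi)}$, $n_i(\pi)$ the number of $i$-cycles. For each homogeneous component $\Lambda_k$ (whose dimension grows polynomially in $|S|$) there is a unique constant $C_{\Lambda_k}$ such that $\operatorname{Exp}^{-1}(C_{\Lambda_k}+Z_{\Lambda_k})$ is a polynomial in the $p_i$; $C_\Lambda:=\sum_k(-t)^kC_{\Lambda_k}$ and the extended cycle index is $Z^+_\Lambda:=C_\Lambda+Z_\Lambda$. Plethysm: $F[G]:=F(t,G(t,p_1,p_2,\dots),G(t^2,p_2,p_4,\dots),\dots)$ (with $t^{1/2}\mapsto t^{k/2}$ in the $k$-th slot). $\operatorname{Exp}=\exp(\sum_ip_i/i)$, $\operatorname{Sinh},\operatorname{Cosh}=\tfrac12\bigl(\exp(\sum_ip_i/i)\mp\exp(\sum_i(-1)^ip_i/i)\bigr)$, $F^\sim:=F(t,p_1,-p_2,p_3,-p_4,\dots)$, and $\operatorname{Arcsinh}^\sim$ is the unique symmetric function without constant term with $\operatorname{Sinh}^\sim[\operatorname{Arcsinh}^\sim]=\operatorname{Arcsinh}^\sim[\operatorname{Sinh}^\sim]=p_1$. *)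

(* Defs.v *)
From HB Require Import structures.
From mathcomp Require Import all_boot all_order all_fingroup all_algebra.
Set Implicit Arguments. Unset Strict Implicit. Unset Printing Implicit Defensive.
Import GRing.Theory Num.Theory.
Local Open Scope ring_scope.

(* Lambda(S) is realized as T(F)/J where F is the Q-vector space with basis  *)
(* the symbols omega_t, t a 4-tuple of elements of S, T(F) is the tensor     *)
(* algebra (degree-k part: basis = words of k symbols), and J is the         *)
(* two-sided ideal generated by                                              *)
(*   (R1) antisymmetry      omega_{t o sigma} - sgn(sigma) omega_t           *)
(*   (R2) five-term         w_ijkl + w_jklm + w_klmi + w_lmij + w_mijk       *)
(*   (R3) supercommutativity of the degree-one generators   x y + y x        *)
(*   (R4) quadratic         w_ijkl w_ijkm                                    *)
(* with i,j,k,l,m distinct in (R2),(R4).  J is homogeneous, and J_k is the   *)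
(* span of all  u (x) r (x) v  with u, v words and r a relation.             *)

Section Lambda.
Variable n : nat.

Definition gen : finType := 4.-tuple 'I_n.
Definition om4 (a b c d : 'I_n) : gen := [tuple a; b; c; d].

(* formal linear combinations of words *)
Definition lc := seq (rat * seq gen).

Definition rels_antisym : seq lc :=
  [seq [:: (1, [:: [tuple tnth t (s i) | i < 4]]); (- ((-1) ^+ odd_perm s), [:: t])]
  | t : gen <- enum {: gen}, s : 'S_4 <- enum {: 'S_4}].

Definition inj5 : seq (5.-tuple 'I_n) := [seq u <- enum {: 5.-tuple 'I_n} | uniq (val u)].

Definition rels_five : seq lc :=
  [seq let a := tnth u 0 in let b := tnth u 1 in let c := tnth u 2 in
       let d := tnth u 3 in let e := tnth u 4 in
       [:: (1, [:: om4 a b c d]); (1, [:: om4 b c d e]); (1, [:: om4 c d e a]);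
           (1, [:: om4 d e a b]); (1, [:: om4 e a b c])]
  | u <- inj5].

Definition rels_supercomm : seq lc :=
  [seq [:: (1, [:: x; y]); (1, [:: y; x])] | x <- enum {: gen}, y <- enum {: gen}].

Definition rels_quad : seq lc :=
  [seq let a := tnth u 0 in let b := tnth u 1 in let c := tnth u 2 in
       let d := tnth u 3 in let e := tnth u 4 in
       [:: (1, [:: om4 a b c d; om4 a b c e])]
  | u <- inj5].

Definition rels : seq lc := rels_antisym ++ rels_five ++ rels_supercomm ++ rels_quad.

(* degree (word length) of a homogeneous relation *)
Definition rdeg (r : lc) : nat := size (head (0, [::]) r).2.

Definition words (m : nat) : seq (seq gen) := [seq val w | w <- enum {: m.-tuple gen}].

Definition Jgen (k : nat) : seq lc :=
  flatten [seq flatten [seq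
    [seq [seq (x.1, u ++ x.2 ++ v) | x <- r] | u <- words a, v <- words (k - a - rdeg r)]
  | a <- iota 0 k.+1] | r <- rels].

Definition Tdim (k : nat) := #|{: k.-tuple gen}|.
Definition vec (k : nat) (r : lc) : 'rV[rat]_(Tdim k) :=
  \row_i \sum_(x <- r) x.1 * (x.2 == val (enum_val i))%:R.

Definition Jk (k : nat) : 'M[rat]_(Tdim k) := (\sum_(r <- Jgen k) <<vec k r>>)%MS.

Definition act (k : nat) (p : 'S_n) (w : k.-tuple gen) : k.-tuple gen :=
  map_tuple (fun t : gen => map_tuple p t) w.
Definition Pmx (k : nat) (p : 'S_n) : 'M[rat]_(Tdim k) :=
  \matrix_(i, j) (act p (enum_val i) == enum_val j)%:R.

(* Trace of p on Lambda_k = T^k(F)/J_k: the rows of Cb k map to a basis of   *)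
(* the quotient; for a row c, c P is congruent mod J_k to c P Pr, which lies *)
(* in the row space of Cb k, whose coordinates are given by pinvmx.  Hence   *)
(* the matrix below is the matrix of the induced map on the quotient.        *)
Definition Cb (k : nat) := row_base ((Jk k)^C)%MS.
Definition Prj (k : nat) := proj_mx ((Jk k)^C)%MS (Jk k).
Definition trLambda (k : nat) (p : 'S_n) : rat :=
  \tr (Cb k *m Pmx k p *m Prj k *m pinvmx (Cb k)).

End Lambda.

Definition ctype (m : nat) (p : 'S_m) : seq nat :=
  sort geq [seq #|X| | X : {set 'I_m} <- enum (porbits p)].

(* A series is given by its coefficients: F j l is the coefficient of         *)
(* s^j p_l, where s = t^(1/2) and l is a partition (nonincreasing list of     *)
(* positive integers) with p_l = prod_(i in l) p_i.  Only partitions l are    *)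
(* meaningful; equality of series is equality on partitions.                  *)
Definition series := nat -> seq nat -> rat.
Definition is_part (l : seq nat) : bool := sorted geq l && all (fun x => 0 < x)%N l.
Definition ser_eq (F G : series) : Prop := forall j l, is_part l -> F j l = G j l.

Definition sadd (F G : series) : series := fun j l => F j l + G j l.
Definition sopp (F : series) : series := fun j l => - F j l.
Definition sscale (a : rat) (F : series) : series := fun j l => a * F j l.

Fixpoint bitseqs (m : nat) : seq bitseq :=
  if m is m'.+1 then [seq b :: s | b <- [:: true; false], s <- bitseqs m'] else [:: [::]].
(* all ways to write the multiset l as a union of two multisets *)
Definition splits (l : seq nat) : seq (seq nat * seq nat) :=
  undup [seq (mask m l, mask (map negb m) l) | m <- bitseqs (size l)].

Definition sone : series := fun j l => ((j == 0%N) && (l == [::]))%:R.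
Definition smul (F G : series) : series := fun j l =>
  \sum_(j1 < j.+1) \sum_(x <- splits l) F j1 x.1 * G (j - j1)%N x.2.
Definition spow (F : series) (m : nat) : series := iter m (smul F) sone.
(* exponential of a series without constant term *)
Definition sexp (F : series) : series := fun j l =>
  \sum_(m < (j + sumn l).+1) (m`!%:R)^-1 * spow F m j l.

(* partitions of m with parts <= b (fuel >= m) *)
Fixpoint partsb (fuel m b : nat) : seq (seq nat) :=
  if m == 0%N then [:: [::]] else
  match fuel with
  | 0 => [::]
  | fuel'.+1 => flatten [seq [seq i :: q | q <- partsb fuel' (m - i) i] | i <- iota 1 (minn m b)]
  end.
Definition parts_upto (N : nat) : seq (seq nat) :=
  flatten [seq partsb k k k | k <- iota 0 N.+1].

(* G(t^m, p_m, p_2m, ...)  with  t^(1/2) |-> t^(m/2) *)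
Definition sdil (m : nat) (G : series) : series := fun j l =>
  if (m %| j)%N && all (fun x => m %| x)%N l then G (j %/ m)%N (map (fun x => x %/ m)%N l) else 0.
Definition sprod_over (mu : seq nat) (G : series) : series :=
  foldr (fun m acc => smul (sdil m G) acc) sone mu.
(* plethysm F[G] = F(t, G(t,p1,p2,..), G(t^2,p2,p4,..), ...), G without
   constant term *)
Definition pleth (F G : series) : series := fun j l =>
  \sum_(j1 < j.+1) \sum_(mu <- parts_upto (j + sumn l)) F j1 mu * sprod_over mu G (j - j1)%N l.

Definition Psum : series := fun j l =>
  if j == 0%N then (if l is [:: i] then (i%:R)^-1 else 0) else 0.
Definition Psum_alt : series := fun j l =>
  if j == 0%N then (if l is [:: i] then (-1) ^+ i / i%:R else 0) else 0.

Definition ExpS : series := sexp Psum.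
Definition ExpInv : series := sexp (sopp Psum).
Definition SinhS : series := sscale (1/2) (sadd (sexp Psum) (sopp (sexp Psum_alt))).
Definition CoshS : series := sscale (1/2) (sadd (sexp Psum) (sexp Psum_alt)).
(* F~ := F(t, p1, -p2, p3, -p4, ...) *)
Definition tilde (F : series) : series := fun j l =>
  (-1) ^+ count (fun x => ~~ odd x) l * F j l.

Definition p1 : series := fun j l => ((j == 0%N) && (l == [:: 1%N]))%:R.
Definition sqrt_t_p1 : series := fun j l => ((j == 1%N) && (l == [:: 1%N]))%:R.
Definition t_p1 : series := fun j l => ((j == 2%N) && (l == [:: 1%N]))%:R.
Definition inv_one_minus_t : series := fun j l => ((~~ odd j) && (l == [::]))%:R.

Definition is_arcsinh_tilde (A : series) : Prop :=
  (forall j l, is_part l -> (0 < j)%N -> A j l = 0) /\ A 0%N [::] = 0 /\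
  ser_eq (pleth (tilde SinhS) A) p1 /\ ser_eq (pleth A (tilde SinhS)) p1.

Definition spoly (F : series) : Prop :=
  exists N, forall j l, is_part l -> (N < j + sumn l)%N -> F j l = 0.

Definition Zk (k : nat) : series := fun j l =>
  if (j == 0%N) && (0 < sumn l)%N then
    ((sumn l)`!%:R)^-1 *
      \sum_(p : 'S_(sumn l) | ctype p == l) trLambda k p
  else 0.

Definition Zk_plus (k : nat) (c : rat) : series := sadd (Zk k) (sscale c sone).

Definition C_Lambda (c : nat -> rat) : series := fun j l =>
  if odd j then 0 else (-1) ^+ (j./2) * c j./2 * (l == [::])%:R.
Definition Z_Lambda : series := fun j l =>
  if odd j then 0 else (-1) ^+ (j./2) * Zk j./2 0%N l.
Definition Zext (c : nat -> rat) : series := sadd (C_Lambda c) Z_Lambda.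

(* t^(-1/2) Arcsinh~[t^(1/2) p1]  (the latter series is divisible by s) *)
Definition Xarg (A : series) : series := fun j l => pleth A sqrt_t_p1 j.+1 l.

Definition Zext_formula (A : series) : series :=
  smul inv_one_minus_t
    (smul (sadd (sopp t_p1) (pleth (tilde CoshS) (pleth A sqrt_t_p1)))
          (pleth ExpS (Xarg A))).

(* Main.v *)
(* Lambda_k(S) is studied through its dual, the functionals on words of length k that kill the
   relations. Singling out a point oo and keeping the letters omega_(abc oo) identifies Lambda on
   N u {oo} with an algebra on triples of N; there words decompose into blocks of 2r+1 points
   carrying r letters, so its cycle index P is Exp[x] with x(l) = s^(|l|-1) a(l). Evaluating on
   a letter through two fixed points splits a block into three; with D = d/dp_1 and u = D a,
     D u = - p_1 u^3,
   so that c = 1/u satisfies D c = p_1 u.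
   Put Y = (C - t p_1) P with C = c(s p_1, s^2 p_2, ...). Then D Y = (1 - t) P = (1 - t) D Z, where Z
   is the cycle index of Lambda. The difference Y - (1 - t) Z is thus free of p_1; since the
   functoriality of Lambda_k under non-injective maps makes Z_k Exp^(-1) polynomial in p_1, and
   Y Exp^(-1) has bounded degree at every order of t, the difference is a constant, namely 1.
   At t = 1 this reads (c - p_1) Exp[a] = 1. Comparing it with its image under p_i -> (-1)^i p_i
   shows that (p_1, c) solves the differential system of (Sinh~[a], Cosh~[a]); hence
   a = Arcsinh~ and c = Cosh~[Arcsinh~]. *)
From HB Require Import structures.
From mathcomp Require Import all_boot all_order all_fingroup all_algebra.
From mathcomp Require Import boolp.
From mathcomp Require Import ring lra zify.
Require Import Defs.
Set Implicit Arguments. Unset Strict Implicit. Unset Printing Implicit Defensive.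
Import Order.TTheory GRing.Theory Num.Theory.
Local Open Scope ring_scope.

(** * Power series in scaled coordinates *)

(** Everything rests on one bound: a functional vanishes on a word that puts m/2 or more letters
    inside m > 0 points ([vanish]). Hence a block of 2r+1 points holds at most r letters, a set of
    even size contributes nothing in degree half its size, and products of functionals over
    saturated blocks are dual to concatenated words. All traces are computed with such dual systems,
    never with bases of the algebra itself. Splitting a block by the letters through two points is
    an isomorphism: it is injective because a saturated functional that kills a pair of points is
    zero, and surjective because an explicit glued product is triangular for the inclusion of
    blocks. The bound on the degree of Y Exp^(-1) comes from Exp[x - p_1]: there s^(|l|-1) occurs
    only with |l| >= 3, and then |l| - 1 >= 2|l|/3, so s^j goes with degree at most 3j/2. For
    Lambda_k, where j = 2k, this is degree 3k; the constant 1 in Y, divided by 1 - t, yields (-1)^k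
    as the constant of Lambda_k. *)

(* A symmetric power series over Q[s], s = t^(1/2), is stored as the function sending a list [l]
   of cycle lengths to z_l times the coefficient of p_l, with 'X for s. In this normalization
   i d/dp_i is [hD i], Exp is constantly 1, and a cycle index becomes its character. *)
Definition hat := seq nat -> {poly rat}.

HB.instance Definition _ := gen_eqMixin hat.
HB.instance Definition _ := gen_choiceMixin hat.

Definition hadd (F G : hat) : hat := fun l => F l + G l.
Definition hopp (F : hat) : hat := fun l => - F l.
Definition hzero : hat := fun=> 0.
Definition hone : hat := fun l => (l == [::])%:R.
Definition hD (a : nat) (F : hat) : hat := fun l => F (a :: l).

(** The Leibniz rule for all [hD a], used as the definition of the product; in scaled coordinates no
    multinomial factors appear. *)
Fixpoint hmulf (F G : hat) (l : seq nat) : {poly rat} :=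
  if l is a :: l' then hmulf (hD a F) G l' + hmulf F (hD a G) l'
  else F [::] * G [::].
Definition hmul (F G : hat) : hat := hmulf F G.

Lemma haddA : associative hadd.
Proof. by move=> F G H; apply/funext => l; rewrite /hadd addrA. Qed.
Lemma haddC : commutative hadd.
Proof. by move=> F G; apply/funext => l; rewrite /hadd addrC. Qed.
Lemma hadd0 : left_id hzero hadd.
Proof. by move=> F; apply/funext => l; rewrite /hadd add0r. Qed.
Lemma haddN : left_inverse hzero hopp hadd.
Proof. by move=> F; apply/funext => l; rewrite /hadd addNr. Qed.

HB.instance Definition _ := GRing.isZmodule.Build hat haddA haddC hadd0 haddN.

Lemma hmulDl : left_distributive hmul hadd.
Proof.
move=> F G H; apply/funext => l; rewrite /hmul /hadd /=.
elim: l F G H => [|a l IHl] F G H /=; first by rewrite mulrDl.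
by rewrite -/(hadd _ _) [X in _ = X]addrACA -!IHl.
Qed.

Lemma hmulC : commutative hmul.
Proof.
move=> F G; apply/funext; rewrite /hmul => l.
by elim: l F G => [|a l IHl] F G /=; rewrite ?(mulrC (F _)) // addrC !(IHl G) !(IHl F) (IHl (hD a G)).
Qed.

Lemma hDM (a : nat) (F G : hat) : hD a (hmul F G) = hadd (hmul (hD a F) G) (hmul F (hD a G)).
Proof. by []. Qed.

Lemma hmulA : associative hmul.
Proof.
move=> F G H; apply/funext => l.
elim: l F G H => [|a l IHl] F G H; first by rewrite /hmul /= mulrA.
rewrite -[LHS]/(hD a (hmul F (hmul G H)) l) -[RHS]/(hD a (hmul (hmul F G) H) l).
rewrite !hDM (hmulC F (hadd _ _)) !hmulDl /hadd.
by rewrite !(hmulC _ F) !IHl addrA.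
Qed.

Lemma hmul1 : left_id hone hmul.
Proof.
move=> F; apply/funext => l; elim: l F => [|a l IHl] F; first by rewrite /hmul /= mul1r.
rewrite -[LHS]/(hD a (hmul hone F) l) hDM /hadd IHl.
have -> : hD a hone = hzero by apply/funext => l'.
have hmul0 (G : hat) : hmul hzero G = hzero.
  apply/funext => m; elim: m G => [|b m IHm] G; first by rewrite /hmul /= mul0r.
  rewrite -[LHS]/(hD b (hmul hzero G) m) hDM /hadd (_ : hD b hzero = hzero) //.
  by rewrite !IHm addr0.
rewrite hmul0.
by rewrite add0r.
Qed.

Lemma hone_neq0 : hone != hzero.
Proof. by apply/eqP => /(congr1 (fun F => F [::])) /eqP; rewrite oner_eq0. Qed.

HB.instance Definition _ :=
  GRing.Zmodule_isComNzRing.Build hat hmulA hmulC hmul1 hmulDl hone_neq0.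

Lemma hatDE (F G : hat) l : (F + G) l = F l + G l. Proof. by []. Qed.
Lemma hatNE (F : hat) l : (- F) l = - F l. Proof. by []. Qed.
Lemma hat0E l : (0 : hat) l = 0. Proof. by []. Qed.
Lemma hat1E l : (1 : hat) l = (l == [::])%:R. Proof. by []. Qed.
Lemma hatM_nil (F G : hat) : (F * G) [::] = F [::] * G [::]. Proof. by []. Qed.
Lemma hatM_cons (F G : hat) a l : (F * G) (a :: l) = (hD a F * G) l + (F * hD a G) l.
Proof. by []. Qed.

Lemma hat_sumE (I : Type) (r : seq I) (P : pred I) (F : I -> hat) l :
  (\sum_(i <- r | P i) F i) l = \sum_(i <- r | P i) F i l.
Proof. by apply: (big_morph (fun F : hat => F l)). Qed.

Lemma hD_add a (F G : hat) : hD a (F + G) = hD a F + hD a G. Proof. by []. Qed.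
Lemma hD_opp a (F : hat) : hD a (- F) = - hD a F. Proof. by []. Qed.
Lemma hD_mul a (F G : hat) : hD a (F * G) = hD a F * G + F * hD a G. Proof. by []. Qed.
Lemma hD_1 a : hD a 1 = 0. Proof. by apply/funext => l. Qed.
Definition hC (c : {poly rat}) : hat := fun l => c * (l == [::])%:R.
Lemma hD_C a c : hD a (hC c) = 0.
Proof. by apply/funext => l; rewrite /hD /hC mulr0. Qed.
Lemma hCM c (F : hat) l : (hC c * F) l = c * F l.
Proof.
elim: l F => [|a l IHl] F; first by rewrite hatM_nil /hC mulr1.
by rewrite hatM_cons hD_C mul0r hat0E add0r IHl.
Qed.

Lemma hmul_eq_le n (F F' G G' : hat) :
  (forall l, (sumn l <= n)%N -> F l = F' l) -> (forall l, (sumn l <= n)%N -> G l = G' l) ->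
  forall l, (sumn l <= n)%N -> (F * G) l = (F' * G') l.
Proof.
move=> eF eG l; elim: l n F F' G G' eF eG => [|a l IHl] n F F' G G' eF eG /= le_n.
  by rewrite !hatM_nil eF ?eG.
have ltn : (sumn l <= n - a)%N by lia.
rewrite !hatM_cons; congr (_ + _); apply: (IHl (n - a)%N) => // m le_m;
  by rewrite /hD ?eF ?eG //= ; lia.
Qed.

Lemma hat_ext (F G : hat) : F [::] = G [::] -> (forall a, hD a F = hD a G) -> F = G.
Proof.
move=> e0 eD; apply/funext => -[//|a l].
by rewrite -[LHS]/(hD a F l) eD.
Qed.

(** A value on a list of length n+1 is a value of the right-hand side on its tail, and there the
    products involve the unknowns only on lists of length at most n. So the constant terms and the
    equations determine the solution. *)
Lemma hat_ode2 (f g : nat -> hat) (F G F' G' : hat) :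
  F [::] = F' [::] -> G [::] = G' [::] ->
  (forall m, hD m F = f m * G - g m * F) -> (forall m, hD m G = f m * F - g m * G) ->
  (forall m, hD m F' = f m * G' - g m * F') -> (forall m, hD m G' = f m * F' - g m * G') ->
  F = F' /\ G = G'.
Proof.
move=> eF eG dF dG dF' dG'.
have H n l : (size l <= n)%N -> F l = F' l /\ G l = G' l.
  elim: n l => [|n IHn] [|a l] //= le_n.
  have mulE (h X X' : hat) (e : forall m, (size m <= n)%N -> X m = X' m) m :
      (size m <= n)%N -> (h * X) m = (h * X') m.
    elim: m h n {IHn le_n} X X' e => [|b m IHm] h n' X X' e /= le_m.
      by rewrite !hatM_nil e.
    rewrite !hatM_cons; congr (_ + _).
      by apply: (IHm _ n') => //; apply: ltnW.
    by apply: (IHm _ n'.-1) => [m' le_m'|]; rewrite /hD ?e //=; lia.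
  rewrite -![_ (a :: l)]/(hD a _ l) dF dG dF' dG' !hatDE !hatNE.
  by split; congr (_ - _); apply: mulE => // m /IHn[].
by split; apply/funext => l; have [] := H _ l (leqnn _).
Qed.

(* F(t^i, p_i, p_2i, ...); the power of i is the ratio z_l / z_(l/i). *)
Definition hpsi (i : nat) (F : hat) : hat := fun l =>
  if all (dvdn i) l then (i ^ size l)%:R * (F [seq (x %/ i)%N | x <- l] \Po 'X^i) else 0.

Lemma hD_psi a i (F : hat) :
  hD a (hpsi i F) = if (i %| a)%N then hC i%:R * hpsi i (hD (a %/ i) F) else 0.
Proof.
apply/funext => l; case: ifP => [ia|ia]; rewrite ?hCM /hD /hpsi /= ia //=.
by case: ifP => // _; rewrite ?mulr0 // expnS natrM mulrA.
Qed.

Lemma hpsi_sub i (F G : hat) : hpsi i (F - G) = hpsi i F - hpsi i G.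
Proof.
apply/funext => l; rewrite hatDE hatNE /hpsi; case: ifP => _; last by rewrite subr0.
by rewrite hatDE hatNE comp_polyB mulrBr.
Qed.

Definition hsym (F : hat) := forall l l', perm_eq l l' -> F l = F l'.
(** A part 0 would be a variable of degree 0. Series that ignore it have finitely many partitions to
    consider in each degree, and [[::]] is the only one of degree 0. *)
Definition hpos (F : hat) := forall l, 0%N \in l -> F l = 0.

Lemma hmul_pos (F G : hat) : hpos F -> hpos G -> hpos (F * G).
Proof.
have aux (H K : hat) : hpos H -> forall a, hpos (hD a H).
  by move=> hH a l l0; apply: hH; rewrite in_cons l0 orbT.
have D0 (H : hat) : hpos H -> hD 0 H = 0.
  by move=> hH; apply/funext => l; apply: hH; rewrite in_cons eqxx.
move=> hF hG l; elim: l F G hF hG => [//|a l IHl] F G hF hG.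
rewrite in_cons hatM_cons => /orP[/eqP <-|l0].
  by rewrite !D0 // mul0r mulr0 addr0.
by rewrite !IHl ?addr0 //; apply: aux.
Qed.

Definition hp1 : hat := fun l => (l == [:: 1%N])%:R.

Lemma hD_p1 a : hD a hp1 = if a == 1%N then 1 else 0.
Proof.
apply/funext => l; rewrite /hD /hp1; case: (eqVneq a 1%N) => [->|a1].
  by rewrite eqseq_cons eqxx.
by rewrite eqseq_cons (negbTE a1).
Qed.

(** * Partitions, the numbers z_l, and splits of a multiset *)

(** Neighbor swaps carry the head of [l] to its place in [l']; the prefix [u] absorbs the entries
    already in place. *)
Lemma perm_swap_ind (T : eqType) (X : Type) (F : seq T -> X) :
  (forall u a b v, F (u ++ a :: b :: v) = F (u ++ b :: a :: v)) ->
  forall l l', perm_eq l l' -> F l = F l'.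
Proof.
move=> sw l l'; rewrite -[l]cat0s -[l']cat0s; move: [::] => u.
elim: l l' u => [|a l IHl] l' u; rewrite perm_cat2l.
  by move/perm_size/eqP; rewrite eq_sym size_eq0 => /eqP ->.
move=> pl; have al' : a \in l' by rewrite -(perm_mem pl) mem_head.
case/splitPr: al' pl => p1 p2 pl.
have {}pl : perm_eq l (p1 ++ p2).
  by rewrite -(perm_cons a) (perm_trans pl) // perm_catC /= perm_cons perm_catC.
rewrite -cat_rcons (IHl (p1 ++ p2) (rcons u a)) ?perm_cat2l // cat_rcons.
elim: p1 u {IHl pl} => [//|b p1 IHp] u /=.
by rewrite sw -[in LHS]cat_rcons IHp cat_rcons.
Qed.

(* z_l, the product of i^(m_i) m_i! over the multiplicities m_i of the parts. *)
Fixpoint zz (l : seq nat) : nat :=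
  if l is a :: l' then a * (count_mem a l').+1 * zz l' else 1.

Lemma zz_perm l l' : perm_eq l l' -> zz l = zz l'.
Proof.
apply: perm_swap_ind => u a b v; elim: u => [|c u IHu] /=; last first.
  by rewrite IHu !count_cat /= !addnA (addnAC _ (a == c)).
case: (eqVneq a b) => [-> //|ab]; rewrite /= ?add0n; lia.
Qed.

Lemma zz_gt0 l : 0%N \notin l -> (0 < zz l)%N.
Proof.
elim: l => [//|a l IHl] /=; rewrite in_cons negb_or => /andP[a0 /IHl].
by move=> z0; rewrite !muln_gt0 z0 andbT andbT; lia.
Qed.

Lemma geq_trans : transitive geq. Proof. by move=> a b c /= h1 h2; lia. Qed.
Lemma geq_total : total geq. Proof. by move=> a b /=; case: leqP => //; lia. Qed.
Lemma geq_anti : antisymmetric geq. Proof. by move=> a b /=; lia. Qed.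

Lemma part_pos l : is_part l -> 0%N \notin l.
Proof. by case/andP=> _ /allP h; apply/negP => /h. Qed.

Lemma is_partP l : is_part l = sorted geq l && (0%N \notin l).
Proof.
rewrite /is_part; congr andb; elim: l => [//|a l /= ->].
by rewrite in_cons negb_or lt0n eq_sym.
Qed.

Lemma zz_part_neq0 l : is_part l -> (zz l)%:R != 0 :> rat.
Proof. by move/part_pos/zz_gt0; rewrite pnatr_eq0 lt0n. Qed.

(** One pair per mask, hence with repetitions, whereas [splits] keeps each pair once. *)
Definition mk (l : seq nat) : seq (seq nat * seq nat) :=
  [seq (mask m l, mask (map negb m) l) | m <- bitseqs (size l)].

Lemma mk_cons a l :
  mk (a :: l) = [seq (a :: x.1, x.2) | x <- mk l] ++ [seq (x.1, a :: x.2) | x <- mk l].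
Proof. by rewrite /mk /= cats0 map_cat -!map_comp. Qed.

Lemma hatM_mk (F G : hat) l : (F * G) l = \sum_(x <- mk l) F x.1 * G x.2.
Proof.
elim: l F G => [|a l IHl] F G; first by rewrite big_seq1.
by rewrite hatM_cons !IHl mk_cons big_cat !big_map.
Qed.

Lemma mk_mem l x : x \in mk l -> perm_eq (x.1 ++ x.2) l.
Proof.
elim: l x => [|a l IHl] x; first by rewrite inE => /eqP ->.
rewrite mk_cons mem_cat => /orP[] /mapP[y /IHl py ->] /=; first by rewrite perm_cons.
by rewrite perm_catC /= perm_cons perm_catC.
Qed.

Lemma mk_sorted l x : sorted geq l -> x \in mk l -> sorted geq x.1 && sorted geq x.2.
Proof.
move=> sl /mapP[m _ ->] /=.
by rewrite !(sorted_mask geq_trans).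
Qed.

Lemma mk_part l x : is_part l -> x \in mk l -> is_part x.1 && is_part x.2.
Proof.
rewrite !is_partP => /andP[sl l0] xl; have /andP[-> ->] := mk_sorted sl xl.
by rewrite !andTb -negb_or -mem_cat (perm_mem (mk_mem xl)).
Qed.

Lemma mk_sumn l x : x \in mk l -> (sumn x.1 + sumn x.2 = sumn l)%N.
Proof. by move/mk_mem/perm_sumn; rewrite sumn_cat. Qed.

Lemma mk_count a l y1 y2 : count_mem (y1, y2) (mk (a :: l)) =
  ((if y1 is b :: y then (b == a) * count_mem (y, y2) (mk l) else 0) +
   (if y2 is b :: y then (b == a) * count_mem (y1, y) (mk l) else 0))%N.
Proof.
rewrite mk_cons; move: (mk l) => s; rewrite count_cat !count_map; congr (_ + _)%N.
  case: y1 => [|b y]; first by apply/eqP; rewrite -leqn0 leqNgt -has_count; apply/hasPn.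
  case: (eqVneq b a) => [->|ba]; rewrite ?mul1n ?mul0n.
    by apply: eq_count => -[z1 z2] /=; rewrite -!pair_eqE /= eqseq_cons eqxx.
  apply/eqP; rewrite -leqn0 leqNgt -has_count; apply/hasPn => -[z1 z2] _ /=.
  by rewrite -!pair_eqE /= eqseq_cons eq_sym (negbTE ba).
case: y2 => [|b y]; first by apply/eqP; rewrite -leqn0 leqNgt -has_count; apply/hasPn => -[z1 z2] _ /=; rewrite -pair_eqE /= andbF.
case: (eqVneq b a) => [->|ba]; rewrite ?mul1n ?mul0n.
  by apply: eq_count => -[z1 z2] /=; rewrite -!pair_eqE /= eqseq_cons eqxx.
apply/eqP; rewrite -leqn0 leqNgt -has_count; apply/hasPn => -[z1 z2] _ /=.
by rewrite -!pair_eqE /= eqseq_cons [a == b]eq_sym (negbTE ba) andbF.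
Qed.

Lemma sorted_head_max a y : sorted geq y -> (forall b, b \in y -> b <= a)%N -> a \in y ->
  exists y', y = a :: y'.
Proof.
case: y => [//|b y] /= sy ub; rewrite in_cons => /orP[/eqP ->|ay]; first by exists y.
have /allP/(_ a ay) /= ab := order_path_min geq_trans sy.
by exists y; congr cons; apply: geq_anti; rewrite /= ab ub ?mem_head.
Qed.

(** The multiplicity of a split is a product of binomial coefficients of multiplicities, that is z_l
    over the product of the two smaller z. It converts the product of series into the product in
    scaled coordinates. Sorting puts the largest part first, so a split of [a :: l] arises from one
    of [l] by giving [a] to the head of one side. *)
Lemma mk_zz l y1 y2 : sorted geq l -> sorted geq y1 -> sorted geq y2 ->
  perm_eq (y1 ++ y2) l -> (count_mem (y1, y2) (mk l) * (zz y1 * zz y2) = zz l)%N.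
Proof.
elim: l y1 y2 => [|a l IHl] y1 y2 sl s1 s2 p12.
  by move/perm_size/eqP: p12; rewrite size_cat addn_eq0 !size_eq0 => /andP[/eqP-> /eqP->].
have ub b : b \in y1 ++ y2 -> (b <= a)%N.
  rewrite (perm_mem p12) in_cons => /orP[/eqP -> //|].
  by move: b; apply/allP; apply: order_path_min sl; exact: geq_trans.
have ub1 b : b \in y1 -> (b <= a)%N by move=> b1; apply: ub; rewrite mem_cat b1.
have ub2 b : b \in y2 -> (b <= a)%N by move=> b2; apply: ub; rewrite mem_cat b2 orbT.
have sl' : sorted geq l by apply: path_sorted sl.
have cnt x : (count_mem x y1 + count_mem x y2 = (a == x) + count_mem x l)%N.
  by rewrite -count_cat (seq.permP p12).
rewrite mk_count.
have tl b y : sorted geq (b :: y) -> sorted geq y by move/path_sorted.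
have pl1 y : y1 = a :: y -> perm_eq (y ++ y2) l by move=> e; rewrite -(perm_cons a) -cat_cons -e.
have pl2 y : y2 = a :: y -> perm_eq (y1 ++ y) l.
  by move=> e; rewrite -(perm_cons a) (perm_trans _ p12) // e -cat1s perm_catCA.
have [a1|a1] := boolP (a \in y1); have [a2|a2] := boolP (a \in y2).
- have [z1 e1] := sorted_head_max s1 ub1 a1; have [z2 e2] := sorted_head_max s2 ub2 a2.
  have I1 : (count_mem (z1, y2) (mk l) * (zz z1 * zz y2) = zz l)%N.
    by apply: IHl => //; [apply: (tl a); rewrite -e1|apply: pl1].
  have I2 : (count_mem (y1, z2) (mk l) * (zz y1 * zz z2) = zz l)%N.
    by apply: IHl => //; [apply: (tl a); rewrite -e2|apply: pl2].
  (* Both sides contain [a], with multiplicities n1 + 1 and n2 + 1: the two recursive counts combine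
     as in Pascal's rule. *)
  have ca : (count_mem a l = (count_mem a z1).+1 + count_mem a z2)%N.
    by have := cnt a; rewrite e1 e2 /= eqxx; lia.
  move: I1 I2; rewrite e1 e2 !eqxx !mul1n -e1 -e2.
  move: (count_mem (z1, y2) _) (count_mem (y1, z2) _) => c1 c2.
  rewrite e1 e2 /= ca; move: (zz l) (zz z1) (zz z2) (count_mem a z1) (count_mem a z2).
  by move=> zl zz1 zz2 n1 n2 I1 I2; nia.
- have [z1 e1] := sorted_head_max s1 ub1 a1.
  have I1 : (count_mem (z1, y2) (mk l) * (zz z1 * zz y2) = zz l)%N.
    by apply: IHl => //; [apply: (tl a); rewrite -e1|apply: pl1].
  have -> : (if y2 is b :: y then (b == a) * count_mem (y1, y) (mk l) else 0)%N = 0%N.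
    by case: y2 a2 {ub ub2 cnt s2 p12 pl1 pl2 I1} => [//|b y]; rewrite in_cons negb_or eq_sym => /andP[/negbTE->].
  have := cnt a; rewrite eqxx (count_memPn a2) e1 /= eqxx => ca.
  rewrite mul1n addn0 -I1 -(addnI (etrans (esym (addn0 _)) ca)); ring.
- have [z2 e2] := sorted_head_max s2 ub2 a2.
  have I2 : (count_mem (y1, z2) (mk l) * (zz y1 * zz z2) = zz l)%N.
    by apply: IHl => //; [apply: (tl a); rewrite -e2|apply: pl2].
  have -> : (if y1 is b :: y then (b == a) * count_mem (y, y2) (mk l) else 0)%N = 0%N.
    by case: y1 a1 {ub ub1 cnt s1 p12 pl1 pl2 I2} => [//|b y]; rewrite in_cons negb_or eq_sym => /andP[/negbTE->].
  have := cnt a; rewrite eqxx (count_memPn a1) e2 /= eqxx => ca.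
  rewrite mul1n add0n -I2 -(addnI (etrans (esym (add0n _)) ca)); ring.
have := mem_head a l; rewrite -(perm_mem p12) mem_cat (negbTE a1) (negbTE a2) //.
Qed.

(** * Translation of series into scaled coordinates *)

(** Only partitions are compared, as in [ser_eq]; on unsorted lists and on lists with a part 0 the
    values of [f] stay free. *)
Definition rep (F : series) (f : hat) :=
  forall j l, is_part l -> (zz l)%:R * F j l = (f l)`_j.

Lemma rep_eq F f j l : rep F f -> is_part l -> F j l = (f l)`_j / (zz l)%:R.
Proof. by move=> rF pl; rewrite -(rF j l pl) mulrC mulKf // zz_part_neq0. Qed.

Lemma rep_smul F G f g : rep F f -> rep G g -> rep (smul F G) (f * g).
Proof.
move=> rF rG j l pl; rewrite hatM_mk coef_sum /smul.
under [RHS]eq_bigr do rewrite coefM.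
rewrite [RHS]exchange_big /= mulr_sumr; apply: eq_bigr => j1 _.
(* Equal masks results are grouped, as in [splits]; [mk_zz] gives the size of each group. *)
rewrite -[RHS](big_undup_iterop_count) /= -/(mk l) mulr_sumr big_seq [RHS]big_seq.
apply: eq_bigr => x; rewrite mem_undup => xl.
have /andP[p1 p2] := mk_part pl xl.
have sl : sorted geq l by case/andP: pl.
have /andP[s1 s2] := mk_sorted sl xl.
rewrite -rF // -rG // -(mk_zz sl s1 s2 (mk_mem xl)).
rewrite -[RHS]/(GRing.natmul _ _) !natrM -mulr_natl -surjective_pairing; ring.
Qed.

Lemma rep_sadd F G f g : rep F f -> rep G g -> rep (sadd F G) (f + g).
Proof. by move=> rF rG j l pl; rewrite /sadd mulrDr rF // rG // hatDE coefD. Qed.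
Lemma rep_sopp F f : rep F f -> rep (sopp F) (- f).
Proof. by move=> rF j l pl; rewrite /sopp mulrN rF // hatNE coefN. Qed.
Lemma rep_sscale c F f : rep F f -> rep (sscale c F) (hC c%:P * f).
Proof. by move=> rF j l pl; rewrite /sscale mulrCA rF // hCM coefCM. Qed.
Lemma rep_sone : rep sone 1.
Proof.
move=> j l pl; rewrite /sone hat1E; case: (eqVneq l [::]) => [->|_]; last first.
  by rewrite andbF mulr0 coef0.
by rewrite andbT mul1r coef1.
Qed.

Lemma count_map_div m a l : (0 < m)%N -> (m %| a)%N -> all (dvdn m) l ->
  count_mem (a %/ m)%N [seq (x %/ m)%N | x <- l] = count_mem a l.
Proof.
move=> m0 ma /allP al; rewrite count_map; apply: eq_in_count => x /al mx /=.
by rewrite -(eqn_pmul2r m0) !divnK.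
Qed.

Lemma zz_div m l : (0 < m)%N -> all (dvdn m) l ->
  zz l = (m ^ size l * zz [seq (x %/ m)%N | x <- l])%N.
Proof.
move=> m0; elim: l => [//|a l IHl] /= /andP[ma al].
rewrite count_map_div // IHl // expnS -{1}(divnK ma).
move: (zz _) (_ %/ m)%N (count_mem _ _) (m ^ _)%N => a1 a2 a3 a4; ring.
Qed.

Lemma part_div m l : (0 < m)%N -> all (dvdn m) l -> is_part l ->
  is_part [seq (x %/ m)%N | x <- l].
Proof.
move=> m0 /allP al /andP[sl /allP pl]; apply/andP; split.
  by apply: homo_sorted sl => x y /= h; apply: leq_div2r.
apply/allP => x /mapP[y yl ->]; rewrite divn_gt0 // dvdn_leq ?al // pl //.
Qed.

Lemma coefnM n (p : {poly rat}) i : (n%:R * p)`_i = n%:R * p`_i.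
Proof. by rewrite [in LHS]mulr_natl coefMn [in RHS]mulr_natl. Qed.

Lemma rep_sdil m G g : (0 < m)%N -> rep G g -> rep (sdil m G) (hpsi m g).
Proof.
move=> m0 rG j l pl; rewrite /sdil /hpsi.
case: (boolP (all _ l)) => [al|]; last by rewrite andbF mulr0 coef0.
rewrite andbT [in RHS]mulr_natl coefMn coef_comp_poly_Xn // (zz_div m0 al).
case: ifP => _; last by rewrite mulr0 mul0rn.
by rewrite natrM -mulrA rG ?mulr_natl // part_div.
Qed.

Definition hlin (y : nat -> rat) : hat := fun l => if l is [:: i] then (y i)%:P else 0.
Definition hexp (y : nat -> rat) : hat := fun l => \prod_(i <- l) (y i)%:P.

Lemma hD_lin a y : hD a (hlin y) = hC (y a)%:P.
Proof. by apply/funext => -[|b l]; rewrite /hD /hlin /hC /= ?mulr1 ?mulr0. Qed.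

Lemma hD_exp a y : hD a (hexp y) = hC (y a)%:P * hexp y.
Proof. by apply/funext => l; rewrite hCM /hD /hexp big_cons. Qed.

Lemma hexp_nil y : hexp y [::] = 1. Proof. by rewrite /hexp big_nil. Qed.

(** The m-th power of a linear form lives on lists of length m. Dividing by m! and summing over m
    leaves the multiplicative function [hexp]. *)
Lemma hlinX y m l : (hlin y ^+ m) l = (if size l == m then m`!%:R * hexp y l else 0).
Proof.
elim: l m => [|a l IHl] [|m] //=; rewrite ?hexp_nil ?mulr1 ?expr0 //.
  by rewrite exprS hatM_nil mul0r.
rewrite exprS -[LHS]/(hD a (hlin y * hlin y ^+ m) l).
have -> : hD a (hlin y * hlin y ^+ m) = hC (m.+1%:R * (y a)%:P) * hlin y ^+ m.
  have hCE c d : hC (c * d) = hC c * hC d.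
    by apply/funext => k; rewrite hCM /hC mulrA.
  rewrite -exprS; elim: m {IHl} => [|m IHm].
    by rewrite expr1 expr0 hD_lin mulr1 mul1r.
  rewrite exprS hD_mul IHm hD_lin !hCE mulrCA -exprS -mulrA.
  have -> : hC m.+2%:R = hC m.+1%:R + 1.
    by apply/funext => k; rewrite hatDE /hC hat1E -[m.+2]addn1 natrD mulrDl mul1r.
  by rewrite mulrDl mul1r -mulrA addrC; congr (_ + _); rewrite mulrA.
rewrite hCM IHl eqSS; case: eqP => _; last by rewrite mulr0.
rewrite -[hexp y (a :: l)]/(hD a (hexp y) l) hD_exp hCM factS natrM.
by move: (hexp y l) (y a)%:P m.+1%:R m`!%:R => b1 b2 b3 b4; ring.
Qed.

Lemma rep_spow F f m : rep F f -> rep (spow F m) (f ^+ m).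
Proof.
move=> rF; elim: m => [|m IHm]; first exact: rep_sone.
by rewrite exprS /spow iterS; apply: rep_smul.
Qed.

Lemma size_le_sumn (l : seq nat) : 0%N \notin l -> (size l <= sumn l)%N.
Proof.
elim: l => [//|a l IHl] /=; rewrite in_cons negb_or => /andP[a0 /IHl].
by move=> h; rewrite -add1n leq_add // lt0n eq_sym.
Qed.

Lemma rep_sexp F y : rep F (hlin y) -> rep (sexp F) (hexp y).
Proof.
move=> rF j l pl; rewrite /sexp mulr_sumr.
transitivity (\sum_(m < (j + sumn l).+1) (m == size l :> nat)%:R * (hexp y l)`_j).
  apply: eq_bigr => m _; rewrite mulrCA (rep_spow m rF) // hlinX eq_sym.
  case: eqP => _; last by rewrite coef0 mulr0 mul0r.
  by rewrite coefnM mulrA mulVf // pnatr_eq0 -lt0n fact_gt0.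
(* Parts are positive, so a partition has at most as many parts as its degree, and the truncated
   exponential contains the one term that matters. *)
have lt : (size l < (j + sumn l).+1)%N.
  by rewrite ltnS (leq_trans (size_le_sumn (part_pos pl))) // leq_addl.
by rewrite (bigD1 (Ordinal lt)) //= eqxx mul1r big1 ?addr0 // => i; rewrite -val_eqE /= => /negbTE ->; rewrite mul0r.
Qed.

Lemma part_one i : is_part [:: i] = (0 < i)%N. Proof. by rewrite /is_part /= andbT. Qed.

Lemma rep_Psum : rep Psum (hlin (fun i => (0 < i)%:R)).
Proof.
move=> j [|i [|b l]] pl; rewrite /Psum /hlin; case: (eqVneq j 0%N) => [->|j0];
  rewrite ?mulr0 ?coef0 // coefC ?(negbTE j0) //=.
by rewrite part_one in pl; rewrite pl !muln1 divff // pnatr_eq0 -lt0n.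
Qed.

Lemma rep_Psum_alt : rep Psum_alt (hlin (fun i => (-1) ^+ i *+ (0 < i))).
Proof.
move=> j [|i [|b l]] pl; rewrite /Psum_alt /hlin; case: (eqVneq j 0%N) => [->|j0];
  rewrite ?mulr0 ?coef0 // coefC ?(negbTE j0) //=.
rewrite part_one in pl; rewrite pl !muln1 mulr1n mulrCA divff ?mulr1 //.
by rewrite pnatr_eq0 -lt0n.
Qed.

Definition hE : hat := hexp (fun i => (0 < i)%:R).
Definition hEinv : hat := hexp (fun i => - (0 < i)%:R).

Lemma rep_ExpS : rep ExpS hE. Proof. exact: rep_sexp rep_Psum. Qed.
Lemma rep_ExpInv : rep ExpInv hEinv.
Proof.
apply: rep_sexp; have -> : hlin (fun i => - (0 < i)%:R) = - hlin (fun i => (0 < i)%:R).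
  by apply/funext => -[|i [|b l]]; rewrite hatNE /hlin ?oppr0 ?polyCN.
exact: rep_sopp rep_Psum.
Qed.

Lemma hEEinv : hE * hEinv = 1.
Proof.
apply: hat_ext => [|a]; first by rewrite hatM_nil /hE /hEinv !hexp_nil mulr1 hat1E.
rewrite hD_1 hD_mul !hD_exp -mulrA [hE * _]mulrCA -mulrDl.
have -> : hC (0 < a)%:R%:P + hC (- (0 < a)%:R)%:P = 0 :> hat.
  by apply/funext => l; rewrite hatDE hat0E /hC -mulrDl -polyCD subrr mul0r.
by rewrite mul0r.
Qed.

Definition evenct (l : seq nat) := count (fun x => ~~ odd x) l.
Lemma rep_tilde F f : rep F f -> rep (tilde F) (fun l => (-1) ^+ evenct l * f l).
Proof.
move=> rF j l pl; rewrite /tilde mulrCA rF //.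
by rewrite -/(evenct l) -[in LHS]signr_odd -[in RHS]signr_odd !mulr_sign; case: ifP => //; rewrite coefN.
Qed.

(** The odd and (in [hCo]) even degree parts of Exp, which is constantly 1 here; the sign of the
    even parts comes from the operation ~. *)
Definition hS : hat := fun l => ((0%N \notin l) && odd (sumn l))%:R * (-1) ^+ evenct l.
Definition hCo : hat := fun l => ((0%N \notin l) && ~~ odd (sumn l))%:R * (-1) ^+ evenct l.

Lemma hexpE l : hE l = (0%N \notin l)%:R.
Proof.
rewrite /hE /hexp; elim: l => [|a l IHl]; first by rewrite big_nil.
rewrite big_cons IHl in_cons negb_or lt0n eq_sym; case: eqP => _ /=; rewrite ?mul0r ?mul1r //.
Qed.

Lemma hexp_altE l : hexp (fun i => (-1) ^+ i *+ (0 < i)) l = (0%N \notin l)%:R * (-1) ^+ sumn l.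
Proof.
rewrite /hexp; elim: l => [|a l IHl]; first by rewrite big_nil mulr1.
rewrite big_cons IHl in_cons negb_or lt0n eq_sym; case: eqP => _ /=; rewrite ?mul0r //.
by rewrite mulr1n exprD mulrCA polyC_exp polyCN.
Qed.

Lemma half_half (p : {poly rat}) : (1 / 2)%:P * (p + p) = p.
Proof.
rewrite -mulr2n mulrnAr -mulrnAl -polyCMn.
suff -> : (1 / 2) *+ 2 = 1 :> rat by rewrite mul1r.
by rewrite -mulr_natr mul1r mulVf.
Qed.

Lemma rep_tSinh : rep (tilde SinhS) hS.
Proof.
have := rep_tilde (rep_sscale (1/2) (rep_sadd (rep_sexp rep_Psum) (rep_sopp (rep_sexp rep_Psum_alt)))).
set f := (fun l => _); have -> // : f = hS.
apply/funext => l; rewrite /f hCM hatDE hatNE hexp_altE -/hE hexpE /hS.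
case: (0%N \notin l); rewrite ?mul0r ?mul1r ?subr0 ?mulr0 ?mul0r //.
rewrite -[in LHS](signr_odd _ (sumn l)) mulrC; case: (odd _); rewrite ?expr1 ?expr0 ?subrr ?mulr0 ?mul0r //.
by rewrite opprK half_half.
Qed.

Lemma rep_tCosh : rep (tilde CoshS) hCo.
Proof.
have := rep_tilde (rep_sscale (1/2) (rep_sadd (rep_sexp rep_Psum) (rep_sexp rep_Psum_alt))).
set f := (fun l => _); have -> // : f = hCo.
apply/funext => l; rewrite /f hCM hatDE hexp_altE -/hE hexpE /hCo.
case: (0%N \notin l); rewrite ?mul0r ?mul1r ?addr0 ?mulr0 ?mul0r //.
rewrite -[in LHS](signr_odd _ (sumn l)) mulrC; case: (odd _); rewrite ?expr1 ?expr0 ?subrr ?mulr0 ?mul0r //.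
by rewrite half_half.
Qed.

(** * Enumeration of partitions *)

Lemma mem_partsb fuel m b l : (m <= fuel)%N ->
  (l \in partsb fuel m b) = [&& is_part l, sumn l == m & (head 0 l <= b)%N].
Proof.
elim: fuel m b l => [|fuel IH] m b l.
  rewrite leqn0 => /eqP -> /=; rewrite inE; case: l => [//|a l] /=.
  by rewrite is_partP in_cons negb_or /=; case: a => [|a]; rewrite ?andbF.
move=> le_m /=; case: eqP => [->|/eqP m0].
  rewrite inE; case: l => [//|a l] /=.
  by rewrite is_partP in_cons negb_or /=; case: a => [|a]; rewrite ?andbF.
apply/flatten_mapP/and3P => [[i]|[pl /eqP sl hl]].
  rewrite mem_iota => /andP[i1 i2] /mapP[q]; rewrite IH; last by lia.
  case/and3P=> pq /eqP sq hq ->; split => /=; last by lia.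
    have [sq' q0] : sorted geq q /\ 0%N \notin q by apply/andP; rewrite -is_partP.
    rewrite is_partP in_cons negb_or q0 andbT /=; apply/andP; split; last by lia.
    by case: q sq' hq {sq pq q0} => [//|c q] /= -> ->.
  by rewrite sq; apply/eqP; lia.
case: l pl sl hl => [_ /= sl|a l pl /= sl hl]; first by rewrite -sl in m0.
have : is_part (a :: l) by [].
rewrite is_partP in_cons negb_or /= => /and3P[pa a0 l0].
exists a; first by rewrite mem_iota; lia.
apply: map_f; rewrite IH; last by lia.
apply/and3P; split; last by case: l pa {pl sl l0} => [//|c l] /= /andP[].
  by rewrite is_partP l0 (path_sorted pa).
by apply/eqP; lia.
Qed.

Lemma partsb_uniq fuel m b : uniq (partsb fuel m b).
Proof.
elim: fuel m b => [|fuel IH] m b /=; case: eqP => //.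
move=> _; elim: (iota 1 _) (iota_uniq 1 (minn m b)) => [//|i r IHr] /= /andP[ir ur].
rewrite cat_uniq IHr // andbT map_inj_uniq ?IH //=; last by move=> x y [].
apply/hasPn => x /flatten_mapP[i' i'r /mapP[q _ ->]]; apply/negP => /mapP[q' _ [e _]].
by rewrite -e i'r in ir.
Qed.

Lemma mem_parts N l : (l \in parts_upto N) = is_part l && (sumn l <= N)%N.
Proof.
apply/flatten_mapP/andP => [[k]|[pl sl]].
  by rewrite mem_iota mem_partsb // => kN /and3P[-> /eqP sl _]; split => //; lia.
exists (sumn l); first by rewrite mem_iota; lia.
rewrite mem_partsb // pl eqxx /=; case: l {pl sl} => [//|a l] /=; lia.
Qed.

Lemma parts_uniq N : uniq (parts_upto N).
Proof.
rewrite /parts_upto; elim: (iota 0 _) (iota_uniq 0 N.+1) => [//|i r IHr] /= /andP[ir ur].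
rewrite cat_uniq IHr // andbT partsb_uniq /=.
apply/hasPn => x /flatten_mapP[i' i'r]; rewrite mem_partsb // => /and3P[_ /eqP e _].
apply/negP; rewrite mem_partsb // => /and3P[_ /eqP e' _].
by rewrite -e' e i'r in ir.
Qed.

Lemma parts_cut (R : nmodType) n N (X : seq nat -> R) : (n <= N)%N ->
  (forall mu, is_part mu -> (n < sumn mu)%N -> X mu = 0) ->
  \sum_(mu <- parts_upto N) X mu = \sum_(mu <- parts_upto n) X mu.
Proof.
move=> nN X0; rewrite (bigID (fun mu => sumn mu <= n)%N) /= addrC.
rewrite big_seq_cond big1 => [|mu /andP[]]; last first.
  by rewrite mem_parts => /andP[pm _]; rewrite -ltnNge => /(X0 _ pm).
rewrite add0r -big_filter; apply: perm_big; apply: uniq_perm.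
- exact/filter_uniq/parts_uniq.
- exact: parts_uniq.
move=> mu; rewrite mem_filter !mem_parts; case: (is_part mu); rewrite ?andbF //=; lia.
Qed.

Lemma hmul_val n1 n2 (F G : hat) : (forall l, (sumn l < n1)%N -> F l = 0) ->
  (forall l, (sumn l < n2)%N -> G l = 0) ->
  forall l, (sumn l < n1 + n2)%N -> (F * G) l = 0.
Proof.
move=> F0 G0 l ltl; rewrite hatM_mk big_seq big1 // => -[x1 x2] /mk_sumn /= e.
case: (ltnP (sumn x1) n1) => [/F0 ->|h]; first by rewrite mul0r.
by rewrite G0 ?mulr0 //; lia.
Qed.

(** * Plethysm *)

Definition hGp (g : hat) (mu : seq nat) : hat := \prod_(m <- mu) hpsi m g.

Lemma sumn0 (l : seq nat) : sumn l = 0%N -> 0%N \notin l -> l = [::].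
Proof. by case: l => [//|[|a] l]. Qed.

Lemma hpsi_val m g l : g [::] = 0 -> hpos g -> (sumn l < m)%N -> hpsi m g l = 0.
Proof.
move=> g0 gp lt; rewrite /hpsi; case: ifP => // al.
suff -> : g [seq (x %/ m)%N | x <- l] = 0 by rewrite comp_poly0 mulr0.
case: l al lt => [//|a l] /= /andP[ma _] lt.
by apply: gp; rewrite in_cons divn_small //; lia.
Qed.

Lemma hGp_val g mu l : g [::] = 0 -> hpos g -> (sumn l < sumn mu)%N -> hGp g mu l = 0.
Proof.
move=> g0 gp; elim: mu l => [//|m mu IHm] l /= lt.
rewrite /hGp big_cons; apply: (hmul_val (n1 := m) (n2 := sumn mu)) => // l' lt'.
exact: hpsi_val.
Qed.

Lemma hpsi_pos m g : hpos g -> hpos (hpsi m g).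
Proof.
move=> gp l l0; rewrite /hpsi; case: ifP => // _.
by rewrite gp ?comp_poly0 ?mulr0 //; apply/mapP; exists 0%N; rewrite ?div0n.
Qed.

Lemma hpos1 : hpos 1. Proof. by case. Qed.

Lemma hGp_pos g mu : hpos g -> hpos (hGp g mu).
Proof.
move=> gp; rewrite /hGp; elim/big_rec: _ => [|i F _]; first exact: hpos1.
by apply: hmul_pos; apply: hpsi_pos.
Qed.

Definition zi (mu : seq nat) : {poly rat} := ((zz mu)%:R^-1)%:P.
(** Partitions heavier than the list contribute nothing when [g] has no constant term ([hpl_cut]),
    so the sum may stop at the degree of the list. The factor [zi] undoes the scaling of [f]. *)
Definition hpl (f g : hat) : hat := fun l =>
  \sum_(mu <- parts_upto (sumn l)) zi mu * f mu * hGp g mu l.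

Lemma hpl_cut f g N l : g [::] = 0 -> hpos g -> (sumn l <= N)%N ->
  hpl f g l = \sum_(mu <- parts_upto N) zi mu * f mu * hGp g mu l.
Proof.
move=> g0 gp le; rewrite /hpl [RHS](@parts_cut _ (sumn l)) // => mu _ lt.
by rewrite hGp_val ?mulr0.
Qed.

Lemma rep_sprod mu G g : is_part mu -> rep G g -> rep (sprod_over mu G) (hGp g mu).
Proof.
case/andP=> _; rewrite /hGp; elim: mu => [|m mu IHm] /=.
  by rewrite big_nil => _ _; apply: rep_sone.
by case/andP=> m0 pm rG; rewrite big_cons; apply: rep_smul; [apply: rep_sdil|apply: IHm].
Qed.

Lemma rep_pleth F G f g : rep F f -> rep G g -> g [::] = 0 -> hpos g ->
  rep (pleth F G) (hpl f g).
Proof.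
move=> rF rG g0 gp j l pl; rewrite (@hpl_cut f g (j + sumn l)%N) ?leq_addl //.
rewrite coef_sum /pleth exchange_big /= mulr_sumr [LHS]big_seq [RHS]big_seq.
apply: eq_bigr => mu; rewrite mem_parts => /andP[pm _].
rewrite -mulrA coefCM coefM mulr_sumr mulr_sumr; apply: eq_bigr => i _.
rewrite mulrCA (rep_sprod pm rG) // -(rF i mu pm) !mulrA mulVf ?mul1r //.
exact: zz_part_neq0.
Qed.

Lemma hpl_nil f g : hpl f g [::] = f [::].
Proof.
rewrite /hpl /= /parts_upto /= big_seq1 /hGp big_nil /zi /= invr1 mul1r.
by rewrite hat1E mulr1.
Qed.

Lemma hD_Gp a g mu : hD a (hGp g mu) = \sum_(i <- mu) hD a (hpsi i g) * hGp g (rem i mu).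
Proof.
elim: mu => [|m mu IHm]; first by rewrite /hGp !big_nil hD_1.
rewrite {1}/hGp big_cons hD_mul -/(hGp g mu) IHm big_cons /= eqxx; congr (_ + _).
rewrite mulr_sumr big_seq [RHS]big_seq; apply: eq_bigr => i im; rewrite mulrCA; congr (_ * _).
rewrite /hGp; case: (eqVneq m i) => [->|mi]; last by rewrite big_cons.
by rewrite (perm_big _ (perm_to_rem im)) big_cons.
Qed.

Lemma rem_part i mu : is_part mu -> is_part (rem i mu).
Proof.
rewrite !is_partP => /andP[sm m0]; apply/andP; split.
  exact: (subseq_sorted geq_trans (rem_subseq i mu)).
by apply: contra m0; apply: (mem_subseq (rem_subseq i mu)).
Qed.

Lemma sort_part i mu : is_part mu -> (0 < i)%N -> is_part (sort geq (i :: mu)).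
Proof.
rewrite !is_partP => /andP[sm m0] i0.
by rewrite sort_sorted ?mem_sort ?in_cons ?negb_or ?m0 ?andbT /=; [lia|exact: geq_total].
Qed.

Lemma part_perm_eq mu nu : is_part mu -> is_part nu -> perm_eq mu nu -> mu = nu.
Proof.
by rewrite !is_partP => /andP[sm _] /andP[sn _]; apply: (sorted_eq geq_trans geq_anti).
Qed.

(** The inverse inserts [i] and sorts. *)
Lemma parts_rem i M : (0 < i <= M)%N ->
  perm_eq [seq rem i mu | mu <- parts_upto M & i \in mu] (parts_upto (M - i)).
Proof.
case/andP=> i0 iM; apply: uniq_perm.
- rewrite map_inj_in_uniq ?filter_uniq ?parts_uniq // => x y.
  rewrite !mem_filter !mem_parts => /and3P[ix px _] /and3P[iy py _] e.
  apply: part_perm_eq => //; apply: (perm_trans (perm_to_rem ix)).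
  by rewrite e perm_sym perm_to_rem.
- exact: parts_uniq.
move=> nu; rewrite mem_parts; apply/mapP/andP => [[mu]|[pn sn]].
  rewrite mem_filter mem_parts => /and3P[im pm sm] ->; split; first exact: rem_part.
  by have := perm_sumn (perm_to_rem im) => /=; lia.
have pn' := sort_part pn i0; exists (sort geq (i :: nu)).
  rewrite mem_filter mem_parts pn' mem_sort mem_head /=.
  by rewrite (perm_sumn (permEl (perm_sort _ _))) /=; lia.
apply: part_perm_eq => //; first exact: rem_part.
have im : i \in sort geq (i :: nu) by rewrite mem_sort mem_head.
rewrite -(perm_cons i); apply: perm_trans (perm_to_rem im).
by rewrite perm_sym perm_sort.
Qed.

Lemma sum_count (R : nmodType) (X : nat -> R) a mu : (0 < a)%N ->
  \sum_(i <- mu | (i %| a)%N) X i = \sum_(i <- divisors a) X i *+ count_mem i mu.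
Proof.
move=> a0; elim: mu => [|m mu IHm].
  by rewrite big_nil big1 // => i _; rewrite mulr0n.
under [RHS]eq_bigr do rewrite /= mulrnDr.
rewrite big_split /= -IHm big_cons; case: ifP => ma.
  congr (_ + _); rewrite (bigD1_seq m) ?divisors_uniq //=; last by rewrite -dvdn_divisors.
  by rewrite eqxx mulr1n big1 ?addr0 // => i; rewrite eq_sym => /negbTE ->.
rewrite [X in _ = X + _]big_seq [X in _ = X + _]big1 ?add0r // => i; rewrite -dvdn_divisors // => ia.
by case: eqP => // e; rewrite e ia in ma.
Qed.

Lemma hD_0 g : hpos g -> hD 0 g = 0.
Proof. by move=> gp; apply/funext => l; rewrite /hD gp ?mem_head. Qed.

Lemma hpsi_0 i : hpsi i 0 = 0.
Proof. by apply/funext => l; rewrite /hpsi comp_poly0 mulr0 if_same. Qed.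

(** The chain rule. The variable p_a enters f[g] through psi_i(g) with i dividing a, and a d/dp_a
    psi_i(g) is i times psi_i of (a/i) d/dp_(a/i) g; this factor i completes d/dp_i f to i d/dp_i
    f. *)
Lemma hD_pl a (f g : hat) : hsym f -> g [::] = 0 -> hpos g ->
  hD a (hpl f g) = \sum_(i <- divisors a) hpl (hD i f) g * hpsi i (hD (a %/ i) g).
Proof.
move=> sf g0 gp; case: (posnP a) => [->|a0].
  (* By convention [divisors 0] is [[:: 1]], so a = 0 has to be checked apart. *)
  rewrite (_ : divisors 0 = [:: 1%N]) // big_seq1 div0n (hD_0 gp) hpsi_0 mulr0.
  apply/funext => l; rewrite /hD /hpl big1 // => mu _.
  by rewrite (hGp_pos mu gp) ?mulr0 // mem_head.
apply/funext => l; rewrite hat_sumE -[LHS]/(hpl f g (a :: l)) {1}/hpl /=.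
set M := (a + sumn l)%N.
pose H i nu := (hpsi i (hD (a %/ i) g) * hGp g nu) l.
transitivity (\sum_(mu <- parts_upto M) \sum_(i <- divisors a)
    (zi mu * f mu * i%:R * H i (rem i mu)) *+ count_mem i mu).
  apply: eq_bigr => mu _; rewrite -sum_count // -[hGp g mu (a :: l)]/(hD a (hGp g mu) l) hD_Gp.
  rewrite hat_sumE mulr_sumr [RHS]big_mkcond; apply: eq_bigr => i _.
  rewrite hD_psi; case: ifP => _; last by rewrite mul0r mulr0.
  by rewrite -(mulrA (hC _)) hCM -/(H i _) !mulrA.
rewrite exchange_big /= big_seq [RHS]big_seq; apply: eq_bigr => i.
rewrite -dvdn_divisors // => ia.
have i0 : (0 < i)%N by apply: dvdn_gt0 ia.
have iM : (0 < i <= M)%N by rewrite i0 (leq_trans (dvdn_leq a0 ia)) ?leq_addr.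
(* Removing a part i from mu divides z_mu by i times the multiplicity of i, which cancels the two
   factors in the sum. *)
transitivity (\sum_(nu <- parts_upto (M - i)) zi nu * f (i :: nu) * H i nu).
  rewrite -(perm_big _ (parts_rem iM)) big_map big_filter [RHS]big_mkcond.
  rewrite big_seq [RHS]big_seq; apply: eq_bigr => mu.
  rewrite mem_parts => /andP[pm _]; case: ifP => [im|/negbT/count_memPn ->]; last by rewrite mulr0n.
  rewrite (sf _ _ (perm_to_rem im)) -mulr_natl /zi (zz_perm (perm_to_rem im)) /=.
  have -> : (count_mem i (rem i mu)).+1 = count_mem i mu.
    by rewrite (seq.permP (perm_to_rem im)) /= eqxx.
  have c0 : (0 < count_mem i mu)%N by rewrite -has_count has_pred1.
  have -> : ((i * count_mem i mu * zz (rem i mu))%:R^-1)%:P =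
            (i%:R^-1)%:P * ((count_mem i mu)%:R^-1)%:P * ((zz (rem i mu))%:R^-1)%:P :> {poly rat}.
    by rewrite -!polyCM !natrM !invfM.
  have e1 : (i%:R^-1)%:P * i%:R = 1 :> {poly rat}.
    by rewrite -polyC_natr -polyCM mulVf // pnatr_eq0 -lt0n.
  have e2 : ((count_mem i mu)%:R^-1)%:P * (count_mem i mu)%:R = 1 :> {poly rat}.
    by rewrite -polyC_natr -polyCM mulVf // pnatr_eq0 -lt0n.
  move: (H i _) (f _) (((zz _)%:R^-1)%:P) (count_mem i mu)%:R (((count_mem i mu)%:R^-1)%:P) (i%:R) ((i%:R^-1)%:P) e1 e2.
  move=> h f' z c c' d d' e1 e2.
  transitivity ((d' * d) * (c' * c) * (z * f' * h)); first by ring.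
  by rewrite e1 e2 !mul1r.
set G' : hat := fun l' => \sum_(nu <- parts_upto (M - i)) zi nu * f (i :: nu) * hGp g nu l'.
have le_l : (sumn l <= M - i)%N by have := dvdn_leq a0 ia; rewrite /M; lia.
rewrite -[RHS](@hmul_eq_le (sumn l) G' (hpl (hD i f) g) (hpsi i (hD (a %/ i) g))) //; last first.
  move=> l' le_l'; rewrite (@hpl_cut _ _ (M - i)) //; exact: leq_trans le_l.
rewrite mulrC hatM_mk; under eq_bigr do rewrite /H hatM_mk mulr_sumr.
rewrite exchange_big /=; apply: eq_bigr => x _; rewrite /G' mulr_sumr.
by apply: eq_bigr => nu _; rewrite mulrCA.
Qed.

(** * Traces on spaces of functions *)

Definition lc_fn (X I : Type) (s : seq I) (c : I -> rat) (f : I -> X -> rat) : X -> rat :=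
  fun x => \sum_(i <- s) c i * f i x.

Definition lin (X Y : Type) (F : (X -> rat) -> (Y -> rat)) :=
  forall (I : Type) (s : seq I) (c : I -> rat) (f : I -> X -> rat),
    F (lc_fn s c f) = lc_fn s c (fun i => F (f i)).

Definition subsp (X : Type) (V : (X -> rat) -> Prop) :=
  V (fun=> 0) /\ forall c f g, V f -> V g -> V (fun x => c * f x + g x).

Lemma subsp_lc (X : Type) (V : (X -> rat) -> Prop) (I : eqType) (s : seq I) c f :
  subsp V -> {in s, forall i, V (f i)} -> V (lc_fn s c f).
Proof.
move=> [V0 VD]; elim: s => [_|i s IHs Vs].
  by have -> : lc_fn [::] c f = fun=> 0 by apply/funext => x; rewrite /lc_fn big_nil.
have -> : lc_fn (i :: s) c f = fun x => c i * f i x + lc_fn s c f x.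
  by apply/funext => x; rewrite /lc_fn big_cons.
by apply: VD; [apply: Vs; rewrite mem_head|apply: IHs => j js; apply: Vs; rewrite in_cons js orbT].
Qed.

Section Frames.
Variable X : eqType.
Implicit Types (V : (X -> rat) -> Prop) (fr : seq (X * (X -> rat))).

(** Writes the identity of V as a sum of point evaluations times elements of V, an element of the
    tensor product of the dual of V with V; [trF] contracts it with an operator. The family may be
    linearly dependent, as in the frame of the quotient algebra, which is indexed by basis vectors
    and words. *)
Definition frame V fr := {in fr, forall p, V p.2} /\
  forall f, V f -> f = lc_fn fr (fun p => f p.1) (fun p => p.2).

Definition trF fr (F : (X -> rat) -> (X -> rat)) := \sum_(p <- fr) F p.2 p.1.

(** Gaussian elimination over the test points: a point where some element of V is nonzero splits off
    one dimension, and the elements vanishing there are treated by induction. *)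
Lemma frame_exists V (ws : seq X) : subsp V ->
  (forall f, V f -> {in ws, forall w, f w = 0} -> f = fun=> 0) ->
  exists2 fr, frame V fr & {in fr, forall p, p.1 \in ws}.
Proof.
elim: ws V => [|w ws IH] V sV det.
  exists [::] => //; split=> // f Vf; rewrite (det f Vf) //.
  by apply/funext => x; rewrite /lc_fn big_nil.
have [[g [Vg gw]]|no] := pselect (exists g, V g /\ g w <> 0); last first.
  have [//|fr frV frw] := IH V sV.
    move=> f Vf f0; apply: det => // u; rewrite in_cons => /orP[/eqP ->|/f0 //].
    by apply/eqP/negPn/negP => /eqP fw; apply: no; exists f.
  by exists fr => // p /frw; rewrite in_cons orbC => ->.
pose V' f := V f /\ f w = 0.
have sV' : subsp V'.
  case: sV => V0 VD; split; first by split.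
  by move=> c f h [Vf fw] [Vh hw]; split; rewrite ?fw ?hw ?mulr0 ?addr0 //; apply: VD.
have [|fr [fr1 fr2] frw] := IH V' sV'.
  move=> f [Vf fw] f0; apply: det => // u; rewrite in_cons => /orP[/eqP -> //|/f0 //].
pose g1 x := g x / g w.
have Vg1 : V g1.
  case: (sV) => V0 VD; have -> : g1 = fun x => (g w)^-1 * g x + 0.
    by apply/funext => x; rewrite addr0 mulrC.
  exact: VD.
have g1w : g1 w = 1 by rewrite /g1 divff //; apply/eqP.
(* In f = f1 + f(w) g1 the part f1 is expanded along [fr]; collecting the multiples of f(w) leaves
   this function. *)
pose g2 x := -1 * lc_fn fr (fun p => g1 p.1) (fun p => p.2) x + g1 x.
exists ((w, g2) :: fr) => [|p]; last by rewrite !in_cons => /orP[/eqP ->|/frw ->]; rewrite ?eqxx ?orbT.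
split=> [p|f Vf].
  rewrite in_cons => /orP[/eqP ->|/fr1 [] //] /=.
  by apply: (proj2 sV) => //; apply: subsp_lc => // q /fr1 [].
pose f1 x := - f w * g1 x + f x.
have Vf1 : V' f1 by split; [apply: (proj2 sV)|rewrite /f1 g1w mulr1 addNr].
have e := fr2 f1 Vf1; apply/funext => x; rewrite /lc_fn big_cons /=.
have -> : f x = f1 x + f w * g1 x by rewrite /f1; ring.
rewrite {1}e /g2 /lc_fn mulrDr addrAC addrC [in RHS]addrC; congr (_ + _).
rewrite mulN1r mulrN mulr_sumr -sumrN -big_split /=; apply: eq_bigr => p _; rewrite /f1; ring.
Qed.

End Frames.

(** Both traces equal the double sum of [F p.2 q.1 * G q.2 p.1]. With the identity for [G] this is
    the independence of the trace from the frame. *)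
Lemma trF_comm (X Y : eqType) (V : (X -> rat) -> Prop) (W : (Y -> rat) -> Prop) fr gr F G :
  frame V fr -> frame W gr -> lin F -> lin G ->
  (forall f, V f -> W (F f)) -> (forall f, W f -> V (G f)) ->
  trF fr (fun f => G (F f)) = trF gr (fun f => F (G f)).
Proof.
move=> [fr1 fr2] [gr1 gr2] lF lG VW WV.
transitivity (\sum_(p <- fr) \sum_(q <- gr) F p.2 q.1 * G q.2 p.1).
  rewrite /trF big_seq [RHS]big_seq; apply: eq_bigr => p /fr1 Vp.
  by rewrite {1}(gr2 _ (VW _ Vp)) lG.
rewrite exchange_big /= /trF big_seq [RHS]big_seq; apply: eq_bigr => q /gr1 Wq.
rewrite {2}(fr2 _ (WV _ Wq)) lF; apply: eq_bigr => p _; exact: mulrC.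
Qed.

Lemma lin_id (X : Type) : lin (@id (X -> rat)). Proof. by []. Qed.

Definition Tr (X : eqType) (V : (X -> rat) -> Prop) (F : (X -> rat) -> (X -> rat)) : rat :=
  if pselect (exists fr, frame V fr) is left h then trF (projT1 (cid h)) F else 0.

Lemma TrE (X : eqType) (V : (X -> rat) -> Prop) fr F : frame V fr -> lin F ->
  (forall f, V f -> V (F f)) -> Tr V F = trF fr F.
Proof.
move=> Vfr lF VF; rewrite /Tr; case: pselect => [h|[]]; last by exists fr.
by case: (cid h) => gr Vgr /=; apply: (trF_comm Vgr Vfr lF (@lin_id X)).
Qed.

Lemma Tr_comm (X Y : eqType) (V : (X -> rat) -> Prop) (W : (Y -> rat) -> Prop) fr gr F G :
  frame V fr -> frame W gr -> lin F -> lin G ->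
  (forall f, V f -> W (F f)) -> (forall f, W f -> V (G f)) ->
  Tr V (fun f => G (F f)) = Tr W (fun f => F (G f)).
Proof.
move=> Vfr Wgr lF lG VW WV.
have linc (A B C : Type) (F1 : (A -> rat) -> (B -> rat)) (F2 : (B -> rat) -> (C -> rat)) :
    lin F1 -> lin F2 -> lin (fun f => F2 (F1 f)).
  by move=> l1 l2 I s c f; rewrite l1 l2.
rewrite (TrE Vfr) ?(TrE Wgr); last first.
- by move=> f /VW /WV.
- exact: linc.
- by move=> f /WV /VW.
- exact: linc.
exact: trF_comm Vfr Wgr lF lG VW WV.
Qed.

(** [Tr_comm] would require the inverse of [P] as a linear map on all functions. Here preimages are
    only chosen one by one for the frame of W, and injectivity of [P] shows that they expand every
    element of V. *)
Lemma Tr_iso (X Y : eqType) (V : (X -> rat) -> Prop) (W : (Y -> rat) -> Prop) fr gr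
    (P : (X -> rat) -> (Y -> rat)) F G :
  subsp V -> frame V fr -> frame W gr -> lin P -> lin F -> lin G ->
  (forall f, V f -> W (P f)) -> (forall f, V f -> V (F f)) -> (forall f, W f -> W (G f)) ->
  (forall f, V f -> P f = (fun=> 0) -> f = fun=> 0) ->
  (forall g, W g -> exists2 f, V f & P f = g) ->
  (forall f, V f -> P (F f) = G (P f)) ->
  Tr V F = Tr W G.
Proof.
move=> sV Vfr Wgr lP lF lG VW VF WG inj surj PFG.
rewrite (TrE Vfr) ?(TrE Wgr) //.
have /choice[xi Hxi] : forall g, exists f, W g -> V f /\ P f = g.
  move=> g; have [/surj[f Vf e]|no] := pselect (W g); first by exists f.
  by exists (fun=> 0).
case: (Vfr) (Wgr) => fr1 fr2 [gr1 gr2].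
have dec f : V f -> f = lc_fn gr (fun q => P f q.1) (fun q => xi q.2).
  move=> Vf; set h := lc_fn _ _ _.
  have Vh : V h by apply: subsp_lc => // q /gr1 /Hxi [].
  have : (fun x => -1 * h x + f x) = fun=> 0.
    apply: inj; first exact: (proj2 sV).
    have -> : (fun x => -1 * h x + f x) = lc_fn [:: (-1, h); (1, f)] fst snd.
      by apply/funext => x; rewrite /lc_fn !big_cons big_nil /= mul1r addr0.
    rewrite lP; apply/funext => y; rewrite /lc_fn !big_cons big_nil /= mul1r addr0.
    suff -> : P h y = P f y by rewrite mulN1r addNr.
    rewrite /h lP [in RHS](gr2 _ (VW _ Vf)) /lc_fn big_seq [RHS]big_seq.
    by apply: eq_bigr => q /gr1 /Hxi [_ ->].
  move=> e; apply/funext => x; have := congr1 (fun k => k x) e => /= /eqP.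
  by rewrite mulN1r addrC subr_eq0 => /eqP.
transitivity (\sum_(p <- fr) \sum_(q <- gr) P (F p.2) q.1 * xi q.2 p.1).
  rewrite /trF big_seq [RHS]big_seq; apply: eq_bigr => p /fr1 Vp.
  by rewrite {1}(dec _ (VF _ Vp)).
rewrite exchange_big /= /trF big_seq [RHS]big_seq; apply: eq_bigr => q /gr1 /Hxi [Vx Px].
rewrite -[in RHS]Px -PFG // [in RHS](fr2 _ Vx) lF lP.
by apply: eq_bigr => p _; rewrite mulrC.
Qed.

(** * The algebra with generators indexed by triples *)

Definition altf (L : Type) (f : seq L -> rat) :=
  forall u g h v, f (u ++ g :: h :: v) = - f (u ++ h :: g :: v).

Lemma eqN0 (x : rat) : x = - x -> x = 0.
Proof. by move=> e; lra. Qed.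

Lemma alt_swap (L : Type) (f : seq L -> rat) g h v : altf f -> f (g :: h :: v) = - f (h :: g :: v).
Proof. by move=> af; apply: (af [::]). Qed.

(** The factor is the sign of the reordering. It depends on the two words only, so two functionals
    can be compared on a conveniently reordered word. *)
Lemma alt_perm (L : eqType) w w' : perm_eq w w' ->
  exists2 e : rat, e != 0 & forall f : seq L -> rat, altf f -> f w = e * f w'.
Proof.
suff H (u : seq L) : perm_eq w w' ->
    exists2 e : rat, e != 0 & forall f, altf f -> f (u ++ w) = e * f (u ++ w').
  exact: (H [::]).
elim: w w' u => [|a l IHl] l' u.
  by move/perm_size/eqP; rewrite eq_sym size_eq0 => /eqP ->; exists 1 => // f _; rewrite mul1r.
move=> pl; have al' : a \in l' by rewrite -(perm_mem pl) mem_head.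
case/splitPr: al' pl => p1 p2 pl.
have {}pl : perm_eq l (p1 ++ p2).
  by rewrite -(perm_cons a) (perm_trans pl) // perm_catC /= perm_cons perm_catC.
have [e e0 H] := IHl (p1 ++ p2) (rcons u a) pl.
suff [e' e'0 H'] : exists2 e' : rat, e' != 0 &
    forall f, altf f -> f (u ++ a :: p1 ++ p2) = e' * f (u ++ p1 ++ a :: p2).
  exists (e * e'); first by rewrite mulf_neq0.
  by move=> f af; rewrite -cat_rcons H // cat_rcons H' // mulrA.
elim: p1 u {IHl pl H} => [|b p1 IHp] u /=; first by exists 1 => // f _; rewrite mul1r.
have [e' e'0 H] := IHp (rcons u b).
exists (- e'); first by rewrite oppr_eq0.
by move=> f af; rewrite af -[in LHS]cat_rcons H // cat_rcons mulNr.
Qed.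

Lemma alt_perm0 (L : eqType) (f : seq L -> rat) w w' : altf f -> perm_eq w w' -> f w' = 0 -> f w = 0.
Proof. by move=> af /alt_perm[e _ /(_ f af) ->] ->; rewrite mulr0. Qed.

Section Letters3.
Variable T : finType.
Notation letter := (T * T * T)%type.
Notation word := (seq letter).
Implicit Types (f : word -> rat) (g h : letter) (u v w : word).

(* The relation (sum of w_el over the pairs e in {bc, ca, ab}) (the same for m) = 0 has nine terms;
   the three terms with equal pairs vanish by [adm_quad]. *)
Definition six f (a b c l m : T) v :=
  f [:: (b,c,l), (c,a,m) & v] + f [:: (b,c,l), (a,b,m) & v] +
  f [:: (c,a,l), (b,c,m) & v] + f [:: (c,a,l), (a,b,m) & v] +
  f [:: (a,b,l), (b,c,m) & v] + f [:: (a,b,l), (c,a,m) & v].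

(* Functionals on words that factor through the algebra. *)
Record Adm f : Prop := MkAdm {
  adm_alt : altf f;
  adm_sg1 : forall a b c v, f ((a,b,c) :: v) = - f ((b,a,c) :: v);
  adm_sg2 : forall a b c v, f ((a,b,c) :: v) = - f ((a,c,b) :: v);
  adm_quad : forall a b c d v, uniq [:: a; b; c; d] -> f [:: (a,b,c), (a,b,d) & v] = 0;
  adm_six : forall a b c l m v, uniq [:: a; b; c; l; m] -> six f a b c l m v = 0 }.

Section AdmTheory.
Variable f : word -> rat.
Hypothesis Hf : Adm f.

Lemma alt_same g v : f (g :: g :: v) = 0.
Proof. by apply: eqN0; apply: alt_swap; apply: adm_alt. Qed.
Lemma rep12 a c v : f ((a,a,c) :: v) = 0.
Proof. by apply: eqN0; apply: adm_sg1. Qed.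
Lemma rep23 a c v : f ((a,c,c) :: v) = 0.
Proof. by apply: eqN0; apply: adm_sg2. Qed.
Lemma rep13 a c v : f ((a,c,a) :: v) = 0.
Proof. by rewrite adm_sg1 // rep23 oppr0. Qed.
Lemma sw g h v : f (g :: h :: v) = - f (h :: g :: v).
Proof. by apply: alt_swap; apply: adm_alt. Qed.

Lemma quad_all a b c d v : f [:: (a,b,c), (a,b,d) & v] = 0.
Proof.
case: (eqVneq a b) => [->|ab]; first by rewrite rep12.
case: (eqVneq a c) => [->|ac]; first by rewrite rep13.
case: (eqVneq a d) => [->|ad]; first by rewrite sw rep13 oppr0.
case: (eqVneq b c) => [->|bc]; first by rewrite rep23.
case: (eqVneq b d) => [->|bd]; first by rewrite sw rep23 oppr0.
case: (eqVneq c d) => [->|cd]; first by rewrite alt_same.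
by apply: (adm_quad Hf); rewrite /= !inE !negb_or ab ac ad bc bd cd.
Qed.

Lemma cyc g v : f (g :: v) = f ((g.1.2, g.2, g.1.1) :: v).
Proof. by case: g => [[a b] c] /=; rewrite (adm_sg1 Hf) (adm_sg2 Hf) opprK. Qed.

Definition pts3 g : seq T := [:: g.1.1; g.1.2; g.2].

Lemma norm2 x y g : x != y -> x \in pts3 g -> y \in pts3 g ->
  exists e z, forall v, f (g :: v) = e * f ((x,y,z) :: v).
Proof.
case: g => [[a b] c]; rewrite !inE /= => xy.
have s1 := adm_sg1 Hf; have s2 := adm_sg2 Hf.
move=> /or3P[] /eqP ex /or3P[] /eqP ey; rewrite -?ex -?ey;
  try by move: xy; rewrite ex ey eqxx.
- by exists 1, c => v; rewrite mul1r.
- by exists (-1), b => v; rewrite mulN1r s2.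
- by exists (-1), c => v; rewrite mulN1r s1.
- by exists 1, a => v; rewrite mul1r cyc.
- by exists 1, b => v; rewrite mul1r (cyc (y,b,x)) /= (cyc (b,x,y)).
- by exists (-1), a => v; rewrite mulN1r s2 (cyc (a,x,y)).
Qed.

Lemma rep0 g v : ~~ uniq (pts3 g) -> f (g :: v) = 0.
Proof.
case: g => [[a b] c]; rewrite /= !inE !andbT negb_and negb_or !negb_and !negbK.
by case/orP=> [/orP[]|] /eqP ->; rewrite ?rep12 ?rep13 ?rep23.
Qed.

Definition zero2 g h := [|| ~~ uniq (pts3 g), ~~ uniq (pts3 h) |
  (1 < size [seq x <- pts3 h | x \in pts3 g])%N].

Lemma zero2P g h v : zero2 g h -> f (g :: h :: v) = 0.
Proof.
rewrite /zero2; have [ug|/rep0 -> //] := boolP (uniq (pts3 g)).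
have [uh|/rep0 e _] := boolP (uniq (pts3 h)); last by rewrite sw e oppr0.
rewrite !orFb; set s := filter _ _ => s1.
have us : uniq s by rewrite filter_uniq.
have sub z : z \in s -> (z \in pts3 g) && (z \in pts3 h) by rewrite mem_filter.
case: s us sub s1 => [//|x [//|y s]] /= /andP[]; rewrite inE negb_or => /andP[xy _] _ sub _.
have /andP[xg xh] := sub x (mem_head _ _).
have /andP[yg yh] : (y \in pts3 g) && (y \in pts3 h) by apply: sub; rewrite !inE eqxx orbT.
have [e [z ->]] := norm2 xy xg yg; have [e' [z' E]] := norm2 xy xh yh.
by rewrite sw E sw quad_all oppr0 mulr0 oppr0 mulr0.
Qed.

(** If two of the five points coincide, each of the six terms vanishes by itself: one of its letters
    repeats a point or its two letters share two points. *)
Lemma six_all a b c l m v : six f a b c l m v = 0.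
Proof.
have [/(adm_six Hf) -> //|] := boolP (uniq [:: a; b; c; l; m]).
have Z1 x y z p q : zero2 (x,y,p) (y,z,q) || uniq [:: x; y; z; p; q].
  rewrite /zero2 /= !inE; do ![case: eqVneq => //= *]; subst; rewrite ?eqxx //=;
  by match goal with H : is_true (?t != ?t) |- _ => rewrite eqxx in H end.
have Z2 x y z p q : zero2 (x,y,p) (z,x,q) || uniq [:: x; y; z; p; q].
  rewrite /zero2 /= !inE; do ![case: eqVneq => //= *]; subst; rewrite ?eqxx //=;
  by match goal with H : is_true (?t != ?t) |- _ => rewrite eqxx in H end.
move=> nu; have {}nu x y z : perm_eq [:: x; y; z; l; m] [:: a; b; c; l; m] ->
    uniq [:: x; y; z; l; m] = false by move/perm_uniq => ->; apply: negbTE.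
have W1 x y z : perm_eq [:: x; y; z; l; m] [:: a; b; c; l; m] -> f [:: (x,y,l), (y,z,m) & v] = 0.
  by move/nu => e; apply: zero2P; have := Z1 x y z l m; rewrite e orbF.
have W2 x y z : perm_eq [:: x; y; z; l; m] [:: a; b; c; l; m] -> f [:: (x,y,l), (z,x,m) & v] = 0.
  by move/nu => e; apply: zero2P; have := Z2 x y z l m; rewrite e orbF.
have P s : perm_eq s [:: a; b; c] -> perm_eq (s ++ [:: l; m]) [:: a; b; c; l; m].
  by move=> h; rewrite -[[:: a; b; c; l; m]]/([:: a; b; c] ++ [:: l; m]) perm_cat2r.
have p1 : perm_eq [:: b; c; a] [:: a; b; c] by rewrite -[[:: b; c; a]]/(rot 1 [:: a; b; c]) perm_rot.
have p2 : perm_eq [:: c; a; b] [:: a; b; c] by rewrite -[[:: c; a; b]]/(rot 2 [:: a; b; c]) perm_rot.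
by rewrite /six !(W1, W2) ?addr0 //; apply: (P [:: _; _; _]).
Qed.
End AdmTheory.

(* For admissible [f]: it vanishes on every word with a letter containing both [p] and [q]. *)
Definition killp (p q : T) f := forall x v, f ((p,q,x) :: v) = 0.

Lemma Adm_cons f g : Adm f -> Adm (fun v => f (g :: v)).
Proof.
move=> Hf; have sw := sw Hf; split.
- by move=> u x y v; apply: (adm_alt Hf (g :: u)).
- by move=> a b c v; rewrite [LHS]sw (adm_sg1 Hf) [in RHS]sw.
- by move=> a b c v; rewrite [LHS]sw (adm_sg2 Hf) [in RHS]sw.
- move=> a b c d v U; rewrite sw (adm_alt Hf [:: _]) opprK.
  by rewrite (quad_all Hf).
- move=> a b c l m v U.
  have E x y : f [:: g, x, y & v] = f [:: x, y, g & v] by rewrite sw (adm_alt Hf [:: _]) opprK.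
  by rewrite /six !E; apply: (six_all Hf).
Qed.

Lemma Adm_cat f u : Adm f -> Adm (fun v => f (u ++ v)).
Proof. by elim: u f => [|g u IHu] f Hf //=; apply: (IHu (fun v => f (g :: v))); apply: Adm_cons. Qed.

Lemma killp_mem f p q g v : Adm f -> killp p q f -> p != q ->
  p \in pts3 g -> q \in pts3 g -> f (g :: v) = 0.
Proof. by move=> Hf kf pq pg qg; have [e [z ->]] := norm2 Hf pq pg qg; rewrite kf mulr0. Qed.

Lemma killp_sym f p q : Adm f -> killp p q f -> killp q p f.
Proof. by move=> Hf kf x v; rewrite (adm_sg1 Hf) kf oppr0. Qed.

Lemma killp_cons f p q g : Adm f -> killp p q f -> killp p q (fun v => f (g :: v)).
Proof. by move=> Hf kf x v; rewrite (sw Hf) kf oppr0. Qed.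

(** In the six-term relation on the triangle q, x, y with extra points p, z, four terms have a
    letter through both p and q. *)
Lemma path_rel f p q x y z v : Adm f -> killp p q f ->
  f [:: (x,y,p), (y,z,q) & v] + f [:: (x,y,p), (z,x,q) & v] = 0.
Proof.
move=> Hf kf; have kf' := killp_sym Hf kf.
have := six_all Hf q x y p z v; rewrite /six.
rewrite !(cyc Hf (y,q,p)) /= !kf' !(cyc Hf (q,x,p)) /= !(cyc Hf (x,p,q)) /= !kf !addr0.
rewrite (sw Hf (x,y,p) (y,q,z)) (adm_sg2 Hf y q) -(sw Hf (x,y,p)).
rewrite (sw Hf (x,y,p) (q,x,z)) (cyc Hf (q,x,z)) /= (adm_sg1 Hf x z) opprK => e.
rewrite (sw Hf (x,y,p) (y,z,q)) (sw Hf (x,y,p) (z,x,q)).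
move: e; rewrite (sw Hf (x,y,p)); lra.
Qed.

(** The same with the triangle p, q, y and the extra points z, x. *)
Lemma path_rel3 f p q x y z v : Adm f -> killp p q f ->
  f [:: (y,z,p), (x,y,q) & v] = f [:: (x,y,p), (y,z,q) & v].
Proof.
move=> Hf kf.
have := six_all Hf p q y z x v; rewrite /six.
rewrite !(sw Hf _ (p,q,x)) !kf !oppr0 !addr0.
rewrite (cyc Hf (q,y,z)) /= (sw Hf (y,z,q)) (adm_sg2 Hf y p x) (adm_sg1 Hf y x) opprK.
rewrite (adm_sg2 Hf y p z) (sw Hf (y,z,p)) (cyc Hf (q,y,x)) /= (adm_sg1 Hf y x) opprK (sw Hf (x,y,q)).
lra.
Qed.

(** The two letters join p to q through c. The relation [path_rel], its mirror images under exchange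
    of p and q, and [path_rel3] form a linear system that has only the zero solution. *)
Lemma path_step f p q a c x v : Adm f -> killp p q f -> f [:: (p,a,c), (c,q,x) & v] = 0.
Proof.
move=> Hf kf; have kf' := killp_sym Hf kf.
rewrite (cyc Hf) /= (sw Hf) (adm_sg2 Hf) opprK -[LHS]opprK -(sw Hf).
have R1 := path_rel a c x v Hf kf.
have R2 i j k : f [:: (j,k,p), (i,j,q) & v] + f [:: (k,i,p), (i,j,q) & v] = 0.
  by have := path_rel i j k v Hf kf'; rewrite !(sw Hf (i,j,q)); lra.
have := R2 c x a; have := R2 x a c; have := path_rel3 c x a v Hf kf; lra.
Qed.

Lemma path_step_mem f p q r g x v : Adm f -> killp p q f ->
  p \in pts3 g -> r \in pts3 g -> f [:: g, (r,q,x) & v] = 0.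
Proof.
move=> Hf kf pg rg; have [<-|pr] := eqVneq p r; first by rewrite (sw Hf) kf oppr0.
have [e [z ->]] := norm2 Hf pr pg rg.
by rewrite (adm_sg2 Hf) (path_step _ _ _ _ Hf kf) oppr0 mulr0.
Qed.

Definition pset g : {set T} := [set x in pts3 g].

Lemma psetP g x : (x \in pset g) = (x \in pts3 g). Proof. by rewrite inE. Qed.

(** Words that stay connected to [A] when read in order: each letter meets the points covered so
    far. *)
Fixpoint grow (A : {set T}) w : bool :=
  if w is g :: w' then (pset g :&: A != set0) && grow (A :|: pset g) w' else true.
Fixpoint cov (A : {set T}) w : {set T} := if w is g :: w' then cov (A :|: pset g) w' else A.

Lemma cov_sub (A : {set T}) w : A \subset cov A w.
Proof. by elim: w A => [//|g w IHw] A /=; apply: subset_trans (IHw _); apply: subsetUl. Qed.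

Lemma cov_mem (A : {set T}) w g : g \in w -> pset g \subset cov A w.
Proof.
elim: w A => [//|h w IHw] A /=; rewrite in_cons => /orP[/eqP <-|/IHw //].
by apply: subset_trans (cov_sub _ _); apply: subsetUr.
Qed.

Lemma cov_min (A : {set T}) w (B : {set T}) : A \subset B -> all (fun g => pset g \subset B) w -> cov A w \subset B.
Proof.
by elim: w A => [//|g w IHw] A /= AB /andP[gB wB]; apply: IHw => //; rewrite subUset AB.
Qed.

(** Letters meeting the covered set are pulled to the front as long as there are any; [es] is the
    part of the word connected to [A]. *)
Lemma grow_exists (A : {set T}) w : exists es rest : word, [/\ perm_eq w (es ++ rest), grow A es &
  all (fun g => [disjoint pset g & cov A es]) rest].
Proof.
have [n] := ubnP (size w); elim: n w A => [//|n IHn] w A le_n.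
have [/hasP[g gw gA]|no] := boolP (has (fun g => pset g :&: A != set0) w); last first.
  exists [::], w; split=> //; apply/allP => g gw; rewrite -setI_eq0.
  by apply/negPn/negP => h; case/hasP: no; exists g.
have [|es [rest [pw ge dr]]] := IHn (rem g w) (A :|: pset g).
  by rewrite size_rem //; case: w gw le_n.
exists (g :: es), rest; split=> //=; last by rewrite gA.
by apply: perm_trans (perm_to_rem gw) _; rewrite /= perm_cons.
Qed.

Lemma card_pset g : (#|pset g| <= 3)%N.
Proof. by rewrite cardsE; apply: leq_trans (card_size _) _. Qed.

(** A letter that meets the covered set adds at most two points. Starting from one point, r letters
    cover at most 2r+1. *)
Lemma card_cov (A : {set T}) w : grow A w -> (#|cov A w| <= #|A| + 2 * size w)%N.
Proof.
elim: w A => [|g w IHw] A /=; first by rewrite muln0 addn0.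
case/andP=> gA /IHw h; apply: leq_trans h _.
have := cardsUI A (pset g); have := card_pset g.
have : (0 < #|A :&: pset g|)%N by rewrite card_gt0 setIC.
lia.
Qed.

(** Once a letter through a point of [A] is split off, [path_step_mem] kills q together with every
    point of that letter. The hypothesis thus spreads along the word until some letter contains
    q. *)
Lemma path_kill f (A : {set T}) q w v : Adm f -> (forall p, p \in A -> killp p q f) ->
  grow A w -> q \in cov A w -> q \notin A -> f (w ++ v) = 0.
Proof.
elim: w A f => [|g w IHw] A f Hf kA /=; first by move=> _ ->.
case/andP=> /set0Pn[p]; rewrite inE psetP => /andP[pg pA] gw qc qA.
have pq : p != q by apply: contraNneq qA => <-.
have [qg|qg] := boolP (q \in pset g).
  by rewrite psetP in qg; apply: (killp_mem _ Hf (kA p pA) pq pg qg).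
apply: (IHw (A :|: pset g) (fun v => f (g :: v))) => //.
- exact: Adm_cons.
- move=> r; rewrite inE => /orP[rA|]; first exact: killp_cons (kA r rA).
  by rewrite psetP => rg x v'; apply: (path_step_mem _ _ Hf (kA p pA) pg rg).
- by rewrite inE negb_or qA.
Qed.

Definition inb (b : {set T}) g := pset g \subset b.

Lemma inbE (b : {set T}) x y z : inb b (x,y,z) = [&& x \in b, y \in b & z \in b].
Proof.
apply/subsetP/and3P => [h|[xb yb zb] t]; last by rewrite psetP !inE => /or3P[] /eqP ->.
by split; apply: h; rewrite psetP !inE eqxx ?orbT.
Qed.

Definition restr (b : {set T}) k f w := if all (inb b) w && (size w == k) then f w else 0.

(** All terms of the antisymmetry and six-term relations involve the same points and have the same
    length, so they survive or disappear together; the terms of the quadratic relation vanish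
    singly. *)
Lemma Adm_restr b k f : Adm f -> Adm (restr b k f).
Proof.
move=> Hf; rewrite /restr; split.
- move=> u g h v; rewrite !all_cat !size_cat /= [inb b g && _]andbCA.
  by case: ifP => _; rewrite ?oppr0 // (adm_alt Hf).
- move=> x y z v /=; have -> : inb b (x,y,z) = inb b (y,x,z).
    by rewrite !inbE andbCA.
  by case: ifP => _; rewrite ?oppr0 // (adm_sg1 Hf).
- move=> x y z v /=; have -> : inb b (x,y,z) = inb b (x,z,y).
    by rewrite !inbE [(y \in b) && _]andbC.
  by case: ifP => _; rewrite ?oppr0 // (adm_sg2 Hf).
- by move=> x y z t v U; case: ifP => // _; rewrite (quad_all Hf).
- move=> x y z l m v U; rewrite /six.
  rewrite /= !inbE; have := six_all Hf x y z l m v; rewrite /six.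
  case: (x \in b); case: (y \in b); case: (z \in b); case: (l \in b); case: (m \in b);
    rewrite /= ?addr0 // => e.
  by case: ifP => _; rewrite ?addr0.
Qed.

Lemma grow_exists_in (b : {set T}) p w : p \in b -> all (inb b) w ->
  exists es rest : word, [/\ perm_eq w (es ++ rest), grow [set p] es,
    all (inb (cov [set p] es)) es, all (inb (b :\: cov [set p] es)) rest &
    (p \in cov [set p] es) && (cov [set p] es \subset b) /\
      (#|cov [set p] es| <= (2 * size es).+1)%N].
Proof.
move=> pb wb; have [es [rest [pw ge dr]]] := grow_exists [set p] w.
have : all (inb b) (es ++ rest) by rewrite -(perm_all _ pw).
rewrite all_cat => /andP[eb rb].
exists es, rest; split => //.
- by apply/allP => g /cov_mem; apply.
- apply/allP => g gr; rewrite /inb subsetD; apply/andP; split; first exact: (allP rb).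
  exact: (allP dr).
split; last by have := card_cov ge; rewrite cards1 add1n.
by rewrite (subsetP (cov_sub _ _)) ?set11 // cov_min ?sub1set.
Qed.

(** Strong induction on the size of b. If the component of a point p is a proper subset of b, either
    it or its complement is overfilled. If the word is connected, it suffices that some pair p, q is
    killed, by [path_kill]. *)
Lemma vanish (b : {set T}) f w : Adm f -> all (inb b) w ->
  (0 < #|b|)%N -> (#|b| <= 2 * size w)%N -> f w = 0.
Proof.
have [n] := ubnP #|b|; elim: n b f w => [//|n IHn] b f w le_n Hf wb b0 bw.
have sub (f' : word -> rat) w' u v (c : {set T}) : Adm f' -> perm_eq w' (u ++ v) ->
    all (inb c) u -> (0 < #|c| < n)%N -> (#|c| <= 2 * size u)%N -> f' w' = 0.
  move=> Hf' pw cu /andP[c0 cn] cs; apply: (alt_perm0 (adm_alt Hf') pw).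
  have -> // : f' (u ++ v) = 0.
  apply: (alt_perm0 (adm_alt Hf') (_ : perm_eq _ (v ++ u))); first by rewrite perm_catC.
  exact: (IHn c _ u _ (Adm_cat v Hf')).
case/card_gt0P: (b0) => p pb.
have [es [rest [pw ge ec rc [/andP[pc cb] cs]]]] := grow_exists_in pb wb.
set c := cov _ _ in ec rc pc cb cs.
have sw' : size w = (size es + size rest)%N by rewrite (perm_size pw) size_cat.
have c0 : (0 < #|c|)%N by apply/card_gt0P; exists p.
have cD : (#|b :\: c| + #|c| = #|b|)%N.
  by rewrite addnC -(cardsID c b) (setIidPr cb).
have [cEb|cNb] := eqVneq c b; last first.
  have cltb : (#|c| < #|b|)%N by rewrite proper_card // properEneq cNb.
  have [le|lt] := leqP #|c| (2 * size es); first by apply: (sub f w es rest c) => //; clear -c0 cltb le_n; lia.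
  apply: (sub f w rest es (b :\: c)) => //; first by rewrite (perm_trans pw) // perm_catC.
    by clear -cD cltb c0 le_n; lia.
  by clear -cD lt bw sw'; lia.
have [b1|b1] := leqP #|b| 1.
  case: w wb bw {pw sw'} => [|g w] /=; first by lia.
  case/andP=> gb _ _; apply: (rep0 Hf); apply/negP => ug.
  have := subset_leq_card gb; rewrite /pset cardsE (card_uniqP ug) /=; lia.
have [q qb qp] : exists2 q, q \in b & q != p.
  have : (0 < #|b :\ p|)%N by have := cardsD1 p b; rewrite pb; lia.
  by case/card_gt0P=> q; rewrite !inE => /andP[qp qb]; exists q.
have le_n' : (#|b| <= n)%N by rewrite -ltnS.
(* A [killp] speaks of all words, but the claim is available only for words in b of the given
   length; the restricted functional reconciles the two. *)
pose f1 := restr b (size w) f.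
have H1 : Adm f1 := Adm_restr _ _ Hf.
have -> : f w = f1 w by rewrite /f1 /restr wb eqxx.
apply: (alt_perm0 (adm_alt H1) pw); apply: (path_kill (A := [set p]) (q := q)) => //; last first.
- by rewrite inE.
- by rewrite -/c cEb.
move=> p'; rewrite inE => /eqP -> {p'} x v; rewrite {1}/f1 /restr.
case: ifP => // /andP[] /= /andP[gb vb] /eqP sv.
have xb : x \in b by apply: (subsetP gb); rewrite psetP !inE eqxx !orbT.
rewrite -[f _](_ : f1 ((p,q,x) :: v) = _); last by rewrite /f1 /restr /= gb vb sv eqxx.
have [->|xp] := eqVneq x p; first by rewrite (rep13 H1).
have [->|xq] := eqVneq x q; first by rewrite (rep23 H1).
(* After the letter p q x, any path between two of p, q, x in the remaining word [v] kills.
   Otherwise b falls into the component of p, that of q, and a rest containing x. *)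
pose f2 v := f1 ((p,q,x) :: v).
have H2 : Adm f2 := Adm_cons _ H1.
have kpq : killp p q f2 by move=> y u; apply: (quad_all H1).
have kpx : killp p x f2.
  by move=> y u; rewrite /f2 (adm_sg2 H1) (quad_all H1) oppr0.
have kqx : killp q x f2 by move=> y u; rewrite /f2 (cyc H1) (quad_all H1).
rewrite -/(f2 v).
have [es1 [r1 [pw1 ge1 ec1 rc1 [/andP[pc1 cb1] cs1]]]] := grow_exists_in pb vb.
set c1 := cov _ _ in ec1 rc1 pc1 cb1 cs1.
have kill (A : word) r : perm_eq v (A ++ r) -> f2 (A ++ r) = 0 -> f2 v = 0.
  by move=> pv; apply: (alt_perm0 (adm_alt H2)).
have [qc1|qc1] := boolP (q \in c1).
  apply: (kill _ _ pw1); apply: (path_kill (A := [set p]) (q := q)) => //; last by rewrite inE.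
  by move=> p'; rewrite inE => /eqP ->.
have [xc1|xc1] := boolP (x \in c1).
  apply: (kill _ _ pw1); apply: (path_kill (A := [set p]) (q := x)) => //; last by rewrite inE.
  by move=> p'; rewrite inE => /eqP ->.
have cltb1 : (#|c1| < #|b|)%N.
  by rewrite proper_card // properE cb1; apply/subsetPn; exists q.
have c10 : (0 < #|c1|)%N by apply/card_gt0P; exists p.
have [le1|lt1] := leqP #|c1| (2 * size es1).
  apply: (sub f2 v es1 r1 c1 H2 pw1 ec1 _ le1).
  by rewrite c10 (leq_trans cltb1).
have qb1 : q \in b :\: c1 by rewrite inE qc1.
have [es2 [r2 [pw2 ge2 ec2 rc2 [/andP[qc2 cb2] cs2]]]] := grow_exists_in qb1 rc1.
set c2 := cov _ _ in ec2 rc2 qc2 cb2 cs2.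
have pv2 : perm_eq v (es2 ++ (r2 ++ es1)).
  rewrite (perm_trans pw1) // perm_catC catA perm_cat2r //.
have [xc2|xc2] := boolP (x \in c2).
  apply: (kill _ _ pv2); apply: (path_kill (A := [set q]) (q := x)) => //; last by rewrite inE.
  by move=> p'; rewrite inE => /eqP ->.
have c2sub : (#|c2| <= #|b :\: c1|)%N by apply: subset_leq_card.
have cD1 : (#|b :\: c1| + #|c1| = #|b|)%N.
  by rewrite addnC -(cardsID c1 b) (setIidPr cb1).
have cD2 : (#|(b :\: c1) :\: c2| + #|c2| = #|b :\: c1|)%N.
  by rewrite addnC -(cardsID c2 (b :\: c1)) (setIidPr cb2).
have c20 : (0 < #|c2|)%N by apply/card_gt0P; exists q.
have [le2|lt2] := leqP #|c2| (2 * size es2).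
  apply: (sub f2 v es2 (r2 ++ es1) c2 H2 pv2 ec2 _ le2).
  by rewrite c20 (leq_ltn_trans c2sub) // (leq_trans _ le_n') // -cD1 -[X in (X < _)%N]addn0 ltn_add2l.
have d0 : (0 < #|(b :\: c1) :\: c2|)%N by apply/card_gt0P; exists x; rewrite !inE xc1 xc2.
have [le3|lt3] := leqP #|(b :\: c1) :\: c2| (2 * size r2).
  apply: (sub f2 v r2 (es2 ++ es1) ((b :\: c1) :\: c2) H2 _ rc2 _ le3).
    by rewrite (perm_trans pv2) // perm_catCA.
  by clear -d0 cD2 cD1 c10 le_n'; lia.
have sz : size v = (size es2 + (size r2 + size es1))%N by rewrite (perm_size pv2) !size_cat.
(* None of the three pieces is overfilled, so |b| >= 2 |v| + 3, against |b| <= 2 (|v| + 1). *)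
exfalso; by clear -lt1 lt2 lt3 cD1 cD2 bw sv sz; lia.
Qed.
End Letters3.

(** * Products of functionals over blocks *)

Section Products3.
Variable T : finType.
Notation letter := (T * T * T)%type.
Notation word := (seq letter).
Implicit Types (f : word -> rat) (g h : letter) (u v w : word) (b : {set T}).

(* Number of inversions when the letters inside [b] are moved to the front. *)
Fixpoint winv b w : nat :=
  if w is g :: w' then ((if inb b g then 0 else count (inb b) w') + winv b w')%N else 0%N.

(** The signed shuffle product, dual to concatenating a word inside b with a word of letters not
    inside b. *)
Definition wprod b f1 f2 w : rat :=
  (-1) ^+ winv b w * (f1 (filter (inb b) w) * f2 (filter (predC (inb b)) w)).

Lemma winv_cat b u v :
  winv b (u ++ v) = (winv b u + winv b v + count (predC (inb b)) u * count (inb b) v)%N.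
Proof.
elim: u => [|g u IHu] /=; first by rewrite addn0.
by rewrite IHu count_cat; case: (inb b g) => /=; lia.
Qed.

Lemma wprod_cons_in b f1 f2 g w : inb b g ->
  wprod b f1 f2 (g :: w) = wprod b (fun v => f1 (g :: v)) f2 w.
Proof. by rewrite /wprod /= => ->. Qed.

Lemma wprod_cons_out b f1 f2 g w : ~~ inb b g ->
  wprod b f1 f2 (g :: w) = (-1) ^+ count (inb b) w * wprod b f1 (fun v => f2 (g :: v)) w.
Proof. by rewrite /wprod /= => /negbTE -> /=; rewrite exprD -!mulrA. Qed.

Lemma wprod2 b f1 f2 g h v :
  let s := (-1) ^+ winv b v in let n := (-1) ^+ count (inb b) v in
  let v1 := filter (inb b) v in let v2 := filter (predC (inb b)) v in
  wprod b f1 f2 [:: g, h & v] = s *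
   (if inb b g then if inb b h then f1 [:: g, h & v1] * f2 v2
                    else n * (f1 (g :: v1) * f2 (h :: v2))
    else if inb b h then - n * (f1 (h :: v1) * f2 (g :: v2))
         else f1 v1 * f2 [:: g, h & v2]).
Proof.
move=> s n v1 v2; rewrite /wprod /= -/v1 -/v2.
case: (inb b g); case: (inb b h); rewrite /= ?add0n ?add1n ?exprD ?exprS -/s -/n; try by ring.
have -> : n * (n * s) = s by rewrite mulrA -expr2 /n sqrr_sign mul1r.
by [].
Qed.

(** Together with [swapb], this says that the functional sees b contracted to a single point. *)
Definition kill2 b f := forall x y z v, x \in b -> y \in b -> f ((x,y,z) :: v) = 0.
Definition swapb b f := forall x x' y z v, x \in b -> x' \in b -> f ((x,y,z) :: v) = f ((x',y,z) :: v).

(** The six-term relation is the crucial case. Either its terms all go to one factor, where the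
    relation holds, or [f2] sees the points of b as one and the surviving terms cancel by [swapb]
    and antisymmetry. *)
Lemma Adm_wprod b f1 f2 : Adm f1 -> Adm f2 -> kill2 b f2 -> swapb b f2 -> Adm (wprod b f1 f2).
Proof.
move=> H1 H2 k2 sb.
have k12 x y z v : x \in b -> y \in b -> f2 ((x,y,z) :: v) = 0 by apply: k2.
have k13 x y z v : x \in b -> z \in b -> f2 ((x,y,z) :: v) = 0.
  by move=> xb zb; rewrite (adm_sg2 H2) k2 ?oppr0.
have k23 x y z v : y \in b -> z \in b -> f2 ((x,y,z) :: v) = 0.
  by move=> yb zb; rewrite (cyc H2) k2.
have j12 g x y z v : x \in b -> y \in b -> f2 [:: g, (x,y,z) & v] = 0.
  by move=> xb yb; rewrite (sw H2) k12 ?oppr0.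
have j13 g x y z v : x \in b -> z \in b -> f2 [:: g, (x,y,z) & v] = 0.
  by move=> xb yb; rewrite (sw H2) k13 ?oppr0.
have j23 g x y z v : y \in b -> z \in b -> f2 [:: g, (x,y,z) & v] = 0.
  by move=> xb yb; rewrite (sw H2) k23 ?oppr0.
have s3 x x' y z v : x \in b -> x' \in b -> f2 ((x,y,z) :: v) = - f2 ((y,x',z) :: v).
  by move=> xb xb'; rewrite (sb x x') // (adm_sg1 H2).
split.
- move=> u g h v; rewrite /wprod !winv_cat !filter_cat /= !addnA.
  case: (inb b g); case: (inb b h) => //=; rewrite ?add0n ?addn0 ?add1n.
  + by rewrite (adm_alt H1); ring.
  + by rewrite (exprD _ _ (_ * _)%N) [in RHS](exprD _ _ (_ * _)%N) addnS addSn exprS; ring.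
  + by rewrite (exprD _ _ (_ * _)%N) [in RHS](exprD _ _ (_ * _)%N) addnS addSn exprS; ring.
  + by rewrite (adm_alt H2); ring.
- move=> x y z v; have E : inb b (y,x,z) = inb b (x,y,z) by rewrite !inbE andbCA.
  case: (boolP (inb b (x,y,z))) => i.
    by rewrite !wprod_cons_in ?E // /wprod (adm_sg1 H1 x); ring.
  by rewrite !wprod_cons_out ?E // /wprod (adm_sg1 H2 x); ring.
- move=> x y z v; have E : inb b (x,z,y) = inb b (x,y,z) by rewrite !inbE [(z \in b) && _]andbC.
  case: (boolP (inb b (x,y,z))) => i.
    by rewrite !wprod_cons_in ?E // /wprod (adm_sg2 H1 x); ring.
  by rewrite !wprod_cons_out ?E // /wprod (adm_sg2 H2 x); ring.
- move=> x y z t v _; rewrite wprod2 !inbE.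
  case xb: (x \in b); case yb: (y \in b); rewrite /=; try case: (z \in b); try case: (t \in b);
    rewrite /= ?(quad_all H1) ?(quad_all H2) ?(k12 x y) ?mul0r ?mulr0 //.
move=> x y z l m v _; rewrite /six !wprod2 !inbE.
set s := (-1) ^+ winv b v; set n := (-1) ^+ count _ _; set v1 := filter _ v; set v2 := filter _ v.
have e1 := six_all H1 x y z l m v1; have e2 := six_all H2 x y z l m v2.
(* All 32 positions of the five points relative to b. The first two alternatives below are the cases
   where one factor receives both letters of each term; the last uses the contraction of b. *)
have [xb|xb] := boolP (x \in b); have [yb|yb] := boolP (y \in b); have [zb|zb] := boolP (z \in b);
have [lb|lb] := boolP (l \in b); have [mb|mb] := boolP (m \in b); rewrite /=;
first [ by transitivity (s * f1 v1 * six f2 x y z l m v2); [rewrite /six; ring|rewrite e2 mulr0]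
      | by transitivity (s * f2 v2 * six f1 x y z l m v1); [rewrite /six; ring|rewrite e1 mulr0]
      | repeat match goal with |- context [f2 ((?p, ?q, ?r) :: ?w)] =>
          first [rewrite (k12 p q r w) //; [] | rewrite (k13 p q r w) //; []
                | rewrite (k23 p q r w) //; []] end;
        repeat match goal with |- context [f2 (?g :: (?p, ?q, ?r) :: ?w)] =>
          first [rewrite (j12 g p q r w) //; [] | rewrite (j13 g p q r w) //; []
                | rewrite (j23 g p q r w) //; []] end;
        first [ by ring | by rewrite (s3 x z y) //; ring | by rewrite (s3 y x z) //; ring
              | by rewrite (s3 z y x) //; ring ] ].
Qed.
End Products3.

(** * Functionals of fixed degree on a set of points, and their characters *)

Definition mapl (T T' : Type) (h : T -> T') (g : T * T * T) : T' * T' * T' :=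
  (h g.1.1, h g.1.2, h g.2).

Section Spaces3.
Variable T : finType.
Notation letter := (T * T * T)%type.
Notation word := (seq letter).
Implicit Types (f : word -> rat) (g : letter) (u v w z : word) (b c N : {set T}).

Definition V3 k N f := Adm f /\ forall w, ~~ (all (inb N) w && (size w == k)) -> f w = 0.

Lemma Adm0 : Adm (fun _ : word => 0 : rat).
Proof. by split=> *; rewrite /six ?oppr0 ?addr0. Qed.

Lemma Adm_lin (c : rat) f f' : Adm f -> Adm f' -> Adm (fun w => c * f w + f' w).
Proof.
move=> H H'; split.
- by move=> u g h v; rewrite (adm_alt H) (adm_alt H'); ring.
- by move=> x y z v; rewrite (adm_sg1 H x) (adm_sg1 H' x); ring.
- by move=> x y z v; rewrite (adm_sg2 H x) (adm_sg2 H' x); ring.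
- by move=> x y z t v _; rewrite (quad_all H) (quad_all H') mulr0 addr0.
move=> x y z l m v _; have e := six_all H x y z l m v; have e' := six_all H' x y z l m v.
transitivity (c * six f x y z l m v + six f' x y z l m v); first by rewrite /six; ring.
by rewrite e e' mulr0 addr0.
Qed.

Lemma V3_subsp k N : subsp (V3 k N).
Proof.
split; first by split=> //; apply: Adm0.
by move=> c f f' [H1 H2] [H1' H2']; split=> [|w h]; [apply: Adm_lin|rewrite H2 // H2' // mulr0 addr0].
Qed.

Lemma V3_restr k N f : Adm f -> V3 k N (restr N k f).
Proof. by move=> H; split=> [|w h]; [apply: Adm_restr|rewrite /restr (negbTE h)]. Qed.

Lemma restr_in N k f w : all (inb N) w -> size w = k -> restr N k f w = f w.
Proof. by rewrite /restr => -> ->; rewrite eqxx. Qed.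

Definition words3 k N : seq word :=
  map val (filter (fun t : k.-tuple letter => all (inb N) (tval t)) (enum {: k.-tuple letter})).

Lemma words3P k N w : (w \in words3 k N) = all (inb N) w && (size w == k).
Proof.
apply/mapP/andP => [[t]|[wN /eqP sw]].
  by rewrite mem_filter => /andP[tN _] ->; rewrite tN size_tuple.
have sw' : size w == k by rewrite sw.
by exists (Tuple sw') => //; rewrite mem_filter mem_enum wN.
Qed.

Lemma V3_frame k N : exists2 fr, frame (V3 k N) fr & {in fr, forall p, p.1 \in words3 k N}.
Proof.
apply: frame_exists; first exact: V3_subsp.
move=> f [H1 H2] H3; apply/funext => w.
have [wN|wN] := boolP (all (inb N) w && (size w == k)); last exact: H2.
by apply: H3; rewrite words3P.
Qed.

Definition fr3 k N := projT1 (cid2 (V3_frame k N)).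
Lemma fr3_frame k N : frame (V3 k N) (fr3 k N).
Proof. by rewrite /fr3; case: cid2. Qed.
Lemma fr3_word k N p : p \in fr3 k N -> all (inb N) p.1 /\ size p.1 = k.
Proof. by rewrite /fr3; case: cid2 => fr /= _ H /H; rewrite words3P => /andP[-> /eqP ->]. Qed.
Lemma fr3_V k N p : p \in fr3 k N -> V3 k N p.2.
Proof. by case: (fr3_frame k N) => H _ /H. Qed.

Lemma fr3_rec k N f w : Adm f -> all (inb N) w -> size w = k ->
  \sum_(p <- fr3 k N) f p.1 * p.2 w = f w.
Proof.
move=> H wN sw; have V := V3_restr k N H; case: (fr3_frame k N) => _ /(_ _ V).
move=> /(congr1 (fun F => F w)); rewrite restr_in // => ->.
by rewrite /lc_fn big_seq [RHS]big_seq; apply: eq_bigr => p /fr3_word[pN sp]; rewrite restr_in.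
Qed.

Lemma vanish_sub f w u v c : Adm f -> perm_eq w (u ++ v) -> all (inb c) u ->
  (0 < #|c|)%N -> (#|c| <= 2 * size u)%N -> f w = 0.
Proof.
move=> Hf pw cu c0 cs; apply: (alt_perm0 (adm_alt Hf) (w' := v ++ u)).
  by rewrite (perm_trans pw) // perm_catC.
exact: (vanish (Adm_cat v Hf) cu).
Qed.

Lemma pset_neq0 g : exists x, x \in pset g.
Proof. by exists g.2; rewrite psetP !inE eqxx !orbT. Qed.

Lemma inb_disj b c g : inb b g -> [disjoint b & c] -> ~~ inb c g.
Proof.
move=> /subsetP gb dbc; apply/negP => /subsetP gc; have [x xg] := pset_neq0 g.
by have := disjointFr dbc (gb _ xg); rewrite (gc _ xg).
Qed.

Lemma all_inb_disj b c w : all (inb b) w -> [disjoint b & c] -> all (predC (inb c)) w.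
Proof. by move=> /allP wb d; apply/allP => g /wb gb; apply: (inb_disj gb). Qed.

Lemma all_inbS b c w : b \subset c -> all (inb b) w -> all (inb c) w.
Proof. by move=> bc /allP wb; apply/allP => g /wb gb; apply: subset_trans bc. Qed.

Lemma winv_in b u : all (inb b) u -> winv b u = 0%N.
Proof. by elim: u => [//|g u IHu] /= /andP[-> /IHu ->]. Qed.
Lemma winv_out b u : all (predC (inb b)) u -> winv b u = 0%N.
Proof.
elim: u => [//|g u IHu] /= /andP[/negbTE -> hu]; rewrite IHu // addn0.
by apply/eqP; rewrite -leqn0 leqNgt -has_count; apply/hasPn => x xu; apply: (allP hu).
Qed.

Lemma filter_out b u : all (predC (inb b)) u -> filter (inb b) u = [::].
Proof. by elim: u => [//|g u IHu] /= /andP[/negbTE -> /IHu]. Qed.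
Lemma filter_outC b u : all (inb b) u -> filter (predC (inb b)) u = [::].
Proof. by elim: u => [//|g u IHu] /= /andP[-> /IHu]. Qed.

Lemma wprod_cat b f1 f2 u v : all (inb b) u -> all (predC (inb b)) v ->
  wprod b f1 f2 (u ++ v) = f1 u * f2 v.
Proof.
move=> ub vb; rewrite /wprod winv_cat winv_in // winv_out // !filter_cat.
rewrite (filter_out vb) (filter_outC ub) cats0 (all_filterP ub) (all_filterP vb).
have -> : count (predC (inb b)) u = 0%N by rewrite -size_filter filter_outC.
by rewrite mul0n expr0 mul1r.
Qed.

Lemma wprod_out b f1 f2 u z : all (predC (inb b)) u ->
  wprod b f1 f2 (u ++ z) =
  (-1) ^+ (size u * count (inb b) z) * wprod b f1 (fun y => f2 (u ++ y)) z.
Proof.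
move=> ub; rewrite /wprod winv_cat winv_out // !filter_cat (filter_out ub) (all_filterP ub).
have -> : count (predC (inb b)) u = size u by rewrite -size_filter (all_filterP ub).
by rewrite add0n exprD; ring.
Qed.

Lemma wprod_count r b f1 f2 z : V3 r b f1 ->
  (-1) ^+ (r * count (inb b) z) * wprod b f1 f2 z = (-1) ^+ r * wprod b f1 f2 z.
Proof.
case=> _ H; have [<-|ne] := eqVneq (count (inb b) z) r.
  by rewrite -signr_odd oddM andbb signr_odd.
by rewrite /wprod H ?mul0r ?mulr0 // size_filter (negbTE ne) andbF.
Qed.

Lemma V3_kill2 k N b f : V3 k N f -> [disjoint N & b] -> kill2 b f.
Proof.
move=> [_ H] d x y z v xb _; apply: H => /=; rewrite inbE.
by rewrite (disjointFl d xb).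
Qed.
Lemma V3_swapb k N b f : V3 k N f -> [disjoint N & b] -> swapb b f.
Proof.
by move=> [_ H] d x x' y z v xb x'b; rewrite !H //= inbE ?(disjointFl d xb) ?(disjointFl d x'b).
Qed.

Lemma Adm_wprodV k M b f1 f2 : Adm f1 -> V3 k M f2 -> [disjoint M & b] -> Adm (wprod b f1 f2).
Proof.
move=> H1 V d; apply: Adm_wprod => //; first by case: V.
  exact: V3_kill2 V d.
exact: V3_swapb V d.
Qed.

Lemma wprod_supp r k' b M f1 f2 w : V3 r b f1 -> V3 k' M f2 -> wprod b f1 f2 w != 0 ->
  [/\ size (filter (inb b) w) = r, all (inb M) (filter (predC (inb b)) w) &
      size (filter (predC (inb b)) w) = k'].
Proof.
move=> [_ H1] [_ H2]; rewrite /wprod !mulf_eq0 !negb_or => /and3P[_ n1 n2].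
have /andP[_ /eqP ->] : all (inb b) (filter (inb b) w) && (size (filter (inb b) w) == r).
  by apply/negPn/negP => /H1 e; rewrite e eqxx in n1.
have /andP[-> /eqP ->] : all (inb M) (filter (predC (inb b)) w) && (size (filter (predC (inb b)) w) == k').
  by apply/negPn/negP => /H2 e; rewrite e eqxx in n2.
by [].
Qed.

Lemma V3_wprod r k' b M N f1 f2 : V3 r b f1 -> V3 k' M f2 -> [disjoint M & b] ->
  b :|: M \subset N -> V3 (r + k') N (wprod b f1 f2).
Proof.
move=> V1 V2 d sN; split=> [|w]; first by apply: (Adm_wprodV _ V2) => //; case: V1.
apply: contraNeq => nz; have [s1 a2 s2] := wprod_supp V1 V2 nz.
move: sN; rewrite subUset => /andP[bN MN].
apply/andP; split; last by rewrite -(count_predC (inb b)) -!size_filter s1 s2.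
apply/allP => g gw; have [gb|gb] := boolP (inb b g); first exact: subset_trans bN.
apply: subset_trans MN; apply: (allP a2); by rewrite mem_filter /= gb.
Qed.

Lemma wprod_letter r k' b M f1 f2 w g : V3 r b f1 -> V3 k' M f2 -> [disjoint M & b] ->
  wprod b f1 f2 w != 0 -> g \in w -> inb b g \/ [disjoint pset g & b].
Proof.
move=> V1 V2 d nz gw; have [_ a2 _] := wprod_supp V1 V2 nz.
have [gb|gb] := boolP (inb b g); [by left|right].
have gM : inb M g by apply: (allP a2); rewrite mem_filter /= gb.
by apply: disjointWl d.
Qed.

(** The |b|/2 letters inside b are distributed over c and its complement in b, and one of these two
    sets gets at least half as many letters as it has points. *)
Lemma wprod_SV2 k' b M f1 f2 u z c : V3 (#|b|./2) b f1 -> V3 k' M f2 -> [disjoint M & b] ->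
  all (inb c) u -> (0 < #|c|)%N -> c \proper b -> all (fun g => [disjoint pset g & c]) z ->
  wprod b f1 f2 (u ++ z) = 0.
Proof.
move=> V1 V2 d uc c0 cb zc; apply/eqP/negPn/negP => nz.
have HA := Adm_wprodV (proj1 V1) V2 d.
have cb' := proper_sub cb; have cD : (#|b :\: c| + #|c| = #|b|)%N.
  by rewrite addnC -(cardsID c b) (setIidPr cb').
have ltc := proper_card cb.
have [le|lt] := leqP #|c| (2 * size u).
  by rewrite (vanish_sub HA (perm_refl _) uc) ?eqxx in nz.
have [s1 _ _] := wprod_supp V1 V2 nz.
pose zb := filter (inb b) z; pose zo := filter (predC (inb b)) z.
have pz : perm_eq (u ++ z) (zb ++ (zo ++ u)).
  by rewrite perm_catC catA perm_cat2r perm_sym perm_filterC.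
have zbc : all (inb (b :\: c)) zb.
  apply/allP => g; rewrite mem_filter => /andP[gb gz].
  by rewrite /inb subsetD; apply/andP; split=> //; apply: (allP zc).
have ub : filter (inb b) u = u by apply/all_filterP/(all_inbS cb').
rewrite filter_cat ub size_cat -/zb in s1.
have [le2|lt2] := leqP #|b :\: c| (2 * size zb).
  by rewrite (vanish_sub HA pz zbc) ?eqxx // in nz; clear -ltc cD; lia.
by clear -s1 lt lt2 cD; lia.
Qed.

(** Where a product does not vanish, every letter lies inside b or misses b ([wprod_letter]). The
    |c|/2 letters of u are then distributed over the two parts into which b cuts c, and one part is
    overfilled. *)
Lemma wprod_SV k' b M f1 f2 u z c : V3 (#|b|./2) b f1 -> V3 k' M f2 -> [disjoint M & b] ->
  all (inb c) u -> size u = #|c|./2 -> ~~ [disjoint c & b] -> ~~ (c \subset b) ->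
  wprod b f1 f2 (u ++ z) = 0.
Proof.
move=> V1 V2 d uc su cb ncb; apply/eqP/negPn/negP => nz.
have HA := Adm_wprodV (proj1 V1) V2 d.
have let_u g : g \in u -> inb b g \/ [disjoint pset g & b].
  by move=> gu; apply: (wprod_letter V1 V2 d nz); rewrite mem_cat gu.
pose u1 := filter (inb b) u; pose u2 := filter (predC (inb b)) u.
have pu : perm_eq u (u1 ++ u2) by rewrite perm_sym perm_filterC.
have a1 : all (inb (c :&: b)) u1.
  apply/allP => g; rewrite mem_filter => /andP[gb gu].
  by rewrite /inb subsetI; apply/andP; split=> //; apply: (allP uc).
have a2 : all (inb (c :\: b)) u2.
  apply/allP => g; rewrite mem_filter /= => /andP[gb gu].
  rewrite /inb subsetD; apply/andP; split; first exact: (allP uc).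
  by have [e|//] := let_u g gu; rewrite e in gb.
have c1 : (0 < #|c :&: b|)%N by rewrite card_gt0 setI_eq0.
have c2 : (0 < #|c :\: b|)%N by rewrite card_gt0 setD_eq0.
have cs := cardsID b c.
have sz : size u = (size u1 + size u2)%N by rewrite (perm_size pu) size_cat.
have [le|lt] := leqP #|c :&: b| (2 * size u1).
  rewrite (vanish_sub HA (_ : perm_eq _ (u1 ++ (u2 ++ z))) a1) ?eqxx // in nz.
  by rewrite catA perm_cat2r.
have [le2|lt2] := leqP #|c :\: b| (2 * size u2).
  rewrite (vanish_sub HA (_ : perm_eq _ (u2 ++ (u1 ++ z))) a2) ?eqxx // in nz.
  by rewrite catA perm_cat2r (perm_trans pu) // perm_catC.
by clear -cs sz su lt lt2; lia.
Qed.

Lemma grow_inside b (A : {set T}) w : grow A w -> A \subset b ->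
  (forall g, g \in w -> inb b g \/ [disjoint pset g & b]) -> cov A w \subset b.
Proof.
elim: w A => [//|g w IHw] A /= /andP[gA gw] Ab H; apply: IHw => //; last first.
  by move=> h hw; apply: H; rewrite in_cons hw orbT.
rewrite subUset Ab; have [//|d] := H g (mem_head _ _).
case/set0Pn: gA => x; rewrite inE => /andP[xg xA].
by have := disjointFr d xg; rewrite (subsetP Ab _ xA).
Qed.
End Spaces3.

Lemma Adm_pull (T T' : finType) (h : T -> T') f :
  Adm f -> Adm (fun w => f (map (mapl h) w)).
Proof.
move=> H; split.
- by move=> u x y v; rewrite !map_cat /= (adm_alt H).
- by move=> a b c v; rewrite /= (adm_sg1 H).
- by move=> a b c v; rewrite /= (adm_sg2 H).
- by move=> a b c d v _; rewrite /= (quad_all H).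
by move=> a b c l m v _; apply: (six_all H).
Qed.

Lemma Adm_catr (T : finType) (f : seq (T * T * T) -> rat) u : Adm f -> Adm (fun w => f (w ++ u)).
Proof.
move=> H; split=> [v x y w|a b c v|a b c v|a b c d v _|a b c l m v _].
- by rewrite -!catA /= (adm_alt H).
- by rewrite /= (adm_sg1 H).
- by rewrite /= (adm_sg2 H).
- by rewrite /= (quad_all H).
exact: (six_all H).
Qed.

Definition pullr (T T' : finType) (N : {set T}) k (h : T -> T') f : seq (T * T * T) -> rat :=
  restr N k (fun w => f (map (mapl h) w)).

Lemma lin_pullr (T T' : finType) (N : {set T}) k (h : T -> T') : lin (pullr N k h).
Proof.
move=> I s c f; apply/funext => w; rewrite /pullr /restr /lc_fn; case: ifP => // _.
by rewrite big1 // => i _; rewrite mulr0.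
Qed.

Lemma V3_pullr (T T' : finType) (N : {set T}) k (h : T -> T') f : Adm f -> V3 k N (pullr N k h f).
Proof. by move=> H; apply/V3_restr/Adm_pull. Qed.

Definition chi3 (T : finType) k (N : {set T}) (pi : T -> T) : rat := Tr (V3 k N) (pullr N k pi).

Lemma inb_map (T T' : finType) (N : {set T}) (N' : {set T'}) (h : T -> T') w :
  {in N, forall x, h x \in N'} -> all (inb N) w -> all (inb N') (map (mapl h) w).
Proof.
move=> hN /allP wN; rewrite all_map; apply/allP => -[[x y] z] /wN /=.
by rewrite !inbE => /and3P[xN yN zN]; rewrite !hN.
Qed.

Lemma map_mapl (T T' T'' : Type) (h : T -> T') (h' : T' -> T'') w :
  map (mapl h') (map (mapl h) w) = map (mapl (fun x => h' (h x))) w.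
Proof. by rewrite -map_comp; apply: eq_map => -[[]]. Qed.

Lemma mapl_in (T T' : finType) (N : {set T}) (h h' : T -> T') w :
  {in N, h =1 h'} -> all (inb N) w -> map (mapl h) w = map (mapl h') w.
Proof.
move=> e /allP wN; apply/eq_in_map => -[[x y] z] /wN; rewrite inbE => /and3P[xN yN zN].
by rewrite /mapl /= !e.
Qed.

Lemma pullr_comp (T T' T'' : finType) (N : {set T}) (N' : {set T'}) k
    (h : T -> T') (h' : T' -> T'') f : {in N, forall x, h x \in N'} ->
  pullr N k h (pullr N' k h' f) = pullr N k (fun x => h' (h x)) f.
Proof.
move=> hN; apply/funext => w; rewrite /pullr /restr; case: ifP => // /andP[wN /eqP sw].
by rewrite (inb_map hN wN) size_map sw eqxx /= map_mapl.
Qed.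

Lemma pullr_eq (T T' : finType) (N : {set T}) k (h h' : T -> T') f :
  {in N, h =1 h'} -> pullr N k h f = pullr N k h' f.
Proof.
move=> e; apply/funext => w; rewrite /pullr /restr; case: ifP => // /andP[wN _].
by rewrite (mapl_in e wN).
Qed.

Lemma chi3_eq (T : finType) (N : {set T}) k (h h' : T -> T) :
  {in N, h =1 h'} -> chi3 k N h = chi3 k N h'.
Proof.
by move=> e; rewrite /chi3; congr Tr; apply/funext => f; apply: pullr_eq.
Qed.

Lemma chi3E (T : finType) k (N : {set T}) pi : {in N, forall x, pi x \in N} ->
  chi3 k N pi = \sum_(p <- fr3 k N) p.2 (map (mapl pi) p.1).
Proof.
move=> piN; rewrite /chi3 (TrE (fr3_frame k N) (lin_pullr _ _ _)); last first.
  by move=> f [H _]; apply: V3_pullr.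
rewrite /trF big_seq [RHS]big_seq; apply: eq_bigr => p pf; have [pN sp] := fr3_word pf.
by rewrite /pullr restr_in.
Qed.

Lemma Adm_delta0 (T : finType) : Adm (fun w : seq (T * T * T) => (w == [::])%:R).
Proof. by split=> [[|? ?] *|*|*|*|*]; rewrite /six ?oppr0 ?addr0. Qed.

Lemma chi3_set0 (T : finType) k pi : chi3 k (set0 : {set T}) pi = (k == 0%N)%:R.
Proof.
have in0 (w : seq (T * T * T)) : all (inb set0) w = (w == [::]).
  case: w => [//|g w] /=; apply/negbTE; rewrite negb_and; apply/orP; left.
  by apply/negP; rewrite /inb subset0 => /eqP e; have [x] := pset_neq0 g; rewrite e inE.
have VF f : V3 k set0 f -> V3 k set0 (pullr set0 k pi f) by case=> H _; apply: V3_pullr.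
have [k0|k0] := eqVneq k 0%N; last first.
  rewrite /chi3 (TrE (fr := [::]) _ (lin_pullr _ _ _) VF); first by rewrite /trF big_nil.
  split=> // f [_ H]; apply/funext => w; rewrite /lc_fn big_nil H // in0.
  by case: eqP => [->|//]; rewrite eq_sym (negbTE k0).
rewrite /chi3 k0 in VF *.
pose fr := [:: ([::] : seq (T * T * T), fun w : seq (T * T * T) => (w == [::])%:R : rat)].
rewrite (TrE (fr := fr) _ (lin_pullr _ _ _) VF); first by rewrite /trF /fr big_seq1 /pullr /restr.
split=> [p|f [_ H]].
  rewrite inE => /eqP -> /=; split; first exact: Adm_delta0.
  by move=> w; rewrite in0; case: eqP => [->|].
apply/funext => w; rewrite /lc_fn /fr big_seq1 /=; case: eqP => [->|ne]; first by rewrite mulr1.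
by rewrite mulr0 H // in0; case: eqP.
Qed.

Lemma chi3_relabel (T T' : finType) k (N : {set T}) (h : T -> T') (pi : T -> T) (pi' : T' -> T') :
  {in N &, injective h} -> {in N, forall x, pi x \in N} -> {in N, forall x, h (pi x) = pi' (h x)} ->
  chi3 k (h @: N) pi' = chi3 k N pi.
Proof.
move=> hI piN hpi; have [->|/set0Pn[x0 x0N]] := eqVneq N set0; first by rewrite imset0 !chi3_set0.
pose hi y := odflt x0 [pick x in N | h x == y].
have hiK x : x \in N -> hi (h x) = x.
  move=> xN; rewrite /hi; case: pickP => [z /andP[zN /eqP e]|/(_ x)]; first exact: hI.
  by rewrite xN eqxx.
have hN x : x \in N -> h x \in h @: N by move=> xN; apply: imset_f.
have hiN y : y \in h @: N -> hi y \in N by case/imsetP=> x xN ->; rewrite hiK.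
have hK y : y \in h @: N -> h (hi y) = y by case/imsetP=> x xN ->; rewrite hiK.
have pi'N y : y \in h @: N -> pi' y \in h @: N.
  by case/imsetP=> x xN ->; rewrite -hpi // hN // piN.
have := Tr_comm (fr3_frame k (h @: N)) (fr3_frame k N) (lin_pullr N k h)
  (lin_pullr (h @: N) k (fun y => hi (pi' y)))
  (fun f (H : V3 k (h @: N) f) => V3_pullr N k h (proj1 H))
  (fun f (H : V3 k N f) => V3_pullr (h @: N) k (fun y => hi (pi' y)) (proj1 H)).
rewrite /chi3 => E.
transitivity (Tr (V3 k (h @: N)) (fun f => pullr (h @: N) k (fun y => hi (pi' y)) (pullr N k h f))).
  congr Tr; apply/funext => f; rewrite pullr_comp; last by move=> y /pi'N /hiN.
  by apply: pullr_eq => y /pi'N /hK ->.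
rewrite E; congr Tr; apply/funext => f; rewrite pullr_comp //.
by apply: pullr_eq => x xN; rewrite -hpi // hiK // piN.
Qed.

(** * Splitting off the block of a point *)

Section Peel.
Variable T : finType.
Notation letter := (T * T * T)%type.
Notation word := (seq letter).
Implicit Types (f : word -> rat) (g : letter) (u v w z : word) (b c N : {set T}).

(** A block of 2r+1 points carries |b|/2 = r letters. For b of even size the functionals of degree
    |b|/2 are zero by [vanish], so such sets may stay in the index set. *)
Definition peelc k N x0 b := [&& x0 \in b, b \subset N & (#|b|./2 <= k)%N].

Definition peelfr k N x0 : seq (word * (word -> rat)) :=
  flatten [seq [seq (p.1 ++ q.1, wprod b p.2 q.2) | p <- fr3 #|b|./2 b, q <- fr3 (k - #|b|./2)%N (N :\: b)]
    | b <- enum (peelc k N x0)].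

Lemma peelfr_sum (R : nmodType) k N x0 (F : word * (word -> rat) -> R) :
  \sum_(r <- peelfr k N x0) F r =
  \sum_(b | peelc k N x0 b) \sum_(p <- fr3 #|b|./2 b) \sum_(q <- fr3 (k - #|b|./2)%N (N :\: b))
    F (p.1 ++ q.1, wprod b p.2 q.2).
Proof.
rewrite /peelfr big_flatten /= big_map big_enum /=; apply: eq_bigr => b _.
by rewrite big_allpairs_dep.
Qed.

Lemma disjDl N b : [disjoint N :\: b & b].
Proof. by rewrite -setI_eq0; apply/eqP/setP => x; rewrite !inE; case: (x \in b); rewrite ?andbF. Qed.

Lemma peel_V k N x0 b p q : peelc k N x0 b ->
  p \in fr3 #|b|./2 b -> q \in fr3 (k - #|b|./2)%N (N :\: b) -> V3 k N (wprod b p.2 q.2).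
Proof.
case/and3P=> _ bN bk pf qf; rewrite -(subnKC bk).
apply: V3_wprod (fr3_V pf) (fr3_V qf) (disjDl _ _) _.
by rewrite subUset bN subsetDl.
Qed.

(** Both sides are admissible, so they may be compared on words consisting of the component c of x0
    followed by the rest. There only b = c contributes: a nonzero product forces c into b, and
    [wprod_SV2] excludes a proper inclusion. *)
Lemma peel_frame k N x0 : x0 \in N -> frame (V3 k N) (peelfr k N x0).
Proof.
move=> x0N; have frV : {in peelfr k N x0, forall r, V3 k N r.2}.
  move=> r /flatten_mapP[b]; rewrite mem_enum => cb /allpairsP[[p q] /= [pf qf ->]] /=.
  exact: peel_V cb pf qf.
split=> // f Vf; have [Hf sf] := Vf.
set R := lc_fn _ _ _; have VR : V3 k N R by apply: subsp_lc => //; apply: V3_subsp.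
have [HR sR] := VR; apply/funext => v.
have [/andP[vN /eqP sv]|nv] := boolP (all (inb N) v && (size v == k)); last by rewrite sf // sR.
have [es [rest [pv ge ec rc [/andP[xc cN] cs]]]] := grow_exists_in x0N vN.
set c := cov _ _ in ec rc xc cN cs.
have [e _ E] := alt_perm pv; rewrite (E f (adm_alt Hf)) (E R (adm_alt HR)); congr (_ * _).
have c0 : (0 < #|c|)%N by apply/card_gt0P; exists x0.
(* If the component is overfilled both sides vanish; otherwise |c| = 2 |es| + 1, the largest size
   that [es] can cover. *)
have [le|lt] := leqP #|c| (2 * size es).
  by rewrite (vanish_sub Hf (perm_refl _) ec) // (vanish_sub HR (perm_refl _) ec).
have ce : size es = #|c|./2 by clear -cs lt; lia.
have sz : (size es + size rest)%N = k by rewrite -sv (perm_size pv) size_cat.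
have cc : peelc k N x0 c by rewrite /peelc xc cN -ce -sz leq_addr.
rewrite /R /lc_fn peelfr_sum (bigD1 c) //= [X in _ = _ + X]big1 ?addr0; last first.
  move=> b /andP[cb bc]; rewrite big_seq big1 // => p pf; rewrite big_seq big1 // => q qf.
  suff -> : wprod b p.2 q.2 (es ++ rest) = 0 by rewrite mulr0.
  have Vp := fr3_V pf; have Vq := fr3_V qf; have dj := disjDl N b.
  have [//|nz] := eqVneq (wprod b p.2 q.2 (es ++ rest)) 0.
  have cb' : c \subset b.
    apply: grow_inside ge _ _; first by rewrite sub1set; case/and3P: cb.
    by move=> g ge'; apply: (wprod_letter Vp Vq dj nz); rewrite mem_cat ge'.
  apply: (wprod_SV2 Vp Vq dj ec c0); first by rewrite properEneq eq_sym bc.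
  apply/allP => g /(allP rc); rewrite /inb subsetD => /andP[_]; exact.
have rC : all (predC (inb c)) rest by apply: all_inb_disj rc (disjDl _ _).
under eq_bigr => p _ do under eq_bigr => q _ do rewrite wprod_cat // mulrCA mulrC.
rewrite exchange_big /=.
transitivity (\sum_(q <- fr3 (k - #|c|./2)%N (N :\: c)) f (es ++ q.1) * q.2 rest).
  by rewrite (fr3_rec (Adm_cat es Hf) rc) // -ce -sz addKn.
apply: eq_bigr => q _; rewrite -(fr3_rec (Adm_catr q.1 Hf) ec ce) mulr_suml.
by apply: eq_bigr => p _; ring.
Qed.
End Peel.

(** * Traces and cyclically permuted blocks *)

Section CyclicBlocks.
Variable T : finType.
Notation letter := (T * T * T)%type.
Notation word := (seq letter).
Implicit Types (f xi : word -> rat) (g : letter) (u v w z : word) (b c N co : {set T}).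
Variable pi : {perm T}.
Notation mw := (map (mapl pi)).

(** The state of a trace while a block is followed along pi: the block [co] has been split off and
    its functional [xi] is waiting, [u] is the word carried to the current image of [co], and [N] is
    the set of remaining points. *)
Definition Top N k co xi u f : word -> rat :=
  restr N k (fun w => wprod co xi f (u ++ mw w)).
Definition Tt N k co xi u := Tr (V3 k N) (Top N k co xi u).

Lemma lin_Top N k co xi u : lin (Top N k co xi u).
Proof.
move=> I s c f; apply/funext => w; rewrite /Top /restr /lc_fn; case: ifP => _; last first.
  by rewrite big1 // => i _; rewrite mulr0.
by rewrite /wprod /lc_fn mulr_sumr mulr_sumr; apply: eq_bigr => i _; ring.
Qed.

Lemma V3_Top N k co xi u f : Adm xi -> [disjoint N & co] -> V3 k N f -> V3 k N (Top N k co xi u f).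
Proof.
move=> Hx d Vf; apply: V3_restr.
by apply: (Adm_pull pi (f := fun w => wprod co xi f (u ++ w))); apply/Adm_cat/(Adm_wprodV Hx Vf d).
Qed.

Lemma inb_perm b w : all (inb b) w -> all (inb (pi @: b)) (mw w).
Proof. by apply: inb_map => x xb; apply: imset_f. Qed.

Section Step.
Variables (N co ci : {set T}) (xi : word -> rat) (u : word).
Hypotheses (dN : [disjoint N & co]) (Vx : V3 #|co|./2 co xi) (sc : #|ci| = #|co|).
Hypotheses (uc : all (inb ci) u) (su : size u = #|ci|./2).

Lemma Tt_last k : ci = co -> {in N, forall x, pi x \in N} ->
  Tt N k co xi u = xi u * chi3 k N pi.
Proof.
move=> e piN; rewrite /Tt (TrE (fr3_frame k N) (lin_Top _ _ _ _ _)); last first.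
  by move=> f; apply: V3_Top => //; case: Vx.
rewrite chi3E // mulr_sumr /trF big_seq [RHS]big_seq; apply: eq_bigr => p pf.
have [pN sp] := fr3_word pf; rewrite /Top restr_in // wprod_cat //; first by rewrite -e.
by apply: all_inb_disj (inb_map piN pN) dN.
Qed.

Lemma Tt_bad k : ~~ [disjoint ci & co] -> ci != co -> Tt N k co xi u = 0.
Proof.
move=> nd ne; rewrite /Tt (TrE (fr3_frame k N) (lin_Top _ _ _ _ _)); last first.
  by move=> f; apply: V3_Top => //; case: Vx.
rewrite /trF big_seq big1 // => p pf; have [pN sp] := fr3_word pf.
rewrite /Top restr_in // (wprod_SV _ Vx (fr3_V pf) dN uc su nd) //.
by apply: contra ne => s; rewrite eqEcard s sc leqnn.
Qed.

Hypotheses (cN : ci \subset N) (c0 : (0 < #|ci|)%N).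
Hypothesis piN : pi @: N = (N :\: ci) :|: co.

(** In the frame that peels a point of [ci] only the block [ci] survives, because [u] saturates it.
    Contracting its frame turns the carried word into the image of [u]. Moving the r letters of [u]
    past the r letters that [co] receives gives (-1)^(r r) = (-1)^r. *)
Lemma Tt_step k : Tt N k co xi u =
  if (#|co|./2 <= k)%N then (-1) ^+ #|co|./2 * Tt (N :\: ci) (k - #|co|./2)%N co xi (mw u) else 0.
Proof.
have [x1 x1c] : exists x, x \in ci by apply/card_gt0P.
have x1N := subsetP cN _ x1c.
have Hx := proj1 Vx.
rewrite /Tt (TrE (peel_frame k x1N) (lin_Top _ _ _ _ _)); last first.
  by move=> f; apply: V3_Top.
have dci : [disjoint ci & co] by apply: disjointWl dN.
have uo : all (predC (inb co)) u by apply: all_inb_disj uc dci.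
have piNc : [disjoint pi @: N & ci].
  rewrite piN -setI_eq0 setIUl setU_eq0 !setI_eq0 disjDl disjoint_sym //.
rewrite /trF peelfr_sum.
have piS b w : b \subset N -> all (inb b) w -> all (fun g => [disjoint pset g & ci]) (mw w).
  move=> bN wb; apply/allP => g gw; apply: disjointWl piNc.
  by apply: (allP (all_inbS _ (inb_perm wb))) => //; apply: imsetS.
have off b p q : peelc k N x1 b -> p \in fr3 #|b|./2 b -> q \in fr3 (k - #|b|./2)%N (N :\: b) ->
    Top N k co xi u (wprod b p.2 q.2) (p.1 ++ q.1) =
    (-1) ^+ (size u * count (inb co) (mw (p.1 ++ q.1))) *
      wprod co xi (fun y => wprod b p.2 q.2 (u ++ y)) (mw (p.1 ++ q.1)).
  case/and3P=> _ bN bk pf qf; have [pN sp] := fr3_word pf; have [qN sq] := fr3_word qf.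
  rewrite /Top restr_in ?wprod_out //; last by rewrite size_cat sp sq subnKC.
  by rewrite all_cat (all_inbS bN pN) (all_inbS _ qN) // subsetDl.
have zero b p q : peelc k N x1 b -> b != ci ->
    p \in fr3 #|b|./2 b -> q \in fr3 (k - #|b|./2)%N (N :\: b) ->
    Top N k co xi u (wprod b p.2 q.2) (p.1 ++ q.1) = 0.
  move=> cb bci pf qf; rewrite off // {1}/wprod; set z := filter (predC _) _.
  have [pN sp] := fr3_word pf; have [qN sq] := fr3_word qf.
  case/and3P: cb => x1b bN bk.
  have -> : wprod b p.2 q.2 (u ++ z) = 0; last by rewrite !mulr0.
  have [cb|ncb] := boolP (ci \subset b).
    apply: (wprod_SV2 (fr3_V pf) (fr3_V qf) (disjDl _ _) uc c0).
      by rewrite properEneq eq_sym bci.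
    apply/allP => g; rewrite mem_filter map_cat mem_cat => /andP[_ /orP[]].
      exact: (allP (piS _ _ bN pN)).
    by apply: (allP (piS _ _ (subsetDl _ _) qN)).
  apply: (wprod_SV _ (fr3_V pf) (fr3_V qf) (disjDl _ _) uc su) => //.
  by apply/pred0Pn; exists x1; rewrite /= x1c.
rewrite -sc; case: ifP => ck; last first.
  rewrite big1 // => b cb; rewrite big_seq big1 // => p pf; rewrite big_seq big1 // => q qf.
  by apply: zero => //; apply: contraTneq cb => ->; rewrite /peelc ck !andbF.
rewrite (bigD1 ci) /=; last by rewrite /peelc x1c cN ck.
rewrite [X in _ + X]big1 ?addr0; last first.
  by move=> b /andP[cb bci]; rewrite big_seq big1 // => p pf; rewrite big_seq big1 // => q qf; apply: zero.
have dN' : [disjoint N :\: ci & co] by apply: disjointWl dN; apply: subsetDl.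
rewrite (TrE (fr3_frame _ (N :\: ci)) (lin_Top _ _ _ _ _)); last first.
  by move=> f; apply: V3_Top.
rewrite exchange_big /= /trF mulr_sumr big_seq [RHS]big_seq; apply: eq_bigr => q qf.
have [qN sq] := fr3_word qf; rewrite {2}/Top restr_in //.
have HG : Adm (fun w => wprod co xi q.2 (mw w ++ mw q.1)).
  apply: (Adm_pull pi (f := fun w => wprod co xi q.2 (w ++ mw q.1))).
  by apply/Adm_catr/(Adm_wprodV Hx (fr3_V qf) dN').
rewrite -(fr3_rec HG uc su) mulr_sumr big_seq [RHS]big_seq; apply: eq_bigr => p pf.
have [pN sp] := fr3_word pf.
have pc : peelc k N x1 ci by rewrite /peelc x1c cN ck.
rewrite off // su sc.
have -> : wprod co xi (fun y => wprod ci p.2 q.2 (u ++ y)) (mw (p.1 ++ q.1)) =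
          p.2 u * wprod co xi q.2 (mw (p.1 ++ q.1)).
  rewrite /wprod -/(wprod ci p.2 q.2 _) wprod_cat //; first by ring.
  apply/allP => g; rewrite mem_filter map_cat mem_cat => /andP[_ gw].
  have : [disjoint pset g & ci].
    by case/orP: gw; [apply: (allP (piS _ _ cN pN))|apply: (allP (piS _ _ (subsetDl _ _) qN))].
  by move=> dg; apply: contraL dg => gc; have [x xg] := pset_neq0 g; apply/pred0Pn; exists x; rewrite /= xg (subsetP gc).
by rewrite mulrCA (wprod_count _ _ Vx) map_cat; ring.
Qed.
End Step.

Notation itm i := (map (mapl (iter i pi))).
Definition img i b := iter i pi @: b.

Lemma imgS i b : img i.+1 b = pi @: img i b.
Proof. by rewrite /img -imset_comp. Qed.
Lemma img_card i b : #|img i b| = #|b|.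
Proof. by apply: card_imset; elim: i => [//|i IHi] x y /= /perm_inj /IHi. Qed.
Lemma iter_inj i : injective (iter i pi).
Proof. by elim: i => [//|i IHi] x y /= /perm_inj /IHi. Qed.
Lemma img_disj i j b : [disjoint img (i + j) b & img i b] = [disjoint img j b & b].
Proof.
have -> : img (i + j) b = iter i pi @: (img j b).
  by rewrite /img -imset_comp; apply: eq_imset => x /=; rewrite iterD.
by rewrite -!setI_eq0 -[X in _ :&: X]/(iter i pi @: b) -imsetI ?imset_eq0 // => x y _ _; apply: iter_inj.
Qed.

Definition orb i b : {set T} := \bigcup_(j < i) img j b.

Lemma orbS i b : orb i.+1 b = orb i b :|: img i b.
Proof. by rewrite /orb big_ord_recr. Qed.
Lemma orb1 b : orb 1 b = b.
Proof. by rewrite /orb big_ord1 /img /=; apply/setP => x; rewrite imset_id. Qed.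

Lemma sub_orb i b : b \subset orb i.+1 b.
Proof. by rewrite -{1}[b]orb1 /orb big_ord1 (bigD1 ord0) //= subsetUl. Qed.

Definition percyc i b := [&& (0 < i)%N, img i b == b &
  [forall j : 'I_i, (0 < j)%N ==> [disjoint img j b & b]]].

Variables (N : {set T}) (k : nat).
Hypothesis piN : pi @: N = N.

Lemma img_sub i b : b \subset N -> img i b \subset N.
Proof.
move=> bN; elim: i => [|i IHi]; first by rewrite /img /=; apply/subsetP => x; rewrite imset_id; apply/subsetP.
by rewrite imgS -piN imsetS.
Qed.

Lemma pi_orb i b : b \subset N -> pi @: (N :\: orb i b) = N :\: (pi @: orb i b).
Proof.
move=> bN; apply/setP => y; rewrite inE -{2}piN -(permKV pi y) !(mem_imset _ _ (@perm_inj _ pi)).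
by rewrite inE.
Qed.

Lemma pi_orb2 i b : pi @: orb i.+1 b :|: b = orb i.+2 b.
Proof.
rewrite /orb [in RHS]big_ord_recl /= setUC.
have -> : img 0 b = b by rewrite /img /=; apply/setP => x; rewrite imset_id.
congr (_ :|: _); rewrite (big_morph _ (@imsetU _ _ pi) (@imset0 _ _ pi)).
by apply: eq_bigr => j _; rewrite -imgS.
Qed.

(** The contribution of the block b to the trace of pi in [peelfr]. *)
Definition Tsum b := \sum_(p <- fr3 #|b|./2 b) Tt (N :\: b) (k - #|b|./2)%N b p.2 (mw p.1).

(** Each of the i - 1 applications of [Tt_step] removes the next image of b from N and contributes
    one sign (-1)^r. *)
Lemma Tsum_iter b i : (0 < #|b|)%N -> b \subset N -> (0 < i)%N -> (#|b|./2 <= k)%N ->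
  (forall j, (0 < j < i)%N -> [disjoint img j b & b]) ->
  Tsum b = if (i * #|b|./2 <= k)%N then
    (-1) ^+ ((i - 1) * #|b|./2) *
      \sum_(p <- fr3 #|b|./2 b) Tt (N :\: orb i b) (k - i * #|b|./2)%N b p.2 (itm i p.1)
  else 0.
Proof.
set r := #|b|./2 => b0 bN i0 rk; elim: i i0 => [//|[|i] IHi] _ dj.
  by rewrite mul1n rk mul0n expr0 mul1r /Tsum orb1.
rewrite IHi //; last by move=> j /andP[j0 ji]; apply: dj; rewrite j0 ltnS ltnW.
have E p : p \in fr3 r b -> Tt (N :\: orb i.+1 b) (k - i.+1 * r)%N b p.2 (itm i.+1 p.1) =
    if (r <= k - i.+1 * r)%N then (-1) ^+ r *
      Tt (N :\: orb i.+2 b) (k - i.+2 * r)%N b p.2 (itm i.+2 p.1) else 0.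
  move=> pf; have [pb sp] := fr3_word pf.
  rewrite (Tt_step (ci := img i.+1 b)).
  - by rewrite -/r -subnDA -mulSnr setDDl -orbS map_mapl.
  - by apply: disjointWr (sub_orb i b) (disjDl _ _).
  - exact: fr3_V.
  - exact: img_card.
  - by apply: inb_map pb => x xb; apply: imset_f.
  - by rewrite size_map sp img_card.
  - rewrite subsetD img_sub //= /orb; apply/bigcup_disjointP => j _ .
    case: j => j /= ji; rewrite -(subnKC (ltnW ji)) img_disj; apply: dj.
    by rewrite subn_gt0 ji ltnS leq_subr.
  - by rewrite img_card.
  rewrite pi_orb // setDDl -orbS; apply/setP => x; rewrite !inE -pi_orb2 !inE.
  have [xb|xb] /= := boolP (x \in b); last by rewrite !orbF.
  rewrite !orbT (subsetP bN) // andbT; apply/negP => xo.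
  move: xo; rewrite /orb (big_morph _ (@imsetU _ _ pi) (@imset0 _ _ pi)) => /bigcupP[j _].
  have djj : [disjoint img j.+1 b & b] by apply: dj; rewrite /= ltnS ltn_ord.
  by rewrite -imgS => xj; have := disjointFr djj xj; rewrite xb.
case: ifP => ik; last first.
  by case: ifP => // ik2; exfalso; move: ik ik2; rewrite mulSnr => /negbT; clear; lia.
rewrite big_seq (eq_bigr _ (fun p => E p)) -big_seq.
have -> : (r <= k - i.+1 * r)%N = (i.+2 * r <= k)%N by rewrite [(i.+2 * _)%N]mulSnr; clear -ik; lia.
case: ifP => _; last by rewrite big1 ?mulr0.
rewrite -mulr_sumr mulrA -exprD; congr (_ ^+ _ * _); clear; lia.
Qed.

Lemma orb_stable i b : (0 < i)%N -> img i b = b -> pi @: orb i b = orb i b.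
Proof.
case: i => [//|i] _ e; apply/eqP; rewrite eqEcard (card_imset _ (@perm_inj _ pi)) leqnn andbT.
rewrite /orb (big_morph _ (@imsetU _ _ pi) (@imset0 _ _ pi)); apply/bigcupsP => j _.
rewrite -imgS; have [lt|ge] := ltnP j.+1 i.+1; first exact: (bigcup_sup (Ordinal lt)).
have -> : j.+1 = i.+1 by apply/eqP; rewrite eqn_leq ge ltn_ord.
by rewrite e; apply: sub_orb.
Qed.

(** The process ends at the first image of b that meets b. If this image is b itself, [xi] evaluates
    the carried word and pi acts on what remains; otherwise [Tt_bad] gives 0. *)
Lemma Tsum_val b i : (0 < #|b|)%N -> b \subset N -> (0 < i)%N -> (#|b|./2 <= k)%N ->
  (forall j, (0 < j < i)%N -> [disjoint img j b & b]) -> ~~ [disjoint img i b & b] ->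
  Tsum b = if (i * #|b|./2 <= k)%N && (img i b == b) then
    (-1) ^+ ((i - 1) * #|b|./2) *
      (chi3 #|b|./2 b (iter i pi) * chi3 (k - i * #|b|./2)%N (N :\: orb i b) pi)
  else 0.
Proof.
move=> b0 bN i0 rk dj nd; rewrite (Tsum_iter b0 bN i0 rk dj).
case: (leqP _ k) => ik //=; have i1 : i = i.-1.+1 by rewrite prednK.
have dO : [disjoint N :\: orb i b & b] by rewrite i1; apply: disjointWr (sub_orb _ b) (disjDl _ _).
have wi p : p \in fr3 #|b|./2 b -> all (inb (img i b)) (itm i p.1) /\ size (itm i p.1) = #|img i b|./2.
  move=> pf; have [pb sp] := fr3_word pf; rewrite size_map sp img_card; split=> //.
  by apply: inb_map pb => x xb; apply: imset_f.
case: eqP => [e|/eqP ne]; last first.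
  rewrite big_seq big1 ?mulr0 // => p pf; have [w1 w2] := wi p pf.
  exact: (Tt_bad dO (fr3_V pf) (img_card i b) w1 w2).
rewrite chi3E; last by move=> x xb; rewrite -e imset_f.
congr (_ * _); rewrite mulr_suml big_seq [RHS]big_seq; apply: eq_bigr => p pf.
have [w1 w2] := wi p pf; apply: (Tt_last dO (fr3_V pf) w1) => // x.
rewrite -[N :\: orb i b](_ : pi @: (N :\: orb i b) = _) ?pi_orb ?(orb_stable i0 e) // => xN.
by rewrite -{1}(orb_stable i0 e) -pi_orb // imset_f.
Qed.

(** Only blocks of x0 that pi permutes in a cycle of i disjoint blocks contribute. Such a cycle
    yields the trace of pi^i on a single block, with the sign of cyclically permuting i factors of
    degree |b|/2. Since x0 returns after m steps, periods are at most m. *)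
Lemma chi3_blocks x0 m : x0 \in N -> iter m pi x0 = x0 -> (0 < m)%N ->
  chi3 k N pi = \sum_(i < m.+1) \sum_(b : {set T} |
      [&& x0 \in b, b \subset N, percyc i b & (i * #|b|./2 <= k)%N])
    (-1) ^+ ((i - 1) * #|b|./2) *
      (chi3 #|b|./2 b (iter i pi) * chi3 (k - i * #|b|./2)%N (N :\: orb i b) pi).
Proof.
move=> x0N e0 m0.
have step x : x \in N -> pi x \in N by move=> xN; rewrite -piN imset_f.
transitivity (\sum_(b | peelc k N x0 b) Tsum b).
  rewrite /chi3 (TrE (peel_frame k x0N) (lin_pullr _ _ _)); last first.
    by move=> f [H _]; apply: V3_pullr.
  rewrite /trF peelfr_sum; apply: eq_bigr => b cb; rewrite /Tsum big_seq [RHS]big_seq.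
  apply: eq_bigr => p pf; have dj := disjDl N b.
  rewrite /Tt (TrE (fr3_frame _ _) (lin_Top _ _ _ _ _)); last first.
    by move=> f; apply: V3_Top => //; case: (fr3_V pf).
  rewrite /trF big_seq [RHS]big_seq; apply: eq_bigr => q qf.
  have [pb sp] := fr3_word pf; have [qb sq] := fr3_word qf; case/and3P: cb => _ bN bk.
  rewrite /Top /pullr !restr_in ?map_cat // ?size_cat ?sp ?sq ?subnKC //.
  by rewrite all_cat (all_inbS bN pb) (all_inbS _ qb) // subsetDl.
rewrite (exchange_big_dep (peelc k N x0)) /=; last first.
  move=> i b _ /and4P[xb bN /and3P[i1 _ _] ik]; rewrite /peelc xb bN /=.
  by apply: leq_trans ik; rewrite leq_pmull.
apply: eq_bigr => b /and3P[xb bN bk].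
have b0 : (0 < #|b|)%N by apply/card_gt0P; exists x0.
have ex : exists i, (0 < i)%N && ~~ [disjoint img i b & b].
  exists m; rewrite m0; apply/pred0Pn; exists x0; rewrite /= xb andbT.
  by rewrite -{1}e0 imset_f.
case: (ex_minnP ex) => i /andP[i0 nd] min.
have dj j : (0 < j < i)%N -> [disjoint img j b & b].
  move=> /andP[j0 ji]; apply/negPn/negP => nd'.
  by have := min j; rewrite j0 nd' leqNgt ji => /(_ isT).
have im : (i <= m)%N.
  apply: min; rewrite m0; apply/pred0Pn; exists x0; rewrite /= xb andbT.
  by rewrite -{1}e0 imset_f.
rewrite (Tsum_val b0 bN i0 bk dj nd).
have uniqi (j : 'I_m.+1) : percyc j b -> j = i :> nat.
  case/and3P=> j0 /eqP ej /forallP dj'; apply/eqP; rewrite eqn_leq; apply/andP; split.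
    rewrite leqNgt; apply/negP => ij.
    by have := dj' (Ordinal ij); rewrite /= i0 (negbTE nd).
  apply: min; rewrite j0 ej; apply/pred0Pn; exists x0; by rewrite /= xb.
case: ifP => [/andP[ik /eqP e]|no].
  have lt : (i < m.+1)%N by rewrite ltnS.
  rewrite (bigD1 (Ordinal lt)) /= ?big1 ?addr0 //.
  - move=> j /andP[/and4P[_ _ /uniqi ej _] ne]; case/eqP: ne; exact: val_inj.
  rewrite xb bN ik andbT /= /percyc i0 e eqxx /=.
  by apply/forallP => j; apply/implyP => j0; apply: dj; rewrite j0 ltn_ord.
rewrite big1 // => j /and4P[_ _ pj jk]; have ej := uniqi j pj; move: jk no; rewrite ej => -> /=.
by case/and3P: pj => _; rewrite ej => ->.
Qed.
End CyclicBlocks.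

(** * Evaluation on the letters through two points *)

Section TwoPoints.
Variable T : finType.
Notation letter := (T * T * T)%type.
Notation word := (seq letter).
Implicit Types (f : word -> rat) (g : letter) (u v w z : word) (b c N A B : {set T}).

Lemma killp_restr p q N k f : killp p q f -> killp p q (restr N k f).
Proof. by move=> kf x v; rewrite /restr kf if_same. Qed.

Lemma killp_cat p q f u : Adm f -> killp p q f -> killp p q (fun w => f (u ++ w)).
Proof.
elim: u f => [//|g u IHu] f Hf kf.
by apply: (IHu (fun w => f (g :: w)) (Adm_cons g Hf)); apply: killp_cons.
Qed.

(** If a saturated word kept p and q in different components, one of the two pieces of b would be
    overfilled. So p and q are joined by a path, which is killed. *)
Lemma top_killp p q b f : V3 #|b|./2 b f -> p \in b -> q \in b -> p != q -> killp p q f ->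
  f = fun=> 0.
Proof.
move=> [Hf sf] pb qb pq kf; apply/funext => w.
have [/andP[wb /eqP sw]|] := boolP (all (inb b) w && (size w == #|b|./2)); last exact: sf.
have [es [rest [pw ge ec rc [/andP[pc cb] cs]]]] := grow_exists_in pb wb.
set c := cov _ _ in ec rc pc cb cs.
have [qc|qc] := boolP (q \in c).
  apply: (alt_perm0 (adm_alt Hf) pw); apply: (path_kill (A := [set p]) (q := q)) => //.
    by move=> p'; rewrite inE => /eqP ->.
  by rewrite inE eq_sym.
have c0 : (0 < #|c|)%N by apply/card_gt0P; exists p.
have d0 : (0 < #|b :\: c|)%N by apply/card_gt0P; exists q; rewrite inE qc.
have [le|lt] := leqP #|c| (2 * size es); first exact: (vanish_sub Hf pw ec).
have [le2|lt2] := leqP #|b :\: c| (2 * size rest).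
  by apply: (vanish_sub Hf _ rc d0 le2); rewrite (perm_trans pw) // perm_catC.
have cD : (#|b :\: c| + #|c| = #|b|)%N by rewrite addnC -(cardsID c b) (setIidPr cb).
have sz : size w = (size es + size rest)%N by rewrite (perm_size pw) size_cat.
by exfalso; clear -lt lt2 cD sz sw; lia.
Qed.

Definition pfr k N x0 (E : pred {set T}) (FR : {set T} -> seq (word * (word -> rat))) :=
  flatten [seq [seq (p.1 ++ q.1, wprod b p.2 q.2) | p <- fr3 #|b|./2 b, q <- FR b]
    | b <- enum [pred b | peelc k N x0 b && E b]].

Lemma pfr_sum (R : nmodType) k N x0 E FR (F : word * (word -> rat) -> R) :
  \sum_(r <- pfr k N x0 E FR) F r =
  \sum_(b | peelc k N x0 b && E b) \sum_(p <- fr3 #|b|./2 b) \sum_(q <- FR b)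
    F (p.1 ++ q.1, wprod b p.2 q.2).
Proof.
rewrite /pfr big_flatten /= big_map big_enum /=; apply: eq_bigr => b _.
by rewrite big_allpairs_dep.
Qed.

Lemma wprod_lc b f (I : Type) (s : seq I) (co : I -> rat) F v :
  wprod b f (lc_fn s co F) v = \sum_(i <- s) co i * wprod b f (F i) v.
Proof.
by rewrite /wprod /lc_fn mulr_sumr mulr_sumr; apply: eq_bigr => i _; ring.
Qed.

Variables (p0 p1 : T) (N : {set T}).
Hypotheses (p01 : p0 != p1) (p0N : p0 \in N) (p1N : p1 \in N).
Let r := #|N|./2.
Hypothesis Nodd : #|N| = (2 * r).+1.
Hypothesis r0 : (0 < r)%N.

(** The conditions satisfied after the letter p0 p1 x has been split off. *)
Definition Wx x f := [/\ V3 (r - 1)%N N f, killp p0 p1 f, killp p0 x f & killp p1 x f].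

Definition Wfr x := pfr (r - 1)%N N p0 (fun b => (p1 \notin b) && (x \notin b))
  (fun b => pfr (r - 1 - #|b|./2)%N (N :\: b) p1 (fun c => x \notin c)
    (fun c => fr3 (r - 1 - #|b|./2 - #|c|./2)%N (N :\: b :\: c))).

Lemma Wx_subsp x : subsp (Wx x).
Proof.
have [V0 VD] := V3_subsp (r - 1)%N N; split; first by split.
move=> c f h [Vf k1 k2 k3] [Vh j1 j2 j3]; split; first exact: VD.
- by move=> y v; rewrite k1 j1 mulr0 addr0.
- by move=> y v; rewrite k2 j2 mulr0 addr0.
- by move=> y v; rewrite k3 j3 mulr0 addr0.
Qed.

Lemma wprod_killp b k M f1 f2 p q : V3 k M f2 -> [disjoint M & b] -> p \in b -> q \notin b ->
  killp p q (wprod b f1 f2).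
Proof.
move=> [_ H] d pb qb x v; rewrite wprod_cons_out; last by rewrite inbE (negbTE qb) /= andbF.
rewrite /wprod H ?mulr0 //= inbE (disjointFl d pb) //.
Qed.

Lemma wprod_killp2 b k M f1 f2 p q : V3 k M f2 -> [disjoint M & b] -> p \notin b ->
  killp p q f2 -> killp p q (wprod b f1 f2).
Proof.
move=> V d pb kf x v; rewrite wprod_cons_out; last by rewrite inbE (negbTE pb).
by rewrite /wprod kf !mulr0.
Qed.

Definition wcond x A B := [&& peelc (r - 1)%N N p0 A, p1 \notin A, x \notin A,
  peelc (r - 1 - #|A|./2)%N (N :\: A) p1 B & x \notin B].

Lemma wcond_V k2 x A B f0 f1 f2 : wcond x A B -> k2 = (r - 1 - #|A|./2 - #|B|./2)%N ->
  V3 #|A|./2 A f0 -> V3 #|B|./2 B f1 -> V3 k2 (N :\: A :\: B) f2 ->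
  V3 (r - 1 - #|A|./2)%N (N :\: A) (wprod B f1 f2) /\ Wx x (wprod A f0 (wprod B f1 f2)).
Proof.
case/and5P=> /and3P[pA AN Ar] p1A xA /and3P[p1B BN Br] xB -> V0 V1 V2.
have VB : V3 (r - 1 - #|A|./2)%N (N :\: A) (wprod B f1 f2).
  rewrite -(subnKC Br); apply: V3_wprod V1 V2 (disjDl _ _) _.
  by rewrite subUset BN subsetDl.
have dA := disjDl N A.
split=> //; split.
- rewrite -(subnKC Ar); apply: V3_wprod V0 VB dA _; by rewrite subUset AN subsetDl.
- exact: wprod_killp VB dA pA p1A.
- exact: wprod_killp VB dA pA xA.
apply: wprod_killp2 VB dA p1A _; exact: wprod_killp V2 (disjDl _ _) p1B xB.
Qed.

Lemma Wfr_sum (R : nmodType) x (F : word * (word -> rat) -> R) :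
  \sum_(t <- Wfr x) F t =
  \sum_(A | peelc (r - 1)%N N p0 A && ((p1 \notin A) && (x \notin A))) \sum_(p <- fr3 #|A|./2 A)
  \sum_(B | peelc (r - 1 - #|A|./2)%N (N :\: A) p1 B && (x \notin B)) \sum_(q <- fr3 #|B|./2 B)
  \sum_(s <- fr3 (r - 1 - #|A|./2 - #|B|./2)%N (N :\: A :\: B))
    F (p.1 ++ (q.1 ++ s.1), wprod A p.2 (wprod B q.2 s.2)).
Proof.
rewrite /Wfr pfr_sum; apply: eq_bigr => A _; apply: eq_bigr => p _.
by rewrite pfr_sum.
Qed.

Lemma fr3_wprod b f k (M : {set T}) (F : word -> rat) v : V3 k M F ->
  \sum_(q <- fr3 k M) F q.1 * wprod b f q.2 v = wprod b f F v.
Proof.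
move=> VF; case: (fr3_frame k M) => _ /(_ F VF) e.
by rewrite [in RHS]e wprod_lc.
Qed.

Lemma peel_wprod b f k (M : {set T}) x0 (F : word -> rat) v : x0 \in M -> V3 k M F ->
  \sum_(q <- peelfr k M x0) F q.1 * wprod b f q.2 v = wprod b f F v.
Proof.
move=> xM VF; case: (peel_frame k xM) => _ /(_ F VF) e.
by rewrite [in RHS]e wprod_lc.
Qed.

(** Peeling at p0 and then at p1. A block that contains two of the points p0, p1, x drops out by
    [top_killp], so x is left to the third piece. *)
Lemma Wx_frame x : x \in N -> x != p0 -> x != p1 -> frame (Wx x) (Wfr x).
Proof.
move=> xN xp0 xp1; split.
  move=> t /flatten_mapP[A]; rewrite mem_enum inE => /andP[cA /andP[p1A xA]].
  case/allpairsP=> -[p t'] /= [pf /flatten_mapP[B]].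
  rewrite mem_enum inE => /andP[cB xB] /allpairsP[[q s] /= [qf sf ->]] -> /=.
  have W : wcond x A B by rewrite /wcond cA p1A xA cB xB.
  by have [] := wcond_V W erefl (fr3_V pf) (fr3_V qf) (fr3_V sf).
move=> f [Vf k01 k0x k1x]; have Hf := proj1 Vf; apply/funext => v.
case: (peel_frame (r - 1)%N p0N) => _ /(_ f Vf) {1}->; rewrite /lc_fn peelfr_sum Wfr_sum.
rewrite (bigID (fun b => (p1 \notin b) && (x \notin b))) /= [X in _ + X]big1 ?addr0; last first.
  move=> b /andP[/and3P[p0b bN bk]]; rewrite -negb_or negbK => nb.
  rewrite big_seq big1 // => p pf; rewrite big1 // => q _.
  suff -> : f (p.1 ++ q.1) = 0 by rewrite mul0r.
  have [pb sp] := fr3_word pf.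
  have VR := V3_restr #|b|./2 b (Adm_catr q.1 Hf).
  have : restr b #|b|./2 (fun w => f (w ++ q.1)) = fun=> 0.
    case/orP: nb => [p1b|xb].
      by apply: (top_killp VR p0b p1b p01); apply: killp_restr => y w; apply: k01.
    by apply: (top_killp VR p0b xb _); [rewrite eq_sym|apply: killp_restr => y w; apply: k0x].
  by move=> /(congr1 (fun F => F p.1)); rewrite restr_in.
apply: eq_bigr => A /andP[cA /andP[p1A xA]]; rewrite big_seq [RHS]big_seq; apply: eq_bigr => p pf.
have VF := V3_restr (r - 1 - #|A|./2)%N (N :\: A) (Adm_cat p.1 Hf).
set F := restr _ _ _ in VF.
transitivity (\sum_(q <- fr3 (r - 1 - #|A|./2)%N (N :\: A)) F q.1 * wprod A p.2 q.2 v).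
  rewrite big_seq [RHS]big_seq; apply: eq_bigr => q qf; have [qN sq] := fr3_word qf.
  by rewrite /F restr_in.
have p1NA : p1 \in N :\: A by rewrite inE p1A.
rewrite fr3_wprod // -(peel_wprod _ _ _ p1NA VF) peelfr_sum.
rewrite (bigID (fun b => x \notin b)) /= [X in _ + X]big1 ?addr0; last first.
  move=> b /andP[/and3P[p1b bN bk]]; rewrite negbK => xb.
  rewrite big_seq big1 // => q qf; rewrite big1 // => s _.
  suff -> : F (q.1 ++ s.1) = 0 by rewrite mul0r.
  have [qb sq] := fr3_word qf.
  have VR := V3_restr #|b|./2 b (Adm_catr s.1 (proj1 VF)).
  have : restr b #|b|./2 (fun w => F (w ++ s.1)) = fun=> 0.
    apply: (top_killp VR p1b xb _); first by rewrite eq_sym.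
    apply: killp_restr => y w; rewrite /F /restr; case: ifP => // _.
    exact: (killp_cat p.1 Hf k1x).
  by move=> /(congr1 (fun F => F q.1)); rewrite restr_in.
apply: eq_bigr => B /andP[cB xB]; rewrite big_seq [RHS]big_seq; apply: eq_bigr => q qf.
rewrite big_seq [RHS]big_seq; apply: eq_bigr => s sf.
have [qb sq] := fr3_word qf; have [sb ss] := fr3_word sf; case/and3P: cB => _ BN Bk.
rewrite /F restr_in //; first by rewrite all_cat (all_inbS BN qb) (all_inbS _ sb) // subsetDl.
by rewrite size_cat sq ss subnKC.
Qed.

Definition clp A p x : T := if x \in A then p else x.
Definition coll A p f w : rat := f (map (mapl (clp A p)) w).

Lemma clp_in A p x : x \in A -> clp A p x = p. Proof. by rewrite /clp => ->. Qed.
Lemma clp_out A p x : x \notin A -> clp A p x = x. Proof. by rewrite /clp => /negbTE ->. Qed.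

Lemma Adm_wprod_col b p f1 f2 : Adm f1 -> Adm f2 -> Adm (wprod b f1 (coll b p f2)).
Proof.
move=> H1 H2; apply: Adm_wprod => //; first exact: (Adm_pull (clp b p) H2).
  by move=> x y z v xb yb; rewrite /coll /= /mapl /= (clp_in _ xb) (clp_in _ yb) (rep12 H2).
by move=> x x' y z v xb yb; rewrite /coll /= /mapl /= !(clp_in _ xb) !(clp_in _ yb).
Qed.

(** The alternating form dual to the single letter p0 p1 x. *)
Definition vol (x : T) w : rat :=
  let e (a b c : T) : rat := ((a == p0) && (b == p1) && (c == x))%:R in
  if w is [:: (a, b, c)] then e a b c - e b a c - e a c b + e b c a + e c a b - e c b a else 0.

Arguments vol : simpl never.

Lemma Adm_vol x : Adm (vol x).
Proof.
have v2 g h v : vol x [:: g, h & v] = 0 by case: g => [[]].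
split=> [[|? [|? ?]] *|a b c [|? ?]|a b c [|? ?]|*|*]; rewrite /six ?v2 ?oppr0 ?addr0 //.
  by rewrite /vol /=; ring.
by rewrite /vol /=; ring.
Qed.

(** If A met c without lying in it, its |A|/2 letters would be distributed over the two parts of A,
    and one of them would be overfilled. *)
Lemma count_sub f A c w u z : Adm f -> count (inb A) w = #|A|./2 -> perm_eq w (u ++ z) ->
  all (inb c) u -> all (fun g => [disjoint pset g & c]) z -> ~~ [disjoint A & c] -> f w != 0 ->
  A \subset c.
Proof.
move=> Hf cw pw uc zc dA nz; apply/negPn/negP => nA; case/negP: nz; apply/eqP.
pose u1 := filter (inb A) u; pose z1 := filter (inb A) z.
have a1 : all (inb (A :&: c)) u1.
  apply/allP => g; rewrite mem_filter => /andP[gA gu].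
  by rewrite /inb subsetI; apply/andP; split=> //; apply: (allP uc).
have a2 : all (inb (A :\: c)) z1.
  apply/allP => g; rewrite mem_filter => /andP[gA gz].
  by rewrite /inb subsetD; apply/andP; split=> //; apply: (allP zc).
have pu := permEl (perm_filterC (inb A) u); have pz := permEl (perm_filterC (inb A) z).
have sz : (size u1 + size z1 = #|A|./2)%N.
  by rewrite -cw (seq.permP pw) count_cat !size_filter.
have cs := cardsID c A.
have c1 : (0 < #|A :&: c|)%N by rewrite card_gt0 setI_eq0.
have c2 : (0 < #|A :\: c|)%N by rewrite card_gt0 setD_eq0.
have [le|lt] := leqP #|A :&: c| (2 * size u1).
  apply: (vanish_sub (v := filter (predC (inb A)) u ++ z) Hf _ a1 c1 le).
  by rewrite (perm_trans pw) // catA perm_cat2r perm_sym.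
have [le2|lt2] := leqP #|A :\: c| (2 * size z1).
  apply: (vanish_sub (v := filter (predC (inb A)) z ++ u) Hf _ a2 c2 le2).
  by rewrite (perm_trans pw) // perm_catC catA perm_cat2r perm_sym.
by exfalso; clear -cs sz lt lt2; lia.
Qed.

Lemma wprod_neq0 b f1 f2 w : wprod b f1 f2 w != 0 ->
  f1 (filter (inb b) w) != 0 /\ f2 (filter (predC (inb b)) w) != 0.
Proof.
move=> nz; split; apply: contraNneq nz => e; by rewrite /wprod e ?mul0r ?mulr0.
Qed.

Section Psi.
Variables (x : T) (A B : {set T}) (k2 : nat) (f0 f1 f2 : word -> rat).
Hypotheses (xN : x \in N) (W : wcond x A B) (ek : k2 = (r - 1 - #|A|./2 - #|B|./2)%N).
Hypotheses (V0 : V3 #|A|./2 A f0) (V1 : V3 #|B|./2 B f1) (V2 : V3 k2 (N :\: A :\: B) f2).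
Let D := x |: (A :|: B).
(** Three functionals are glued along the letter p0 p1 x: contracting B to p1 and A to p0 leaves
    [vol x], and contracting D to x leaves [f2]. Up to smaller terms in the sense of [Psi_sub],
    [Psi] is the sought preimage of the product of [f0], [f1], [f2] placed at x. *)
Definition chi1 := wprod B f1 (coll B p1 (vol x)).
Definition chi0 := wprod A f0 (coll A p0 chi1).
Definition Psi := restr N r (wprod D chi0 (coll D x f2)).

Let p0A : p0 \in A. Proof. by case/and5P: W => /and3P[]. Qed.
Let p1A : p1 \notin A. Proof. by case/and5P: W. Qed.
Let xA : x \notin A. Proof. by case/and5P: W. Qed.
Let xB : x \notin B. Proof. by case/and5P: W. Qed.
Let p1B : p1 \in B. Proof. by case/and5P: W => _ _ _ /and3P[]. Qed.
Let dAB y : y \in B -> y \notin A.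
Proof. by case/and5P: W => _ _ _ /and3P[_ /subsetP h _] _ /h; rewrite inE => /andP[]. Qed.
Let p0B : p0 \notin B. Proof. by apply: contraL p0A => /dAB. Qed.
Let p0D : p0 \in D. Proof. by rewrite !inE p0A orbT. Qed.
Let p1D : p1 \in D. Proof. by rewrite !inE p1B !orbT. Qed.
Let xD : x \in D. Proof. by rewrite !inE eqxx. Qed.

Lemma Adm_chi1 : Adm chi1.
Proof. by apply: Adm_wprod_col (Adm_vol x); case: V1. Qed.
Lemma Adm_chi0 : Adm chi0.
Proof. by apply: Adm_wprod_col Adm_chi1; case: V0. Qed.
Lemma V3_Psi : V3 r N Psi.
Proof. by apply/V3_restr/(Adm_wprod_col _ _ Adm_chi0); case: V2. Qed.

Lemma Psi_other y w : y != x -> Psi ((p0,p1,y) :: w) = 0.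
Proof.
move=> yx; rewrite /Psi /restr; case: ifP => // _.
have [yD|yD] := boolP (y \in D); last first.
  rewrite wprod_cons_out; last by rewrite inbE (negbTE yD) !andbF.
  rewrite /wprod /coll /= /mapl /= (clp_in _ p0D) (clp_in _ p1D).
  by rewrite (rep12 (proj1 V2)) !mulr0.
rewrite wprod_cons_in; last by rewrite inbE p0D p1D yD.
suff e v : chi0 ((p0,p1,y) :: v) = 0 by rewrite /wprod e mul0r mulr0.
rewrite /chi0 wprod_cons_out; last by rewrite inbE (negbTE p1A) !andbF.
rewrite /wprod {1}/coll /= /mapl /= (clp_in _ p0A) (clp_out _ p1A).
set v' := map _ _; suff -> : chi1 ((p0, p1, clp A p0 y) :: v') = 0 by rewrite !mulr0.
have [yA|yA] := boolP (y \in A).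
  by rewrite (clp_in _ yA); apply: (rep13 Adm_chi1).
rewrite (clp_out _ yA) /chi1 wprod_cons_out; last by rewrite inbE (negbTE p0B).
rewrite /wprod {1}/coll /= /mapl /= (clp_in _ p1B) (clp_out _ p0B).
have yB : y \in B by move: yD; rewrite !inE (negbTE yx) (negbTE yA).
by rewrite (clp_in _ yB) (rep23 (Adm_vol x)) !mulr0.
Qed.

Lemma chi1_x v : chi1 ((p0,p1,x) :: v) =
  (-1) ^+ #|B|./2 * wprod B f1 (fun u => (u == [::])%:R) v.
Proof.
rewrite /chi1 wprod_cons_out; last by rewrite inbE (negbTE p0B).
have -> : (fun u => coll B p1 (vol x) ((p0,p1,x) :: u)) = fun u => (u == [::])%:R.
  apply/funext => u; rewrite /coll /= /mapl /= (clp_in _ p1B) (clp_out _ p0B) (clp_out _ xB).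
  case: u => [|//]; rewrite /vol /= !eqxx (negbTE p01) eq_sym (negbTE p01) /=.
  have -> : (x == p0) = false by apply: contraNF xA => /eqP ->.
  have -> : (x == p1) = false by apply: contraNF xB => /eqP ->.
  by rewrite !andbF /=; ring.
have [_ H] := V1; have [->//|ne] := eqVneq (count (inb B) v) #|B|./2.
by rewrite /wprod H ?mul0r ?mulr0 // size_filter (negbTE ne) andbF.
Qed.

Lemma inb_col g : inb B (mapl (clp A p0) g) = inb B g.
Proof.
have e y : (clp A p0 y \in B) = (y \in B).
  rewrite /clp; case: ifP => // yA; rewrite (negbTE p0B); apply/esym/negbTE.
  by apply: contraL yA => /dAB.
by case: g => [[a b] c]; rewrite /mapl /= !inbE !e.
Qed.

Lemma chi0_x v : chi0 ((p0,p1,x) :: v) = (-1) ^+ #|A|./2 *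
  wprod A f0 (coll A p0 (fun u => chi1 ((p0,p1,x) :: u))) v.
Proof.
rewrite /chi0 wprod_cons_out; last by rewrite inbE (negbTE p1A) !andbF.
have -> : (fun u => coll A p0 chi1 ((p0,p1,x) :: u)) = coll A p0 (fun u => chi1 ((p0,p1,x) :: u)).
  by apply/funext => u; rewrite /coll /= /mapl /= (clp_in _ p0A) (clp_out _ p1A) (clp_out _ xA).
have [_ H] := V0; have [->//|ne] := eqVneq (count (inb A) v) #|A|./2.
by rewrite /wprod H ?mul0r ?mulr0 // size_filter (negbTE ne) andbF.
Qed.

Lemma Psi_x w : all (inb N) w -> size w = (r - 1)%N ->
  Psi ((p0,p1,x) :: w) = wprod D (fun u => chi0 ((p0,p1,x) :: u)) (coll D x f2) w.
Proof.
move=> wN sw; rewrite /Psi restr_in ?wprod_cons_in ?inbE ?p0D ?p1D ?xD //=.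
  by rewrite inbE p0N p1N xN.
by rewrite sw; clear -r0; lia.
Qed.

Lemma filter_sub (A' D' : {set T}) w : A' \subset D' ->
  filter (inb A') (filter (inb D') w) = filter (inb A') w.
Proof.
move=> s; rewrite -filter_predI; apply: eq_filter => g /=.
by case: (boolP (inb A' g)) => //= h; apply: subset_trans h s.
Qed.

Lemma Psi_count w : all (inb N) w -> size w = (r - 1)%N -> Psi ((p0,p1,x) :: w) != 0 ->
  count (inb A) w = #|A|./2 /\ count (inb B) w = #|B|./2.
Proof.
move=> wN sw; rewrite Psi_x // => /wprod_neq0[+ _].
rewrite chi0_x mulf_eq0 negb_or => /andP[_ /wprod_neq0[n0]].
rewrite /coll chi1_x mulf_eq0 negb_or => /andP[_ /wprod_neq0[n1 _]].
have AD : A \subset D by rewrite /D setUCA subsetUl.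
have BD : B \subset D by rewrite /D setUA subsetUr.
split.
  have [_ H] := V0; rewrite -size_filter; apply/eqP/negPn/negP => ne.
  by case/eqP: n0; apply: H; rewrite (filter_sub _ AD) (negbTE ne) andbF.
have [_ H] := V1; apply/eqP/negPn/negP => ne; case/eqP: n1; apply: H.
rewrite filter_map size_map; set u := filter _ _.
suff -> : size u = count (inb B) w by rewrite (negbTE ne) andbF.
rewrite /u (eq_filter (a2 := inb B)); last by move=> g /=; rewrite inb_col.
rewrite -filter_predI (eq_filter (a2 := inb B)) ?(filter_sub _ BD) ?size_filter //.
move=> g /=; case: (boolP (inb B g)) => //= gB; apply/negP => gA.
have [y yg] := pset_neq0 g; have := dAB (subsetP gB _ yg); by rewrite (subsetP gA).
Qed.

(** The triangularity behind surjectivity: on words of blocks A', B' the glued functional is nonzero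
    only if these contain A and B. *)
Lemma Psi_sub A' B' u v s : wcond x A' B' -> all (inb A') u -> all (inb B') v ->
  all (inb (N :\: A' :\: B')) s -> size (u ++ v ++ s) = (r - 1)%N ->
  Psi ((p0,p1,x) :: u ++ v ++ s) != 0 -> (A \subset A') && (B \subset B').
Proof.
case/and5P=> /and3P[p0A' AN' _] _ _ /and3P[p1B' BN' _] _ uA vB sC sw nz.
have wN : all (inb N) (u ++ v ++ s).
  rewrite !all_cat (all_inbS AN' uA) (all_inbS (subset_trans BN' (subsetDl _ _)) vB).
  by rewrite (all_inbS _ sC) // setDDl subsetDl.
have [cA cB] := Psi_count wN sw nz.
have HG := Adm_cons (p0,p1,x) (proj1 V3_Psi).
have dj (c c' : {set T}) w : all (inb c) w -> [disjoint c & c'] -> all (fun g => [disjoint pset g & c']) w.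
  by move=> /allP h d; apply/allP => g /h gc; apply: disjointWl gc d.
have dBA : [disjoint B' & A'] by apply: disjointWl BN' (disjDl _ _).
apply/andP; split.
  apply: (count_sub HG cA (perm_refl _) uA _ _ nz); last by apply/pred0Pn; exists p0; rewrite /= p0A.
  rewrite all_cat (dj _ _ _ vB dBA) (dj _ _ _ sC) // setDDl; apply: disjointWr (disjDl _ _).
  exact: subsetUl.
apply: (count_sub (z := u ++ s) HG cB _ vB _ _ nz).
- by rewrite perm_catCA.
- rewrite all_cat (dj _ _ _ uA) 1?disjoint_sym // (dj _ _ _ sC) // ?disjDl //.
- by apply/pred0Pn; exists p1; rewrite /= p1B.
Qed.

Lemma Psi_eq u v s : all (inb A) u -> all (inb B) v -> all (inb (N :\: A :\: B)) s ->
  size (u ++ v ++ s) = (r - 1)%N ->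
  Psi ((p0,p1,x) :: u ++ v ++ s) = (-1) ^+ (#|A|./2 + #|B|./2) * (f0 u * (f1 v * f2 s)).
Proof.
move=> uA vB sC sw; case/and5P: (W) => /and3P[_ AN _] _ _ /and3P[_ BN _] _.
have wN : all (inb N) (u ++ v ++ s).
  rewrite !all_cat (all_inbS AN uA) (all_inbS (subset_trans BN (subsetDl _ _)) vB).
  by rewrite (all_inbS _ sC) // setDDl subsetDl.
have AD : A \subset D by rewrite /D setUCA subsetUl.
have BD : B \subset D by rewrite /D setUA subsetUr.
have nA y : y \in N :\: A :\: B -> y \in D -> y = x.
  by rewrite !inE => /and3P[/negbTE -> /negbTE -> _]; rewrite !orbF => /eqP.
(* D meets the third piece in x alone, so a letter of s inside D repeats x and both sides vanish. *)
have [/hasP[g gs gD]|/hasPn sD] := boolP (has (inb D) s).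
  have ng : ~~ uniq (pts3 g).
    have gC := allP sC _ gs; case: g {gs} gC gD => [[a b] c]; rewrite !inbE => /and3P[h1 h2 h3] /and3P[h4 h5 h6].
    by rewrite (nA a) // (nA b) // (nA c) //= !inE eqxx.
  have z f w : Adm f -> g \in w -> f w = 0.
    move=> Hf gw; apply: (alt_perm0 (adm_alt Hf) (perm_to_rem gw)); exact: (rep0 Hf).
  rewrite (z f2 s (proj1 V2) gs) !mulr0.
  apply: (z (fun w => Psi ((p0,p1,x) :: w))); first exact: Adm_cons (proj1 V3_Psi).
  by rewrite !mem_cat gs !orbT.
rewrite Psi_x // catA wprod_cat; last 2 first.
- by rewrite all_cat (all_inbS AD uA) (all_inbS BD vB).
- by apply/allP => g /sD.
have -> : coll D x f2 s = f2 s.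
  rewrite /coll; congr f2; rewrite -[RHS]map_id; apply/eq_in_map => -[[a b] c] /(allP sC).
  rewrite inbE => /and3P[h1 h2 h3]; have e y : y \in N :\: A :\: B -> clp D x y = y.
    by move=> yC; rewrite /clp; case: ifP => // /(nA _ yC).
  by rewrite /mapl /= !e.
have vA : all (predC (inb A)) v.
  apply: all_inb_disj vB _; rewrite -setI_eq0; apply/eqP/setP => y; rewrite !inE.
  by apply/negP => /andP[/dAB /negbTE ->].
rewrite chi0_x wprod_cat //.
have -> : coll A p0 (fun u => chi1 ((p0,p1,x) :: u)) v = (-1) ^+ #|B|./2 * f1 v.
  rewrite /coll; have -> : map (mapl (clp A p0)) v = v.
    rewrite -[RHS]map_id; apply/eq_in_map => -[[a b] c] /(allP vB).
    rewrite inbE => /and3P[h1 h2 h3]; by rewrite /mapl /= !clp_out ?dAB.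
  by rewrite chi1_x -[X in wprod _ _ _ X]cats0 wprod_cat //= mulr1.
by rewrite exprD; ring.
Qed.
End Psi.

Lemma Wfr_sum2 (R : nmodType) x (F : word * (word -> rat) -> R) :
  \sum_(t <- Wfr x) F t =
  \sum_(A | peelc (r - 1)%N N p0 A && ((p1 \notin A) && (x \notin A)))
  \sum_(B | peelc (r - 1 - #|A|./2)%N (N :\: A) p1 B && (x \notin B))
  \sum_(p <- fr3 #|A|./2 A) \sum_(q <- fr3 #|B|./2 B)
  \sum_(s <- fr3 (r - 1 - #|A|./2 - #|B|./2)%N (N :\: A :\: B))
    F (p.1 ++ (q.1 ++ s.1), wprod A p.2 (wprod B q.2 s.2)).
Proof. by rewrite Wfr_sum; apply: eq_bigr => A _; rewrite exchange_big. Qed.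

Let S x := [&& x \in N, x != p0 & x != p1].
Notation X := (T * word)%type.
(** Functions of a pair (x, word) model the direct sum over the third points x; [VS] is the sum of
    the spaces [Wx x], which turns out to be the image. *)
Definition Phi f : X -> rat := fun y => if S y.1 then f ((p0,p1,y.1) :: y.2) else 0.
Definition VS (th : X -> rat) :=
  forall x, if S x then Wx x (fun w => th (x, w)) else (fun w => th (x, w)) = fun=> 0.
Definition dl x f : X -> rat := fun y => (y.1 == x)%:R * f y.2.
Definition ImPhi (th : X -> rat) := exists2 f, V3 r N f & Phi f = th.

Lemma lin_Phi : lin Phi.
Proof.
move=> I s co f; apply/funext => y; rewrite /Phi /lc_fn; case: ifP => // _.
by rewrite big1 // => i _; rewrite mulr0.
Qed.

Lemma ImPhi_lin co th th' : ImPhi th -> ImPhi th' -> ImPhi (fun y => co * th y + th' y).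
Proof.
move=> [f Vf <-] [f' Vf' <-]; exists (fun w => co * f w + f' w).
  exact: (proj2 (V3_subsp r N)).
by apply/funext => y; rewrite /Phi; case: ifP; rewrite ?mulr0 ?addr0.
Qed.

Lemma ImPhi0 : ImPhi (fun=> 0).
Proof.
exists (fun=> 0); first exact: (proj1 (V3_subsp r N)).
by apply/funext => y; rewrite /Phi if_same.
Qed.

Lemma ImPhi_sum (I : eqType) (s : seq I) (P : pred I) (th : I -> X -> rat) :
  (forall i, i \in s -> P i -> ImPhi (th i)) -> ImPhi (fun y => \sum_(i <- s | P i) th i y).
Proof.
elim: s => [|i s IHs] H.
  have -> : (fun y => \sum_(i <- [::] | P i) th i y) = fun=> 0 by apply/funext => y; rewrite big_nil.
  exact: ImPhi0.
have {}IHs := IHs (fun j js => H j (mem_behead (s := i :: s) js)).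
have [Pi|Pi] := boolP (P i).
  have -> : (fun y => \sum_(i <- i :: s | P i) th i y) =
    fun y => 1 * th i y + \sum_(i <- s | P i) th i y.
    by apply/funext => y; rewrite big_cons Pi mul1r.
  by apply: ImPhi_lin IHs; apply: H; rewrite ?mem_head.
have -> // : (fun y => \sum_(i <- i :: s | P i) th i y) = fun y => \sum_(i <- s | P i) th i y.
by apply/funext => y; rewrite big_cons (negbTE Pi).
Qed.

Lemma Phi_VS f : V3 r N f -> VS (Phi f).
Proof.
move=> [H sf] x; case: ifP => Sx; rewrite /Phi /= Sx //.
case/and3P: Sx => xN _ _; split.
- split; first exact: Adm_cons.
  move=> w nw; apply: sf; apply: contra nw; rewrite /= -andbA => /and3P[_ -> /eqP <-].
  by rewrite subn1 eqxx.
- by move=> y v; apply: (quad_all H).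
- by move=> y v; rewrite (adm_sg2 H) (quad_all H) oppr0.
- by move=> y v; rewrite (cyc H) (quad_all H).
Qed.

Lemma fr3_val k (M : {set T}) (F : word -> rat) v : V3 k M F ->
  \sum_(q <- fr3 k M) F q.1 * q.2 v = F v.
Proof. by move=> VF; case: (fr3_frame k M) => _ /(_ F VF) e; rewrite [in RHS]e. Qed.

Lemma wprod3_sum A B k0 k1 k2 M0 M1 M2 f0 f1 f2 v : V3 k0 M0 f0 -> V3 k1 M1 f1 -> V3 k2 M2 f2 ->
  \sum_(p <- fr3 k0 M0) \sum_(q <- fr3 k1 M1) \sum_(s <- fr3 k2 M2)
    (f0 p.1 * (f1 q.1 * f2 s.1)) * wprod A p.2 (wprod B q.2 s.2) v =
  wprod A f0 (wprod B f1 f2) v.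
Proof.
move=> V0 V1 V2; rewrite /wprod; set vA := filter (inb A) v; set vC := filter (predC (inb A)) v.
set sA := _ ^+ _; set sB := _ ^+ _; set v1 := filter _ vC; set v2 := filter _ vC.
transitivity (\sum_(p <- fr3 k0 M0) sA * sB * (f1 v1 * f2 v2) * (f0 p.1 * p.2 vA)).
  apply: eq_bigr => p _.
  transitivity (\sum_(q <- fr3 k1 M1) sA * sB * f2 v2 * (f0 p.1 * p.2 vA) * (f1 q.1 * q.2 v1)).
    apply: eq_bigr => q _; rewrite -(fr3_val v2 V2) mulr_sumr !mulr_suml; apply: eq_bigr => s _; ring.
  by rewrite -mulr_sumr fr3_val //; ring.
by rewrite -mulr_sumr fr3_val //; ring.
Qed.

(** Downward induction on |A| + |B|. The glued functional for A, B realizes the wanted product up to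
    sign, plus products for larger pairs of blocks, which are in the image by induction. *)
Lemma ImPhi_dl x A B f0 f1 f2 : S x -> wcond x A B ->
  V3 #|A|./2 A f0 -> V3 #|B|./2 B f1 -> V3 (r - 1 - #|A|./2 - #|B|./2)%N (N :\: A :\: B) f2 ->
  ImPhi (dl x (wprod A f0 (wprod B f1 f2))).
Proof.
move=> Sx; have [n] := ubnP (#|N| + #|N| - #|A| - #|B|)%N.
elim: n A B f0 f1 f2 => [//|n IHn] A B f0 f1 f2 le_n W V0 V1 V2.
have xN : x \in N by case/and3P: Sx.
pose Ps := Psi x A B f0 f1 f2; have VP : V3 r N Ps := V3_Psi x V0 V1 V2.
pose G w := Ps ((p0,p1,x) :: w).
have WG : Wx x G by have := Phi_VS VP x; rewrite Sx /Phi /= Sx.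
have frW : frame (Wx x) (Wfr x) by case/and3P: Sx => ? ? ?; apply: Wx_frame.
have dlG : ImPhi (dl x G).
  exists Ps => //; apply/funext => -[y w]; rewrite /Phi /dl /=.
  have [->|yx] := eqVneq y x; first by rewrite Sx mul1r.
  by rewrite mul0r /Ps (Psi_other f0 W V1 V2) // if_same.
pose e : rat := (-1) ^+ (#|A|./2 + #|B|./2).
have e2 : e * e = 1 by rewrite -expr2 sqrr_sign.
pose tg := wprod A f0 (wprod B f1 f2).
pose CC A' B' v := \sum_(p <- fr3 #|A'|./2 A') \sum_(q <- fr3 #|B'|./2 B')
  \sum_(s <- fr3 (r - 1 - #|A'|./2 - #|B'|./2)%N (N :\: A' :\: B'))
    G (p.1 ++ (q.1 ++ s.1)) * wprod A' p.2 (wprod B' q.2 s.2) v.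
(* The component of [G] at the blocks A', B', with the wanted product removed at A, B themselves. *)
pose H A' B' (y : X) := (y.1 == x)%:R * (CC A' B' y.2 - ((A' == A) && (B' == B))%:R * (e * tg y.2)).
have ssz A' B' p q s : wcond x A' B' -> p \in fr3 #|A'|./2 A' -> q \in fr3 #|B'|./2 B' ->
   s \in fr3 (r - 1 - #|A'|./2 - #|B'|./2)%N (N :\: A' :\: B') -> size (p.1 ++ q.1 ++ s.1) = (r - 1)%N.
  case/and5P=> /and3P[_ _ le1] _ _ /and3P[_ _ le2] _ /fr3_word[_ e1] /fr3_word[_ e3] /fr3_word[_ e4].
  by rewrite !size_cat e1 e3 e4; clear -le1 le2; lia.
have ImH A' B' : wcond x A' B' -> ImPhi (H A' B').
  move=> W'; have [/andP[/eqP eA /eqP eB]|ne] := boolP ((A' == A) && (B' == B)).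
    have -> : H A' B' = fun=> 0; last exact: ImPhi0.
    apply/funext => y; rewrite /H eA eB !eqxx mul1r.
    suff -> : CC A B y.2 = e * tg y.2 by rewrite subrr mulr0.
    rewrite /tg -(wprod3_sum A B y.2 V0 V1 V2) /CC mulr_sumr.
    rewrite big_seq [RHS]big_seq; apply: eq_bigr => p pf; rewrite mulr_sumr.
    rewrite big_seq [RHS]big_seq; apply: eq_bigr => q qf; rewrite mulr_sumr.
    rewrite big_seq [RHS]big_seq; apply: eq_bigr => s sf.
    have [pb _] := fr3_word pf; have [qb _] := fr3_word qf; have [sb _] := fr3_word sf.
    by rewrite /G /Ps (Psi_eq xN W V0 V1 V2 pb qb sb (ssz _ _ _ _ _ W pf qf sf)) [RHS]mulrA.
  have -> : H A' B' = fun y => \sum_(p <- fr3 #|A'|./2 A') \sum_(q <- fr3 #|B'|./2 B')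
      \sum_(s <- fr3 (r - 1 - #|A'|./2 - #|B'|./2)%N (N :\: A' :\: B'))
      (G (p.1 ++ (q.1 ++ s.1)) * dl x (wprod A' p.2 (wprod B' q.2 s.2)) y + 0).
    apply/funext => y; rewrite /H (negbTE ne) mul0r subr0 /CC mulr_sumr; apply: eq_bigr => p _.
    rewrite mulr_sumr; apply: eq_bigr => q _; rewrite mulr_sumr; apply: eq_bigr => s _.
    by rewrite addr0 /dl mulrCA.
  apply: ImPhi_sum => p pf _; apply: ImPhi_sum => q qf _; apply: ImPhi_sum => s sf _.
  have [pb _] := fr3_word pf; have [qb _] := fr3_word qf; have [sb _] := fr3_word sf.
  have [->|nz] := eqVneq (G (p.1 ++ q.1 ++ s.1)) 0.
    by have -> : (fun y => 0 * dl x (wprod A' p.2 (wprod B' q.2 s.2)) y + 0) = fun=> 0;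
      [apply/funext => y; rewrite mul0r addr0|apply: ImPhi0].
  apply: ImPhi_lin ImPhi0; apply: IHn => //; [|exact: fr3_V..].
  have /andP[sA sB] := Psi_sub xN W V0 V1 V2 W' pb qb sb (ssz _ _ _ _ _ W' pf qf sf) nz.
  have cA := subset_leq_card sA; have cB := subset_leq_card sB.
  have AN : (#|A'| <= #|N|)%N by apply: subset_leq_card; case/and5P: W' => /and3P[].
  have BN : (#|B'| <= #|N|)%N.
    apply: subset_leq_card; case/and5P: W' => _ _ _ /and3P[_ h _] _.
    exact: subset_trans h (subsetDl _ _).
  have [ltA|ltB] : (#|A| < #|A'|)%N \/ (#|B| < #|B'|)%N.
  - move: ne; rewrite negb_and => /orP[] ne; [left|right]; apply: proper_card; rewrite properEneq eq_sym ne //.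
  - by clear -cA cB AN BN ltA le_n; lia.
  by clear -cA cB AN BN ltB le_n; lia.
have -> : dl x tg = fun y => - e * (\sum_(A' | peelc (r - 1)%N N p0 A' && ((p1 \notin A') && (x \notin A')))
   \sum_(B' | peelc (r - 1 - #|A'|./2)%N (N :\: A') p1 B' && (x \notin B')) H A' B' y) + (e * dl x G y + 0).
  apply/funext => y; rewrite addr0 /H.
  have -> : G = lc_fn (Wfr x) (fun p => G p.1) (fun p => p.2) by case: frW => _ /(_ G WG).
  rewrite {2}/dl /lc_fn Wfr_sum2.
  under eq_bigr => A' _ do rewrite -mulr_sumr sumrB.
  rewrite -mulr_sumr sumrB; set S1 := \sum_(A' | _) _; set S2 := \sum_(A' | _) _.
  have -> : S2 = e * tg y.2.
    case/and5P: (W) => a1 a2 a3 a4 a5.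
    rewrite /S2 (bigD1 A) /= ?a1 ?a2 ?a3 // (bigD1 B) /= ?a4 ?a5 // !eqxx mul1r.
    rewrite big1 ?addr0; last by move=> B' /andP[_ /negbTE ->]; rewrite mul0r.
    rewrite big1 ?addr0 // => A' /andP[_ /negbTE ->]; by rewrite big1 // => B' _; rewrite mul0r.
  rewrite /dl; transitivity (e * e * ((y.1 == x)%:R * tg y.2)); first by rewrite e2 mul1r.
  rewrite -/S1; ring.
apply: ImPhi_lin; last exact: ImPhi_lin dlG ImPhi0.
apply: ImPhi_sum => A' _ /andP[a1 /andP[a2 a3]]; apply: ImPhi_sum => B' _ /andP[a4 a5].
by apply: ImH; rewrite /wcond a1 a2 a3 a4 a5.
Qed.

Lemma VS_dl th y : VS th -> th y = \sum_(x | S x) dl x (fun w => th (x, w)) y.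
Proof.
case: y => y w V; rewrite /dl /=; have := V y; have [Sy _|Sy /(congr1 (fun F => F w)) /= ->] := boolP (S y).
  rewrite (bigD1 y) //= eqxx mul1r big1 ?addr0 // => x /andP[_ ne].
  by rewrite eq_sym (negbTE ne) mul0r.
by rewrite big1 // => x Sx; rewrite (negbTE (_ : y != x)) ?mul0r //; apply: contraNneq Sy => ->.
Qed.

Lemma Phi_surj th : VS th -> ImPhi th.
Proof.
move=> V; have -> : th = fun y => \sum_(x | S x) dl x (fun w => th (x, w)) y.
  by apply/funext => y; apply: VS_dl.
apply: ImPhi_sum => x _ Sx; have := V x; rewrite Sx => Wt.
have [_ /(_ _ Wt) ->] : frame (Wx x) (Wfr x) by case/and3P: Sx => ? ? ?; apply: Wx_frame.
have -> : dl x (lc_fn (Wfr x) (fun p => th (x, p.1)) (fun p => p.2)) =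
    fun y => \sum_(t <- Wfr x) (th (x, t.1) * dl x t.2 y + 0).
  by apply/funext => y; rewrite /dl /lc_fn mulr_sumr; apply: eq_bigr => t _; rewrite addr0; ring.
apply: ImPhi_sum => t tW _; apply: ImPhi_lin ImPhi0.
case/flatten_mapP: tW => A; rewrite mem_enum inE => /andP[cA /andP[p1A xA]].
case/allpairsP=> -[p t'] /= [pf /flatten_mapP[B]].
rewrite mem_enum inE => /andP[cB xB] /allpairsP[[q s] /= [qf sf ->]] -> /=.
by apply: ImPhi_dl; rewrite ?(fr3_V pf) ?(fr3_V qf) //; [rewrite /wcond cA p1A xA cB xB|exact: fr3_V..].
Qed.

Definition VSfr : seq (X * (X -> rat)) :=
  flatten [seq [seq ((x, t.1), dl x t.2) | t <- Wfr x] | x <- enum S].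

Lemma VS_frame : frame VS VSfr.
Proof.
split=> [t /flatten_mapP[x]|th V].
  rewrite mem_enum => Sx /mapP[t' tW ->] y /=.
  have [frW _] : frame (Wx x) (Wfr x) by case/and3P: Sx => ? ? ?; apply: Wx_frame.
  have [->|yx] := eqVneq y x.
    rewrite [S x]Sx; have -> // : (fun w => dl x t'.2 (x, w)) = t'.2; last exact: frW.
    by apply/funext => w; rewrite /dl /= eqxx mul1r.
  have -> : (fun w => dl x t'.2 (y, w)) = fun=> 0.
    by apply/funext => w; rewrite /dl /= (negbTE yx) mul0r.
  by case: ifP => // _; apply: (proj1 (Wx_subsp y)).
apply/funext => y; rewrite (VS_dl y V) /lc_fn /VSfr big_flatten /= big_map big_enum /=.
apply: eq_bigr => x Sx; rewrite big_map /=; have := V x; rewrite [S x]Sx => Wt.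
have [_ /(_ _ Wt) e] : frame (Wx x) (Wfr x) by case/and3P: (Sx : S x) => ? ? ?; apply: Wx_frame.
by rewrite e {1}/dl /lc_fn mulr_sumr; apply: eq_bigr => t _; rewrite /dl; ring.
Qed.

Variable pi : {perm T}.
Hypotheses (piN : {in N, forall x, pi x \in N}) (pi0 : pi p0 = p0) (pi1 : pi p1 = p1).
Notation mw := (map (mapl pi)).

Definition VSop (th : X -> rat) : X -> rat :=
  fun y => if S y.1 then restr N (r - 1)%N (fun w => th (pi y.1, mw w)) y.2 else 0.

Lemma S_pi x : S x -> S (pi x).
Proof.
case/and3P=> xN x0 x1; rewrite /S piN //= -{1}pi0 -{1}pi1 !(inj_eq perm_inj).
by rewrite x0 x1.
Qed.

Lemma lin_VSop : lin VSop.
Proof.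
move=> I s co f; apply/funext => y; rewrite /VSop /restr /lc_fn.
by case: ifP => _; [case: ifP => // _|]; rewrite big1 // => i _; rewrite mulr0.
Qed.

Lemma VS_VSop th : VS th -> VS (VSop th).
Proof.
move=> V x; rewrite /VSop /=; have [Sx|//] := boolP (S x); have := V (pi x); rewrite (S_pi Sx).
case=> -[H sf] k1 k2 k3; split.
- by apply/V3_restr/(Adm_pull pi H).
- by apply: killp_restr => z v; rewrite /= /mapl /= pi0 pi1.
- by apply: killp_restr => z v; rewrite /= /mapl /= pi0.
- by apply: killp_restr => z v; rewrite /= /mapl /= pi1.
Qed.

(** [Phi] is an isomorphism onto [VS], injective by [top_killp] and surjective by [Phi_surj]. Since
    pi permutes the summands of [VS], only fixed third points contribute to the trace. *)
Lemma chi3_Wfr : chi3 r N pi = \sum_(x | S x && (pi x == x)) \sum_(t <- Wfr x) t.2 (mw t.1).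
Proof.
rewrite /chi3 (Tr_iso (V3_subsp r N) (fr3_frame r N) VS_frame lin_Phi (lin_pullr N r pi) lin_VSop
  Phi_VS _ VS_VSop); first last.
- move=> f Vf; apply/funext => -[y w]; rewrite /Phi /VSop /= /pullr /restr /=.
  case: ifP => // Sy; case/and3P: (Sy) => yN _ _; rewrite S_pi // inbE p0N p1N yN /=.
  rewrite /mapl /= pi0 pi1; congr (if _ && _ then _ else _).
  by apply/eqP/eqP; clear -r0; lia.
- exact: Phi_surj.
- move=> f Vf e; apply: (top_killp Vf p0N p1N p01) => x v.
  have [Sx|Sx] := boolP (S x).
    by have := congr1 (fun F => F (x, v)) e; rewrite /Phi /= Sx.
  case: Vf => H sf; move: Sx; rewrite /S !negb_and !negbK => /or3P[xN|/eqP ->|/eqP ->].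
  - by apply: sf; rewrite /= inbE (negbTE xN) !andbF.
  - exact: (rep13 H).
  - exact: (rep23 H).
- by move=> f [H _]; apply: V3_pullr.
rewrite (TrE VS_frame lin_VSop VS_VSop) /trF /VSfr big_flatten /= big_map big_enum /=.
rewrite [RHS]big_mkcondr /=; apply: eq_bigr => x Sx; rewrite big_map /=.
have [frW _] : frame (Wx x) (Wfr x) by case/and3P: (Sx : S x) => ? ? ?; apply: Wx_frame.
have wW t : t \in Wfr x -> all (inb N) t.1 && (size t.1 == (r - 1)%N).
  case/flatten_mapP=> A; rewrite mem_enum inE => /andP[/and3P[_ AN le1] _].
  case/allpairsP=> -[p t'] /= [/fr3_word[pb sp] /flatten_mapP[B]].
  rewrite mem_enum inE => /andP[/and3P[_ BN le2] _] /allpairsP[[q s] /= [/fr3_word[qb sq] /fr3_word[sb ss] ->]] -> /=.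
  rewrite !all_cat (all_inbS AN pb) (all_inbS (subset_trans BN (subsetDl _ _)) qb).
  rewrite (all_inbS _ sb) /=; last by rewrite setDDl subsetDl.
  by rewrite !size_cat sp sq ss; clear -le1 le2; apply/eqP; lia.
case: eqP => [e|/eqP ne].
  rewrite big_seq [RHS]big_seq; apply: eq_bigr => t tW.
  by rewrite /VSop /= [S x]Sx /restr wW //= /dl e eqxx mul1r.
rewrite big_seq big1 // => t tW; rewrite /VSop /= [S x]Sx /restr wW //=.
by rewrite /dl (negbTE ne) mul0r.
Qed.

Lemma chi3_vanish k (b : {set T}) (h : T -> T) : (0 < #|b| <= 2 * k)%N -> chi3 k b h = 0.
Proof.
case/andP=> b0 bk; rewrite /chi3 (TrE (fr := [::]) _ (lin_pullr _ _ _)).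
- by rewrite /trF big_nil.
- split=> // f [H sf]; apply/funext => w; rewrite /lc_fn big_nil.
  have [/andP[wb /eqP sw]|/sf //] := boolP (all (inb b) w && (size w == k)).
  by apply: (vanish H wb) => //; rewrite sw.
by move=> f [H _]; apply: V3_pullr.
Qed.

(** A block that pi moves still shares p0 or p1 with its image, so [wprod_SV] removes its
    contribution; for stable blocks the trace is multiplicative. *)
Lemma wcond_trace x A B : wcond x A B -> pi x = x ->
  \sum_(p <- fr3 #|A|./2 A) \sum_(q <- fr3 #|B|./2 B)
  \sum_(s <- fr3 (r - 1 - #|A|./2 - #|B|./2)%N (N :\: A :\: B))
    wprod A p.2 (wprod B q.2 s.2) (mw (p.1 ++ (q.1 ++ s.1))) =
  if (pi @: A == A) && (pi @: B == B) then
   chi3 #|A|./2 A pi * chi3 #|B|./2 B pi * chi3 (r - 1 - #|A|./2 - #|B|./2)%N (N :\: A :\: B) pi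
  else 0.
Proof.
move=> W ex; case/and5P: (W) => /and3P[p0A AN le1] p1A xA /and3P[p1B BN le2] xB.
have ci (b : {set T}) : #|pi @: b| = #|b| by apply/card_imset/perm_inj.
have VB q s : q \in fr3 #|B|./2 B -> s \in fr3 (r - 1 - #|A|./2 - #|B|./2)%N (N :\: A :\: B) ->
    V3 (r - 1 - #|A|./2)%N (N :\: A) (wprod B q.2 s.2).
  move=> qf sf; rewrite -(subnKC le2); apply: V3_wprod (fr3_V qf) (fr3_V sf) (disjDl _ _) _.
  by rewrite subUset BN subsetDl.
have sb (b : {set T}) w : all (inb b) w -> all (inb (pi @: b)) (mw w).
  by apply: inb_map => y yb; apply: imset_f.
have ns (b c : {set T}) : pi @: b != b -> ~~ (pi @: b \subset b).
  by apply: contra => h; rewrite eqEcard h ci leqnn.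
have nm (b : {set T}) y : y \in b -> pi y = y -> ~~ [disjoint pi @: b & b].
  by move=> yb ey; apply/pred0Pn; exists y; rewrite /= yb -{1}ey imset_f.
have [eA|neA] := boolP (pi @: A == A); last first.
  rewrite big_seq big1 // => p pf; rewrite big_seq big1 // => q qf; rewrite big_seq big1 // => s sf.
  have [pb sp] := fr3_word pf; rewrite map_cat.
  apply: (wprod_SV _ (fr3_V pf) (VB _ _ qf sf) (disjDl _ _) (sb _ _ pb)).
  - by rewrite size_map ci.
  - exact: nm p0A pi0.
  - exact: ns neA.
have pA (w : word) : all (inb A) w -> all (inb A) (mw w) by move=> h; rewrite -(eqP eA) sb.
have pinA y : y \notin A -> pi y \notin A.
  by apply: contra; rewrite -{1}(eqP eA) (mem_imset _ _ (@perm_inj _ pi)).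
have piNA : {in N :\: A, forall y, pi y \in N :\: A}.
  by move=> y; rewrite !inE => /andP[yA yN]; rewrite pinA // piN.
have st1 p q s : p \in fr3 #|A|./2 A -> q \in fr3 #|B|./2 B ->
   s \in fr3 (r - 1 - #|A|./2 - #|B|./2)%N (N :\: A :\: B) ->
   wprod A p.2 (wprod B q.2 s.2) (mw (p.1 ++ (q.1 ++ s.1))) =
   p.2 (mw p.1) * wprod B q.2 s.2 (mw (q.1 ++ s.1)).
  move=> /fr3_word[pb _] /fr3_word[qb _] /fr3_word[sb' _]; rewrite map_cat wprod_cat ?pA //.
  apply: (all_inb_disj (b := N :\: A)); last exact: disjDl.
  apply: (inb_map piNA); rewrite all_cat (all_inbS BN qb) (all_inbS _ sb') //; exact: subsetDl.
have [eB|neB] := boolP (pi @: B == B); last first.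
  rewrite big_seq big1 // => p pf; rewrite big_seq big1 // => q qf; rewrite big_seq big1 // => s sf.
  have [qb sq] := fr3_word qf; rewrite st1 // map_cat.
  rewrite (wprod_SV _ (fr3_V qf) (fr3_V sf) (disjDl _ _) (sb _ _ qb)) ?mulr0 //.
  - by rewrite size_map ci.
  - exact: nm p1B pi1.
  - exact: ns neB.
have pinB y : y \notin B -> pi y \notin B.
  by apply: contra; rewrite -{1}(eqP eB) (mem_imset _ _ (@perm_inj _ pi)).
have piNB : {in N :\: A :\: B, forall y, pi y \in N :\: A :\: B}.
  by move=> y; rewrite inE => /andP[yB /piNA yN]; rewrite inE pinB.
rewrite /= !chi3E //; last first.
- by move=> y yA; rewrite -(eqP eA) imset_f.
- by move=> y yA; rewrite -(eqP eB) imset_f.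
rewrite -mulrA mulr_suml big_seq [RHS]big_seq; apply: eq_bigr => p pf.
rewrite mulr_suml mulr_sumr big_seq [RHS]big_seq; apply: eq_bigr => q qf.
rewrite !mulr_sumr big_seq [RHS]big_seq; apply: eq_bigr => s sf.
have [qb _] := fr3_word qf; have [sb' _] := fr3_word sf.
rewrite st1 // map_cat wprod_cat //; first by rewrite -(eqP eB) sb.
by apply: (all_inb_disj (inb_map piNB sb')); apply: disjDl.
Qed.

(** Sets A or B of even size contribute 0. If both are odd, so is the third piece, and the degree r
    - 1 - |A|/2 - |B|/2 left for it is exactly its top degree. *)
Lemma chi3_two : chi3 r N pi =
  \sum_(x | [&& x \in N, x != p0, x != p1 & pi x == x])
  \sum_(A : {set T} | [&& p0 \in A, A \subset N, p1 \notin A, x \notin A & pi @: A == A])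
  \sum_(B : {set T} | [&& p1 \in B, B \subset N :\: A, x \notin B & pi @: B == B])
   (chi3 #|A|./2 A pi * chi3 #|B|./2 B pi * chi3 #|N :\: A :\: B|./2 (N :\: A :\: B) pi).
Proof.
rewrite chi3_Wfr; apply: eq_big => [x|x /andP[Sx /eqP ex]]; first by rewrite /S -!andbA.
rewrite Wfr_sum2.
transitivity (\sum_(A : {set T} | [&& p0 \in A, A \subset N, p1 \notin A & x \notin A])
  \sum_(B : {set T} | [&& p1 \in B, B \subset N :\: A & x \notin B])
   (if (pi @: A == A) && (pi @: B == B) then chi3 #|A|./2 A pi * chi3 #|B|./2 B pi *
     chi3 #|N :\: A :\: B|./2 (N :\: A :\: B) pi else 0)); last first.
  rewrite [LHS](bigID (fun A => pi @: A == A)) /= [X in _ + X]big1 ?addr0; last first.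
    by move=> A /andP[_ /negbTE ->]; rewrite big1.
  apply: eq_big => [A|A /andP[_ ->]]; first by rewrite -!andbA.
  rewrite [LHS](bigID (fun B => pi @: B == B)) /= [X in _ + X]big1 ?addr0; last first.
    by move=> B /andP[_ /negbTE ->].
  by apply: eq_big => [B|B /andP[_ ->]] //; rewrite -!andbA.
pose F A B := if (pi @: A == A) && (pi @: B == B) then
   chi3 #|A|./2 A pi * chi3 #|B|./2 B pi * chi3 (r - 1 - #|A|./2 - #|B|./2)%N (N :\: A :\: B) pi
  else 0.
have even0 (b : {set T}) y : y \in b -> ~~ odd #|b| -> chi3 #|b|./2 b pi = 0.
  move=> yb ob; apply: chi3_vanish; apply/andP; split; first by apply/card_gt0P; exists y.
  by rewrite mul2n even_halfK.
transitivity (\sum_(A | peelc (r - 1)%N N p0 A && ((p1 \notin A) && (x \notin A)))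
  \sum_(B | peelc (r - 1 - #|A|./2)%N (N :\: A) p1 B && (x \notin B)) F A B).
  apply: eq_bigr => A /andP[a1 /andP[a2 a3]]; apply: eq_bigr => B /andP[a4 a5].
  by rewrite (wcond_trace _ ex) // /wcond a1 a2 a3 a4 a5.
have cards A B : A \subset N -> B \subset N :\: A -> x \notin A -> x \notin B ->
    (#|N :\: A :\: B| + #|B| + #|A| = #|N|)%N /\ (0 < #|N :\: A :\: B|)%N.
  move=> AN BN xA xB; have := cardsID A N; have := cardsID B (N :\: A).
  rewrite (setIidPr AN) (setIidPr BN) => e1 e2; split; first by clear -e1 e2; lia.
  by apply/card_gt0P; exists x; rewrite !inE xA xB; case/and3P: Sx.
rewrite [LHS]big_mkcond [RHS]big_mkcond /=; apply: eq_bigr => A _.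
have [/and4P[p0A AN p1A xA]|nA] := boolP [&& p0 \in A, A \subset N, p1 \notin A & x \notin A]; last first.
  rewrite /peelc ifF //; apply: contraNF nA => /andP[/and3P[-> -> _] /andP[-> ->]] //.
have [oA|oA] := boolP (odd #|A|); last first.
  rewrite big1 ?if_same; last by move=> B _; rewrite /F (even0 A p0 p0A oA) !mul0r if_same.
  by rewrite big1 // => B _; rewrite (even0 A p0 p0A oA) !mul0r if_same.
have oA' := odd_double_half #|A|; rewrite oA in oA'.
have -> : peelc (r - 1)%N N p0 A && ((p1 \notin A) && (x \notin A)).
  rewrite /peelc p0A AN p1A xA !andbT /=.
  have := @cards A set0 AN (sub0set _) xA; rewrite inE setD0 cards0 => /(_ isT) [e _].
  have c2 : (1 < #|N :\: A|)%N.
    apply/card_gt1P; exists p1, x; split; rewrite ?inE ?p1A ?xA //; last by rewrite eq_sym; case/and3P: Sx.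
    by case/and3P: Sx.
  by clear -e c2 Nodd oA'; lia.
rewrite [LHS]big_mkcond [RHS]big_mkcond /=; apply: eq_bigr => B _.
have [/and3P[p1B BN xB]|nB] := boolP [&& p1 \in B, B \subset N :\: A & x \notin B]; last first.
  rewrite /peelc ifF //; apply: contraNF nB => /andP[/and3P[-> -> _] ->] //.
have [oB|oB] := boolP (odd #|B|); last first.
  by rewrite /F (even0 B p1 p1B oB) !mulr0 !mul0r !if_same.
have oB' := odd_double_half #|B|; rewrite oB in oB'.
have [e c0] := cards A B AN BN xA xB.
have -> : peelc (r - 1 - #|A|./2)%N (N :\: A) p1 B && (x \notin B).
  by rewrite /peelc p1B BN xB andbT /=; clear -e c0 oA' oB' Nodd; lia.
rewrite /F; suff -> : (r - 1 - #|A|./2 - #|B|./2)%N = #|N :\: A :\: B|./2 by [].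
by clear -e c0 oA' oB' Nodd; lia.
Qed.
End TwoPoints.

(** * The algebra with generators indexed by quadruples *)

Section Letters4.
Variable T : finType.
Notation letter := (T * T * T * T)%type.
Notation word := (seq letter).
Implicit Types (f : word -> rat) (g : letter) (u v w : word).

Definition five f (a b c d e : T) v : rat :=
  f ((a,b,c,d) :: v) + f ((b,c,d,e) :: v) + f ((c,d,e,a) :: v) + f ((d,e,a,b) :: v) + f ((e,a,b,c) :: v).

Variable M : {set T}.

(** The five-term relation is imposed on points of M only: each of its terms omits one point, so it
    would not survive the restriction to words in M if outside points took part. *)
Record Adm4 f : Prop := MkAdm4 {
  adm4_alt : altf f;
  adm4_sg1 : forall a b c d v, f ((a,b,c,d) :: v) = - f ((b,a,c,d) :: v);
  adm4_sg2 : forall a b c d v, f ((a,b,c,d) :: v) = - f ((a,c,b,d) :: v);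
  adm4_sg3 : forall a b c d v, f ((a,b,c,d) :: v) = - f ((a,b,d,c) :: v);
  adm4_five : forall a b c d e v, all [in M] [:: a; b; c; d; e] -> uniq [:: a; b; c; d; e] -> five f a b c d e v = 0;
  adm4_quad : forall a b c d e v, uniq [:: a; b; c; d; e] -> f [:: (a,b,c,d), (a,b,c,e) & v] = 0 }.

Section Theory4.
Variable f : word -> rat.
Hypothesis Hf : Adm4 f.

Lemma sw4 g h v : f (g :: h :: v) = - f (h :: g :: v).
Proof. by apply: alt_swap; apply: adm4_alt. Qed.
Lemma rep4_12 a c d v : f ((a,a,c,d) :: v) = 0.
Proof. by apply: eqN0; apply: adm4_sg1. Qed.
Lemma rep4_23 a c d v : f ((a,c,c,d) :: v) = 0.
Proof. by apply: eqN0; apply: adm4_sg2. Qed.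
Lemma rep4_34 a c d v : f ((a,c,d,d) :: v) = 0.
Proof. by apply: eqN0; apply: adm4_sg3. Qed.
Lemma rep4_13 a b d v : f ((a,b,a,d) :: v) = 0.
Proof. by rewrite (adm4_sg1 Hf) rep4_23 oppr0. Qed.
Lemma rep4_24 a b d v : f ((d,a,b,a) :: v) = 0.
Proof. by rewrite (adm4_sg2 Hf) rep4_34 oppr0. Qed.
Lemma rep4_14 a b d v : f ((a,b,d,a) :: v) = 0.
Proof. by rewrite (adm4_sg1 Hf) rep4_24 oppr0. Qed.

Lemma cyc4 a b c d v : f ((a,b,c,d) :: v) = - f ((b,c,d,a) :: v).
Proof. by rewrite (adm4_sg1 Hf a) (adm4_sg2 Hf b a) (adm4_sg3 Hf b c a) opprK. Qed.

(** With a repeated point the relation follows from antisymmetry; a rotation makes the two equal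
    points neighbors or leaves one point between them. *)
Lemma five_all a b c d e v : all [in M] [:: a; b; c; d; e] -> five f a b c d e v = 0.
Proof.
move=> inM.
have rot x y z t s : five f x y z t s v = five f y z t s x v by rewrite /five; ring.
have F1 x z t s : five f x x z t s v = 0.
  by rewrite /five rep4_12 rep4_34 rep4_23 (cyc4 x z t s); ring.
have F2 x y t s : five f x y x t s v = 0.
  rewrite /five rep4_13 rep4_14 rep4_24 (cyc4 t s x y) (cyc4 s x y t) (adm4_sg1 Hf x y); ring.
have [u|] := boolP (uniq [:: a; b; c; d; e]); first exact: (adm4_five Hf).
rewrite /= !inE.
case: (eqVneq a b) => [->|_]; first by rewrite F1.
case: (eqVneq a c) => [->|_]; first by rewrite F2.
case: (eqVneq a d) => [->|_]; first by rewrite 3!rot F2.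
case: (eqVneq a e) => [->|_]; first by rewrite 4!rot F1.
case: (eqVneq b c) => [->|_]; first by rewrite rot F1.
case: (eqVneq b d) => [->|_]; first by rewrite rot F2.
case: (eqVneq b e) => [->|_]; first by rewrite 4!rot F2.
case: (eqVneq c d) => [->|_]; first by rewrite 2!rot F1.
case: (eqVneq c e) => [->|_]; first by rewrite 2!rot F2.
by case: (eqVneq d e) => [->|//]; rewrite 3!rot F1.
Qed.

Lemma quad4_all a b c d e v : f [:: (a,b,c,d), (a,b,c,e) & v] = 0.
Proof.
case: (eqVneq a b) => [->|ab]; first by rewrite rep4_12.
case: (eqVneq a c) => [->|ac]; first by rewrite rep4_13.
case: (eqVneq b c) => [->|bc]; first by rewrite rep4_23.
case: (eqVneq a d) => [->|ad]; first by rewrite rep4_14.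
case: (eqVneq b d) => [->|bd]; first by rewrite rep4_24.
case: (eqVneq c d) => [->|cd]; first by rewrite rep4_34.
case: (eqVneq a e) => [->|ae]; first by rewrite sw4 rep4_14 oppr0.
case: (eqVneq b e) => [->|be]; first by rewrite sw4 rep4_24 oppr0.
case: (eqVneq c e) => [->|ce]; first by rewrite sw4 rep4_34 oppr0.
case: (eqVneq d e) => [->|de]; first by apply: eqN0; apply: sw4.
by apply: (adm4_quad Hf); rewrite /= !inE !negb_or ab ac ad ae bc bd be cd ce de.
Qed.
End Theory4.

Lemma Adm4_cons f g : Adm4 f -> Adm4 (fun v => f (g :: v)).
Proof.
move=> Hf; have sw := sw4 Hf; split.
- by move=> u x y v; apply: (adm4_alt Hf (g :: u)).
- by move=> a b c d v; rewrite [LHS]sw (adm4_sg1 Hf) [in RHS]sw.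
- by move=> a b c d v; rewrite [LHS]sw (adm4_sg2 Hf) [in RHS]sw.
- by move=> a b c d v; rewrite [LHS]sw (adm4_sg3 Hf) [in RHS]sw.
- move=> a b c d e v inM _; rewrite /five !(sw g).
  have := five_all Hf (g :: v) inM; rewrite /five; lra.
- by move=> a b c d e v _; rewrite sw (adm4_alt Hf [:: _]) opprK (quad4_all Hf).
Qed.

Lemma Adm4_cat f u : Adm4 f -> Adm4 (fun v => f (u ++ v)).
Proof. by elim: u f => [|g u IHu] f Hf //=; apply: (IHu (fun v => f (g :: v))); apply: Adm4_cons. Qed.

Lemma Adm4_lin (co : rat) f f' : Adm4 f -> Adm4 f' -> Adm4 (fun w => co * f w + f' w).
Proof.
move=> H H'; split.
- by move=> u g h v; rewrite (adm4_alt H) (adm4_alt H'); ring.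
- by move=> a b c d v; rewrite (adm4_sg1 H a) (adm4_sg1 H' a); ring.
- by move=> a b c d v; rewrite (adm4_sg2 H a) (adm4_sg2 H' a); ring.
- by move=> a b c d v; rewrite (adm4_sg3 H a) (adm4_sg3 H' a); ring.
- move=> a b c d e v inM _; have e1 := five_all H v inM; have e2 := five_all H' v inM.
  transitivity (co * five f a b c d e v + five f' a b c d e v); first by rewrite /five; ring.
  by rewrite e1 e2 mulr0 addr0.
by move=> a b c d e v _; rewrite (quad4_all H) (quad4_all H') mulr0 addr0.
Qed.

Definition inb4 g :=
  [&& g.1.1.1 \in M, g.1.1.2 \in M, g.1.2 \in M & g.2 \in M].
Definition restr4 k f w := if all (inb4) w && (size w == k) then f w else 0.

Lemma Adm4_restr k f : Adm4 f -> Adm4 (restr4 k f).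
Proof.
move=> Hf; rewrite /restr4; split.
- move=> u g h v; rewrite !all_cat !size_cat /= [inb4 g && _]andbCA.
  by case: ifP => _; rewrite ?oppr0 // (adm4_alt Hf).
- move=> a b c d v /=; have -> : inb4 (a,b,c,d) = inb4 (b,a,c,d) by rewrite /inb4 /= andbCA.
  by case: ifP => _; rewrite ?oppr0 // (adm4_sg1 Hf).
- move=> a b c d v /=; have -> : inb4 (a,b,c,d) = inb4 (a,c,b,d).
    by rewrite /inb4 /= [(b \in M) && _]andbCA.
  by case: ifP => _; rewrite ?oppr0 // (adm4_sg2 Hf).
- move=> a b c d v /=; have -> : inb4 (a,b,c,d) = inb4 (a,b,d,c).
    by rewrite /inb4 /= [(c \in M) && _]andbC.
  by case: ifP => _; rewrite ?oppr0 // (adm4_sg3 Hf).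
- move=> a b c d e v inM U; have := five_all Hf v inM.
  move: inM; rewrite /five /= /inb4 /= => /and5P[-> -> -> -> /andP[-> _]] /=.
  by case: ifP => _; rewrite ?addr0.
by move=> a b c d e v U; case: ifP => // _; rewrite (quad4_all Hf).
Qed.

Lemma Adm4_0 : Adm4 (fun=> 0).
Proof. by split=> *; rewrite /five ?oppr0 ?addr0. Qed.

Definition V4 k f := Adm4 f /\ forall w, ~~ (all inb4 w && (size w == k)) -> f w = 0.

Lemma V4_subsp k : subsp (V4 k).
Proof.
split; first by split=> //; apply: Adm4_0.
by move=> c f f' [H1 H2] [H1' H2']; split=> [|w h]; [apply: Adm4_lin|rewrite H2 // H2' // mulr0 addr0].
Qed.

Lemma V4_restr k f : Adm4 f -> V4 k (restr4 k f).
Proof. by move=> H; split=> [|w h]; [apply: Adm4_restr|rewrite /restr4 (negbTE h)]. Qed.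

Lemma restr4_in k f w : all inb4 w -> size w = k -> restr4 k f w = f w.
Proof. by rewrite /restr4 => -> ->; rewrite eqxx. Qed.

Lemma V4_frame k : exists2 fr, frame (V4 k) fr & {in fr, forall p, all inb4 p.1 /\ size p.1 = k}.
Proof.
pose ws : seq word := map val (filter (fun t : k.-tuple letter => all inb4 (tval t)) (enum {: k.-tuple letter})).
have wsP w : (w \in ws) = all inb4 w && (size w == k).
  apply/mapP/andP => [[t]|[wN /eqP sw]].
    by rewrite mem_filter => /andP[tN _] ->; rewrite tN size_tuple.
  have sw' : size w == k by rewrite sw.
  by exists (Tuple sw') => //; rewrite mem_filter mem_enum wN.
have [|fr frV frw] := frame_exists (ws := ws) (V4_subsp k).
  move=> f [H1 H2] H3; apply/funext => w.
  have [wN|wN] := boolP (all inb4 w && (size w == k)); last exact: H2.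
  by apply: H3; rewrite wsP.
by exists fr => // p /frw; rewrite wsP => /andP[-> /eqP ->].
Qed.
End Letters4.

Definition mapl4 (T T' : Type) (h : T -> T') (g : T * T * T * T) : T' * T' * T' * T' :=
  (h g.1.1.1, h g.1.1.2, h g.1.2, h g.2).

Lemma map_mapl4 (T T' T'' : Type) (h : T -> T') (h' : T' -> T'') w :
  map (mapl4 h') (map (mapl4 h) w) = map (mapl4 (fun x => h' (h x))) w.
Proof. by rewrite -map_comp; apply: eq_map => -[[[]]]. Qed.

Lemma Adm4_pull (T T' : finType) (h : T -> T') (M : {set T}) (M' : {set T'}) f :
  {in M, forall x, h x \in M'} -> Adm4 M' f -> Adm4 M (fun w => f (map (mapl4 h) w)).
Proof.
move=> hM H; split.
- by move=> u x y v; rewrite !map_cat /= (adm4_alt H).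
- by move=> a b c d v; rewrite /= (adm4_sg1 H).
- by move=> a b c d v; rewrite /= (adm4_sg2 H).
- by move=> a b c d v; rewrite /= (adm4_sg3 H).
- move=> a b c d e v inM _; apply: (five_all H); move: inM => /= /and5P[aM bM cM dM /andP[eM _]].
  by rewrite !hM.
by move=> a b c d e v _; rewrite /= (quad4_all H).
Qed.

Lemma inb4_map (T T' : finType) (M : {set T}) (M' : {set T'}) (h : T -> T') w :
  {in M, forall x, h x \in M'} -> all (inb4 M) w -> all (inb4 M') (map (mapl4 h) w).
Proof.
move=> hM /allP wM; rewrite all_map; apply/allP => -[[[a b] c] d] /wM /=.
by rewrite /inb4 /= => /and4P[? ? ? ?]; rewrite !hM.
Qed.

Lemma mapl4_in (T T' : finType) (M : {set T}) (h h' : T -> T') w :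
  {in M, h =1 h'} -> all (inb4 M) w -> map (mapl4 h) w = map (mapl4 h') w.
Proof.
move=> e /allP wM; apply/eq_in_map => -[[[a b] c] d] /wM; rewrite /inb4 /= => /and4P[? ? ? ?].
by rewrite /mapl4 /= !e.
Qed.

Definition pullr4 (T T' : finType) (M : {set T}) k (h : T -> T') f : seq (T * T * T * T) -> rat :=
  restr4 M k (fun w => f (map (mapl4 h) w)).

Lemma lin_pullr4 (T T' : finType) (M : {set T}) k (h : T -> T') : lin (pullr4 M k h).
Proof.
move=> I s c f; apply/funext => w; rewrite /pullr4 /restr4 /lc_fn; case: ifP => // _.
by rewrite big1 // => i _; rewrite mulr0.
Qed.

Lemma V4_pullr (T T' : finType) (M : {set T}) (M' : {set T'}) k (h : T -> T') f :
  {in M, forall x, h x \in M'} -> V4 M' k f -> V4 M k (pullr4 M k h f).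
Proof. by move=> hM [H _]; apply/V4_restr/(Adm4_pull hM). Qed.

Definition chi4 (T : finType) k (M : {set T}) (pi : T -> T) : rat := Tr (V4 M k) (pullr4 M k pi).

Lemma pullr4_comp (T T' T'' : finType) (M : {set T}) (M' : {set T'}) k
    (h : T -> T') (h' : T' -> T'') f : {in M, forall x, h x \in M'} ->
  pullr4 M k h (pullr4 M' k h' f) = pullr4 M k (fun x => h' (h x)) f.
Proof.
move=> hM; apply/funext => w; rewrite /pullr4 /restr4; case: ifP => // /andP[wM /eqP sw].
by rewrite (inb4_map hM wM) size_map sw eqxx /= map_mapl4.
Qed.

Lemma pullr4_eq (T T' : finType) (M : {set T}) k (h h' : T -> T') f :
  {in M, h =1 h'} -> pullr4 M k h f = pullr4 M k h' f.
Proof.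
move=> e; apply/funext => w; rewrite /pullr4 /restr4; case: ifP => // /andP[wM _].
by rewrite (mapl4_in e wM).
Qed.

(* A factorization of maps of finite sets moves a trace from one set to another. *)
Lemma chi4_comm (T T' : finType) k (M : {set T}) (M' : {set T'}) (h : T -> T') (h' : T' -> T) :
  {in M, forall x, h x \in M'} -> {in M', forall x, h' x \in M} ->
  chi4 k M (fun x => h' (h x)) = chi4 k M' (fun x => h (h' x)).
Proof.
move=> hM hM'; have [fr Vfr _] := V4_frame M k; have [gr Vgr _] := V4_frame M' k.
have := Tr_comm Vfr Vgr (lin_pullr4 M' k h') (lin_pullr4 M k h)
  (fun f => V4_pullr (h := h') (k := k) hM') (fun f => V4_pullr (h := h) (k := k) hM).
rewrite /chi4 => E.
transitivity (Tr (V4 M k) (fun f => pullr4 M k h (pullr4 M' k h' f))).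
  by congr Tr; apply/funext => f; rewrite pullr4_comp.
by rewrite E; congr Tr; apply/funext => f; rewrite pullr4_comp.
Qed.

Lemma chi4_eq (T : finType) (M : {set T}) k (h h' : T -> T) :
  {in M, h =1 h'} -> chi4 k M h = chi4 k M h'.
Proof.
by move=> e; rewrite /chi4; congr Tr; apply/funext => f; apply: pullr4_eq.
Qed.

Lemma chi4_relabel (T T' : finType) k (M : {set T}) (h : T -> T') (pi : T -> T) (pi' : T' -> T') :
  M != set0 -> {in M &, injective h} -> {in M, forall x, pi x \in M} ->
  {in M, forall x, h (pi x) = pi' (h x)} -> chi4 k (h @: M) pi' = chi4 k M pi.
Proof.
move=> /set0Pn[x0 x0M] hI piM hpi.
pose hi y := odflt x0 [pick x in M | h x == y].
have hiK x : x \in M -> hi (h x) = x.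
  move=> xM; rewrite /hi; case: pickP => [z /andP[zN /eqP e]|/(_ x)]; first exact: hI.
  by rewrite xM eqxx.
have hiM y : y \in h @: M -> hi y \in M by case/imsetP=> x xM ->; rewrite hiK.
have hK y : y \in h @: M -> h (hi y) = y by case/imsetP=> x xM ->; rewrite hiK.
transitivity (chi4 k M (fun x => pi (hi (h x)))); last by apply: chi4_eq => x xM; rewrite hiK.
rewrite (@chi4_comm _ _ k M (h @: M) h (fun y => pi (hi y))).
- by apply: chi4_eq => y yM; rewrite hpi ?hiM // hK.
- by move=> x xM; apply: imset_f.
- by move=> y /hiM /piM.
Qed.

(** Let e_J send J to b and fix the other points. The map pi e_J of M factors through M minus J, so
    [chi4_comm] gives it the trace of pi there. All these traces are now taken on one space, and on
    a single word e_J matters only through the points that the word mentions. *)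
Lemma chi4_collapse (T : finType) k (M J0 : {set T}) (pi : T -> T) b :
  {in M, forall x, pi x \in M} -> J0 \subset M -> {in J0, forall x, pi x = x} ->
  {in M :\: J0, forall x, pi x \notin J0} ->
  b \in M :\: J0 -> (4 * k < #|J0|)%N ->
  \sum_(J : {set T} | J \subset J0) (-1) ^+ #|J| * chi4 k (M :\: J) pi = 0.
Proof.
move=> piM JM fix0 piJ; rewrite inE => /andP[bJ bM] kJ.
pose e (J : {set T}) x := if x \in J then b else x.
have eM (J : {set T}) x : J \subset J0 -> x \in M -> e J x \in M :\: J.
  move=> sJ xM; rewrite /e; case: ifP => xJ; rewrite inE ?xJ //.
  by rewrite bM andbT; apply: contra bJ; apply: (subsetP sJ).
have E (J : {set T}) : J \subset J0 -> chi4 k (M :\: J) pi = chi4 k M (fun x => pi (e J x)).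
  move=> sJ; rewrite (@chi4_comm _ _ k M (M :\: J) (e J) pi).
  - apply: chi4_eq => x; rewrite inE /e => /andP[xJ xM].
    suff /negbTE -> : pi x \notin J by [].
    have [xJ0|xJ0] := boolP (x \in J0); first by rewrite fix0.
    by apply: contra (piJ x _); [apply: (subsetP sJ)|rewrite inE xJ0].
  - by move=> x; apply: eM.
  by move=> x; rewrite inE => /andP[_ /piM].
have [fr Vfr frw] := V4_frame M k.
have trE (J : {set T}) : J \subset J0 -> chi4 k (M :\: J) pi =
    \sum_(p <- fr) p.2 (map (mapl4 (fun x => pi (e J x))) p.1).
  move=> sJ; rewrite E // /chi4 (TrE Vfr (lin_pullr4 _ _ _)); last first.
    by move=> f; apply: V4_pullr => x xM; apply: piM; have := eM J x sJ xM; rewrite inE => /andP[].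
  rewrite /trF big_seq [RHS]big_seq; apply: eq_bigr => p /frw[pM sp].
  by rewrite /pullr4 restr4_in.
rewrite (eq_bigr (fun J : {set T} => \sum_(p <- fr) (-1) ^+ #|J| * p.2 (map (mapl4 (fun x => pi (e J x))) p.1))); last first.
  by move=> J sJ; rewrite trE // mulr_sumr.
rewrite exchange_big big_seq big1 // => p pf; have [pM sp] := frw p pf.
(* a word of length k mentions at most 4k points, so some point of J0 is missed *)
pose P : {set T} := [set x in flatten [seq [:: g.1.1.1; g.1.1.2; g.1.2; g.2] | g <- p.1]].
have [j jJ jP] : exists2 j, j \in J0 & j \notin P.
  apply/subsetPn/negP => /subset_leq_card; apply/negP; rewrite -ltnNge; apply: leq_ltn_trans kJ.
  rewrite /P cardsE (leq_trans (card_size _)) // size_flatten /shape -map_comp -sp.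
  by elim: (p.1) => [//|g w IHw] /=; rewrite mulnS leq_add2l.
have tog (J : {set T}) : map (mapl4 (fun x => pi (e (j |: J) x))) p.1 = map (mapl4 (fun x => pi (e J x))) p.1.
  have eP x : x \in P -> e (j |: J) x = e J x.
    by move=> xP; rewrite /e !inE; case: eqP => [xj|//]; rewrite xj (negbTE jP) in xP.
  have gP g : g \in p.1 -> {in [:: g.1.1.1; g.1.1.2; g.1.2; g.2], forall x, x \in P}.
    by move=> gp x xg; rewrite inE; apply/flatten_mapP; exists g.
  apply/eq_in_map => g /gP gP'; rewrite /mapl4 !eP //; apply: gP'; rewrite !inE eqxx ?orbT //.
rewrite (bigID (fun J : {set T} => j \in J)) /= addrC.
rewrite [X in _ + X](reindex_onto (fun J => j |: J) (fun J => J :\ j)) /=; last first.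
  by move=> J /andP[_ jJ']; rewrite setD1K.
rewrite [X in _ + X](eq_bigl (fun J : {set T} => (J \subset J0) && (j \notin J))); last first.
  move=> J; rewrite setU11 andbT subUset sub1set jJ /=.
  have [jn|jn] := boolP (j \in J).
    by rewrite andbF; apply/negbTE; rewrite negb_and; apply/orP; right; apply: contraTneq jn => <-; rewrite !inE eqxx.
  by rewrite andbT setU1K // eqxx andbT.
rewrite -big_split big1 //= => J /andP[_ jn]; rewrite tog cardsU1 jn exprS; ring.
Qed.

(** * Singling out a point of the set *)

Section Cone.
Variables (T : finType) (N : {set T}) (oo : T).
Hypothesis ooN : oo \notin N.
Let M := oo |: N.
Notation word3 := (seq (T * T * T)).
Notation word4 := (seq (T * T * T * T)).
Implicit Types (f : word4 -> rat) (phi : word3 -> rat) (k : nat).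

Definition app_oo (g : T * T * T) : T * T * T * T := (g.1.1, g.1.2, g.2, oo).
Definition res f : word3 -> rat := fun w => f (map app_oo w).

Let ooM : oo \in M. Proof. exact: setU11. Qed.

(** The five-term relation with fifth point [oo]. *)
Lemma exE f a b c d v : Adm4 M f -> all [in M] [:: a; b; c; d] ->
  f ((a,b,c,d) :: v) = f ((a,b,c,oo) :: v) - f ((a,b,d,oo) :: v) + f ((a,c,d,oo) :: v) - f ((b,c,d,oo) :: v).
Proof.
move=> H inM; have inM' : all [in M] [:: a; b; c; d; oo].
  by move: inM => /= /and5P[-> -> -> -> _]; rewrite ooM.
have := five_all H v inM'; rewrite /five.
rewrite (adm4_sg3 H c d oo a) (adm4_sg2 H c d a oo) (adm4_sg1 H c a d oo).
rewrite (adm4_sg2 H d oo a b) (adm4_sg3 H d a oo b) (adm4_sg1 H d a b oo) (adm4_sg2 H a d b oo).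
by rewrite (cyc4 H oo a b c); lra.
Qed.

(** The six-term relation is the product of omega_(abcl) and omega_(abcm), which is zero, expanded
    through [oo]. Words mentioning [oo] inside a triple vanish because the letter then repeats
    it. *)
Lemma V3_res k f : V4 M k f -> V3 k N (res f).
Proof.
move=> [H sf].
have K2 x y p q v : f [:: (x,y,p,oo), (x,y,q,oo) & v] = 0.
  by rewrite (adm4_sg3 H x y p) (sw4 H) (adm4_sg3 H x y q) (quad4_all H) !oppr0.
split; last first.
  move=> w nw; have [/allP wM|wM] := boolP (all (inb4 M) (map app_oo w)); last by apply: sf; rewrite negb_and wM.
  have [sz|sz] := eqVneq (size w) k; last by apply: sf; rewrite size_map (negbTE sz) andbF.
  move: nw; rewrite sz eqxx andbT -has_predC => /hasP[[[a b] c] gw /= gN].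
  have := wM _ (map_f app_oo gw); rewrite /inb4 /= => /and4P[aM bM cM _].
  rewrite /res; apply: (alt_perm0 (adm4_alt H) (perm_map app_oo (perm_to_rem gw))) => /=.
  have z x : x \in M -> x \notin N -> x = oo by rewrite !inE => /orP[/eqP //|->].
  move: gN; rewrite inbE !negb_and => /or3P[] /(z _ _) e; rewrite /app_oo /= e //.
  - exact: (rep4_14 H).
  - exact: (rep4_24 H).
  - exact: (rep4_34 H).
split.
- by move=> u g h v; rewrite /res !map_cat /= (adm4_alt H).
- by move=> a b c v; rewrite /res /= (adm4_sg1 H).
- by move=> a b c v; rewrite /res /= (adm4_sg2 H).
- by move=> a b c d v _; rewrite /res /= K2.
move=> a b c l m v _; rewrite /res /six /= /app_oo /=; set v' := map _ v.
have [inM|ninM] := boolP (all [in M] [:: a; b; c; l; m]); last first.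
  have z g h : ~~ all [in M] [:: g.1.1.1; g.1.1.2; g.1.2; h.1.1.1; h.1.1.2; h.1.2] -> f [:: g, h & v'] = 0.
    move=> n; apply: sf; rewrite negb_and; apply/orP; left; apply: contra n => /= /and3P[].
    by rewrite /inb4 => /and4P[-> -> -> _] /and4P[-> -> -> _].
  rewrite !z ?addr0 //=; move: ninM => /=; apply: contra => /and5P[? ? ? ? /and3P[? ? _]];
    by repeat (apply/andP; split).
move: inM => /= /and5P[aM bM cM lM /andP[mM _]].
have s1 := adm4_sg1 H; have s2 := adm4_sg2 H; have sw := sw4 H.
pose G x y : rat := f [:: app_oo x, app_oo y & v'].
have k1 x y p q : G (x,p,y) (x,y,q) = 0 by rewrite /G /app_oo /= (s2 x p) K2 !oppr0.
have k2 x y p q : G (p,x,y) (x,y,q) = 0 by rewrite /G /app_oo /= (s1 p) (s2 x p) K2 !oppr0.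
have k3 x y z p : G (x,y,p) (x,y,z) = 0 by rewrite /G /app_oo /= K2.
have Gs x y : G x y = - G y x by rewrite /G sw.
(* Of the sixteen products in the expansion, those whose triples share two points vanish or cancel;
   these six remain. *)
have E : G (a,b,l) (a,c,m) - G (a,b,l) (b,c,m) + G (a,c,l) (a,b,m) + G (a,c,l) (b,c,m)
    - G (b,c,l) (a,b,m) + G (b,c,l) (a,c,m) = 0.
  have ex2 g x y z t : all [in M] [:: x; y; z; t] -> f [:: g, (x,y,z,t) & v'] =
      f [:: g, (x,y,z,oo) & v'] - f [:: g, (x,y,t,oo) & v'] + f [:: g, (x,z,t,oo) & v'] - f [:: g, (y,z,t,oo) & v'].
    by move=> inM; rewrite sw (exE _ H inM) !(sw g); ring.
  have := quad4_all H a b c l m v';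
  have inl : all [in M] [:: a; b; c; l] by rewrite /= aM bM cM lM.
  have inm : all [in M] [:: a; b; c; m] by rewrite /= aM bM cM mM.
  rewrite (exE _ H inl) !(ex2 _ _ _ _ _ inm).
  have z1 := k3 a b c c; have z2 := k3 a b l c; have z3 := k1 a c b l; have z4 := k2 b c a l.
  have z5 := k3 a b m c; have z6 := k3 a b m l; have z7 := k1 a c b m; have z8 := k3 a c m l.
  have z9 := k2 b c a m; have z10 := k3 b c m l; have z11 := k3 a b c l.
  have y3 := Gs (a,c,l) (a,b,c); have y4 := Gs (b,c,l) (a,b,c).
  rewrite /G /app_oo /= in z1 z2 z3 z4 z5 z6 z7 z8 z9 z10 z11 y3 y4 *.
  lra.
have e1 x y : G x (c,a,y) = - G x (a,c,y) by rewrite /G /app_oo /= sw (s1 c) -sw.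
have e2 x y : G (c,a,y) x = - G (a,c,y) x by rewrite /G /app_oo /= (s1 c).
have y1 := e1 (b,c,l) m; have y2 := e2 (b,c,m) l; have y3 := e2 (a,b,m) l; have y4 := e1 (a,b,l) m.
rewrite /G /app_oo /= in E y1 y2 y3 y4.
lra.
Qed.

(** The inverse of [res], which expands the letters through [oo] one at a time. *)
Definition exD (g : T * T * T * T) phi : word3 -> rat := fun v =>
  let: (a, b, c, d) := g in
  phi ((a,b,c) :: v) - phi ((a,b,d) :: v) + phi ((a,c,d) :: v) - phi ((b,c,d) :: v).
Fixpoint ext phi (w : word4) : rat := if w is g :: w' then ext (exD g phi) w' else phi [::].

Lemma ext_eq phi phi' w : phi =1 phi' -> ext phi w = ext phi' w.
Proof. by move=> /funext ->. Qed.

Lemma ext_lin (co : rat) phi phi' w : ext (fun v => co * phi v + phi' v) w = co * ext phi w + ext phi' w.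
Proof.
elim: w phi phi' => [//|g w IHw] phi phi' /=; rewrite -IHw; apply: ext_eq => v.
by case: g => [[[a b] c] d]; rewrite /exD; ring.
Qed.

Lemma ext0 w : ext (fun=> 0) w = 0.
Proof.
have e : (fun=> 0 : rat) = (fun v : word3 => 0 * 0 + 0) by apply/funext => v; rewrite mulr0 addr0.
by have := ext_lin (-1) (fun=> 0) (fun=> 0) w; rewrite mulr0 addr0 mulN1r addNr.
Qed.

Lemma extN phi w : ext (fun v => - phi v) w = - ext phi w.
Proof.
transitivity (ext (fun v => -1 * phi v + 0) w); first by apply: ext_eq => v; rewrite mulN1r addr0.
by rewrite ext_lin ext0 mulN1r addr0.
Qed.

Lemma extD phi phi' w : ext (fun v => phi v + phi' v) w = ext phi w + ext phi' w.
Proof.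
transitivity (ext (fun v => 1 * phi v + phi' v) w); first by apply: ext_eq => v; rewrite mul1r.
by rewrite ext_lin mul1r.
Qed.

Lemma Adm_exD g phi : Adm phi -> Adm (exD g phi).
Proof.
case: g => [[[a b] c] d] H.
have -> : exD (a,b,c,d) phi = fun v => -1 * phi ((b,c,d) :: v) +
   (1 * phi ((a,c,d) :: v) + (-1 * phi ((a,b,d) :: v) + phi ((a,b,c) :: v))).
  by apply/funext => v; rewrite /exD; ring.
by do 3 (apply: Adm_lin; first exact: Adm_cons); apply: Adm_cons.
Qed.

Lemma Adm4_ext phi : Adm phi -> Adm4 M (ext phi).
Proof.
move=> H; split.
- move=> u g h v; elim: u phi H => [|x u IHu] phi H /=; last exact: IHu (Adm_exD x H).
  rewrite -extN; apply: ext_eq => z; case: g h => [[[a b] c] d] [[[a' b'] c'] d'].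
  rewrite /exD !(sw H (a',b',c')) !(sw H (a',b',d')) !(sw H (a',c',d')) !(sw H (b',c',d')); ring.
- move=> a b c d v /=; rewrite -extN; apply: ext_eq => z; rewrite /exD.
  rewrite (adm_sg1 H a b c) (adm_sg1 H a b d); ring.
- move=> a b c d v /=; rewrite -extN; apply: ext_eq => z; rewrite /exD.
  rewrite (adm_sg2 H a b c) (adm_sg1 H b c d); ring.
- move=> a b c d v /=; rewrite -extN; apply: ext_eq => z; rewrite /exD.
  rewrite (adm_sg2 H a c d) (adm_sg2 H b c d); ring.
- move=> a b c d e v _ _; rewrite /five /= -!extD -[RHS](ext0 v); apply: ext_eq => z; rewrite /exD.
  have y1 := cyc H (d,a,b) z; have y2 := cyc H (c,d,a) z; have y3 := cyc H (d,a,c) z.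
  have y4 := cyc H (e,b,c) z; have y5 := cyc H (d,e,b) z; have y6 := cyc H (e,b,d) z.
  have y7 := cyc H (c,e,a) z.
  by rewrite /= in y1 y2 y3 y4 y5 y6 y7; lra.
move=> a b c l m v _; rewrite /= -[RHS](ext0 v); apply: ext_eq => z; rewrite /exD.
pose G x y : rat := phi [:: x, y & z].
have k1 x y p q : G (x,p,y) (x,y,q) = 0 by rewrite /G (adm_sg2 H) (quad_all H) oppr0.
have k2 x y p q : G (p,x,y) (x,y,q) = 0 by rewrite /G (cyc H) /= (quad_all H).
have k3 x y q p : G (x,y,p) (x,y,q) = 0 by rewrite /G (quad_all H).
have Gs x y : G x y = - G y x by rewrite /G (sw H).
have z1 := k3 a b c c; have z2 := k3 a b l c; have z3 := k1 a c b l; have z4 := k2 b c a l.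
have z5 := k3 a b m c; have z6 := k3 a b m l; have z7 := k1 a c b m; have z8 := k3 a c m l.
have z9 := k2 b c a m; have z10 := k3 b c m l; have z11 := k3 a b c l.
have x3 := Gs (a,c,l) (a,b,c); have x4 := Gs (b,c,l) (a,b,c).
have e1 x y : G x (c,a,y) = - G x (a,c,y) by rewrite /G (sw H) (adm_sg1 H c) -(sw H).
have e2 x y : G (c,a,y) x = - G (a,c,y) x by rewrite /G (adm_sg1 H c).
have y1 := e1 (b,c,l) m; have y2 := e2 (b,c,m) l; have y3 := e2 (a,b,m) l; have y4 := e1 (a,b,l) m.
have := six_all H a b c l m z; rewrite /six.
by rewrite /G in z1 z2 z3 z4 z5 z6 z7 z8 z9 z10 z11 x3 x4 y1 y2 y3 y4; lra.
Qed.

Lemma ext_app phi w : (forall u a b c v, oo \in [:: a; b; c] -> phi (u ++ (a,b,c) :: v) = 0) ->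
  ext phi (map app_oo w) = phi w.
Proof.
elim: w phi => [//|[[a b] c] w IHw] phi z /=.
have e : exD (app_oo (a,b,c)) phi = fun v => phi ((a,b,c) :: v).
  apply/funext => v; have zo x y : phi ((x,y,oo) :: v) = 0.
    by apply: (z [::]); rewrite !inE eqxx !orbT.
  by rewrite /exD /app_oo /= !zo; ring.
by rewrite e IHw // => u a' b' c' v h; apply: (z (_ :: u)).
Qed.

Lemma ext_res f w : Adm4 M f -> all (inb4 M) w -> ext (res f) w = f w.
Proof.
elim: w f => [//|[[[a b] c] d] w IHw] f H /= /andP[gM wM].
rewrite -(IHw _ (Adm4_cons (a,b,c,d) H) wM); apply: ext_eq => v.
have inM : all [in M] [:: a; b; c; d] by move: gM; rewrite /inb4 /= => /and4P[-> -> -> ->].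
by rewrite /exD /res /= /app_oo /= (exE _ H inM).
Qed.

Lemma res_inj k f : V4 M k f -> res f = (fun=> 0) -> f = fun=> 0.
Proof.
move=> [H sf] e; apply/funext => w; have [/andP[wM _]|/sf //] := boolP (all (inb4 M) w && (size w == k)).
by rewrite -(ext_res H wM) e ext0.
Qed.

Lemma chi4_cone k (pi : T -> T) : {in N, forall x, pi x \in N} -> pi oo = oo ->
  chi4 k M pi = chi3 k N pi.
Proof.
move=> piN pio; have [fr Vfr _] := V4_frame M k.
have piM : {in M, forall x, pi x \in M}.
  by move=> x; rewrite !inE => /orP[/eqP ->|/piN ->]; rewrite ?pio ?eqxx ?orbT.
rewrite /chi4 (Tr_iso (P := res) (V4_subsp M k) Vfr (fr3_frame k N) _ (lin_pullr4 M k pi) (lin_pullr N k pi) (@V3_res k)) //.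
- by move=> f; apply: V4_pullr.
- by move=> f [H _]; apply: V3_pullr.
- exact: res_inj.
- move=> g [Hg sg]; exists (restr4 M k (ext g)); first by apply/V4_restr/Adm4_ext.
  have zg u a b c v : oo \in [:: a; b; c] -> g (u ++ (a,b,c) :: v) = 0.
    move=> h; apply: sg; rewrite negb_and all_cat /= inbE; apply/orP; left.
    by move: h; rewrite !inE => /or3P[] /eqP <-; rewrite (negbTE ooN) ?andbF.
  apply/funext => w; rewrite /res /restr4 size_map ext_app //.
  case: ifP => // /negbT nw; rewrite sg //; apply: contra nw => /andP[wN ->]; rewrite andbT all_map.
  apply/allP => -[[a b] c] /(allP wN); rewrite inbE /inb4 /= ooM !inE => /and3P[-> -> ->].
  by rewrite !orbT.
move=> f [H sf]; apply/funext => w; rewrite /res /pullr4 /pullr /restr4 /restr size_map -!map_comp.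
have -> : map (mapl4 pi \o app_oo) w = map (app_oo \o mapl pi) w.
  by apply: eq_map => -[[a b] c]; rewrite /= /mapl4 /mapl /app_oo /= pio.
have [wN|nw] := boolP (all (inb N) w).
  have -> // : all (inb4 M) (map app_oo w).
  rewrite all_map; apply/allP => -[[a b] c] /(allP wN); rewrite inbE /inb4 /= ooM !inE => /and3P[-> -> ->].
  by rewrite !orbT.
rewrite /=; case: ifP => // /andP[wM _].
case/allPn: nw => -[[a b] c] gw gN.
have := allP wM _ (map_f app_oo gw); rewrite /inb4 /= => /and4P[aM bM cM _].
apply: (alt_perm0 (adm4_alt H) (perm_map (app_oo \o mapl pi) (perm_to_rem gw))) => /=.
have z x : x \in M -> x \notin N -> x = oo by rewrite !inE => /orP[/eqP //|->].
move: gN; rewrite inbE !negb_and /app_oo /mapl /= => /or3P[] /(z _ _) -> //; rewrite pio.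
- exact: (rep4_14 H).
- exact: (rep4_24 H).
- exact: (rep4_34 H).
Qed.
End Cone.

Lemma chi4_vanish (T : finType) k (M : {set T}) (pi : T -> T) : {in M, forall x, pi x \in M} ->
  (0 < k)%N -> (0 < #|M| <= 2 * k)%N -> chi4 k M pi = 0.
Proof.
move=> piM k0 /andP[/card_gt0P[oo oM] Mk].
have eM : M = oo |: (M :\ oo) by rewrite setD1K.
have oN : oo \notin M :\ oo by rewrite !inE eqxx.
rewrite /chi4 (TrE (fr := [::]) _ (lin_pullr4 _ _ _)).
- by rewrite /trF big_nil.
- split=> // f Vf; rewrite eM in Vf.
  rewrite (res_inj Vf); first by apply/funext => w; rewrite /lc_fn big_nil.
  have [H sf] := V3_res Vf; apply/funext => w.
  have [/andP[wb /eqP sw]|/sf //] := boolP (all (inb (M :\ oo)) w && (size w == k)).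
  have [N0|N0] := posnP #|M :\ oo|; last first.
    by apply: (vanish H wb) => //; rewrite sw; have := cardsD1 oo M; rewrite oM; clear -Mk; lia.
  exfalso; move/eqP: N0; rewrite cards_eq0 => /eqP N0.
  case: w wb sw => [_ /= e|g w /= /andP[gN _] _]; first by rewrite -e in k0.
  have [x xg] := pset_neq0 g; have := subsetP gN _ xg; by rewrite N0 inE.
by move=> f; apply: V4_pullr.
Qed.

(** * The quotient T(F)/J and its dual *)

Section LambdaTrace.
Variables (n k : nat).
Notation letter := ('I_n * 'I_n * 'I_n * 'I_n)%type.

Definition t2q (t : gen n) : letter := (tnth t 0, tnth t 1, tnth t 2, tnth t 3).
Definition q2t (q : letter) : gen n := om4 q.1.1.1 q.1.1.2 q.1.2 q.2.

Lemma om4E (t : gen n) : t = om4 (tnth t 0) (tnth t 1) (tnth t 2) (tnth t 3).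
Proof.
apply: eq_from_tnth => i; case: i => [[|[|[|[|//]]]] Hi]; rewrite [in RHS](tnth_nth (tnth t 0)) /=;
  congr (tnth t _); exact: val_inj.
Qed.
Lemma t2qK : cancel t2q q2t. Proof. by move=> t; rewrite /q2t /t2q /= -om4E. Qed.
Lemma q2tK : cancel q2t t2q. Proof. by case=> [[[a b] c] d]. Qed.

Lemma om4_tperm (g : gen n -> rat) :
  (forall a b c d, g (om4 a b c d) = - g (om4 b a c d)) ->
  (forall a b c d, g (om4 a b c d) = - g (om4 a c b d)) ->
  (forall a b c d, g (om4 a b c d) = - g (om4 a b d c)) ->
  forall (t : gen n) (i j : 'I_4), i != j -> g [tuple tnth t (tperm i j x) | x < 4] = - g t.
Proof.
move=> s1 s2 s3 t i j; rewrite [X in _ = - g X]om4E [X in g X = _]om4E !tnth_mktuple.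
move: (tnth t) => F.
have S13 a b c d : g (om4 c b a d) = - g (om4 a b c d) by rewrite s1 s2 s1 !opprK.
have S24 a b c d : g (om4 a d c b) = - g (om4 a b c d) by rewrite s2 s3 s2 !opprK.
have S14 a b c d : g (om4 d b c a) = - g (om4 a b c d) by rewrite s1 S24 s1 opprK.
have o0 H : Ordinal (n := 4) (m := 0) H = 0 by exact: val_inj.
have o1 H : Ordinal (n := 4) (m := 1) H = 1 by exact: val_inj.
have o2 H : Ordinal (n := 4) (m := 2) H = 2 by exact: val_inj.
have o3 H : Ordinal (n := 4) (m := 3) H = 3 by exact: val_inj.
case: i => [[|[|[|[|//]]]] Hi]; case: j => [[|[|[|[|//]]]] Hj] //= _;
  rewrite ?o0 ?o1 ?o2 ?o3 !permE /=.
- by rewrite s1.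
- by rewrite S13.
- by rewrite S14.
- by rewrite s1.
- by rewrite s2.
- by rewrite S24.
- by rewrite S13.
- by rewrite s2.
- by rewrite s3.
- by rewrite S14.
- by rewrite S24.
by rewrite s3.
Qed.

Lemma om4_perm (g : gen n -> rat) :
  (forall a b c d, g (om4 a b c d) = - g (om4 b a c d)) ->
  (forall a b c d, g (om4 a b c d) = - g (om4 a c b d)) ->
  (forall a b c d, g (om4 a b c d) = - g (om4 a b d c)) ->
  forall (t : gen n) (s : 'S_4), g [tuple tnth t (s x) | x < 4] = (-1) ^+ odd_perm s * g t.
Proof.
move=> s1 s2 s3 t s; case: (prod_tpermP s) => ts -> dts.
rewrite odd_perm_prod // signr_odd; elim: ts t dts => [|[i j] ts IHt] t /=.
  move=> _; rewrite big_nil expr0 mul1r; congr g; apply: eq_from_tnth => x.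
  by rewrite tnth_mktuple perm1.
case/andP=> ij dts; rewrite big_cons exprS -mulrA -IHt // mulN1r -(om4_tperm s1 s2 s3 _ ij).
congr g; apply: eq_from_tnth => x; by rewrite !tnth_mktuple permM.
Qed.

Definition colv (f : seq letter -> rat) : 'cV[rat]_(Tdim n k) :=
  \col_i f (map t2q (val (enum_val i))).

Lemma vec_colv (r : lc n) f : (forall w, size w != k -> f w = 0) ->
  (vec k r *m colv f) 0 0 = \sum_(x <- r) x.1 * f (map t2q x.2).
Proof.
move=> fk; rewrite mxE.
under eq_bigr => i _ do rewrite !mxE mulr_suml.
rewrite exchange_big /=; apply: eq_bigr => x _.
under eq_bigr => i _ do rewrite -mulrA.
rewrite -mulr_sumr; congr (_ * _).
have [/eqP sk|nk] := boolP (size x.2 == k); last first.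
  rewrite fk ?size_map // big1 // => i _; case: eqP => [e|]; last by rewrite mul0r.
  by rewrite e size_tuple eqxx in nk.
have sk' : size x.2 == k by rewrite sk.
pose t : k.-tuple (gen n) := Tuple sk'.
rewrite (bigD1 (enum_rank t)) //= enum_rankK eqxx mul1r big1 ?addr0 // => i ne.
case: eqP => [e|]; last by rewrite mul0r.
case/eqP: ne; apply: enum_val_inj; rewrite enum_rankK; exact/val_inj/esym.
Qed.

Lemma sub_Jk r : r \in Jgen n k -> (vec k r <= Jk n k)%MS.
Proof.
rewrite /Jk; elim: (Jgen n k) => [//|r' s IHs]; rewrite in_cons big_cons.
case/orP=> [/eqP ->|/IHs h]; first by rewrite (submx_trans _ (addsmxSl _ _)) ?genmxE.
exact: submx_trans h (addsmxSr _ _).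
Qed.

Lemma Jk_kill f : (forall r, r \in Jgen n k -> vec k r *m colv f = 0) -> Jk n k *m colv f = 0.
Proof.
move=> h; apply/sub_kermxP; rewrite /Jk big_seq.
elim/big_ind: _ => [|A B hA hB|r /h /sub_kermxP hr]; first exact: sub0mx.
  by rewrite addsmx_sub hA.
by rewrite genmxE.
Qed.

Lemma JgenP r0 r u v : r \in rels n -> all (fun x => size x.2 == rdeg r) r ->
  (size u + rdeg r + size v)%N = k -> r0 = [seq (x.1, u ++ x.2 ++ v) | x <- r] -> r0 \in Jgen n k.
Proof.
have wE m (w : seq (gen n)) : size w = m -> w \in words n m.
  move=> sw; have sw' : size w == m by rewrite sw.
  by apply/mapP; exists (Tuple sw'); rewrite ?mem_enum.
move=> rr _ sz ->; apply/flatten_mapP; exists r => //.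
apply/flatten_mapP; exists (size u); first by rewrite mem_iota add0n ltnS -sz -addnA leq_addr.
apply/allpairsP; exists (u, v); split=> //=; apply: wE => //.
by rewrite -sz -addnA addKn addKn.
Qed.

Lemma Adm4_rel f u v r : Adm4 [set: 'I_n] f -> r \in rels n ->
  \sum_(x <- r) x.1 * f (map t2q (u ++ x.2 ++ v)) = 0.
Proof.
move=> H; under eq_bigr => x _ do rewrite !map_cat.
move: (map t2q u) (map t2q v) => {}u {}v rr.
suff G F : Adm4 [set: 'I_n] F -> \sum_(x <- r) x.1 * F (map t2q x.2 ++ v) = 0.
  exact: (G _ (Adm4_cat u H)).
move=> {f}H; move: rr; rewrite /rels !mem_cat => /or4P[].
- case/allpairsP=> -[t s] /= [_ _ ->]; rewrite !big_cons big_nil addr0 mul1r mulNr.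
  apply/eqP; rewrite subr_eq0; apply/eqP.
  apply: (@om4_perm (fun t => F (t2q t :: v)) _ _ _ t s) => a b c d; rewrite /t2q !(tnth_nth a) /=.
  + exact: (adm4_sg1 H).
  + exact: (adm4_sg2 H).
  + exact: (adm4_sg3 H).
- case/mapP=> t _ -> /=; rewrite !big_cons big_nil /=; set a := tnth t 0; set b := tnth t 1.
  set c := tnth t 2; set d := tnth t 3; set e := tnth t 4.
  have := five_all H (a := a) (b := b) (c := c) (d := d) (e := e) v.
  by rewrite /= !inE => /(_ isT); rewrite /five /t2q /=; lra.
- case/allpairsP=> -[x y] /= [_ _ ->]; rewrite !big_cons big_nil /=.
  by rewrite (sw4 H); ring.
- case/mapP=> t _ -> /=; rewrite big_seq1 /= mul1r; exact: (quad4_all H).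
Qed.

Lemma Adm4_Jgen f r : Adm4 [set: 'I_n] f -> (forall w, size w != k -> f w = 0) ->
  r \in Jgen n k -> vec k r *m colv f = 0.
Proof.
move=> H fk /flatten_mapP[r0 rr /flatten_mapP[a _ /allpairsP[[u v] /= [_ _ ->]]]].
apply/matrixP => i j; rewrite !ord1 vec_colv // big_map mxE /=; exact: Adm4_rel.
Qed.

Lemma Jgen_rel f u v r : (forall w, size w != k -> f w = 0) ->
  (forall r, r \in Jgen n k -> vec k r *m colv f = 0) ->
  r \in rels n -> all (fun x => size x.2 == rdeg r) r ->
  \sum_(x <- r) x.1 * f (map t2q (u ++ x.2 ++ v)) = 0.
Proof.
move=> fk h rr hr; have [sz|sz] := eqVneq (size u + rdeg r + size v)%N k; last first.
  rewrite big_seq big1 // => x xr; rewrite fk ?mulr0 // size_map !size_cat (eqP (allP hr _ xr)).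
  by rewrite addnA.
have := h _ (JgenP rr hr sz erefl) => /(congr1 (fun A : 'M_1 => A 0 0)).
by rewrite vec_colv // big_map mxE /=.
Qed.

Lemma Jgen_Adm4 f : (forall w, size w != k -> f w = 0) ->
  (forall r, r \in Jgen n k -> vec k r *m colv f = 0) -> Adm4 [set: 'I_n] f.
Proof.
move=> fk h; have R u v r := @Jgen_rel f u v r fk h.
have mq (w : seq letter) : w = map t2q (map q2t w) by rewrite -map_comp map_id_in // => q _ /=; rewrite q2tK.
have Q4 x y z w : t2q (om4 x y z w) = (x,y,z,w) by rewrite -[om4 _ _ _ _]/(q2t (x,y,z,w)) q2tK.
have A i j : i != j -> forall q v, f (t2q [tuple tnth (q2t q) (tperm i j x) | x < 4] :: v) = - f (q :: v).
  move=> ij q v; have := R [::] (map q2t v)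
    [:: (1, [:: [tuple tnth (q2t q) (tperm i j x) | x < 4]]); (- ((-1) ^+ odd_perm (tperm i j)), [:: q2t q])].
  rewrite !big_cons big_nil /= -mq q2tK odd_tperm ij /= => E; rewrite -[LHS]mul1r.
  have := E _ isT; rewrite expr1 opprK !mul1r addr0 => E'; apply/eqP; rewrite -addr_eq0; apply/eqP/E'.
  rewrite /rels !mem_cat; apply/orP; left; apply/allpairsP; exists (q2t q, tperm i j); split; rewrite ?mem_enum //.
  by rewrite /= odd_tperm ij expr1.
have i5 a b c d e : uniq [:: a; b; c; d; e] -> [tuple a; b; c; d; e] \in inj5 n.
  by move=> U; rewrite mem_filter mem_enum andbT.
split.
- move=> u g h' v; have := R (map q2t u) (map q2t v) [:: (1, [:: q2t g; q2t h']); (1, [:: q2t h'; q2t g])].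
  rewrite !big_cons big_nil /= !map_cat /= -!mq !q2tK !mul1r addr0 => E.
  apply/eqP; rewrite -addr_eq0; apply/eqP/E => //.
  rewrite /rels !mem_cat; apply/or4P; apply: Or43; apply/allpairsP; exists (q2t g, q2t h').
  by split; rewrite ?mem_enum.
- by move=> a b c d v; have := A 0 1 isT (b,a,c,d) v; rewrite /t2q !tnth_mktuple !permE /=.
- by move=> a b c d v; have := A 1 2 isT (a,c,b,d) v; rewrite /t2q !tnth_mktuple !permE /=.
- by move=> a b c d v; have := A 2 3 isT (a,b,d,c) v; rewrite /t2q !tnth_mktuple !permE /=.
- move=> a b c d e v _ U; have := R [::] (map q2t v)
    [:: (1, [:: om4 a b c d]); (1, [:: om4 b c d e]); (1, [:: om4 c d e a]);
           (1, [:: om4 d e a b]); (1, [:: om4 e a b c])].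
  rewrite !big_cons big_nil /= !Q4 -!mq !mul1r addr0 !addrA; apply=> //.
  rewrite /rels !mem_cat; apply/or4P; apply: Or42; apply/mapP; exists [tuple a; b; c; d; e] => //.
  exact: i5.
- move=> a b c d e v U; have := R [::] (map q2t v) [:: (1, [:: om4 a b c d; om4 a b c e])].
  rewrite !big_cons big_nil /= !Q4 -!mq !mul1r addr0; apply=> //.
  rewrite /rels !mem_cat; apply/or4P; apply: Or44; apply/mapP; exists [tuple a; b; c; d; e] => //.
  exact: i5.
Qed.

Let J := Jk n k.
Let Cbk := Cb n k.
(** Sends a vector to the coordinates of its class modulo J with respect to the rows of [Cbk]. *)
Let Q := Prj n k *m pinvmx Cbk.

Lemma capJ : ((J^C)%MS :&: J = 0)%MS.
Proof. by rewrite capmxC capmx_compl. Qed.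

Lemma JQ0 : J *m Q = 0.
Proof. by rewrite /Q mulmxA /Prj proj_mx_0 ?mul0mx // capJ. Qed.

(** A functional that kills J is recovered from its values on the rows of [Cbk]. *)
Lemma QCb (psi : 'cV[rat]_(Tdim n k)) : J *m psi = 0 -> Q *m (Cbk *m psi) = psi.
Proof.
move=> J0; rewrite mulmxA; have E : Q *m Cbk = Prj n k.
  rewrite /Q mulmxKpV // /Cbk /Cb eq_row_base -[Prj n k]mul1mx; exact: proj_mx_sub.
have full : ((1%:M : 'M[rat]_(Tdim n k)) <= (J^C)%MS + J)%MS.
  by rewrite sub1mx addsmxC addsmx_compl_full.
rewrite E -[RHS]mul1mx -(add_proj_mx capJ full) mulmxDl !mul1mx.
suff -> : proj_mx J (J^C)%MS *m psi = 0 by rewrite addr0.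
have /submxP[D ->] : (proj_mx J (J^C)%MS <= J)%MS by rewrite -[X in (X <= _)%MS]mul1mx proj_mx_sub.
by rewrite -mulmxA J0 mulmx0.
Qed.

(** The c-th coordinate of the quotient as a functional on words; words of another length get 0. *)
Definition phiQ c (w : seq letter) : rat :=
  if insub (map q2t w) is Some t then Q (enum_rank (t : k.-tuple (gen n))) c else 0.

Lemma phiQ_supp c w : size w != k -> phiQ c w = 0.
Proof. by move=> sw; rewrite /phiQ insubN // size_map. Qed.

Lemma mapq2tK (t : seq (gen n)) : map q2t (map t2q t) = t.
Proof. by rewrite -map_comp map_id_in // => x _ /=; rewrite t2qK. Qed.

Lemma phiQ_val c (t : k.-tuple (gen n)) : phiQ c (map t2q t) = Q (enum_rank t) c.
Proof. by rewrite /phiQ mapq2tK valK. Qed.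

Lemma V4_phiQ c : V4 [set: 'I_n] k (phiQ c).
Proof.
split; last first.
  move=> w; rewrite negb_and => /orP[|]; last exact: phiQ_supp.
  by case/negP; apply/allP => g _; rewrite /inb4 !inE.
apply: Jgen_Adm4; first exact: phiQ_supp.
move=> r rJ; have -> : colv (phiQ c) = col c Q.
  by apply/matrixP => i j; rewrite [LHS]mxE [RHS]mxE phiQ_val enum_valK.
rewrite colE mulmxA; suff -> : vec k r *m Q = 0 by rewrite mul0mx.
by have /submxP[D ->] := sub_Jk rJ; rewrite -mulmxA JQ0 mulmx0.
Qed.

(** Pulling functionals back along p is the transpose of the action of p on the quotient and has the
    same trace. The frame expands a functional through its values on the basis rows, each written as
    a combination of all words. *)
Lemma trLambdaE (p : 'S_n) : trLambda k p = chi4 k [set: 'I_n] p.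
Proof.
pose fr := [seq (map t2q (val (enum_val i)), fun w => Cbk c i * phiQ c w)
  | c <- enum 'I_(\rank (J^C)%MS), i <- enum 'I_(Tdim n k)].
have inT (w : seq letter) : all (inb4 [set: 'I_n]) w.
  by apply/allP => g _; rewrite /inb4 !inE.
have Vfr : frame (V4 [set: 'I_n] k) fr.
  split=> [q /allpairsP[[c i] /= [_ _ ->]] /=|f [H sf]].
    have [V0 VD] := V4_subsp [set: 'I_n] k.
    have -> : (fun w => Cbk c i * phiQ c w) = fun w => Cbk c i * phiQ c w + 0.
      by apply/funext => w; rewrite addr0.
    exact: VD (V4_phiQ c) V0.
  have fk w : size w != k -> f w = 0 by move=> sw; apply: sf; rewrite (negbTE sw) andbF.
  apply/funext => w; rewrite /lc_fn big_allpairs_dep /= big_enum /=.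
  under eq_bigr => c _ do rewrite big_enum /=.
  have [/eqP sw|sw] := boolP (size w == k); last first.
    by rewrite fk // big1 // => c _; rewrite big1 // => i _; rewrite phiQ_supp // !mulr0.
  have sw' : size (map q2t w) == k by rewrite size_map sw.
  pose t : k.-tuple (gen n) := Tuple sw'.
  have ew : w = map t2q t by rewrite /= -map_comp map_id_in // => x _ /=; rewrite q2tK.
  have J0 : J *m colv f = 0 by apply: Jk_kill => r; apply: Adm4_Jgen.
  have := congr1 (fun A : 'cV_(Tdim n k) => A (enum_rank t) 0) (QCb J0).
  rewrite mxE [in X in _ = X -> _]mxE enum_rankK -ew => <-.
  apply: eq_bigr => c _; rewrite [X in _ * X]mxE mulr_sumr; apply: eq_bigr => i _.
  by rewrite [colv f i 0]mxE ew phiQ_val; ring.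
rewrite /chi4 (TrE Vfr (lin_pullr4 _ _ _)); last first.
  by move=> f; apply: V4_pullr => x _; rewrite inE.
rewrite /trF big_allpairs_dep /= big_enum /= /trLambda -mulmxA -/Q /mxtrace.
apply: eq_bigr => c _; rewrite big_enum /= [LHS]mxE.
transitivity (\sum_j \sum_i Cbk c i * Pmx k p i j * Q j c).
  by apply: eq_bigr => j _; rewrite [X in X * _]mxE mulr_suml.
rewrite exchange_big /=; apply: eq_bigr => i _.
rewrite /pullr4 restr4_in ?size_map ?size_tuple //.
have -> : map (mapl4 p) (map t2q (val (enum_val i))) = map t2q (act p (enum_val i)).
  rewrite /= -!map_comp; apply: eq_map => t; rewrite /= /mapl4 /t2q /=.
  by rewrite !tnth_map.
rewrite phiQ_val (bigD1 (enum_rank (act p (enum_val i)))) //= [Pmx k p _ _]mxE enum_rankK eqxx mulr1 big1 ?addr0 //.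
move=> j ne; rewrite [Pmx k p _ _]mxE; case: eqP => [e|]; last by rewrite mulr0 mul0r.
by case/eqP: ne; rewrite e enum_valK.
Qed.
End LambdaTrace.

(** * Cycles of permutations *)

Section Cycles.
Variable T : finType.
Implicit Types (pi : {perm T}) (x y : T) (xs : seq T).

Lemma orb_gt0 pi x : (0 < #|porbit pi x|)%N.
Proof. by apply/card_gt0P; exists x; apply: porbit_id. Qed.

Lemma iter_in_orb pi x t : iter t pi x \in porbit pi x.
Proof. by rewrite -permX mem_porbit. Qed.

Lemma iter_mod pi x t : iter t pi x = iter (t %% #|porbit pi x|) pi x.
Proof.
rewrite {1}(divn_eq t #|porbit pi x|) addnC iterD; congr iter.
by elim: (t %/ _)%N => [//|q IHq]; rewrite mulSn iterD IHq iter_porbit.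
Qed.

Lemma nth_orb pi x t : (t < #|porbit pi x|)%N ->
  nth x (traject pi x #|porbit pi x|) t = iter t pi x.
Proof. by move=> h; rewrite nth_traject. Qed.

Lemma iter_orb_inj pi x t1 t2 : (t1 < #|porbit pi x|)%N -> (t2 < #|porbit pi x|)%N ->
  iter t1 pi x = iter t2 pi x -> t1 = t2.
Proof.
move=> h1 h2; rewrite -!nth_orb // => /eqP.
by rewrite nth_uniq ?size_traject ?uniq_traject_porbit // => /eqP.
Qed.

Lemma iter_eq_mod pi x t1 t2 : (iter t1 pi x == iter t2 pi x) = (t1 == t2 %[mod #|porbit pi x|]).
Proof.
rewrite (iter_mod pi x t1) (iter_mod pi x t2); apply/eqP/eqP => [|-> //].
by apply: iter_orb_inj; rewrite ltn_mod orb_gt0.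
Qed.

Lemma orbP pi x y : y \in porbit pi x -> exists2 t, (t < #|porbit pi x|)%N & y = iter t pi x.
Proof. by rewrite porbit_traject => /trajectP. Qed.

Definition oidx pi x y := index y (traject pi x #|porbit pi x|).

Lemma oidx_iter pi x t : oidx pi x (iter t pi x) = (t %% #|porbit pi x|)%N.
Proof.
have h : (t %% #|porbit pi x| < #|porbit pi x|)%N by rewrite ltn_mod orb_gt0.
by rewrite /oidx iter_mod -(nth_orb h) index_uniq ?size_traject ?uniq_traject_porbit.
Qed.

(** A list with one point from each of several distinct cycles, the way a permutation is tied to a
    list of cycle lengths. *)
Definition csys pi xs := uniq (map (porbit pi) xs).
Definition lens pi xs := [seq #|porbit pi x| | x <- xs].
Definition cU pi xs : {set T} := \bigcup_(x <- xs) porbit pi x.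

Lemma cU_cons pi x xs : cU pi (x :: xs) = porbit pi x :|: cU pi xs.
Proof. by rewrite /cU big_cons. Qed.
Lemma cU_nil pi : cU pi [::] = set0. Proof. by rewrite /cU big_nil. Qed.
Lemma mem_cU pi xs y : (y \in cU pi xs) = has (fun x => y \in porbit pi x) xs.
Proof. by elim: xs => [|x xs IHx]; rewrite ?cU_nil ?cU_cons ?inE //= IHx. Qed.
Lemma cU_perm pi xs ys : perm_eq xs ys -> cU pi xs = cU pi ys.
Proof. by move=> p; apply: perm_big. Qed.
Lemma cU_stable pi xs y : (pi y \in cU pi xs) = (y \in cU pi xs).
Proof.
rewrite !mem_cU; apply: eq_has => x; rewrite /=.
by rewrite -!eq_porbit_mem -[pi y]/(iter 1 pi y) -permX porbit_perm.
Qed.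
Lemma lens_pos pi xs : 0%N \notin lens pi xs.
Proof. by apply/mapP => -[x _ e]; have := orb_gt0 pi x; rewrite -e. Qed.

Lemma csys_cons pi x xs : csys pi (x :: xs) = [disjoint porbit pi x & cU pi xs] && csys pi xs.
Proof.
rewrite /csys /=; congr (_ && _); apply/idP/idP => [nx|d]; last first.
  apply/mapP => -[y yx e]; have := disjointFr d (porbit_id pi x).
  by rewrite mem_cU => /hasPn/(_ y yx); rewrite -e porbit_id.
rewrite -setI_eq0; apply/eqP/setP => z; rewrite !inE; apply/negP => /andP[zx].
rewrite mem_cU => /hasP[y yx zy]; case/mapP: nx; exists y => //.
by move: zx zy; rewrite -!eq_porbit_mem => /eqP <- /eqP <-.
Qed.

Lemma card_cU pi xs : csys pi xs -> #|cU pi xs| = sumn (lens pi xs).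
Proof.
elim: xs => [|x xs IHx]; first by rewrite cU_nil cards0.
by rewrite csys_cons cU_cons => /andP[d /IHx] /= <-; rewrite cardsU disjoint_setI0 // cards0 subn0.
Qed.

End Cycles.

(** Points correspond by their position along the cycle. This makes characters functions of the
    cycle lengths alone. *)
Lemma sys_map (T T' : finType) (pi : {perm T}) (pi' : {perm T'}) xs xs' (t0 : T') :
  csys pi xs -> csys pi' xs' -> lens pi xs = lens pi' xs' ->
  exists h : T -> T', [/\ {in cU pi xs &, injective h},
    {in cU pi xs, forall y, h (pi y) = pi' (h y)}, h @: cU pi xs = cU pi' xs' & map h xs = xs'].
Proof.
elim: xs xs' => [|x xs IHx] [|x' xs'] //.
  by move=> _ _ _; exists (fun=> t0); rewrite !cU_nil imset0; split=> [y z|y||]; rewrite ?inE.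
rewrite !csys_cons => /andP[d c] /andP[d' c'] [ex /(IHx _ c c')[h [h1 h2 h3 h4]]].
pose g y := if y \in porbit pi x then iter (oidx pi x y) pi' x' else h y.
have gx t : g (iter t pi x) = iter t pi' x'.
  by rewrite /g iter_in_orb oidx_iter ex -iter_mod.
have gU y : y \in cU pi xs -> g y = h y by move=> yU; rewrite /g (disjointFl d yU).
have hU y : y \in cU pi xs -> h y \in cU pi' xs' by move=> yU; rewrite -h3 imset_f.
exists g; split.
- move=> y z; rewrite cU_cons !inE => /orP[/orbP[t lt ->]|yU] /orP[/orbP[t' lt' ->]|zU].
  + rewrite !gx => e; congr iter; rewrite ex in lt lt'; exact: iter_orb_inj lt lt' e.
  + rewrite gx gU // => e; have := disjointFl d' (hU z zU); by rewrite -e iter_in_orb.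
  + rewrite gx gU // => e; have := disjointFl d' (hU y yU); by rewrite e iter_in_orb.
  + by rewrite !gU //; apply: h1.
- move=> y; rewrite cU_cons inE => /orP[/orbP[t lt ->]|yU].
    by rewrite -[pi _]/(iter t.+1 pi x) !gx.
  by rewrite !gU ?cU_stable //; apply: h2.
- rewrite !cU_cons imsetU; congr (_ :|: _); last by rewrite -h3; apply: eq_in_imset.
  apply/setP => z; apply/imsetP/idP => [[y /orbP[t lt ->] ->]|/orbP[t lt ->]]; rewrite ?gx ?iter_in_orb //.
  by exists (iter t pi x); rewrite ?gx ?iter_in_orb.
rewrite /= -[x in g x]/(iter 0 pi x) gx /= -h4; congr (_ :: _).
apply/eq_in_map => y yx; apply: gU; rewrite mem_cU; apply/hasP; exists y => //; exact: porbit_id.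
Qed.

(** * Sets of exact period i under a permutation *)

Section Blocks.
Variables (T : finType) (pi : {perm T}).
Implicit Types (x y : T) (xs : seq T) (b O : {set T}).

Lemma iterX i n x : iter n (pi ^+ i)%g x = iter (n * i) pi x.
Proof.
elim: n => [//|n IHn]; rewrite iterS IHn permX mulSn iterD.
by [].
Qed.

Section OneCycle.
Variables (i : nat) (x : T).
Hypothesis i0 : (0 < i)%N.
Let c := #|porbit pi x|.

(** If i divides the length of the cycle of x, these are its points at positions congruent to r
    modulo i ([mem_Rc]). *)
Definition Rc r := porbit (pi ^+ i)%g (iter r pi x).

Lemma mem_Rc r t : (i %| c)%N -> (iter t pi x \in Rc r) = (t == r %[mod i]).
Proof.
move=> ic; apply/idP/idP.
  case/orbP=> q _ /eqP; rewrite iterX -iterD iter_eq_mod -/c => /eqP e.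
  by rewrite -(modn_dvdm t ic) e modn_dvdm // modnMDl.
move=> /eqP e; have c0 : (0 < c)%N by apply: orb_gt0.
have le : (r <= t + c * r)%N by rewrite (leq_trans _ (leq_addl _ _)) // leq_pmull.
have dv : (i %| t + c * r - r)%N.
  rewrite -eqn_mod_dvd // -modnDmr.
  by have /eqP -> : (i %| c * r)%N by [rewrite dvdn_mulr]; rewrite addn0 e.
have -> : iter t pi x = iter (t + c * r) pi x.
  by apply/eqP; rewrite iter_eq_mod -/c addnC mulnC modnMDl.
by rewrite -(subnK le) iterD -(divnK dv) -iterX; apply: iter_in_orb.
Qed.

Lemma card_Rc r : (i %| c)%N -> #|Rc r| = (c %/ i)%N.
Proof.
move=> ic; have H n : (#|Rc r| %| n)%N = (c %/ i %| n)%N.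
  have := iter_eq_mod (pi ^+ i)%g (iter r pi x) n 0; rewrite iterX -/(Rc r) mod0n.
  move=> e; transitivity (n %% #|Rc r| == 0)%N; first by [].
  rewrite -e -[X in _ == X]/(iter 0 pi (iter r pi x)) iter_eq_mod mod0n.
  have -> : porbit pi (iter r pi x) = porbit pi x by rewrite -permX porbit_perm.
  by rewrite -/c -/(dvdn c (n * i)) -{1}(divnK ic) dvdn_pmul2r.
by apply/eqP; rewrite eqn_dvd -H dvdnn H dvdnn.
Qed.

Lemma Rc_sub r : Rc r \subset porbit pi x.
Proof.
apply/subsetP => y /orbP[t _ ->]; rewrite iterX -iterD; exact: iter_in_orb.
Qed.

Lemma percyc_Rc r : (i %| c)%N -> percyc pi i (Rc r).
Proof.
move=> ic; rewrite /percyc i0 /=; apply/andP; split.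
  rewrite eqEcard (card_imset _ (@iter_inj _ pi i)) leqnn andbT.
  apply/subsetP => _ /imsetP[y yR ->]; have /orbP[t _ ey] := subsetP (Rc_sub r) _ yR.
  by move: yR; rewrite ey -iterD !mem_Rc // modnDl.
apply/forallP => j; apply/implyP => j0; rewrite -setI_eq0; apply/eqP/setP => z; rewrite !inE.
apply/negP => /andP[/imsetP[y yR ->]]; have /orbP[t _ ey] := subsetP (Rc_sub r) _ yR.
move: yR; rewrite ey -iterD !mem_Rc // => /eqP <-; rewrite -{2}[t]add0n eqn_modDr mod0n modn_small //.
by apply/negP; rewrite -lt0n j0.
Qed.

(** If i did not divide the length c, a shift by c mod i would bring a point of b back into b too
    early; so would two different residues modulo i inside b. *)
Lemma percyc_one b : b \subset porbit pi x -> percyc pi i b -> b != set0 ->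
  (i %| c)%N /\ exists2 r, (r < i)%N & b = Rc r.
Proof.
move=> bO /and3P[_ /eqP ib /forallP dj] /set0Pn[y yb].
have ibk q z : z \in b -> iter (q * i) pi z \in b.
  move=> zb; elim: q => [//|q IHq]; rewrite mulSn iterD -ib; exact: imset_f.
have nj j z : (0 < j < i)%N -> z \in b -> iter j pi z \in b -> False.
  move=> /andP[j0 ji] zb jb; have := dj (Ordinal ji); rewrite /= j0 /= => d.
  by have := disjointFl d jb; rewrite imset_f.
have perq z : z \in b -> iter c pi z = z.
  move=> zb; have := subsetP bO _ zb; rewrite -eq_porbit_mem => /eqP e; by rewrite /c -e iter_porbit.
have ic : (i %| c)%N.
  rewrite /dvdn; apply/negPn/negP; rewrite -lt0n => r0.
  apply: (@nj (c %% i)%N (iter (c %/ i * i) pi y)); rewrite ?r0 ?ltn_mod ?ibk // -iterD addnC -divn_eq perq //.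
split=> //; have [t _ ey] := orbP (subsetP bO _ yb).
exists (t %% i)%N; first by rewrite ltn_mod.
(* moving by a multiple of i reaches the class representative of an element *)
have toR s : iter s pi x \in b -> iter (s %% i) pi x \in b.
  move=> sb; have h : (0 < c)%N := orb_gt0 pi x.
  have -> : iter (s %% i) pi x = iter ((c - 1) * (s %/ i) * i) pi (iter s pi x).
    rewrite -iterD; apply/eqP; rewrite iter_eq_mod -/c.
    have e q rr : (0 < c)%N -> ((c - 1) * q * i + (q * i + rr) = q * i * c + rr)%N by clear; nia.
    by rewrite [X in (_ + X)%N](divn_eq s i) e // modnMDl.
  exact: ibk.
apply/setP => z; apply/idP/idP => [zb|zR].
  have [t' _ ez] := orbP (subsetP bO _ zb); rewrite ez mem_Rc // modn_mod; apply/negPn/negP => ne.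
  have h1 : iter (t %% i) pi x \in b by apply: toR; rewrite -ey.
  have h2 : iter (t' %% i) pi x \in b by apply: toR; rewrite -ez.
  have l1 : (t %% i < i)%N by rewrite ltn_mod.
  have l2 : (t' %% i < i)%N by rewrite ltn_mod.
  have [lt|gt|//] := ltngtP (t %% i) (t' %% i); last by move=> e; rewrite e eqxx in ne.
    apply: (nj (t' %% i - t %% i)%N _ _ h1); first by rewrite subn_gt0 lt (leq_ltn_trans (leq_subr _ _)).
    by rewrite -iterD subnK // ltnW.
  apply: (nj (t %% i - t' %% i)%N _ _ h2); first by rewrite subn_gt0 gt (leq_ltn_trans (leq_subr _ _)).
  by rewrite -iterD subnK // ltnW.
have [t' _ ez] := orbP (subsetP (Rc_sub _) _ zR); move: zR; rewrite ez mem_Rc // modn_mod => /eqP e.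
(* z and y differ by a multiple of i *)
have le : (t <= t' + c * t)%N by rewrite (leq_trans _ (leq_addl _ _)) // leq_pmull // orb_gt0.
have dv : (i %| t' + c * t - t)%N.
  rewrite -eqn_mod_dvd // -modnDmr.
  by have /eqP -> : (i %| c * t)%N by [rewrite dvdn_mulr]; rewrite addn0 e.
have -> : iter t' pi x = iter (t' + c * t) pi x.
  by apply/eqP; rewrite iter_eq_mod -/c addnC mulnC modnMDl.
by rewrite -(subnK le) iterD -(divnK dv) -ey ibk.
Qed.

Lemma sum_one (R : nmodType) (F : {set T} -> R) :
  \sum_(b : {set T} | (b \subset porbit pi x) && percyc pi i b) F b =
  F set0 + (if (i %| c)%N then \sum_(r <- iota 0 i) F (Rc r) else 0).
Proof.
pose L : seq {set T} := set0 :: (if (i %| c)%N then map Rc (iota 0 i) else [::]).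
transitivity (\sum_(b <- L) F b); last first.
  by rewrite big_cons; case: ifP => _; rewrite ?big_map ?big_nil.
have Rne r : Rc r != set0 by apply/set0Pn; exists (iter r pi x); apply: porbit_id.
have uL : uniq L.
  rewrite /L /=; case: ifP => // ic; apply/andP; split.
    by apply/mapP => -[r _ e]; have := Rne r; rewrite -e eqxx.
  rewrite map_inj_in_uniq ?iota_uniq // => r s; rewrite !mem_iota /= => ri si e.
  have : iter r pi x \in Rc s by rewrite -e porbit_id.
  by rewrite mem_Rc // !modn_small // => /eqP.
rewrite big_uniq //; apply: eq_bigl => b; rewrite /L in_cons.
have [->|nb] := eqVneq b set0.
  rewrite sub0set /percyc i0 /img imset0 eqxx /=; apply/forallP => j; apply/implyP => _.
  by rewrite /img imset0 -setI_eq0 set0I.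
apply/andP/idP => /=.
  case=> bO pb; have [ic [r ri ->]] := percyc_one bO pb nb; rewrite ic.
  by apply: map_f; rewrite mem_iota.
by case: ifP => // ic /mapP[r _ ->]; rewrite Rc_sub percyc_Rc.
Qed.
End OneCycle.

Lemma img_capl j b O : (forall y, (pi y \in O) = (y \in O)) -> img pi j (b :&: O) = img pi j b :&: O.
Proof.
move=> st; have sti q z : (iter q pi z \in O) = (z \in O) by elim: q => [//|q IHq] /=; rewrite st.
apply/setP => z; rewrite inE; apply/imsetP/andP => [[y]|[/imsetP[y yb ->]]].
  by rewrite inE => /andP[yb yO] ->; rewrite sti yO imset_f.
by rewrite sti => yO; exists y; rewrite // inE yb.
Qed.

Lemma imgU j b b' : img pi j (b :|: b') = img pi j b :|: img pi j b'.
Proof. exact: imsetU. Qed.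

Lemma percycU i b b' O O' : (forall y, (pi y \in O) = (y \in O)) -> (forall y, (pi y \in O') = (y \in O')) ->
  [disjoint O & O'] -> b \subset O -> b' \subset O' ->
  percyc pi i (b :|: b') = percyc pi i b && percyc pi i b'.
Proof.
move=> st st' d bO bO'.
have e1 : (b :|: b') :&: O = b.
  rewrite setIUl (setIidPl bO) (_ : b' :&: O = set0) ?setU0 //; apply/eqP.
  by rewrite setI_eq0 disjoint_sym (disjointWr bO').
have e2 : (b :|: b') :&: O' = b'.
  rewrite setIUl (setIidPl bO') (_ : b :&: O' = set0) ?set0U //; apply/eqP.
  by rewrite setI_eq0 (disjointWl bO).
apply/idP/andP => [/and3P[i0 /eqP e /forallP dj]|[/and3P[i0 /eqP e /forallP dj] /and3P[_ /eqP e' /forallP dj']]].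
  split; apply/and3P; split=> //.
  - by rewrite -{1}e1 img_capl // e e1.
  - apply/forallP => j; apply/implyP => j0; have := dj j; rewrite j0 /=; apply: disjointW.
      by apply: imsetS; apply: subsetUl.
    exact: subsetUl.
  - by rewrite -{1}e2 img_capl // e e2.
  apply/forallP => j; apply/implyP => j0; have := dj j; rewrite j0 /=; apply: disjointW.
    by apply: imsetS; apply: subsetUr.
  exact: subsetUr.
apply/and3P; split=> //; first by rewrite imgU e e'.
apply/forallP => j; apply/implyP => j0; rewrite imgU.
have iO : img pi j b \subset O by rewrite -(setIidPl bO) img_capl // subsetIr.
have iO' : img pi j b' \subset O' by rewrite -(setIidPl bO') img_capl // subsetIr.
have := dj j; have := dj' j; rewrite j0 /= -!setI_eq0 => /eqP d1 /eqP d2.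
rewrite setIUl !setIUr d1 d2 setU0 set0U setU_eq0 !setI_eq0.
by rewrite (disjointW iO bO' d) disjoint_sym (disjointW bO iO' d).
Qed.

Lemma porbit_stable x y : (pi y \in porbit pi x) = (y \in porbit pi x).
Proof. by have := cU_stable pi [:: x] y; rewrite /cU !big_seq1. Qed.

(** The choices that make up a set of exact period i: each cycle is left out or contributes one of
    its i residue classes. The first list represents the set by cycles of pi^i, the second one the
    cycles left out. *)
Fixpoint dec i xs : seq (seq T * seq T) :=
  if xs is x :: xs' then
    [seq (d.1, x :: d.2) | d <- dec i xs'] ++
    (if (i %| #|porbit pi x|)%N then [seq (iter r pi x :: d.1, d.2) | r <- iota 0 i, d <- dec i xs'] else [::])
  else [:: ([::], [::])].

Lemma dec_sum (R : nmodType) i xs (F : {set T} -> R) : (0 < i)%N -> csys pi xs ->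
  \sum_(b : {set T} | (b \subset cU pi xs) && percyc pi i b) F b =
  \sum_(d <- dec i xs) F (cU (pi ^+ i)%g d.1).
Proof.
move=> i0; elim: xs F => [|x xs IHx] F.
  move=> _; rewrite /= big_seq1 !cU_nil (bigD1 set0) /= ?big1 ?addr0 //.
    by move=> b /andP[/andP[]]; rewrite subset0 => /eqP -> _ /eqP.
  rewrite sub0set /percyc i0 /img imset0 eqxx /=; apply/forallP => j; apply/implyP => _.
  by rewrite /img imset0 -setI_eq0 set0I.
rewrite csys_cons => /andP[d c]; set O := porbit pi x in d; set U := cU pi xs in d.
have stO : forall y, (pi y \in O) = (y \in O) by apply: porbit_stable.
have stU : forall y, (pi y \in U) = (y \in U) by apply: cU_stable.
transitivity (\sum_(b : {set T} | (b \subset O) && percyc pi i b)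
   \sum_(b' : {set T} | (b' \subset U) && percyc pi i b') F (b :|: b')).
  rewrite pair_big_dep /= (reindex_onto (fun p : {set T} * {set T} => p.1 :|: p.2) (fun b => (b :&: O, b :&: U))) /=.
    apply: eq_bigl => -[b b'] /=; rewrite cU_cons.
    apply/idP/idP.
      case/andP=> /andP[sb pb] /eqP[e1 e2].
      have bO : b \subset O by rewrite -e1 subsetIr.
      have bU : b' \subset U by rewrite -e2 subsetIr.
      by move: pb; rewrite (percycU _ stO stU d bO bU) bO bU => /andP[-> ->].
    case/andP=> /andP[bO pb] /andP[bU pb'].
    rewrite setUSS //= (percycU _ stO stU d bO bU) pb pb' /= xpair_eqE.
    rewrite !setIUl (setIidPl bO) (setIidPl bU).
    have -> : b' :&: O = set0 by apply/eqP; rewrite setI_eq0 disjoint_sym (disjointWr bU).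
    have -> : b :&: U = set0 by apply/eqP; rewrite setI_eq0 (disjointWl bO).
    by rewrite setU0 set0U !eqxx.
  move=> b /andP[+ _]; rewrite cU_cons -/O -/U -setIUr => s; exact/setIidPl.
under eq_bigr => b _ do rewrite IHx //.
rewrite sum_one // big_cat big_map /=; congr (_ + _).
  by apply: eq_bigr => dd _; rewrite set0U.
case: ifP => _; last by rewrite big_nil.
rewrite big_allpairs_dep; apply: eq_bigr => r _; apply: eq_bigr => dd _.
by rewrite cU_cons.
Qed.

Lemma orbU i b b' : orb pi i (b :|: b') = orb pi i b :|: orb pi i b'.
Proof. by rewrite /orb -big_split; apply: eq_bigr => j _; apply: imgU. Qed.

Lemma orb_Rc i r x : (0 < i)%N -> (i %| #|porbit pi x|)%N -> orb pi i (Rc i x r) = porbit pi x.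
Proof.
move=> i0 ic; have /and3P[_ /eqP e _] := percyc_Rc i0 r ic.
apply/eqP; rewrite eqEsubset; apply/andP; split.
  apply/bigcupsP => j _; apply/subsetP => _ /imsetP[y /(subsetP (Rc_sub _ _ _)) yO ->].
  by elim: (nat_of_ord j) => [//|q IHq] /=; rewrite porbit_stable.
have st := orb_stable i0 e; have z0 : iter r pi x \in orb pi i (Rc i x r).
  by case: (i) i0 => [//|i'] _; apply: (subsetP (sub_orb _ _ _)); apply: porbit_id.
have -> : porbit pi x = porbit pi (iter r pi x) by rewrite -permX porbit_perm.
apply/subsetP => y /orbP[t _ ->]; elim: t => [//|t IHt]; rewrite iterS -st; exact: imset_f.
Qed.

Lemma dec_sys i xs d : (0 < i)%N -> csys pi xs -> d \in dec i xs ->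
  [/\ csys (pi ^+ i)%g d.1, csys pi d.2, subseq d.2 xs, cU (pi ^+ i)%g d.1 \subset cU pi xs &
      cU pi d.2 = cU pi xs :\: orb pi i (cU (pi ^+ i)%g d.1)].
Proof.
move=> i0; elim: xs d => [|x xs IHx] d.
  move=> _; rewrite inE => /eqP -> /=; split=> //; rewrite !cU_nil ?sub0set // set0D //.
rewrite csys_cons => /andP[dj c]; rewrite mem_cat => /orP[/mapP[d' /(IHx _ c)[c1 c2 ss s1 e] ->]|] /=.
  have ou : orb pi i (cU (pi ^+ i)%g d'.1) \subset cU pi xs.
    apply/bigcupsP => j _; apply/subsetP => _ /imsetP[y /(subsetP s1) yO ->].
    by elim: (nat_of_ord j) => [//|q IHq] /=; rewrite cU_stable.
  have e2 : cU pi (x :: d'.2) = cU pi (x :: xs) :\: orb pi i (cU (pi ^+ i)%g d'.1).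
    rewrite !cU_cons e setDUl; congr (_ :|: _); apply/esym/setDidPl; exact: disjointWr dj.
  split=> //; last by rewrite cU_cons; apply: subset_trans s1 (subsetUr _ _).
    by rewrite csys_cons c2 andbT e; apply: disjointWr dj; apply: subsetDl.
  by rewrite eqxx.
case: ifP => // ic /allpairsP[[r d'] /= [_ /(IHx _ c)[c1 c2 ss s1 e] ->]] /=.
have R1 : Rc i x r \subset porbit pi x := Rc_sub _ _ _.
split=> //.
- by rewrite csys_cons c1 andbT; apply: disjointW R1 s1 dj.
- exact: subseq_trans ss (subseq_cons _ _).
- by rewrite !cU_cons setUSS.
rewrite !cU_cons orbU orb_Rc // e setDUl.
rewrite (_ : porbit pi x :\: _ = set0) ?set0U; last by apply/eqP; rewrite setD_eq0 subsetUl.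
rewrite setDUr; apply/esym/setIidPr; apply: subset_trans (subsetDl _ _) _.
by rewrite subsetD subxx disjoint_sym.
Qed.

(** Each cycle used offers i residue classes and has its length divided by i, which are precisely
    the factor and the division in [hpsi]. *)
Lemma dec_mk i xs (G : seq nat -> seq nat -> {poly rat}) : (0 < i)%N ->
  \sum_(d <- dec i xs) G (lens (pi ^+ i)%g d.1) (lens pi d.2) =
  \sum_(m <- mk (lens pi xs)) (if all (dvdn i) m.1 then
     (i ^ size m.1)%:R * G [seq (a %/ i)%N | a <- m.1] m.2 else 0).
Proof.
move=> i0; elim: xs G => [|x xs IHx] G; first by rewrite !big_seq1 /= mul1r.
rewrite /= mk_cons !big_cat !big_map /= addrC; congr (_ + _); last first.
  by rewrite (IHx (fun l1 l2 => G l1 (#|porbit pi x| :: l2))) /mk big_map.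
case: ifP => ic; last by rewrite big_nil big1.
rewrite big_allpairs_dep /=.
transitivity (\sum_(r <- iota 0 i) \sum_(d <- dec i xs)
   G ((#|porbit pi x| %/ i)%N :: lens (pi ^+ i)%g d.1) (lens pi d.2)).
  by apply: eq_bigr => r _; apply: eq_bigr => d _; rewrite -[porbit (pi ^+ i)%g _]/(Rc i x r) card_Rc.
rewrite (IHx (fun l1 l2 => G ((#|porbit pi x| %/ i)%N :: l1) l2)) /mk big_map.
rewrite big_const_seq count_predT size_iota iter_addr_0 -sumrMnl; apply: eq_bigr => m _.
by rewrite /=; case: ifP => _; rewrite ?mul0rn // expnS natrM -[in RHS]mulrA [in RHS](mulr_natl _ i).
Qed.
End Blocks.

(** * Permutations of a given cycle type and their number *)

Section Model.
Local Open Scope nat_scope.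

(* The permutation of [0, sumn l) that rotates consecutive blocks of sizes l. *)
Fixpoint blk (l : seq nat) (x : nat) : nat :=
  if l is a :: l' then
    if x < a then (if x.+1 == a then 0 else x.+1) else a + blk l' (x - a)
  else x.
Fixpoint offs (l : seq nat) : seq nat :=
  if l is a :: l' then 0 :: map (addn a) (offs l') else [::].

Lemma blk_lt l x : x < sumn l -> blk l x < sumn l.
Proof.
elim: l x => [//|a l IHl] x /= lt; case: ifP => xa.
  by case: eqP => e; lia.
by rewrite ltn_add2l IHl //; lia.
Qed.

Lemma blk_inj l x y : x < sumn l -> y < sumn l -> blk l x = blk l y -> x = y.
Proof.
elim: l x y => [//|a l IHl] x y /= lx ly.
have [xa|xa] := ltnP x a; have [ya|ya] := ltnP y a.
- by case: (eqVneq x.+1 a) => ?; case: (eqVneq y.+1 a) => ? ?; lia.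
- by case: (eqVneq x.+1 a) => ? ?; lia.
- by case: (eqVneq y.+1 a) => ? ?; lia.
move=> /addnI /IHl e; have := e; lia.
Qed.

Lemma iter_blk_tl a l t y : iter t (blk (a :: l)) (a + y) = a + iter t (blk l) y.
Proof. by elim: t => [//|t IHt]; rewrite !iterS IHt /= ltnNge leq_addr /= addKn. Qed.

Lemma size_offs l : size (offs l) = size l.
Proof. by elim: l => //= a l <-; rewrite size_map. Qed.

Lemma iter_blk l t j : 0 \notin l -> j < size l ->
  iter t (blk l) (nth 0 (offs l) j) = nth 0 (offs l) j + t %% nth 0 l j.
Proof.
elim: l j => [//|a l IHl] [|j]; rewrite in_cons negb_or => /andP[a0 l0] jl.
  change (iter t (blk (a :: l)) 0 = 0 + t %% a); elim: t {IHl} => [|t IHt]; first by rewrite mod0n.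
  rewrite iterS IHt add0n /=; have ma : t %% a < a by rewrite ltn_mod; lia.
  rewrite ma -[t.+1]addn1 -modnDml addn1; case: (eqVneq (t %% a).+1 a) => e; first by rewrite e modnn.
  by rewrite (@modn_small (t %% a).+1 a) // ltn_neqAle e.
rewrite [nth 0 (offs (a :: l)) j.+1]/= (nth_map 0) ?size_offs //.
by rewrite iter_blk_tl IHl // addnA.
Qed.

Lemma offs_lt l j : 0 \notin l -> j < size l -> nth 0 (offs l) j < sumn l.
Proof.
elim: l j => [//|a l IHl] [|j]; rewrite in_cons negb_or => /andP[a0 l0] /= jl; first by lia.
by rewrite (nth_map 0) ?size_offs // ltn_add2l IHl.
Qed.

Lemma offs_mono l j k : 0 \notin l -> j < k -> k < size l -> nth 0 (offs l) j < nth 0 (offs l) k.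
Proof.
elim: l j k => [//|a l IHl] [|j] [|k] //; rewrite in_cons negb_or => /andP[a0 l0] /= jk kl.
  by rewrite (nth_map 0) ?size_offs //; lia.
have jl : j < size l by apply: (ltn_trans jk kl).
by rewrite !(nth_map 0) ?size_offs // ltn_add2l IHl.
Qed.
End Model.

Lemma model_exists l : 0%N \notin l -> exists p : 'S_(sumn l), exists xs,
  csys p xs /\ lens p xs = l.
Proof.
move=> l0; pose f (x : 'I_(sumn l)) : 'I_(sumn l) := Ordinal (blk_lt (ltn_ord x)).
have fI : injective f by move=> x y /(congr1 val) /= /(blk_inj (ltn_ord x) (ltn_ord y)) /val_inj.
pose p := perm fI; pose xs : seq 'I_(sumn l) := pmap insub (offs l).
have vi t x : val (iter t p x) = iter t (blk l) (val x).
  by elim: t => [//|t IHt]; rewrite !iterS /= permE /= IHt.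
have vx : map val xs = offs l.
  rewrite /xs pmap_filter; last by move=> x; rewrite insubK.
  apply/all_filterP/(all_nthP 0%N) => j; rewrite size_offs => jl.
  by case: insubP => // /negP[]; apply: offs_lt.
have sx : size xs = size l by rewrite -(size_map val) vx size_offs.
have vn j x0 : (j < size l)%N -> val (nth x0 xs j) = nth 0%N (offs l) j.
  by move=> jl; rewrite -vx (nth_map x0) ?sx.
have it t j x0 : (j < size l)%N ->
    val (iter t p (nth x0 xs j)) = (nth 0 (offs l) j + t %% nth 0 l j)%N.
  by move=> jl; rewrite vi vn // iter_blk.
exists p, xs; split.
  case: (posnP (size l)) => [s0|]; first by rewrite /csys (size0nil (_ : size xs = 0%N)) // sx.
  case: xs sx vn it {vx} => [<- //|x0 xs'] sx vn it _; move: (x0 :: xs') sx vn it => xs sx vn it.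
  apply/(uniqP set0) => j k; rewrite !inE size_map sx => jl kl.
  rewrite !(nth_map x0) ?sx // => e; wlog jk : j k jl kl e / (j < k)%N.
    by move=> W; case: (ltngtP j k) => [lt|gt|//]; [apply: W|apply/esym/W].
  have : nth x0 xs j \in porbit p (nth x0 xs k) by rewrite -e porbit_id.
  case/orbP=> t _ /(congr1 val); rewrite it // vn // => E.
  by have := offs_mono l0 jk kl; rewrite E ltnNge leq_addr.
apply: (@eq_from_nth _ 0%N); rewrite size_map ?sx // => j jl.
have x0 : 'I_(sumn l) by case: (xs) sx => [s0|x //]; rewrite -s0 in jl.
rewrite (nth_map x0) ?sx //; set x := nth x0 xs j.
have H n : (#|porbit p x| %| n)%N = (nth 0 l j %| n)%N.
  have := iter_eq_mod p x n 0; rewrite mod0n -/(dvdn _ n) => <-.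
  rewrite -(inj_eq val_inj) /= it // vn // -[X in _ == X]addn0 eqn_add2l.
  by [].
by apply/eqP; rewrite eqn_dvd -H dvdnn H dvdnn.
Qed.

Section Reps.
Variables (T : finType) (pi : {perm T}).
Implicit Types (N : {set T}) (xs ys : seq T).

(** The ordered systems of representatives with cycle lengths l; a permutation of that type has z_l
    of them ([size_reps]). *)
Fixpoint reps (l : seq nat) N : seq (seq T) :=
  if l is a :: l' then
    flatten [seq [seq y :: ys | ys <- reps l' (N :\: porbit pi y)] | y <- enum N & #|porbit pi y| == a]
  else [:: [::]].

Lemma mem_reps l N ys : {in N, forall y, porbit pi y \subset N} ->
  (ys \in reps l N) = [&& csys pi ys, lens pi ys == l & cU pi ys \subset N].
Proof.
elim: l N ys => [|a l IHl] N ys sN.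
  by rewrite inE /=; case: ys => [|y ys]; rewrite //= ?andbF // cU_nil sub0set.
have sD y : {in N :\: porbit pi y, forall z, porbit pi z \subset N :\: porbit pi y}.
  move=> z; rewrite inE => /andP[zy zN]; rewrite subsetD sN //= -setI_eq0.
  apply/eqP/setP => t; rewrite !inE -!eq_porbit_mem; apply/negP => /andP[/eqP -> e].
  by rewrite -eq_porbit_mem e in zy.
apply/flatten_mapP/and3P => [[y]|[]].
  rewrite mem_filter mem_enum => /andP[/eqP ea yN] /mapP[ys'].
  rewrite IHl // subsetD => /and4P[c /eqP el sU d] ->.
  by rewrite csys_cons cU_cons /= ea el eqxx subUset sN // sU c disjoint_sym d.
case: ys => [//|y ys]; rewrite csys_cons cU_cons subUset => /andP[d c] /eqP[ea el] /andP[sy sU].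
have yN : y \in N by apply: (subsetP sy); apply: porbit_id.
exists y; first by rewrite mem_filter mem_enum ea eqxx.
by apply: map_f; rewrite IHl // c -el eqxx subsetD sU disjoint_sym d.
Qed.

Lemma uniq_reps l N : uniq (reps l N).
Proof.
elim: l N => [//|a l IHl] N /=.
have : uniq [seq y <- enum N | #|porbit pi y| == a] by rewrite filter_uniq ?enum_uniq.
elim: (filter _ _) => [//|y s IHs] /= /andP[ys us].
rewrite cat_uniq map_inj_uniq ?IHl ?IHs // => [|u v [] //]; rewrite andbT /=.
apply/hasPn => t /flatten_mapP[z zs /mapP[t' _ ->]]; apply/mapP => -[t'' _ [e _]].
by rewrite e (negbTE ys) in zs.
Qed.

Lemma sum_orb a xs : csys pi xs ->
  (\sum_(y in cU pi xs) (#|porbit pi y| == a) = a * count_mem a (lens pi xs))%N.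
Proof.
elim: xs => [|x xs IHx] /=; first by rewrite cU_nil big_set0 muln0.
rewrite csys_cons cU_cons => /andP[d c]; rewrite (eq_bigl [predU porbit pi x & cU pi xs]) => [|y]; last by rewrite !inE.
rewrite bigU //= IHx // mulnDr; congr (_ + _)%N.
rewrite (eq_bigr (fun=> nat_of_bool (#|porbit pi x| == a))); last first.
  by move=> y; rewrite -eq_porbit_mem => /eqP ->.
by rewrite sum_nat_const; case: eqP => [->|_]; rewrite ?muln0.
Qed.

Lemma size_reps l xs : csys pi xs -> perm_eq (lens pi xs) l -> size (reps l (cU pi xs)) = zz l.
Proof.
elim: l xs => [|a l IHl] xs cx px; first by [].
rewrite /= size_flatten /shape -map_comp.
have H y : y \in cU pi xs -> #|porbit pi y| = a -> size (reps l (cU pi xs :\: porbit pi y)) = zz l.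
  rewrite mem_cU => /hasP[x xx]; rewrite -eq_porbit_mem => /eqP e ea.
  have px' := perm_to_rem xx.
  have eU : cU pi xs :\: porbit pi y = cU pi (rem x xs).
    rewrite (cU_perm pi px') cU_cons e setDUl setDv set0U; apply/setDidPl.
    move: cx; rewrite /csys (perm_uniq (perm_map _ px')) => /= cx.
    by have : csys pi (x :: rem x xs) := cx; rewrite csys_cons disjoint_sym => /andP[].
  rewrite eU; apply: IHl.
    by rewrite /csys (subseq_uniq _ cx) // map_subseq // rem_subseq.
  rewrite -(perm_cons a) -ea e -[X in perm_eq X]/(lens pi (x :: rem x xs)) -e ea.
  by apply: perm_trans px; apply: perm_map; rewrite perm_sym.
rewrite sumnE big_map big_filter big_enum_cond /=.
transitivity (\sum_(y in cU pi xs) (#|porbit pi y| == a) * zz l)%N.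
  rewrite big_mkcondr; apply: eq_bigr => y yU; case: eqP => [ea|_]; last by rewrite mul0n.
  by rewrite size_map H // mul1n.
by rewrite -big_distrl /= sum_orb // (seq.permP px) /= eqxx.
Qed.
End Reps.

Lemma ctype_sys n (q : 'S_n) : exists xs, [/\ csys q xs, cU q xs = setT & lens q xs = ctype q].
Proof.
rewrite /ctype sort_map; set Xs := sort _ _.
have pX : perm_eq Xs (enum (porbits q)) by rewrite perm_sort.
have [xs ex] : exists xs, map (porbit q) xs = Xs.
  have : {subset Xs <= porbits q} by move=> X; rewrite (perm_mem pX) mem_enum.
  elim: (Xs) => [|X s IHs] sub; first by exists [::].
  have [|xs <-] := IHs; first by move=> Y Ys; apply: sub; rewrite in_cons Ys orbT.
  by case/imsetP: (sub X (mem_head _ _)) => x _ ->; exists (x :: xs).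
exists xs; split.
- by rewrite /csys ex (perm_uniq pX) enum_uniq.
- apply/setP => y; rewrite inE mem_cU; apply/hasP.
  have : porbit q y \in Xs by rewrite (perm_mem pX) mem_enum imset_f.
  by rewrite -ex => /mapP[x xx e]; exists x; rewrite // -e porbit_id.
by rewrite /lens -[X in _ = map _ X]ex -map_comp.
Qed.

Lemma lens_ctype n (q : 'S_n) ys : csys q ys -> cU q ys = setT -> perm_eq (lens q ys) (ctype q).
Proof.
move=> c eU; rewrite /ctype perm_sym (perm_trans (permEl (perm_sort _ _))) //.
rewrite -[lens q ys]map_id /lens map_id (map_comp (fun X : {set 'I_n} => #|X|) (porbit q)).
apply: perm_map; rewrite perm_sym; apply: uniq_perm => //; first exact: enum_uniq.
move=> X; rewrite mem_enum; apply/mapP/imsetP => -[y yy ->]; first by exists y.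
have : y \in cU q ys by rewrite eU inE.
by rewrite mem_cU => /hasP[z zz]; rewrite -eq_porbit_mem => /eqP ->; exists z.
Qed.

Lemma iterJ (T : finType) (p s : {perm T}) t x : iter t (p ^ s)%g (s x) = s (iter t p x).
Proof. by elim: t => [//|t IHt]; rewrite !iterS IHt permJ. Qed.

Lemma porbitJ (T : finType) (p s : {perm T}) x : porbit (p ^ s)%g (s x) = s @: porbit p x.
Proof.
apply/setP => y; apply/idP/imsetP => [/orbP[t _ ->]|[z /orbP[t _ ->] ->]].
  by exists (iter t p x); rewrite ?iter_in_orb ?iterJ.
by rewrite -iterJ iter_in_orb.
Qed.

(** Sending s to the conjugate of p0 by s and the image of [xs] under s is a bijection from S_n to
    the pairs of a permutation of type l and one of its z_l systems of representatives. *)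
Lemma count_ctype l : is_part l ->
  (#|[set q : 'S_(sumn l) | ctype q == l]| * zz l = (sumn l)`!)%N.
Proof.
move=> pl; have l0 := part_pos pl; have [p0 [xs [c0 e0]]] := model_exists l0.
set n := sumn l in p0 xs c0 e0 *.
have full (q : 'S_n) ys : csys q ys -> lens q ys = l -> cU q ys = setT.
  move=> c e; apply/eqP; rewrite eqEcard subsetT cardsT card_ord card_cU // e.
  exact: leqnn.
pose L := [seq (q, ys) | q <- enum {: 'S_n}, ys <- reps q l setT].
pose M := [seq ((p0 ^ s)%g, map s xs) | s : 'S_n <- enum {: 'S_n}].
have sT (q : 'S_n) : {in [set: 'I_n], forall y, porbit q y \subset setT} by move=> y _; apply: subsetT.
have memL q ys : ((q, ys) \in L) = csys q ys && (lens q ys == l).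
  apply/allpairsPdep/idP => [[q' [ys' [_ h [-> ->]]]]|h].
    by move: h; rewrite mem_reps // => /and3P[-> ->].
  by exists q, ys; rewrite mem_enum mem_reps // andbA h subsetT.
have cardJ (s : 'S_n) x : #|porbit (p0 ^ s)%g (s x)| = #|porbit p0 x|.
  by rewrite porbitJ card_imset //; apply: perm_inj.
have pLM : perm_eq L M.
  apply: uniq_perm.
  - rewrite allpairs_uniq_dep ?enum_uniq // => [q _|[q ys] [q' ys'] _ _ [-> ->] //].
    exact: uniq_reps.
  - rewrite map_inj_in_uniq ?enum_uniq // => s t _ _ [eq exs]; apply/permP => y.
    have : y \in cU p0 xs by rewrite (full _ _ c0 e0) inE.
    rewrite mem_cU => /hasP[x xx /orbP[k _ ->]]; rewrite -!iterJ eq; congr iter.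
    by have := exs => /eq_in_map; apply.
  case=> q ys; rewrite memL; apply/andP/mapP => [[cq /eqP eq]|[s _ [-> ->]]]; last first.
    rewrite /csys /lens -!map_comp; split; last first.
      by apply/eqP; rewrite -[RHS]e0; apply: eq_map => x /=; rewrite cardJ.
    have -> : map (porbit (p0 ^ s)%g \o s) xs = map ((fun X : {set 'I_n} => s @: X) \o porbit p0) xs.
      by apply: eq_map => x /=; apply: porbitJ.
    rewrite map_comp map_inj_uniq //; exact/imset_inj/perm_inj.
  (* [sys_map] needs a default point, so the empty set is treated apart. *)
  have [t0|h0] := pselect (exists t0 : 'I_n, True); last first.
    exists p0; first by rewrite mem_enum.
    have nil (s : seq 'I_n) : s = [::] by case: s => // x; case: h0; exists x.
    rewrite (nil ys) (nil (map _ _)); congr (_, _); apply/permP => x; case: h0; by exists x.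
  case: t0 => t0 _; have [h [h1 h2 h3 h4]] := sys_map t0 c0 cq (etrans e0 (esym eq)).
  rewrite (full _ _ c0 e0) in h1 h2; have hI : injective h by move=> x y; apply: h1; rewrite inE.
  exists (perm hI); first by rewrite mem_enum.
  congr (_, _); last by rewrite -h4; apply: eq_map => x; rewrite permE.
  apply/permP => y; have [z ->] : exists z, y = perm hI z by exists ((perm hI)^-1 y)%g; rewrite permKV.
  by rewrite permJ !permE h2 ?inE.
have := perm_size pLM; rewrite size_map -cardE card_Sn => <-.
rewrite size_allpairs_dep sumnE big_map big_enum /= -sum1dep_card big_distrl /=.
rewrite big_mkcond /=; apply: eq_bigr => q _; case: eqP => [e|ne].
  have [xs' [c' U' l']] := ctype_sys q; rewrite -U' size_reps ?mul1n // l' e.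
  exact: perm_refl.
case E : (reps q l setT) => [//|ys s]; case: ne.
have : ys \in reps q l setT by rewrite E mem_head.
rewrite mem_reps // => /and3P[c /eqP el _]; apply: (sorted_eq geq_trans geq_anti).
- exact: sort_sorted geq_total _.
- by case/andP: pl.
by rewrite perm_sym -el; apply: lens_ctype => //; apply: full.
Qed.

(** * Characters as power series *)

(** The value is taken on a model permutation; [sys_map] and [chi3_relabel] carry it to every
    permutation with the same cycle lengths. *)
Lemma chi3v_exists : exists F : nat -> seq nat -> rat,
  (forall k l, 0%N \in l -> F k l = 0) /\
  forall k (T : finType) (pi : {perm T}) xs, csys pi xs -> chi3 k (cU pi xs) pi = F k (lens pi xs).
Proof.
have /choice[F HF] : forall kl : nat * seq nat, exists r : rat, (0%N \in kl.2 -> r = 0) /\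
    forall (T : finType) (pi : {perm T}) xs, csys pi xs -> lens pi xs = kl.2 ->
      chi3 kl.1 (cU pi xs) pi = r.
  move=> [k l] /=; have [l0|l0] := boolP (0%N \in l).
    by exists 0; split=> // T pi xs _ e; have := lens_pos pi xs; rewrite e l0.
  have [p [ys [cy ey]]] := model_exists l0.
  exists (chi3 k (cU p ys) p); split=> // T pi xs cx ex.
  case: ys cy ey => [|y ys] cy ey.
    have -> : xs = [::] by case: (xs) ex => [//|? ?]; rewrite -ey.
    by rewrite !cU_nil !chi3_set0.
  have [h [h1 h2 h3 h4]] := sys_map y cx cy (etrans ex (esym ey)).
  by rewrite -h3; apply/esym/(chi3_relabel _ h1) => // z zU; rewrite cU_stable.
exists (fun k l => F (k, l)); split=> [k l|k T pi xs cx]; first by have [h _] := HF (k, l); apply: h.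
by have [_ h] := HF (k, lens pi xs); apply: h.
Qed.

Lemma chi4v_exists : exists F : nat -> seq nat -> rat,
  (forall k l, 0%N \in l -> F k l = 0) /\
  forall k (T : finType) (pi : {perm T}) xs, xs != [::] -> csys pi xs ->
    chi4 k (cU pi xs) pi = F k (lens pi xs).
Proof.
have /choice[F HF] : forall kl : nat * seq nat, exists r : rat, (0%N \in kl.2 -> r = 0) /\
    forall (T : finType) (pi : {perm T}) xs, xs != [::] -> csys pi xs -> lens pi xs = kl.2 ->
      chi4 kl.1 (cU pi xs) pi = r.
  move=> [k l] /=; have [l0|l0] := boolP (0%N \in l).
    by exists 0; split=> // T pi xs _ _ e; have := lens_pos pi xs; rewrite e l0.
  have [p [ys [cy ey]]] := model_exists l0.
  exists (chi4 k (cU p ys) p); split=> // T pi xs nx cx ex.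
  case: ys cy ey => [|y ys] cy ey; first by have := etrans ex (esym ey); case: (xs) nx.
  have [h [h1 h2 h3 h4]] := sys_map y cx cy (etrans ex (esym ey)).
  rewrite -h3; apply/esym/(chi4_relabel _ _ h1) => // [|z zU]; last by rewrite cU_stable.
  case: xs nx {cx ex h1 h2 h3 h4} => [//|x xs] _; apply/set0Pn; exists x.
  by rewrite cU_cons inE porbit_id.
exists (fun k l => F (k, l)); split=> [k l|k T pi xs nx cx]; first by have [h _] := HF (k, l); apply: h.
by have [_ h] := HF (k, lens pi xs); apply: h.
Qed.

Definition chi3v := projT1 (cid chi3v_exists).
Definition chi4v := projT1 (cid chi4v_exists).
Lemma chi3v_pos k l : 0%N \in l -> chi3v k l = 0.
Proof. by have [H _] := projT2 (cid chi3v_exists); apply: H. Qed.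
Lemma chi3v_sys k (T : finType) (pi : {perm T}) xs : csys pi xs ->
  chi3 k (cU pi xs) pi = chi3v k (lens pi xs).
Proof. by have [_ H] := projT2 (cid chi3v_exists); apply: H. Qed.
Lemma chi4v_pos k l : 0%N \in l -> chi4v k l = 0.
Proof. by have [H _] := projT2 (cid chi4v_exists); apply: H. Qed.
Lemma chi4v_sys k (T : finType) (pi : {perm T}) xs : xs != [::] -> csys pi xs ->
  chi4 k (cU pi xs) pi = chi4v k (lens pi xs).
Proof. by have [_ H] := projT2 (cid chi4v_exists); apply: H. Qed.

Lemma chi3v_nil k : chi3v k [::] = (k == 0%N)%:R.
Proof.
by have := @chi3v_sys k 'I_0 1%g [::] isT; rewrite cU_nil chi3_set0 => ->.
Qed.

Lemma chi3v_vanish k l : (0 < sumn l <= 2 * k)%N -> chi3v k l = 0.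
Proof.
move=> h; have [l0|l0] := boolP (0%N \in l); first exact: chi3v_pos.
have [p [xs [cx ex]]] := model_exists l0; rewrite -ex -chi3v_sys // chi3_vanish //.
by rewrite card_cU // ex.
Qed.

Lemma chi3v_big k l : (sumn l < k)%N -> chi3v k l = 0.
Proof.
move=> h; have [l0|l0] := boolP (0%N \in l); first exact: chi3v_pos.
have [s0|s0] := posnP (sumn l); last by apply: chi3v_vanish; clear -s0 h; lia.
by rewrite (sumn0 s0 l0) chi3v_nil; case: k h.
Qed.

Lemma chi4v_big k l : l != [::] -> (sumn l < k)%N -> chi4v k l = 0.
Proof.
move=> ln h; have [l0|l0] := boolP (0%N \in l); first exact: chi4v_pos.
have [p [xs [cx ex]]] := model_exists l0.
have xn : xs != [::] by case: xs ex {cx} ln => [<-|].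
rewrite -ex -chi4v_sys // chi4_vanish //.
- by move=> z; rewrite cU_stable.
- by case: k h.
rewrite card_cU // ex; clear -h ln l0; case: l l0 ln h => [//|[|a] l] //= _ _; lia.
Qed.

Notation mt := (- 'X^2 : {poly rat}).

Definition hP : hat := fun l => \sum_(k < (sumn l).+1) mt ^+ k * (chi3v k l)%:P.
(** Lambda lives on nonempty sets, so there is no constant term. Degrees above |l| contribute 0
    ([chi4v_big]), hence the sum over k is complete. *)
Definition hZ : hat := fun l => if l == [::] then 0 else \sum_(k < (sumn l).+1) mt ^+ k * (chi4v k l)%:P.
(** The signed character of a saturated block, without the power of t that [hx] adds; it vanishes in
    even degree. *)
Definition ha : hat := fun l => ((l != [::])%:R * (-1) ^+ (sumn l)./2 * chi3v (sumn l)./2 l)%:P.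
Definition hx : hat := fun l => (l != [::])%:R * mt ^+ (sumn l)./2 * (chi3v (sumn l)./2 l)%:P.

Lemma sum_cut (F : nat -> {poly rat}) n B : (n <= B)%N -> (forall k, (n <= k)%N -> F k = 0) ->
  \sum_(k < B) F k = \sum_(k < n) F k.
Proof.
move=> nB F0; rewrite -!(big_mkord xpredT) (big_cat_nat (n := n)) //= [X in _ + X]big_nat_cond.
by rewrite [X in _ + X]big1 ?addr0 // => k /andP[/andP[/F0]].
Qed.

Lemma sum_shift (F : nat -> {poly rat}) q B : (q <= B)%N ->
  \sum_(k < B | (q <= k)%N) F (k - q)%N = \sum_(k < B - q) F k.
Proof.
move=> le; rewrite -(big_mkord (fun k => q <= k)%N (fun k => F (k - q)%N)).
rewrite (big_cat_nat (n := q)) //= big_nat_cond big1 ?add0r; last first.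
  by move=> k /andP[/andP[_ h1] h2]; exfalso; clear -h1 h2; lia.
rewrite -{1}[q]add0n big_addn big_mkord; apply: eq_big => [k|k _]; first by rewrite leq_addl.
by rewrite addnK.
Qed.

Lemma hP_cut B l : (sumn l < B)%N -> hP l = \sum_(k < B) mt ^+ k * (chi3v k l)%:P.
Proof.
move=> h; rewrite (sum_cut (n := (sumn l).+1) (F := fun k => mt ^+ k * (chi3v k l)%:P)) // => k hk.
by rewrite chi3v_big // mulr0.
Qed.

Lemma hP_nil : hP [::] = 1.
Proof. by rewrite /hP big_ord1 chi3v_nil expr0 mulr1. Qed.

Lemma hP_pos : hpos hP.
Proof. by move=> l l0; rewrite /hP big1 // => k _; rewrite chi3v_pos // mulr0. Qed.
Lemma hZ_pos : hpos hZ.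
Proof. by move=> l l0; rewrite /hZ; case: eqP => // _; rewrite big1 // => k _; rewrite chi4v_pos // mulr0. Qed.
Lemma ha_pos : hpos ha.
Proof. by move=> l l0; rewrite /ha chi3v_pos // mulr0. Qed.
Lemma hx_pos : hpos hx.
Proof. by move=> l l0; rewrite /hx chi3v_pos // mulr0. Qed.

Lemma ha_even l : ~~ odd (sumn l) -> ha l = 0.
Proof.
move=> el; rewrite /ha; have [->|ln] := eqVneq l [::]; first by rewrite !mul0r.
have [l0|l0] := boolP (0%N \in l); first by rewrite chi3v_pos // mulr0.
rewrite chi3v_vanish ?mulr0 //; have := odd_double_half (sumn l); rewrite (negbTE el).
by case: l ln l0 {el} => [//|[|a] l] //= _ _; lia.
Qed.

Lemma hx_a l : hx l = 'X^((sumn l).-1) * ha l.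
Proof.
have [ol|el] := boolP (odd (sumn l)); last first.
  rewrite ha_even // mulr0 /hx; have [->|ln] := eqVneq l [::]; first by rewrite !mul0r.
  have [l0|l0] := boolP (0%N \in l); first by rewrite chi3v_pos // mulr0.
  rewrite chi3v_vanish ?mulr0 //; have := odd_double_half (sumn l); rewrite (negbTE el).
  by case: l ln l0 {el} => [//|[|a] l] //= _ _; lia.
have -> : (sumn l).-1 = (2 * (sumn l)./2)%N.
  by have := odd_double_half (sumn l); rewrite ol -mul2n; lia.
rewrite /hx /ha exprM (exprNn 'X^2) !polyCM.
have -> : ((-1 : rat) ^+ (sumn l)./2)%:P = (-1) ^+ (sumn l)./2 by rewrite rmorphXn /= rmorphN1.
have -> : ((l != [::])%:R : rat)%:P = (l != [::])%:R by case: (l != [::]).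
by ring.
Qed.

Lemma sys_exists l : 0%N \notin l -> exists (T : finType) (p : {perm T}) xs,
  csys p xs /\ lens p xs = l.
Proof. by move=> /model_exists[p [xs h]]; exists _, p, xs. Qed.

(** * The character of the triple algebra as an exponential *)

Section RootedBlocks.
Variables (T : finType) (pi : {perm T}).

(** A set of exact period i through x0 meets the cycle of x0 in the residue class of x0, so one
    choice is forced there. *)
Lemma dec_sum0 (R : nmodType) i x0 xs (F : {set T} -> R) : (0 < i)%N -> csys pi (x0 :: xs) ->
  \sum_(b : {set T} | [&& x0 \in b, b \subset cU pi (x0 :: xs) & percyc pi i b]) F b =
  if (i %| #|porbit pi x0|)%N then \sum_(d <- dec pi i xs) F (cU (pi ^+ i)%g (x0 :: d.1)) else 0.
Proof.
move=> i0 c; have := c; rewrite csys_cons => /andP[dj cx].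
transitivity (\sum_(b : {set T} | (b \subset cU pi (x0 :: xs)) && percyc pi i b)
   (if x0 \in b then F b else 0)).
  by rewrite -big_mkcondr; apply: eq_bigl => b; rewrite andbC andbA.
have dE : dec pi i (x0 :: xs) = [seq (d.1, x0 :: d.2) | d <- dec pi i xs] ++
    (if (i %| #|porbit pi x0|)%N then [seq (iter r pi x0 :: d.1, d.2) | r <- iota 0 i, d <- dec pi i xs]
     else [::]) by [].
rewrite dec_sum // dE big_cat big_map /=; rewrite [X in X + _]big_seq [X in X + _]big1 ?add0r; last first.
  move=> d /(dec_sys i0 cx)[_ _ _ s _]; rewrite /=; case: ifP => // /(subsetP s) h.
  by have := disjointFr dj (porbit_id pi x0); rewrite h.
case: ifP => ic; last by rewrite big_nil.
rewrite big_allpairs_dep; case: i i0 ic {dE} => [//|i'] i0 ic; rewrite [iota _ _]/= big_cons /=.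
rewrite [X in _ + X]big_seq [X in _ + X]big1 ?addr0; last first.
  move=> r; rewrite mem_iota => /andP[r1 r2]; rewrite big_seq big1 // => d /(dec_sys i0 cx)[_ _ _ s _] /=.
  rewrite cU_cons inE -/(Rc pi i'.+1 x0 r) -[x0 in x0 \in _]/(iter 0 pi x0) mem_Rc // mod0n modn_small //.
  rewrite eq_sym (negbTE (_ : r != 0%N)) -?lt0n //=.
  case: ifP => // /(subsetP s) h; by have := disjointFr dj (porbit_id pi x0); rewrite h.
by apply: eq_bigr => d _; rewrite cU_cons inE porbit_id.
Qed.
End RootedBlocks.

Lemma comp_mt i h : (mt ^+ h) \Po 'X^i = (-1) ^+ h * 'X^(i * (2 * h)).
Proof.
by rewrite [LHS]rmorphXn /= rmorphN /= comp_Xn_poly (exprNn ('X^i ^+ 2)) -!exprM -mulnA.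
Qed.

(** The sign of permuting i blocks of degree h cyclically turns (-t)^(ih) into (-1)^h t^(ih), which
    is psi_i of (-t)^h. *)
Lemma mt_psi i h (q : rat) : (0 < i)%N ->
  mt ^+ (i * h) * ((-1) ^+ ((i - 1) * h) * q)%:P = (mt ^+ h * q%:P) \Po 'X^i.
Proof.
move=> i0; rewrite comp_polyM comp_polyC comp_mt polyCM mulrA; congr (_ * _).
have -> : ((-1 : rat) ^+ ((i - 1) * h))%:P = (-1) ^+ ((i - 1) * h) by rewrite rmorphXn /= rmorphN1.
rewrite (exprNn 'X^2) -exprM mulrAC -exprD; congr (_ * _); last by rewrite mulnCA.
rewrite -(signr_odd _ (_ + _)) -[RHS]signr_odd.
suff -> : odd (i * h + (i - 1) * h) = odd h by [].
by clear -i0; rewrite oddD !oddM oddB //; case: (odd i); case: (odd h).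
Qed.

(** The logarithmic derivative of Exp[x]. In [chi3_blocks] at a point of an m-cycle, a block of
    period i contains one cycle of pi^i of length m/i from there, whence psi_i(D_(m/i) x); the
    points outside its orbit give the factor P. *)
Lemma hP_rec m : hD m hP = hP * \sum_(i <- divisors m) hpsi i (hD (m %/ i) hx).
Proof.
have [->|m0] := posnP m.
  by rewrite hD_0 ?big_seq1 ?divn1 ?(hD_0 hx_pos) ?hpsi_0 ?mulr0 //; apply: hP_pos.
apply/funext => l; have [l0|l0] := boolP (0%N \in l).
  rewrite /hD hP_pos ?in_cons ?l0 ?orbT // hmul_pos //; first exact: hP_pos.
  move=> l' l'0; rewrite hat_sumE big1 // => i _; apply: hpsi_pos l'0 => l'' h.
  by rewrite /hD hx_pos // in_cons h orbT.
have ml0 : 0%N \notin m :: l by rewrite in_cons negb_or l0 andbT; lia.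
have [T [p [[|x0 xs] [cx ex]]]] := sys_exists ml0; first by [].
case: ex => em el; have := cx; rewrite csys_cons => /andP[dj cx'].
set N := cU p (x0 :: xs); set n := #|N|.
have nE : n = sumn (m :: l) by rewrite /n card_cU //= em el.
(* Large enough for the degrees up to n that remain after i |b|/2 is subtracted, as i and |b| are at
   most n. *)
pose B := (n * n + n).+1.
have piN : p @: N = N.
  apply/eqP; rewrite eqEcard card_imset ?leqnn ?andbT; last exact: perm_inj.
  by apply/subsetP => _ /imsetP[y yN ->]; rewrite cU_stable.
rewrite /hD (@hP_cut B) -?nE; last by rewrite /B ltnS leq_addl.
have x0N : x0 \in N by rewrite /N cU_cons inE porbit_id.
have e0 : iter m p x0 = x0 by rewrite -em iter_porbit.
have := chi3v_sys _ cx; rewrite /= em el => chE.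
pose hb (b : {set T}) := #|b|./2.
pose X i b : {poly rat} := mt ^+ (i * hb b) * ((-1) ^+ ((i - 1) * hb b) * chi3 (hb b) b (iter i p))%:P.
transitivity (\sum_(i < m.+1) \sum_(b : {set T} | [&& x0 \in b, b \subset N & percyc p i b])
   X i b * \sum_(k < B - i * hb b) mt ^+ k * (chi3 k (N :\: orb p i b) p)%:P).
  transitivity (\sum_(i < m.+1) \sum_(b : {set T} | [&& x0 \in b, b \subset N & percyc p i b])
     \sum_(k < B | (i * hb b <= k)%N) X i b * (mt ^+ (k - i * hb b) * (chi3 (k - i * hb b)%N (N :\: orb p i b) p)%:P)).
    transitivity (\sum_(k < B) \sum_(i < m.+1) \sum_(b : {set T} | [&& x0 \in b, b \subset N, percyc p i b & (i * hb b <= k)%N])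
      X i b * (mt ^+ (k - i * hb b) * (chi3 (k - i * hb b)%N (N :\: orb p i b) p)%:P)).
      apply: eq_bigr => k _; rewrite -chE (chi3_blocks k piN x0N e0 m0) rmorph_sum mulr_sumr.
      apply: eq_bigr => i _; rewrite rmorph_sum mulr_sumr; apply: eq_bigr => b /and4P[_ _ _ le].
      rewrite /X -/(hb b) -{1}(subnKC le) exprD !polyCM; ring.
    rewrite exchange_big; apply: eq_bigr => i _; rewrite (exchange_big_dep (fun b : {set T} => [&& x0 \in b, b \subset N & percyc p i b])) /=.
      apply: eq_bigr => b /and3P[h1 h2 h3]; apply: eq_bigl => k; by rewrite h1 h2 h3.
    by move=> k b _ /and4P[-> -> ->].
  apply: eq_bigr => i _; apply: eq_bigr => b /and3P[_ bN _]; rewrite -mulr_sumr; congr (_ * _).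
  have le : (i * hb b <= B)%N.
    have h1 : (i <= n)%N by apply: (leq_trans (n := m)); [rewrite -ltnS|rewrite nE leq_addr].
    have h2 : (hb b <= n)%N by apply: (leq_trans (n := #|b|)); [rewrite /hb; clear; lia|apply: subset_leq_card].
    by apply: (leq_trans (leq_mul h1 h2)); rewrite /B -addnS leq_addr.
  exact: (sum_shift (fun k => mt ^+ k * (chi3 k (N :\: orb p i b) p)%:P) le).
transitivity (\sum_(i < m.+1 | (0 < i)%N && (i %| m)%N) (hpsi i (hD (m %/ i) hx) * hP) l).
  rewrite [RHS]big_mkcond; apply: eq_bigr => i _; case: (posnP i) => [i0|i0] /=.
    by rewrite big1 // => b /and3P[_ _]; rewrite /percyc i0.
  rewrite dec_sum0 // em; case: ifP => // im.
  pose G l1 l2 : {poly rat} := (hx ((m %/ i)%N :: l1) \Po 'X^i) * hP l2.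
  rewrite hatM_mk -el; transitivity (\sum_(d <- dec p i xs) G (lens (p ^+ i)%g d.1) (lens p d.2)); last first.
    rewrite dec_mk //; apply: eq_bigr => mm _; rewrite /hpsi /G /hD.
    by case: ifP => _; rewrite ?mul0r ?mulrA.
  rewrite big_seq [RHS]big_seq; apply: eq_bigr => d dd.
  have dd' : (x0 :: d.1, d.2) \in dec p i (x0 :: xs).
    rewrite [dec _ _ _]/= mem_cat em im; apply/orP; right; apply/allpairsP.
    by exists (0%N, d); split; rewrite ?mem_iota.
  have [c1 c2 _ s1 e2] := dec_sys i0 cx dd'; rewrite /= in c1 c2 e2 s1.
  set b := cU (p ^+ i)%g (x0 :: d.1) in e2 s1 *; have Eb := card_cU c1; rewrite -/b in Eb.
  have lE : lens (p ^+ i)%g (x0 :: d.1) = (m %/ i)%N :: lens (p ^+ i)%g d.1.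
    by rewrite /= -[porbit _ x0]/(Rc p i x0 0) card_Rc // em.
  rewrite /G -/b -e2; congr (_ * _); last first.
    rewrite (@hP_cut (B - i * hb b)%N).
      by apply: eq_bigr => k _; rewrite chi3v_sys.
    have h1 : (i <= n)%N by apply: (leq_trans (n := m)); [rewrite -ltnS|rewrite nE leq_addr].
    have h2 : (hb b <= n)%N by apply: (leq_trans (n := #|b|)); [rewrite /hb; clear; lia|apply: subset_leq_card].
    have h3 : (sumn (lens p d.2) <= n)%N by rewrite -card_cU // e2; apply/subset_leq_card/subsetDl.
    by rewrite ltn_subRL /B ltnS; apply: leq_add h3; apply: leq_mul.
  rewrite /X; have -> : chi3 (hb b) b (iter i p) = chi3v (hb b) (lens (p ^+ i)%g (x0 :: d.1)).
    by rewrite -chi3v_sys //; apply: chi3_eq => y _; rewrite permX.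
  by rewrite lE in Eb *; rewrite mt_psi // /hx -Eb mul1r.
rewrite mulrC mulr_suml hat_sumE.
rewrite -(big_mkord (fun i => (0 < i)%N && (i %| m)%N) (fun i => (hpsi i (hD (m %/ i) hx) * hP) l)).
rewrite -big_filter; apply: perm_big; apply: uniq_perm.
- by rewrite filter_uniq // iota_uniq.
- exact: divisors_uniq.
move=> i; rewrite mem_filter mem_index_iota -dvdn_divisors // andbC andbCA.
by have [im|] := boolP (i %| m)%N; rewrite ?andbF // andbT ltnS (dvdn_leq m0 im) (dvdn_gt0 m0 im).
Qed.

(** * The cubic differential equation of a block *)

(** The substitution of z^i p_i for p_i, used with z = s and z = -1. *)
Definition Gam (z : {poly rat}) (F : hat) : hat := fun l => z ^+ sumn l * F l.

Lemma GamM z (F G : hat) : Gam z (F * G) = Gam z F * Gam z G.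
Proof.
apply/funext => l; rewrite /Gam !hatM_mk mulr_sumr big_seq [RHS]big_seq.
by apply: eq_bigr => x /mk_sumn <-; rewrite exprD; ring.
Qed.
Lemma GamD z (F G : hat) : Gam z (F + G) = Gam z F + Gam z G.
Proof. by apply/funext => l; rewrite hatDE /Gam !hatDE mulrDr. Qed.
Lemma GamN z (F : hat) : Gam z (- F) = - Gam z F.
Proof. by apply/funext => l; rewrite hatNE /Gam hatNE mulrN. Qed.
Lemma Gam1 z : Gam z 1 = 1.
Proof. by apply/funext => -[|a l]; rewrite /Gam !hat1E ?mul1r // mulr0. Qed.
Lemma Gam_p1 z : Gam z hp1 = hC z * hp1.
Proof.
apply/funext => l; rewrite hCM /Gam /hp1; case: eqP => [->|_]; last by rewrite !mulr0.
by rewrite /= expr1.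
Qed.
Lemma hD_Gam m z F : hD m (Gam z F) = hC (z ^+ m) * Gam z (hD m F).
Proof. by apply/funext => l; rewrite hCM /hD /Gam /= exprD mulrA. Qed.

Lemma signp n : ((-1 : rat) ^+ n)%:P = (-1) ^+ n.
Proof. by rewrite rmorphXn /= rmorphN1. Qed.

Lemma Gam_Da : Gam (-1) (hD 1 ha) = hD 1 ha.
Proof.
apply/funext => l; rewrite /Gam /hD; have [ol|el] := boolP (odd (sumn l)).
  by rewrite ha_even ?mulr0 //= ol.
by rewrite -signr_odd (negbTE el) expr0 mul1r.
Qed.

Section FixedSum.
Variables (T : finType) (pi : {perm T}).

Lemma hp1M_sys (F : hat) xs : uniq xs ->
  (hp1 * F) (lens pi xs) = \sum_(x <- xs | #|porbit pi x| == 1%N) F (lens pi (rem x xs)).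
Proof.
elim: xs F => [|x xs IHx] F /=.
  by rewrite big_nil hatM_nil /hp1 /= mul0r.
case/andP=> xx ux; rewrite hatM_cons hD_p1 IHx // big_cons /= eqxx.
have -> : \sum_(y <- xs | #|porbit pi y| == 1%N) F (lens pi (if x == y then xs else x :: rem y xs)) =
          \sum_(y <- xs | #|porbit pi y| == 1%N) hD #|porbit pi x| F (lens pi (rem y xs)).
  rewrite big_seq_cond [RHS]big_seq_cond; apply: eq_bigr => y /andP[yx _].
  by case: eqP => [e|//]; rewrite e yx in xx.
by case: eqP => _; rewrite ?mul1r // mul0r hat0E add0r.
Qed.
End FixedSum.

Lemma csys_perm (T : finType) (pi : {perm T}) xs ys : perm_eq xs ys -> csys pi xs = csys pi ys.
Proof. by move=> p; apply/perm_uniq/perm_map. Qed.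
Lemma csys_uniq (T : finType) (pi : {perm T}) xs : csys pi xs -> uniq xs.
Proof. exact: map_uniq. Qed.

Lemma percyc1 (T : finType) (pi : {perm T}) b : percyc pi 1 b = (pi @: b == b).
Proof.
rewrite /percyc /=; have -> : [forall j : 'I_1, (0 < j)%N ==> [disjoint img pi j b & b]].
  by apply/forallP => j; rewrite ord1.
by rewrite andbT.
Qed.

Lemma lens_fix (T : finType) (pi : {perm T}) x : #|porbit pi x| = 1%N -> pi x = x.
Proof. by move=> e; have := iter_porbit pi x; rewrite e. Qed.
Lemma porbit_fix (T : finType) (pi : {perm T}) x : #|porbit pi x| = 1%N -> porbit pi x = [set x].
Proof. by move/eqP/cards1P => [y e]; have := porbit_id pi x; rewrite e inE => /eqP ->. Qed.
Lemma fix_lens (T : finType) (pi : {perm T}) x : pi x = x -> #|porbit pi x| = 1%N.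
Proof.
move=> e; apply/eqP; rewrite -dvdn1; have := iter_eq_mod pi x 1 0; rewrite mod0n /= e eqxx.
by move=> /esym.
Qed.

Definition asys (T : finType) (pi : {perm T}) (b : {set T}) : rat :=
  (-1) ^+ #|b|./2 * chi3 #|b|./2 b pi.

Lemma asysE (T : finType) (pi : {perm T}) xs : csys pi xs -> xs != [::] ->
  (asys pi (cU pi xs))%:P = ha (lens pi xs).
Proof.
move=> cx nx; rewrite /asys /ha card_cU // chi3v_sys //.
by case: xs nx {cx} => [//|x xs] _; rewrite mul1r.
Qed.

Lemma asys_even (T : finType) (pi : {perm T}) (b : {set T}) : (0 < #|b|)%N -> ~~ odd #|b| ->
  chi3 #|b|./2 b pi = 0.
Proof. by move=> b0 eb; apply: chi3_vanish; rewrite b0 /= mul2n even_halfK. Qed.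

Lemma dec1_mk (T : finType) (pi : {perm T}) xs (G : seq nat -> seq nat -> {poly rat}) :
  \sum_(d <- dec pi 1 xs) G (lens pi d.1) (lens pi d.2) =
  \sum_(m <- mk (lens pi xs)) G m.1 m.2.
Proof.
have := dec_mk pi xs G (isT : (0 < 1)%N); rewrite expg1 => ->; apply: eq_bigr => m _.
rewrite (eq_all (a2 := xpredT)) => [|y]; last exact: dvd1n.
rewrite all_predT exp1n mul1r; congr (G _ _); rewrite -[RHS]map_id; apply: eq_map => y; exact: divn1.
Qed.

Lemma dec1_sum0 (T : finType) (pi : {perm T}) x0 xs (F : {set T} -> {poly rat}) : csys pi (x0 :: xs) ->
  \sum_(b : {set T} | [&& x0 \in b, b \subset cU pi (x0 :: xs) & pi @: b == b]) F b =
  \sum_(d <- dec pi 1 xs) F (cU pi (x0 :: d.1)).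
Proof.
move=> c; have := dec_sum0 F (isT : (0 < 1)%N) c; rewrite dvd1n expg1 => <-.
by apply: eq_bigl => b; rewrite percyc1.
Qed.

Lemma dec1_sys (T : finType) (pi : {perm T}) xs d : csys pi xs -> d \in dec pi 1 xs ->
  [/\ csys pi d.1, csys pi d.2, cU pi d.1 \subset cU pi xs & cU pi d.2 = cU pi xs :\: cU pi d.1].
Proof.
by move=> c /(dec_sys (isT : (0 < 1)%N) c); rewrite expg1 orb1 => -[? ? _ ? ?].
Qed.

Lemma polyN0 (q : {poly rat}) : q = - q -> q = 0.
Proof.
move=> e; apply/polyP => j; rewrite coef0; apply: eqN0.
by rewrite {1}e coefN.
Qed.

(** [chi3_two] for a permutation to which two fixed points p0, p1 are adjoined. The third point x is
    one of the other fixed points, which is the factor p_1, and each of the three pieces contains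
    one of p0, p1, x as a marked fixed point, which gives u three times. The number of letters is
    one more than the sum over the pieces, hence the minus sign. *)
Lemma ha_rec : hD 1 (hD 1 ha) = - (hp1 * (hD 1 ha * (hD 1 ha * hD 1 ha))).
Proof.
set u := hD 1 ha; apply/funext => l; rewrite hatNE.
have [l0|l0] := boolP (0%N \in l).
  rewrite /u /hD ha_pos ?in_cons ?l0 ?orbT //.
  have up : hpos u by move=> l' l'0; rewrite /u /hD ha_pos // in_cons l'0 orbT.
  rewrite hmul_pos ?oppr0 //; last by do !apply: hmul_pos.
  by move=> l' l'0; rewrite /hp1; case: eqP l'0 => [->|].
(* In even degree both sides vanish by parity. *)
have [el|ol] := boolP (odd (sumn l)); last first.
  rewrite /u /hD ha_even //=; last by rewrite negbK.
  have : Gam (-1) (hp1 * (u * (u * u))) = - (hp1 * (u * (u * u))).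
    by rewrite !GamM Gam_p1 Gam_Da; apply/funext => l'; rewrite -mulrA hCM hatNE mulN1r.
  move=> /(congr1 (fun F : hat => F l)); rewrite hatNE /Gam -signr_odd (negbTE ol) expr0 mul1r => e.
  by rewrite -/u (polyN0 e) oppr0.
have l1 : 0%N \notin [:: 1, 1 & l]%N by rewrite !in_cons.
have [T [p [[|p0 [|p1 xs]] [cx ex]]]] := sys_exists l1 => //.
case: ex => e0 e1 ex; set N := cU p [:: p0, p1 & xs].
have := cx; rewrite !csys_cons !cU_cons (porbit_fix e0) (porbit_fix e1) disjoints1 disjoints1.
rewrite !inE negb_or => /and3P[/andP[p01 p0x] p1x cx'].
have NE : N = p0 |: (p1 |: cU p xs) by rewrite /N !cU_cons (porbit_fix e0) (porbit_fix e1).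
have nE : #|N| = (sumn l).+2 by rewrite card_cU //= e0 e1 ex.
have p0N : p0 \in N by rewrite NE !inE eqxx.
have p1N : p1 \in N by rewrite NE !inE eqxx orbT.
have piN : {in N, forall x, p x \in N} by move=> x; rewrite cU_stable.
have Nodd : #|N| = (2 * #|N|./2).+1.
  by have := odd_double_half #|N|; rewrite nE /= negbK el -mul2n; lia.
have r0 : (0 < #|N|./2)%N by rewrite nE.
have two := chi3_two p01 p0N p1N Nodd r0 piN (lens_fix e0) (lens_fix e1).
have -> : hD 1 u l = (asys p N)%:P.
  by rewrite /u /hD asysE //= e0 e1 ex.
have {}two : (asys p N)%:P = - (\sum_(x | [&& x \in N, x != p0, x != p1 & p x == x])
  \sum_(A : {set T} | [&& p0 \in A, A \subset N, p1 \notin A, x \notin A & p @: A == A])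
  \sum_(B : {set T} | [&& p1 \in B, B \subset N :\: A, x \notin B & p @: B == B])
   ((asys p A)%:P * ((asys p B)%:P * (asys p (N :\: A :\: B))%:P))).
  have E : asys p N = - (\sum_(x | [&& x \in N, x != p0, x != p1 & p x == x])
     \sum_(A : {set T} | [&& p0 \in A, A \subset N, p1 \notin A, x \notin A & p @: A == A])
     \sum_(B : {set T} | [&& p1 \in B, B \subset N :\: A, x \notin B & p @: B == B])
     (asys p A * (asys p B * asys p (N :\: A :\: B)))).
    rewrite {1}/asys two mulr_sumr -sumrN; apply: eq_bigr => x /and4P[xN _ _ _].
    rewrite mulr_sumr -sumrN; apply: eq_bigr => A /and5P[p0A AN p1A xA _].
    rewrite mulr_sumr -sumrN; apply: eq_bigr => B /and4P[p1B BN xB _].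
    have xC : x \in N :\: A :\: B by rewrite !inE xA xB.
    have ps (b : {set T}) y : y \in b -> (0 < #|b|)%N by move=> yb; apply/card_gt0P; exists y.
    rewrite /asys; have [oA|eA] := boolP (odd #|A|); last by rewrite (asys_even _ (ps _ _ p0A) eA); ring.
    have [oB|eB] := boolP (odd #|B|); last by rewrite (asys_even _ (ps _ _ p1B) eB); ring.
    have [oC|eC] := boolP (odd #|N :\: A :\: B|); last by rewrite (asys_even _ (ps _ _ xC) eC); ring.
    have := odd_double_half #|A|; have := odd_double_half #|B|; have := odd_double_half #|N :\: A :\: B|.
    rewrite oA oB oC; have := cardsID A N; have := cardsID B (N :\: A).
    rewrite (setIidPr AN) (setIidPr BN) => s1 s2 t1 t2 t3.
    have -> : #|N|./2 = (#|A|./2 + (#|B|./2 + #|N :\: A :\: B|./2)).+1 by clear -s1 s2 t1 t2 t3 Nodd; lia.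
    rewrite exprS !exprD; ring.
  rewrite E rmorphN rmorph_sum; congr (- _); apply: eq_bigr => x _; rewrite rmorph_sum.
  apply: eq_bigr => A _; rewrite rmorph_sum; apply: eq_bigr => B _; by rewrite !rmorphM.
rewrite two -ex hp1M_sys ?(csys_uniq cx') //; congr (- _).
have xsP x : [&& x \in N, x != p0, x != p1 & p x == x] = (x \in xs) && (#|porbit p x| == 1%N).
  apply/and4P/andP => [[xN x0 x1 /eqP fx]|[xx /eqP ox]].
    rewrite (fix_lens fx) eqxx; split=> //.
    move: xN; rewrite NE !inE (negbTE x0) (negbTE x1) mem_cU => /hasP[y yx].
    rewrite -eq_porbit_mem (porbit_fix (fix_lens fx)) => /eqP ey.
    by have := porbit_id p y; rewrite -ey inE => /eqP <-.
  have xU : x \in cU p xs by rewrite mem_cU; apply/hasP; exists x; rewrite ?porbit_id.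
  rewrite NE !inE xU !orbT (lens_fix ox) eqxx; split=> //.
    by apply: contraNneq p0x => <-.
  by apply: contraNneq p1x => <-.
transitivity (\sum_(x in xs | #|porbit p x| == 1%N)
   \sum_(A : {set T} | [&& p0 \in A, A \subset N, p1 \notin A, x \notin A & p @: A == A])
  \sum_(B : {set T} | [&& p1 \in B, B \subset N :\: A, x \notin B & p @: B == B])
   ((asys p A)%:P * ((asys p B)%:P * (asys p (N :\: A :\: B))%:P))).
  by apply: eq_bigl => x; rewrite xsP.
rewrite big_mkcondr -big_uniq ?(csys_uniq cx') //= [RHS]big_mkcond big_seq [RHS]big_seq.
apply: eq_bigr => x xx; case: eqP => // ox.
have px := perm_to_rem xx; set ys := rem x xs in px *.
have := cx'; rewrite (csys_perm p px) csys_cons (porbit_fix ox) disjoints1 => /andP[xy cy].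
have UE : cU p xs = x |: cU p ys by rewrite (cU_perm p px) cU_cons (porbit_fix ox).
move: p0x p1x; rewrite UE !inE !negb_or => /andP[p0x p0y] /andP[p1x p1y].
have c0 : csys p (p0 :: ys) by rewrite csys_cons (porbit_fix e0) disjoints1 p0y.
rewrite (eq_bigl (fun A : {set T} => [&& p0 \in A, A \subset cU p (p0 :: ys) & p @: A == A])); last first.
  move=> A; have -> : cU p (p0 :: ys) = N :\ p1 :\ x.
    apply/setP => z; rewrite NE UE cU_cons (porbit_fix e0) !inE.
    case: (eqVneq z x) => [->|zx]; first by rewrite (negbTE xy) eq_sym (negbTE p0x).
    case: (eqVneq z p1) => [->|zp]; first by rewrite (negbTE p1y) eq_sym (negbTE p01).
    by [].
  by rewrite !subsetD1 -!andbA.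
rewrite dec1_sum0 //.
transitivity (\sum_(d <- dec p 1 ys) u (lens p d.1) * (u * u) (lens p d.2)); last first.
  by rewrite [RHS]hatM_mk -(dec1_mk p ys (fun l1 l2 => u l1 * (u * u) l2)).
rewrite big_seq [RHS]big_seq; apply: eq_bigr => d dd; have [d1 d2 d3 d4] := dec1_sys cy dd.
set A := cU p (p0 :: d.1).
have c1 : csys p (p1 :: d.2).
  by rewrite csys_cons (porbit_fix e1) disjoints1 d2 andbT d4 inE (negbTE p1y) andbF.
rewrite (eq_bigl (fun B : {set T} => [&& p1 \in B, B \subset cU p (p1 :: d.2) & p @: B == B])); last first.
  move=> B; have -> : cU p (p1 :: d.2) = N :\: A :\ x.
    apply/setP => z; rewrite NE UE /A !cU_cons (porbit_fix e0) (porbit_fix e1) d4 !inE.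
    case: (eqVneq z x) => [->|zx]; first by rewrite (negbTE xy) eq_sym (negbTE p1x) andbF.
    case: (eqVneq z p1) => [->|zp] /=.
      by rewrite eq_sym (negbTE p01) (contraNF (subsetP d3 p1)).
    by case: (eqVneq z p0) => [->|zp0] //=; rewrite (negbTE p0y) andbF.
  by rewrite !subsetD1 -!andbA.
rewrite dec1_sum0 // hatM_mk -(dec1_mk p d.2 (fun l1 l2 => u l1 * u l2)) mulr_sumr.
rewrite big_seq [RHS]big_seq; apply: eq_bigr => d' dd'; have [d1' d2' d3' d4'] := dec1_sys d2 dd'.
have CE : N :\: A :\: cU p (p1 :: d'.1) = cU p (x :: d'.2).
  apply/setP => z; rewrite NE UE /A !cU_cons (porbit_fix e0) (porbit_fix e1) (porbit_fix ox) d4' d4 !inE.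
  have nd y : y \notin cU p ys -> (y \in cU p d.1) = false by move=> h; apply: contraNF h; apply: (subsetP d3).
  have nd' y : y \notin cU p ys -> (y \in cU p d'.1) = false.
    by move=> h; apply: contraNF h => /(subsetP d3'); rewrite d4 inE => /andP[].
  case: (eqVneq z x) => [->|zx].
    by rewrite (nd _ xy) (nd' _ xy) ![x == _]eq_sym (negbTE p1x) (negbTE p0x) !orbT.
  case: (eqVneq z p1) => [->|zp] /=; first by rewrite (negbTE p1y) !andbF.
  by case: (eqVneq z p0) => [->|zp0] //=; rewrite ?(negbTE p0y) ?andbF.
have g1 : csys p (p0 :: d.1).
  by rewrite csys_cons (porbit_fix e0) disjoints1 d1 andbT; apply: contra p0y; apply: (subsetP d3).
have g2 : csys p (p1 :: d'.1).
  rewrite csys_cons (porbit_fix e1) disjoints1 d1' andbT; apply: contra p1y => /(subsetP d3').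
  by rewrite d4 inE => /andP[].
have g3 : csys p (x :: d'.2).
  by rewrite csys_cons (porbit_fix ox) disjoints1 d2' andbT d4' d4 !inE (negbTE xy) !andbF.
by rewrite CE !asysE // /u /hD /= e0 e1 ox.
Qed.

(** * One fixed point removed, many fixed points collapsed *)

Lemma hZ_D1 : hD 1 hZ = hP.
Proof.
apply/funext => l; have [l0|l0] := boolP (0%N \in l).
  by rewrite /hD hZ_pos ?hP_pos // in_cons l0 orbT.
have l1 : 0%N \notin 1%N :: l by rewrite in_cons.
have [T [p [[|x0 xs] [cx ex]]]] := sys_exists l1 => //; case: (ex) => e0 el.
rewrite /hD /hZ /= (@hP_cut (1 + sumn l).+1) ?ltnS ?leq_addl //.
apply: eq_bigr => k _; congr (_ * _%:P); rewrite -ex -chi4v_sys //.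
have := cx; rewrite csys_cons (porbit_fix e0) disjoints1 => /andP[x0x cx'].
rewrite cU_cons (porbit_fix e0) chi4_cone ?chi3v_sys ?el // ?(lens_fix e0) //.
by move=> x; rewrite cU_stable.
Qed.

Lemma sum_subsets (T : finType) (J0 : {set T}) (g : nat -> rat) :
  \sum_(J : {set T} | J \subset J0) g #|J| = \sum_(j < #|J0|.+1) g j *+ 'C(#|J0|, j).
Proof.
rewrite (partition_big (fun J : {set T} => inord #|J| : 'I_#|J0|.+1) xpredT) //=.
apply: eq_bigr => j _; rewrite -cards_draws -sumr_const; apply: eq_big => [J|J].
  rewrite inE; have [sJ|//] := boolP (J \subset J0).
  by rewrite -val_eqE /= inordK // ltnS subset_leq_card.
by case/andP=> sJ /eqP <-; rewrite inordK // ltnS subset_leq_card.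
Qed.

(** The d fixed points form the set J0 of [chi4_collapse]; a point of the cycles in [l] serves as
    the point onto which they are collapsed, so [l] must be nonempty. *)
Lemma chi4v_collapse k l d : l != [::] -> 0%N \notin l -> (4 * k < d)%N ->
  \sum_(j < d.+1) ((-1) ^+ j * chi4v k (nseq (d - j) 1%N ++ l)) *+ 'C(d, j) = 0.
Proof.
move=> ln l0 kd; have ll0 : 0%N \notin nseq d 1%N ++ l.
  by rewrite mem_cat negb_or l0 andbT mem_nseq andbF.
have [T [p [xs [cx ex]]]] := sys_exists ll0.
pose fs := take d xs; pose ys := drop d xs.
have exs : xs = fs ++ ys by rewrite cat_take_drop.
have sx : size xs = (d + size l)%N by rewrite -(size_map (fun x => #|porbit p x|)) -/(lens p xs) ex size_cat size_nseq.
have efs : lens p fs = nseq d 1%N.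
  by rewrite /lens /fs map_take -/(lens p xs) ex take_size_cat ?size_nseq.
have eys : lens p ys = l by rewrite /lens /ys map_drop -/(lens p xs) ex drop_size_cat ?size_nseq.
have f1 x : x \in fs -> #|porbit p x| = 1%N.
  by move=> xf; apply/eqP; have := map_f (fun x => #|porbit p x|) xf; rewrite -/(lens p fs) efs mem_nseq => /andP[_].
have ux := csys_uniq cx.
have ufs : uniq fs by rewrite take_uniq.
pose J0 := [set x in fs].
have cJ : #|J0| = d by rewrite cardsE (card_uniqP ufs) size_take sx; case: (l) ln => [//|? ?] _ /=; case: ltnP; lia.
have [y yy] : exists y, y \in ys by case: (ys) eys => [e|y s _]; [rewrite -e in ln|exists y; rewrite mem_head].
have cUc us vs : cU p (us ++ vs) = cU p us :|: cU p vs by rewrite /cU big_cat.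
have csc us vs : csys p (us ++ vs) -> [disjoint cU p us & cU p vs].
  elim: us => [|z us IHu]; first by rewrite cU_nil -setI_eq0 set0I.
  rewrite /= csys_cons cUc cU_cons => /andP[d1 /IHu d2].
  by rewrite -setI_eq0 setIUl setU_eq0 !setI_eq0 d2 andbT; apply: disjointWr d1; apply: subsetUr.
have UfE us : {subset us <= fs} -> cU p us = [set x in us].
  elim: us => [|z us IHu] sub; first by rewrite cU_nil; apply/setP => z; rewrite !inE.
  rewrite cU_cons IHu; last by move=> t tu; apply: sub; rewrite in_cons tu orbT.
  by rewrite (porbit_fix (f1 z _)) ?sub ?mem_head //; apply/setP => t; rewrite !inE.
have J0E : cU p fs = J0 by rewrite UfE.
have dJ : [disjoint J0 & cU p ys] by rewrite -J0E; apply: csc; rewrite -exs.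
have yU : y \in cU p ys by rewrite mem_cU; apply/hasP; exists y; rewrite ?porbit_id.
have ME : cU p xs = J0 :|: cU p ys by rewrite exs cUc J0E.
have := @chi4_collapse T k (cU p xs) J0 p y; rewrite cJ => H.
rewrite -[RHS]H //; last first.
- by rewrite ME !inE yU orbT andbT; have := disjointFl dJ yU; rewrite inE => ->.
- move=> x; rewrite inE => /andP[xJ _]; apply: contra xJ => h.
  by have : p (p x) = p x; [apply/lens_fix/f1; move: h; rewrite inE|move=> /perm_inj e; rewrite -e].
- by move=> x; rewrite inE => xf; apply/lens_fix/f1.
- by rewrite ME subsetUl.
- by move=> x; rewrite cU_stable.
rewrite -[in LHS]cJ -(sum_subsets J0 (fun j => (-1) ^+ j * chi4v k (nseq (#|J0| - j) 1%N ++ l))).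
apply: eq_bigr => J sJ; congr (_ * _).
pose us := [seq x <- fs | x \notin J].
have ssub : {subset us <= fs} by move=> x; rewrite mem_filter => /andP[].
have ss : subseq (us ++ ys) xs by rewrite exs cat_subseq // filter_subseq.
have cus : csys p (us ++ ys) by apply: subseq_uniq cx; apply: map_subseq.
have -> : cU p xs :\: J = cU p (us ++ ys).
  rewrite cUc (UfE us) // ME; apply/setP => x; rewrite !inE mem_filter.
  have [xU|xU] /= := boolP (x \in cU p ys); last by rewrite !orbF.
  rewrite !orbT andbT; apply/negP => /(subsetP sJ) h; by have := disjointFl dJ xU; rewrite h.
rewrite chi4v_sys //; last by case: (us) => //; case: (ys) yy.
congr (chi4v k _); rewrite /lens map_cat -!/(lens p _) eys; congr (_ ++ _).
have -> : lens p us = nseq (size us) 1%N.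
  rewrite -(size_map (fun x => #|porbit p x|) us); apply/all_pred1P; rewrite all_map.
  by apply/allP => x /ssub /f1 /= ->.
congr (nseq _ _); have <- : #|[set x in us]| = size us by rewrite cardsE; apply/card_uniqP; rewrite filter_uniq.
have -> : [set x in us] = J0 :\: J by apply/setP => x; rewrite !inE mem_filter.
by rewrite cardsD (setIidPr sJ).
Qed.

(** D_1 conjugated by multiplication with Exp ([iter_DlE]): its d-th iterate kills F exactly when F
    Exp^(-1) has degree less than d in p_1. *)
Definition Dl (F : hat) : hat := hD 1 F - F.

Lemma iter_Dl d (F : hat) l :
  iter d Dl F l = \sum_(j < d.+1) ((-1) ^+ j * F (nseq (d - j) 1%N ++ l)) *+ 'C(d, j).
Proof.
elim: d F => [|d IHd] F; first by rewrite big_ord1 expr0 mul1r.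
rewrite iterSr IHd; pose f j := F (nseq (d.+1 - j) 1%N ++ l).
transitivity (\sum_(j < d.+1) ((-1) ^+ j * f j) *+ 'C(d, j) -
              \sum_(j < d.+1) ((-1) ^+ j * f j.+1) *+ 'C(d, j)).
  rewrite -sumrB; apply: eq_bigr => j _; rewrite -mulrnBl -mulrBr; congr (_ * _ *+ _).
  by rewrite /Dl hatDE hatNE /hD /f subSS subSn // -ltnS.
rewrite [RHS]big_ord_recl [X in X - _]big_ord_recl !bin0 -!addrA; congr (_ + _).
transitivity (\sum_(j < d.+1) ((-1) ^+ j.+1 * f j.+1) *+ 'C(d, j.+1) -
              \sum_(j < d.+1) ((-1) ^+ j * f j.+1) *+ 'C(d, j)).
  by congr (_ - _); rewrite [RHS]big_ord_recr /= bin_small // mulr0n addr0.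
rewrite -sumrB; apply: eq_bigr => j _; rewrite binS mulrnDr; congr (_ + _).
by rewrite -mulNrn exprS mulN1r mulNr.
Qed.

Lemma coef_mt (c : nat -> rat) n i : (\sum_(k < n) mt ^+ k * (c k)%:P)`_i =
  if odd i then 0 else if (i./2 < n)%N then (-1) ^+ i./2 * c i./2 else 0.
Proof.
rewrite coef_sum; have E (k : 'I_n) : (mt ^+ k * (c k)%:P)`_i = (-1) ^+ k * c k *+ (i == k.*2).
  rewrite coefMC (exprNn 'X^2) -exprM -signp coefCM coefXn mul2n.
  by case: (i == _); rewrite ?mulr1 // mulr0 mul0r.
rewrite (eq_bigr _ (fun k _ => E k)).
have [oi|ei] := boolP (odd i).
  by rewrite big1 // => k _; case: eqP => // e; rewrite e odd_double in oi.
have ei' : i = i./2.*2 by rewrite even_halfK.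
case: ltnP => [lt|ge].
  rewrite (bigD1 (Ordinal lt)) //= -ei' eqxx mulr1n big1 ?addr0 // => k ne.
  by case: eqP => // e; case/eqP: ne; apply: val_inj; rewrite /= e doubleK.
by rewrite big1 // => k _; case: eqP => // e; rewrite e doubleK leqNgt ltn_ord in ge.
Qed.

Lemma hZ_coef l i : l != [::] -> (hZ l)`_i = if odd i then 0 else (-1) ^+ i./2 * chi4v i./2 l.
Proof.
move=> ln; rewrite /hZ (negbTE ln) (coef_mt (fun k => chi4v k l)); case: odd => //.
by case: ltnP => // h; rewrite chi4v_big ?mulr0.
Qed.

(** The coefficient of s^i belongs to Lambda_(i/2), whose words mention at most 2i points. *)
Lemma hZ_collapse d l i : l != [::] -> (2 * i < d)%N -> (iter d Dl hZ l)`_i = 0.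
Proof.
move=> ln di; rewrite iter_Dl coef_sum.
have [l0|l0] := boolP (0%N \in l).
  by rewrite big1 // => j _; rewrite hZ_pos ?mulr0 ?mul0rn ?coef0 // mem_cat l0 orbT.
have nn j : nseq j 1%N ++ l != [::] by case: (l) ln => // a l' _; case: j.
have E (j : 'I_d.+1) : (((-1) ^+ j * hZ (nseq (d - j) 1%N ++ l)) *+ 'C(d, j))`_i =
   (if odd i then 0 else (-1) ^+ i./2) * (((-1) ^+ j * chi4v i./2 (nseq (d - j) 1%N ++ l)) *+ 'C(d, j)).
  rewrite coefMn -signp coefCM hZ_coef //; case: ifP => _; first by rewrite mulr0 mul0r mul0rn.
  by rewrite -mulrnAr mulrnAr; ring.
rewrite (eq_bigr _ (fun j _ => E j)) -mulr_sumr chi4v_collapse ?mulr0 //.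
by clear -di; lia.
Qed.

(** * Solving the differential equations *)

Lemma chi3_0 (T : finType) (N : {set T}) pi : chi3 0 N pi = 1.
Proof.
have VF f : V3 0 N f -> V3 0 N (pullr N 0 pi f) by case=> H _; apply: V3_pullr.
pose fr := [:: ([::] : seq (T * T * T), fun w : seq (T * T * T) => (w == [::])%:R : rat)].
rewrite /chi3 (TrE (fr := fr) _ (lin_pullr _ _ _) VF); first by rewrite /trF /fr big_seq1 /pullr /restr.
split=> [p|f [_ H]].
  rewrite inE => /eqP -> /=; split; first exact: Adm_delta0.
  by case=> //= g w; rewrite andbF.
apply/funext => -[|g w]; first by rewrite /lc_fn big_seq1 /= mulr1.
by rewrite /lc_fn big_seq1 /= mulr0 H //= andbF.
Qed.

Lemma ha_1 : ha [:: 1%N] = 1.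
Proof.
have [T [p [xs [cx ex]]]] := @sys_exists [:: 1%N] isT.
by rewrite /ha /= -ex -chi3v_sys // chi3_0 mulr1.
Qed.

Lemma hCM2 c d : hC (c * d) = hC c * hC d.
Proof. by apply/funext => l; rewrite hCM /hC mulrA. Qed.
Lemma hCD c d : hC (c + d) = hC c + hC d.
Proof. by apply/funext => l; rewrite hatDE /hC mulrDl. Qed.
Lemma hC1 : hC 1 = 1.
Proof. by apply/funext => l; rewrite /hC mul1r. Qed.
Lemma hCN c : hC (- c) = - hC c.
Proof. by apply/funext => l; rewrite hatNE /hC mulNr. Qed.

Lemma hpsi1 F : hpsi 1 F = F.
Proof.
apply/funext => l; rewrite /hpsi; have -> : all (dvdn 1) l by apply/allP => x _; rewrite dvd1n.
rewrite exp1n mul1r expr1 comp_polyXr; congr (F _).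
by rewrite -[RHS]map_id; apply: eq_map => x; rewrite divn1.
Qed.

(** The geometric series for 1/u when u has constant term 1, cut off at the degree of the list. *)
Definition hinv (u : hat) : hat := fun l => (\sum_(m < (sumn l).+1) (1 - u) ^+ m) l.

Lemma hX_val (v : hat) m l : (forall l, sumn l = 0%N -> v l = 0) -> (sumn l < m)%N -> (v ^+ m) l = 0.
Proof.
move=> v0; elim: m l => [//|m IHm] l lt; rewrite exprS.
apply: (@hmul_val 1 m) => // l'; rewrite ltnS leqn0 => /eqP; exact: v0.
Qed.

Lemma mul_hinv (u : hat) : u [::] = 1 -> hpos u -> u * hinv u = 1.
Proof.
move=> u1 up; apply/funext => l; set n := sumn l.
have v0 m : sumn m = 0%N -> (1 - u) m = 0.
  move=> m0; rewrite hatDE hatNE; have [z|z] := boolP (0%N \in m).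
    by rewrite up // hat1E subr0; case: (m) z.
  by rewrite (sumn0 m0 z) u1 subrr.
rewrite (@hmul_eq_le n _ u _ (\sum_(m < n.+1) (1 - u) ^+ m)) //; last first.
  move=> l' le; rewrite /hinv !hat_sumE -!(big_mkord xpredT (fun m => ((1 - u) ^+ m) l')).
  rewrite [RHS](big_cat_nat (n := (sumn l').+1)) //= [X in _ = _ + X]big_nat_cond [X in _ = _ + X]big1 ?addr0 //.
  by move=> m /andP[/andP[h _] _]; apply: hX_val.
have := subrX1 (1 - u) n.+1; rewrite [1 - u - 1]addrAC subrr sub0r mulNr => /eqP.
rewrite eq_sym eqr_oppLR opprB => /eqP ->.
by rewrite hatDE hatNE hX_val // subr0.
Qed.

Lemma hinv_uniq (u v w : hat) : u * v = 1 -> u * w = 1 -> v = w.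
Proof. by move=> uv uw; rewrite -[v]mulr1 -uw mulrA [v * u]mulrC uv mul1r. Qed.

Definition hu : hat := hD 1 ha.
Definition hc : hat := hinv hu.

Lemma hucE : hu * hc = 1.
Proof.
by apply: mul_hinv; [exact: ha_1|move=> l l0; apply: ha_pos; rewrite in_cons l0 orbT].
Qed.

Lemma hc_nil : hc [::] = 1.
Proof. by have := congr1 (fun F : hat => F [::]) hucE; rewrite hatM_nil /hu /hD ha_1 mul1r. Qed.

Lemma hD1_c : hD 1 hc = hp1 * hu.
Proof.
have := congr1 (hD 1) hucE; rewrite hD_1 hD_mul {1}/hu ha_rec -/hu => /eqP.
rewrite mulNr addrC subr_eq0 => /eqP E.
have -> : hD 1 hc = (hu * hc) * hD 1 hc by rewrite hucE mul1r.
rewrite mulrAC E; transitivity (hp1 * hu * ((hu * hc) * (hu * hc))); first by ring.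
by rewrite hucE !mulr1.
Qed.

Lemma Gam_hc : Gam (-1) hc = hc.
Proof.
apply: (@hinv_uniq hu); last exact: hucE.
by rewrite {1}/hu -Gam_Da -/hu -GamM hucE Gam1.
Qed.

Lemma hD1_x : hD 1 hx = Gam 'X hu.
Proof. by apply/funext => l; rewrite /hD hx_a. Qed.

Definition hY : hat := (Gam 'X hc - hC 'X^2 * hp1) * hP.

Lemma hD1_P : hD 1 hP = hP * Gam 'X hu.
Proof. by rewrite hP_rec (_ : divisors 1 = [:: 1%N]) // big_seq1 hpsi1 divn1 hD1_x. Qed.

Lemma hD1_Y : hD 1 hY = hC (1 - 'X^2) * hP.
Proof.
have UC : Gam 'X hu * Gam 'X hc = 1 by rewrite -GamM hucE Gam1.
rewrite /hY hD_mul hD_add hD_opp hD_mul hD_C mul0r add0r hD_p1 mulr1 hD_Gam expr1 hD1_c GamM Gam_p1 hD1_P.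
rewrite hCD hCN hC1 expr2 hCM2.
move: UC; move: (Gam 'X hu) (Gam 'X hc) (hC 'X) hp1 hP => U C x p P UC.
transitivity ((U * C) * P - x * x * P); last by rewrite UC; ring.
by ring.
Qed.

Lemma hEinv_pos : hpos hEinv.
Proof.
by move=> l l0; rewrite /hEinv /hexp (perm_big _ (perm_to_rem l0)) big_cons /= oppr0 mul0r.
Qed.

Lemma hD_E m : (0 < m)%N -> hD m hE = hE.
Proof. by move=> m0; rewrite hD_exp m0 hC1 mul1r. Qed.
Lemma hD_Einv m : (0 < m)%N -> hD m hEinv = - hEinv.
Proof. by move=> m0; rewrite hD_exp m0 polyCN hCN hC1 mulN1r. Qed.

Lemma sumn_div i l : all (dvdn i) l -> (sumn [seq (x %/ i)%N | x <- l] * i = sumn l)%N.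
Proof. by elim: l => [//|a l IHl] /= /andP[ia /IHl <-]; rewrite mulnDl divnK. Qed.

(* [val e F]: in the coefficient of [p_l], the power of [s] is at least 2/3 of the degree |l| + e. *)
Definition val e (F : hat) := forall l j, (3 * j < 2 * (sumn l + e))%N -> (F l)`_j = 0.

(** The bound on F is asked only on lists no longer than [l], so that the induction in [val_ode] can
    supply it. *)
Lemma valM_at e (F G : hat) l j : (3 * j < 2 * (sumn l + e))%N ->
  (forall m i, (size m <= size l)%N -> (3 * i < 2 * sumn m)%N -> (F m)`_i = 0) -> val e G -> ((F * G) l)`_j = 0.
Proof.
move=> jl vF vG; rewrite hatM_mk coef_sum big_seq big1 // => x xl.
have sx := mk_sumn xl; have zx : (size x.1 <= size l)%N.
  by have := perm_size (mk_mem xl); rewrite size_cat => <-; apply: leq_addr.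
rewrite coefM big1 // => i _.
case: (ltnP (3 * i) (2 * sumn x.1)) => [h|h]; first by rewrite vF // mul0r.
rewrite vG ?mulr0 //; move: (sumn x.1) (sumn x.2) (sumn l) (nat_of_ord i) (ltn_ord i) h sx jl; clear.
by move=> a b c i' h1 h2 h3 h4; lia.
Qed.

Lemma valM (F G : hat) : val 0 F -> val 0 G -> val 0 (F * G).
Proof. by move=> vF vG l j jl; apply: (valM_at jl) => // m i _ h; apply: vF; rewrite addn0. Qed.

Lemma val_ode (F : hat) h : (forall m, hD m F = F * h m) -> (forall m, val m (h m)) -> val 0 F.
Proof.
move=> dF vh; suff H n l j : (size l <= n)%N -> (3 * j < 2 * sumn l)%N -> (F l)`_j = 0.
  by move=> l j; rewrite addn0; apply: H.
elim: n l j => [|n IHn] [|a l] j //= sl jl.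
rewrite -[F (a :: l)]/(hD a F l) dF; apply: (@valM_at a) => //; first by rewrite addnC.
by move=> m i sm; apply: IHn; apply: leq_trans sm sl.
Qed.

(** psi_i multiplies the power of s and the degree alike by i, so the ratio is kept; the m/i taken
    by the derivative becomes m. *)
Lemma val_psi i m (y : hat) : (i %| m)%N -> (0 < i)%N -> val 0 y -> val m (hpsi i (hD (m %/ i) y)).
Proof.
move=> im i0 vy l j jl; rewrite /hpsi; case: ifP => al; last by rewrite coef0.
rewrite coefnM coef_comp_poly_Xn //; case: ifP => ij; last by rewrite mulr0.
rewrite /hD vy ?mulr0 //= addn0; have := sumn_div al; move: (sumn [seq _ | _ <- _]) => s e.
have e1 := divnK im; have e2 := divnK ij; clear -jl e e1 e2 i0; nia.
Qed.

Definition hy : hat := hx - hp1.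

Lemma hp1_pos : hpos hp1.
Proof. by move=> l l0; rewrite /hp1; case: eqP l0 => // ->. Qed.

Lemma hy_pos : hpos hy.
Proof. by move=> l l0; rewrite /hy hatDE hatNE hx_pos // hp1_pos // subr0. Qed.

Lemma sumn1 l : 0%N \notin l -> sumn l = 1%N -> l = [:: 1%N].
Proof.
case: l => [//|a l]; rewrite in_cons negb_or /= => /andP[a0 l0] s.
have e : sumn l = 0%N by clear -a0 s; lia.
by rewrite (sumn0 e l0) in s *; congr (_ :: _); move: s => /=; rewrite addn0.
Qed.

(** For odd |l| >= 3 one has |l| - 1 >= 2|l|/3, with equality at 3, which is the origin of the
    ratio. The exception |l| = 1 is removed by subtracting p_1. *)
Lemma val_hy : val 0 hy.
Proof.
move=> l j; rewrite addn0 => jl; have [l0|l0] := boolP (0%N \in l); first by rewrite hy_pos ?coef0.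
rewrite /hy hatDE hatNE; have [s1|s1] := eqVneq (sumn l) 1%N.
  by rewrite (sumn1 l0 s1) hx_a /= ha_1 mulr1 /hp1 /= subrr coef0.
have -> : hp1 l = 0 by rewrite /hp1; case: eqP => // e; rewrite e in s1.
rewrite subr0 hx_a coefXnM; case: ltnP => // h; have [ol|el] := boolP (odd (sumn l)); last first.
  by rewrite ha_even ?coef0.
by exfalso; clear -ol s1 jl h; lia.
Qed.

Lemma hpsi_id m : (0 < m)%N -> hpsi m 1 = 1.
Proof.
move=> m0; apply/funext => -[|a l].
  by rewrite /hpsi /= hat1E mul1r -polyC1 comp_polyC.
by rewrite /hpsi hat1E /= comp_poly0 mulr0 if_same.
Qed.

Lemma psi_p1 m : (0 < m)%N -> \sum_(i <- divisors m) hpsi i (hD (m %/ i) hp1) = 1.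
Proof.
move=> m0; rewrite (bigD1_seq m) ?divisors_uniq ?divisors_id //= divnn m0 hD_p1 hpsi_id //.
rewrite big_seq_cond big1 ?addr0 // => i; rewrite -dvdn_divisors // => /andP[im ne].
rewrite hD_p1; case: eqP => [e|_]; last exact: hpsi_0.
by case/eqP: ne; rewrite -{1}(divnK im) e mul1n.
Qed.

Lemma divisors_gt0 i m : i \in divisors m -> (i %| m)%N && (0 < i)%N.
Proof.
case: (posnP m) => [->|m0]; first by rewrite (_ : divisors 0 = [:: 1%N]) // inE => /eqP ->.
by rewrite -dvdn_divisors // => im; rewrite im (dvdn_gt0 m0 im).
Qed.

(** P Exp^(-1) is Exp[x - p_1], used through its logarithmic derivatives. *)
Lemma val_PEinv : val 0 (hP * hEinv).
Proof.
apply: (@val_ode _ (fun m => \sum_(i <- divisors m) hpsi i (hD (m %/ i) hy))) => [m|m l j jl].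
  case: (posnP m) => [->|m0].
    rewrite (_ : divisors 0 = [:: 1%N]) // big_seq1 div0n (hD_0 hy_pos) hpsi_0 mulr0.
    by apply: hD_0; apply: hmul_pos; [exact: hP_pos|exact: hEinv_pos].
  have -> : \sum_(i <- divisors m) hpsi i (hD (m %/ i) hy) =
      \sum_(i <- divisors m) hpsi i (hD (m %/ i) hx) - 1.
    by rewrite -(psi_p1 m0) -sumrB; apply: eq_bigr => i _; rewrite -hpsi_sub.
  by rewrite hD_mul hP_rec hD_Einv //; ring.
rewrite hat_sumE coef_sum big_seq big1 // => i /divisors_gt0/andP[im i0].
by apply: (val_psi im i0 val_hy).
Qed.

Lemma val_YEinv : val 0 (hY * hEinv).
Proof.
rewrite /hY -mulrA; apply: valM => [l j|]; last exact: val_PEinv.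
rewrite addn0 => jl; rewrite hatDE hatNE hCM coefB /Gam !coefXnM.
case: ltnP => h; last by exfalso; clear -h jl; lia.
rewrite sub0r; case: ltnP => h2; first by rewrite oppr0.
rewrite /hp1; case: eqP => [e|_]; last by rewrite coef0 oppr0.
by exfalso; rewrite e /= in jl h; clear -jl h2; lia.
Qed.

Lemma iter_DlE d (F : hat) : iter d Dl (hE * F) = hE * iter d (hD 1) F.
Proof.
elim: d F => [//|d IHd] F; rewrite !iterSr -IHd; congr (iter d Dl _).
by rewrite /Dl hD_mul hD_E //; ring.
Qed.

Lemma iter_hD1 d (F : hat) l : iter d (hD 1) F l = F (nseq d 1%N ++ l).
Proof. by elim: d F => [//|d IHd] F; rewrite iterSr IHd. Qed.

Lemma sumn_ones d l : sumn (nseq d 1%N ++ l) = (d + sumn l)%N.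
Proof. by rewrite sumn_cat sumn_nseq mul1n. Qed.

Lemma hEM_coef (F : hat) j : (forall l, (F l)`_j = 0) -> forall l, ((hE * F) l)`_j = 0.
Proof.
move=> F0 l; rewrite hatM_mk coef_sum big1 // => x _; rewrite hexpE.
by case: (_ \notin _); rewrite ?mul1r ?mul0r ?coef0.
Qed.

Lemma hY_collapse d l j : (3 * j < 2 * d)%N -> (iter d Dl hY l)`_j = 0.
Proof.
move=> jd; have -> : hY = hE * (hY * hEinv) by rewrite mulrCA hEEinv mulr1.
rewrite iter_DlE; apply: hEM_coef => m; rewrite iter_hD1; apply: val_YEinv.
by rewrite sumn_ones addn0; clear -jd; lia.
Qed.

Lemma iter_Dl_sub d (F G : hat) : iter d Dl (F - G) = iter d Dl F - iter d Dl G.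
Proof.
elim: d F G => [//|d IHd] F G; rewrite !iterSr -IHd; congr (iter d Dl _).
by rewrite /Dl hD_add hD_opp; ring.
Qed.
Lemma iter_Dl_C d c (F : hat) : iter d Dl (hC c * F) = hC c * iter d Dl F.
Proof.
elim: d F => [//|d IHd] F; rewrite !iterSr -IHd; congr (iter d Dl _).
by rewrite /Dl hD_mul hD_C mul0r add0r; ring.
Qed.
Lemma iter_Dl_ker d (F : hat) : hD 1 F = 0 -> iter d Dl F = (-1) ^+ d * F.
Proof.
move=> F0; elim: d => [|d IHd]; first by rewrite expr0 mul1r.
have D1 : hD 1 ((-1) ^+ d * F) = 0.
  elim: d {IHd} => [|d IHd]; first by rewrite expr0 mul1r.
  by rewrite exprS mulN1r mulNr hD_opp IHd oppr0.
by rewrite iterS IHd /Dl D1 sub0r exprS mulN1r mulNr.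
Qed.

(** On the p_1-free difference W the operator [Dl] is -1, yet a high iterate of it annihilates each
    coefficient of W on a nonempty list. So W is constant, with value 1 from the empty list. *)
Lemma hY_Z : hY = hC (1 - 'X^2) * hZ + 1.
Proof.
pose W := hY - hC (1 - 'X^2) * hZ.
have D1W : hD 1 W = 0.
  by rewrite /W hD_add hD_opp hD_mul hD_C mul0r add0r hZ_D1 hD1_Y subrr.
suff WE : W = 1 by rewrite -WE /W addrC subrK.
apply/funext => l; have [->|ln] := eqVneq l [::].
  rewrite /W hatDE hatNE hCM /hZ /= mulr0 subr0 /hY hatM_nil hP_nil mulr1 hatDE hatNE hCM.
  by rewrite /hp1 mulr0 subr0 /Gam expr0 mul1r hc_nil.
rewrite hat1E (negbTE ln); apply/polyP => j; rewrite coef0.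
(* The exponent d = 2j+1 satisfies both 3j < 2d and 2j < d. *)
have := congr1 (fun F : hat => (F l)`_j) (iter_Dl_ker (2 * j).+1 D1W).
rewrite {1}/W iter_Dl_sub iter_Dl_C hatDE hatNE hCM coefB hY_collapse; last by clear; lia.
rewrite mulrBl mul1r coefB coefXnM hZ_collapse //.
rewrite (_ : (if (j < 2)%N then _ else _) = 0); last first.
  by case: ltnP => // h; apply: hZ_collapse => //; clear -h; lia.
rewrite !subrr => /esym; elim: (2 * j).+1 => [|d IHd]; first by rewrite expr0 mul1r.
by rewrite exprS mulN1r mulNr hatNE coefN => /eqP; rewrite oppr_eq0 => /eqP.
Qed.

(** * Specialization at s = 1 and the hyperbolic functions *)

(** On each list the value is a polynomial in s, so s = 1 may be inserted. *)
Definition ev1 (F : hat) : hat := fun l => ((F l).[1])%:P.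

Lemma ev1D (F G : hat) : ev1 (F + G) = ev1 F + ev1 G.
Proof. by apply/funext => l; rewrite hatDE /ev1 hatDE hornerD polyCD. Qed.
Lemma ev1N (F : hat) : ev1 (- F) = - ev1 F.
Proof. by apply/funext => l; rewrite hatNE /ev1 hatNE hornerN polyCN. Qed.
Lemma ev1M (F G : hat) : ev1 (F * G) = ev1 F * ev1 G.
Proof.
apply/funext => l; rewrite /ev1 !hatM_mk horner_sum rmorph_sum /=.
by apply: eq_bigr => x _; rewrite hornerM polyCM.
Qed.
Lemma ev1_sum (I : Type) (r : seq I) (F : I -> hat) :
  ev1 (\sum_(i <- r) F i) = \sum_(i <- r) ev1 (F i).
Proof.
apply/funext => l; rewrite /ev1 !hat_sumE horner_sum rmorph_sum /=.
by apply: eq_bigr.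
Qed.
Lemma ev1_1 : ev1 1 = 1.
Proof. by apply/funext => -[|a l]; rewrite /ev1 !hat1E ?hornerC ?horner0. Qed.
Lemma hD_ev1 m F : hD m (ev1 F) = ev1 (hD m F). Proof. by []. Qed.
Lemma hC0 : hC 0 = 0.
Proof. by apply/funext => l; rewrite /hC mul0r. Qed.
Lemma ev1_C c : ev1 (hC c) = hC (c.[1])%:P.
Proof.
apply/funext => l; rewrite /ev1 /hC; case: eqP => _; first by rewrite !mulr1.
by rewrite !mulr0 horner0.
Qed.
Lemma ev1_Gam F : ev1 (Gam 'X F) = ev1 F.
Proof. by apply/funext => l; rewrite /ev1 /Gam hornerM hornerXn expr1n mul1r. Qed.
Lemma ev1_p1 : ev1 hp1 = hp1.
Proof. by apply/funext => l; rewrite /ev1 /hp1; case: eqP => _; rewrite ?hornerC ?horner0. Qed.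
Lemma ev1_ha : ev1 ha = ha.
Proof. by apply/funext => l; rewrite /ev1 /ha hornerC. Qed.
Lemma ev1_hx : ev1 hx = ha.
Proof.
apply/funext => l; rewrite -[in RHS]ev1_ha /ev1 hx_a hornerM hornerXn expr1n mul1r //.
Qed.
Lemma ev1_psi i F : ev1 (hpsi i F) = hpsi i (ev1 F).
Proof.
apply/funext => l; rewrite /ev1 /hpsi; case: ifP => _; last by rewrite horner0.
by rewrite comp_polyC hornerM horner_comp hornerXn expr1n polyCM -polyC_natr hornerC.
Qed.
Lemma ev1_hc : ev1 hc = hc.
Proof.
apply: (@hinv_uniq hu); last exact: hucE.
by rewrite {1}/hu -ev1_ha hD_ev1 -/hu -ev1M hucE ev1_1.
Qed.

Definition sig (a : hat) m : hat := \sum_(i <- divisors m) hpsi i (hD (m %/ i) a).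
Definition sig_tw (a : hat) m : hat :=
  \sum_(i <- divisors m) (-1) ^+ (i.+1) * hpsi i (hD (m %/ i) a).

Lemma hD_evP m : hD m (ev1 hP) = ev1 hP * sig ha m.
Proof.
rewrite hD_ev1 hP_rec ev1M ev1_sum; congr (_ * _); apply: eq_bigr => i _.
by rewrite ev1_psi -hD_ev1 ev1_hx.
Qed.

(* Setting s = 1 in [hY_Z] kills the term involving [hZ]. *)
Lemma c_sub_p1 : (hc - hp1) * ev1 hP = 1.
Proof.
have := congr1 ev1 hY_Z; rewrite /hY ev1M !ev1D ev1N !ev1M ev1_Gam ev1_hc !ev1_C ev1_p1 ev1_1.
by rewrite hornerXn expr1n hC1 mul1r => ->; rewrite !hornerE expr1n subrr hC0 mul0r add0r.
Qed.

Lemma hD_c_sub_p1 m : hD m (hc - hp1) = - (hc - hp1) * sig ha m.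
Proof.
have := congr1 (hD m) c_sub_p1; rewrite hD_1 hD_mul hD_evP => E.
have e := c_sub_p1; move: E e; move: (hc - hp1) (hD m _) (ev1 hP) (sig ha m) => q dq E s.
move=> H e; transitivity (q * (dq * E + q * (E * s)) - q * (q * E) * s + dq * (1 - q * E)); first by ring.
by rewrite e subrr mulr0 addr0 H; ring.
Qed.

(** Since [ha] lives in odd degree, psi_i(D_(m/i) a) lives in degrees n for which m + n is an odd
    multiple of i, hence has the parity of i. *)
Lemma sign_psi i m : (i %| m)%N -> (0 < i)%N ->
  hC ((-1) ^+ m) * Gam (-1) (hpsi i (hD (m %/ i) ha)) = (-1) ^+ i * hpsi i (hD (m %/ i) ha).
Proof.
move=> im i0; have sg n (F : hat) l : ((-1) ^+ n * F) l = (-1) ^+ n * F l.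
  elim: n => [|n IHn]; first by rewrite !expr0 !mul1r.
  by rewrite !exprS -mulrA mulN1r hatNE IHn -mulrA mulN1r.
apply/funext => l; rewrite hCM sg /Gam mulrA /hpsi; case: ifP => al; last by rewrite !mulr0.
have [ol|el] := boolP (odd (sumn (m %/ i :: [seq (x %/ i)%N | x <- l])%N)); last first.
  by rewrite /hD ha_even // comp_poly0 !mulr0.
rewrite -exprD; congr (_ * _).
rewrite -(signr_odd _ (m + _)%N) -(signr_odd _ i) -(sumn_div al) -{1}(divnK im) -mulnDl oddM.
by move: ol => /= ->.
Qed.

Lemma hD_c_add_p1 m : hD m (hc + hp1) = (hc + hp1) * sig_tw ha m.
Proof.
have GE : Gam (-1) (hc - hp1) = hc + hp1.
  by rewrite GamD GamN Gam_hc Gam_p1 hCN hC1 mulN1r opprK.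
rewrite -{1}GE hD_Gam hD_c_sub_p1 GamM GamN GE mulrCA mulNr -mulrN; congr (_ * _).
rewrite /sig_tw /sig (big_morph (Gam (-1)) (@GamD (-1)) (_ : Gam (-1) 0 = 0)); last first.
  by apply/funext => l; rewrite /Gam hat0E mulr0.
rewrite mulr_sumr -sumrN big_seq [RHS]big_seq; apply: eq_bigr => i /divisors_gt0/andP[im i0].
by rewrite sign_psi // exprS mulN1r mulNr.
Qed.

Lemma hpl_D f f' g : hpl (f + f') g = hpl f g + hpl f' g.
Proof.
apply/funext => l; rewrite hatDE /hpl -big_split /=; apply: eq_bigr => mu _.
by rewrite hatDE mulrDr mulrDl.
Qed.
Lemma hpl_N f g : hpl (- f) g = - hpl f g.
Proof.
apply/funext => l; rewrite hatNE /hpl -sumrN; apply: eq_bigr => mu _.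
by rewrite hatNE mulrN mulNr.
Qed.

Lemma hat_ode1 (h : nat -> hat) (F G : hat) : F [::] = G [::] ->
  (forall m, hD m F = F * h m) -> (forall m, hD m G = G * h m) -> F = G.
Proof.
move=> e dF dG; have [] // := @hat_ode2 h (fun=> 0) F F G G e e;
  by move=> m; rewrite mul0r subr0 mulrC.
Qed.

Lemma hE_sym : hsym hE.
Proof. by move=> l l' p; rewrite !hexpE (perm_mem p). Qed.
Lemma hS_sym : hsym hS.
Proof. by move=> l l' p; rewrite /hS (perm_mem p) (perm_sumn p) /evenct (seq.permP p). Qed.
Lemma hCo_sym : hsym hCo.
Proof. by move=> l l' p; rewrite /hCo (perm_mem p) (perm_sumn p) /evenct (seq.permP p). Qed.

Lemma hD_S i : (0 < i)%N -> hD i hS = if odd i then hCo else - hS.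
Proof.
move=> i0; apply/funext => l; rewrite /hD /hS /hCo in_cons negb_or (ltn_eqF i0) /= oddD.
case: (odd i) => /=; first by rewrite add0n.
by rewrite hatNE exprS mulN1r mulrN.
Qed.
Lemma hD_Co i : (0 < i)%N -> hD i hCo = if odd i then hS else - hCo.
Proof.
move=> i0; apply/funext => l; rewrite /hD /hS /hCo in_cons negb_or (ltn_eqF i0) /= oddD.
case: (odd i) => /=; first by rewrite add0n negbK.
by rewrite hatNE exprS mulN1r mulrN.
Qed.

Lemma hat_half (F G : hat) : F + F = G + G -> F = G.
Proof.
move=> e; apply/funext => l; have := congr1 (fun H : hat => H l) e; rewrite !hatDE => e'.
by rewrite -[F l]half_half e' half_half.
Qed.

Lemma ha_nil : ha [::] = 0. Proof. by rewrite /ha !mul0r. Qed.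

(** Cosh~ - Sinh~ is Exp^(-1) and Cosh~ + Sinh~ is the exponential of the sum of (-1)^(i+1) p_i / i.
    By the chain rule their plethysms with a satisfy the first-order equations of c - p_1 and c +
    p_1, and uniqueness applies to each sign separately. *)
Lemma pl_sinh_cosh : hpl hS ha = hp1 /\ hpl hCo ha = hc.
Proof.
have sB : hsym (hCo - hS) by move=> l l' p; rewrite !hatDE !hatNE (hCo_sym p) (hS_sym p).
have sA : hsym (hCo + hS) by move=> l l' p; rewrite !hatDE (hCo_sym p) (hS_sym p).
have eB : hpl (hCo - hS) ha = hc - hp1.
  apply: (@hat_ode1 (fun m => - sig ha m)) => [|m|m]; last by rewrite hD_c_sub_p1; ring.
    by rewrite hpl_nil !hatDE !hatNE hc_nil /hCo /hS /hp1 /= mul0r mul1r.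
  rewrite (hD_pl _ sB ha_nil ha_pos) mulrN mulr_sumr -sumrN big_seq [RHS]big_seq.
  apply: eq_bigr => i /divisors_gt0/andP[im i0]; rewrite -mulNr -hpl_N; congr (hpl _ _ * _).
  by rewrite hD_add hD_opp hD_S // hD_Co //; case: odd; ring.
have eA : hpl (hCo + hS) ha = hc + hp1.
  apply: (@hat_ode1 (sig_tw ha)) => [|m|m]; last exact: hD_c_add_p1.
    by rewrite hpl_nil !hatDE hc_nil /hCo /hS /hp1 /= mul0r mul1r.
  rewrite (hD_pl _ sA ha_nil ha_pos) mulr_sumr big_seq [RHS]big_seq.
  apply: eq_bigr => i /divisors_gt0/andP[im i0]; rewrite mulrA; congr (_ * _).
  rewrite hD_add hD_S // hD_Co // -signr_odd /=; case: odd; first by rewrite expr0 mulr1 addrC.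
  by rewrite -opprD hpl_N expr1 mulrN1.
move: eA eB; rewrite !hpl_D hpl_N => eA eB; split; apply: hat_half.
  transitivity ((hpl hCo ha + hpl hS ha) - (hpl hCo ha - hpl hS ha)); first by ring.
  by rewrite eA eB; ring.
transitivity ((hpl hCo ha + hpl hS ha) + (hpl hCo ha - hpl hS ha)); first by ring.
by rewrite eA eB; ring.
Qed.

Lemma hx_nil : hx [::] = 0. Proof. by rewrite /hx !mul0r. Qed.

Lemma pl_exp : hpl hE hx = hP.
Proof.
apply: (@hat_ode1 (sig hx)) => [|m|m]; last exact: hP_rec.
  by rewrite hpl_nil hP_nil hexpE.
rewrite (hD_pl _ hE_sym hx_nil hx_pos) mulr_sumr big_seq [RHS]big_seq.
by apply: eq_bigr => i /divisors_gt0/andP[im i0]; rewrite hD_E.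
Qed.

(** * Plethysm and the scaling by powers of s *)

Lemma psi_Gam m g : hpsi m (Gam 'X g) = Gam 'X (hpsi m g).
Proof.
apply/funext => l; rewrite /Gam /hpsi; case: ifP => al; last by rewrite mulr0.
by rewrite comp_polyM comp_Xn_poly -exprM mulnC sumn_div // mulrCA.
Qed.

Lemma Gp_Gam g mu : hGp (Gam 'X g) mu = Gam 'X (hGp g mu).
Proof.
rewrite /hGp; elim: mu => [|m mu IHm]; first by rewrite !big_nil Gam1.
by rewrite !big_cons IHm GamM psi_Gam.
Qed.

Lemma pl_Gam f g : hpl f (Gam 'X g) = Gam 'X (hpl f g).
Proof.
apply/funext => l; rewrite /hpl /Gam mulr_sumr; apply: eq_bigr => mu _.
by rewrite -/(Gam 'X g) Gp_Gam /Gam mulrCA.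
Qed.

Definition hsp1 : hat := hC 'X * hp1.

Lemma hsp1_pos : hpos hsp1.
Proof. by move=> l l0; rewrite /hsp1 hCM hp1_pos ?mulr0. Qed.
Lemma hsp1_nil : hsp1 [::] = 0. Proof. by rewrite /hsp1 hCM mulr0. Qed.

Lemma hpsi_C m c : hpsi m (hC c) = hC (c \Po 'X^m).
Proof.
apply/funext => -[|a l]; first by rewrite /hpsi /hC /= expn0 mul1r !mulr1.
by rewrite /hpsi /hC /= mulr0 comp_poly0 !mulr0 if_same.
Qed.

(** In the chain rule for D_a only the divisor i = a survives, and psi_a(s) is s^a. *)
Lemma pl_sp1 f : hsym f -> hpos f -> hpl f hsp1 = Gam 'X f.
Proof.
move=> sf pf; apply/funext => l; elim: l f sf pf => [|a l IHl] f sf pf.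
  by rewrite hpl_nil /Gam expr0 mul1r.
rewrite -[LHS]/(hD a (hpl f hsp1) l) (hD_pl _ sf hsp1_nil hsp1_pos).
case: (posnP a) => [->|a0].
  rewrite (_ : divisors 0 = [:: 1%N]) // big_seq1 div0n (hD_0 hsp1_pos) hpsi_0 mulr0.
  by rewrite /Gam pf ?mulr0 // mem_head.
have DE i : hD i hsp1 = if i == 1%N then hC 'X else 0.
  by rewrite /hsp1 hD_mul hD_C mul0r add0r hD_p1; case: ifP; rewrite ?mulr1 ?mulr0.
rewrite (bigD1_seq a) ?divisors_uniq ?divisors_id //= divnn a0 DE hatDE hat_sumE.
rewrite big_seq_cond big1 ?addr0 => [|i]; last first.
  rewrite -dvdn_divisors // => /andP[ia ne]; rewrite DE; case: eqP => [e|_]; last by rewrite hpsi_0 mulr0.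
  by case/eqP: ne; rewrite -{1}(divnK ia) e mul1n.
rewrite hpsi_C comp_polyX mulrC hCM IHl; first by rewrite /Gam /= exprD mulrA.
- by move=> x y p; apply: sf; rewrite perm_cons.
by move=> x x0; apply: pf; rewrite in_cons x0 orbT.
Qed.

(** * The extended cycle index *)

Definition agree n (g g' : hat) := forall l, is_part l -> (sumn l < n)%N -> g l = g' l.

Lemma sumn_div_le m l : (sumn [seq (x %/ m)%N | x <- l] <= sumn l)%N.
Proof. by elim: l => [//|a l IHl] /=; apply: leq_add; rewrite ?leq_div. Qed.

Lemma agree_psi n m g g' : (0 < m)%N -> agree n g g' -> agree n (hpsi m g) (hpsi m g').
Proof.
move=> m0 e l pl sl; rewrite /hpsi; case: ifP => // al; rewrite e ?part_div //.
exact: leq_ltn_trans (sumn_div_le m l) sl.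
Qed.

Lemma agreeM n (f f' g g' : hat) : agree n f f' -> agree n g g' -> agree n (f * g) (f' * g').
Proof.
move=> ef eg l pl sl; rewrite !hatM_mk big_seq [RHS]big_seq; apply: eq_bigr => x xl.
have /andP[p1 p2] := mk_part pl xl; have sx := mk_sumn xl.
by rewrite ef ?eg //; apply: leq_ltn_trans sl; rewrite -sx ?leq_addl ?leq_addr.
Qed.

Lemma agree_Gp n g g' mu : is_part mu -> agree n g g' -> agree n (hGp g mu) (hGp g' mu).
Proof.
case/andP=> _ pm e; rewrite /hGp; elim: mu pm => [|m mu IHm] /=; first by rewrite !big_nil.
by case/andP=> m0 /IHm H; rewrite !big_cons; apply: agreeM => //; apply: agree_psi.
Qed.

(* In a product of two factors without constant term only strictly smaller lists occur. *)
Lemma agreeMS n (f f' g g' : hat) : agree n f f' -> agree n g g' ->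
  f [::] = 0 -> f' [::] = 0 -> g [::] = 0 -> g' [::] = 0 -> agree n.+1 (f * g) (f' * g').
Proof.
move=> ef eg f0 f0' g0 g0' l pl; rewrite ltnS => sl.
rewrite !hatM_mk big_seq [RHS]big_seq; apply: eq_bigr => x xl.
have /andP[p1 p2] := mk_part pl xl; have sx := mk_sumn xl.
have [z1|z1] := posnP (sumn x.1).
  by rewrite (sumn0 z1 (part_pos p1)) f0 f0' !mul0r.
have [z2|z2] := posnP (sumn x.2).
  by rewrite (sumn0 z2 (part_pos p2)) g0 g0' !mulr0.
by rewrite ef ?eg //; move: (sumn x.1) (sumn x.2) (sumn l) sx sl z1 z2; clear; move=> a b c; lia.
Qed.

Lemma hpsi_nil m (g : hat) : g [::] = 0 -> hpsi m g [::] = 0.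
Proof. by move=> g0; rewrite /hpsi /= g0 comp_poly0 mulr0. Qed.

Lemma Gp_nil m mu (g : hat) : g [::] = 0 -> hGp g (m :: mu) [::] = 0.
Proof. by move=> g0; rewrite /hGp big_cons hatM_nil hpsi_nil ?mul0r. Qed.

(** Except for mu = [1], a product of psi_m(g) in degree n uses only smaller degrees of g: a single
    psi_m with m >= 2 divides degrees by m, and two factors without constant term share the
    degree. *)
Lemma agree_GpS n g g' mu : g [::] = 0 -> g' [::] = 0 -> is_part mu -> mu != [:: 1%N] ->
  (0 < n)%N -> agree n g g' -> agree n.+1 (hGp g mu) (hGp g' mu).
Proof.
move=> g0 g0' pm m1 n0 e; case: mu pm m1 => [|m [|m' mu]] pm m1.
- by rewrite /hGp !big_nil.
- rewrite /hGp !big_seq1 => l pl; rewrite ltnS => sl.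
  rewrite part_one in pm; have m2 : (1 < m)%N by case: m pm m1 => [|[|m]].
  rewrite /hpsi; case: ifP => // al; rewrite e ?part_div //.
  have := sumn_div al; move: (sumn [seq _ | _ <- _]) => s es.
  by clear -es sl m2 n0; nia.
have /and3P[_ a0 pm'] : [&& sorted geq (m :: m' :: mu), (0 < m)%N & all (fun x => 0 < x)%N (m' :: mu)].
  by have := pm; rewrite /is_part /= => /andP[-> ->].
have pm2 : is_part (m' :: mu) by rewrite /is_part pm' andbT; case/andP: pm => /path_sorted.
have E h : hGp h [:: m, m' & mu] = hpsi m h * hGp h (m' :: mu) by rewrite /hGp big_cons.
by rewrite !E; apply: agreeMS; rewrite ?hpsi_nil ?Gp_nil //; [apply: agree_psi|apply: agree_Gp].
Qed.

(** Induction on the degree: the term p_1 of f contributes g itself, and all other terms agree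
    already. *)
Lemma pl_inj f g g' : f [:: 1%N] = 1 -> g [::] = 0 -> g' [::] = 0 ->
  (forall l, is_part l -> hpl f g l = hpl f g' l) -> forall l, is_part l -> g l = g' l.
Proof.
move=> f1 g0 g0' e l pl; suff H n : agree n.+1 g g' by apply: (H (sumn l)).
elim: n => [|n IHn] {l pl} l pl.
  rewrite ltnS leqn0 => /eqP s0; by rewrite (sumn0 s0 (part_pos pl)) g0 g0'.
rewrite ltnS leq_eqVlt => /orP[/eqP sl|]; last exact: IHn.
have := e l pl; rewrite /hpl.
have m1 : [:: 1%N] \in parts_upto (sumn l) by rewrite mem_parts sl.
rewrite !(bigD1_seq [:: 1%N] m1 (parts_uniq _)) /= /hGp !big_seq1 !hpsi1 f1.
set r := \sum_(_ <- _ | _) _; set r' := \sum_(_ <- _ | _) _.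
have -> : r = r'.
  rewrite /r /r' big_seq_cond [RHS]big_seq_cond; apply: eq_bigr => mu /andP[].
  rewrite mem_parts => /andP[pm _] m1'; congr (_ * _).
  by apply: (agree_GpS g0 g0' pm m1' (n := n.+1)) => //; rewrite sl.
move/addIr; rewrite /zi /= !muln1 invr1 !mul1r //.
Qed.

(** Only the values of [A] on partitions carry information. Other lists take the value of their
    sorted form and lists with a part 0 the value 0, which ensures [hsym] and [hpos]. *)
Definition hat_of (A : series) : hat := fun l =>
  if 0%N \in l then 0 else ((zz l)%:R * A 0%N (sort geq l))%:P.

Lemma hat_of_pos A : hpos (hat_of A).
Proof. by move=> l l0; rewrite /hat_of l0. Qed.

Lemma hat_of_sym A : hsym (hat_of A).
Proof.
move=> l l' p; rewrite /hat_of (perm_mem p) (zz_perm p).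
by have /(perm_sortP geq_total geq_trans geq_anti) -> := p.
Qed.

Lemma rep_hat_of A : (forall j l, is_part l -> (0 < j)%N -> A j l = 0) -> rep A (hat_of A).
Proof.
move=> A0 j l pl; rewrite /hat_of (negbTE (part_pos pl)) coefC sorted_sort; last 2 first.
- exact: geq_trans.
- by case/andP: pl.
by case: eqP => [-> //|/eqP]; rewrite -lt0n => j0; rewrite A0 ?mulr0.
Qed.

Lemma rep_ext F f g : rep F f -> (forall l, is_part l -> f l = g l) -> rep F g.
Proof. by move=> rF e j l pl; rewrite rF // e. Qed.

Lemma rep_Xp1 n : rep (fun j l => ((j == n) && (l == [:: 1%N]))%:R) (hC 'X^n * hp1).
Proof.
move=> j l pl; rewrite hCM /hp1; case: (eqVneq l [:: 1%N]) => [->|_]; last by rewrite andbF !mulr0 coef0.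
by rewrite andbT mul1r mulr1 coefXn.
Qed.

(** 1/(1 - t) is not a polynomial in s; this truncation agrees with it at least up to s^j. *)
Definition geo j : {poly rat} := \sum_(i < j.+1) ('X^2) ^+ i.

Lemma geo_coef j i : (i <= j)%N -> (geo j)`_i = (~~ odd i)%:R.
Proof.
move=> ij; rewrite /geo coef_sum.
under eq_bigr do rewrite -exprM coefXn mul2n.
have [oi|ei] := boolP (odd i).
  by rewrite big1 // => k _; case: eqP => // e; rewrite e odd_double in oi.
have lt : (i./2 < j.+1)%N by clear -ij; lia.
rewrite (bigD1 (Ordinal lt)) //= even_halfK // eqxx big1 ?addr0 // => k ne.
by case: eqP => // e; case/eqP: ne; apply: val_inj; rewrite /= e doubleK.
Qed.

Lemma geoM j : geo j * (1 - 'X^2) = 1 - 'X^(2 * j.+1).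
Proof. by rewrite exprM -[RHS]opprB subrX1 -[RHS]mulNr opprB mulrC. Qed.

Section Formula.
Variable A : series.
Hypothesis hA : is_arcsinh_tilde A.

(** [A] and a both have plethysm p_1 with Sinh~ on the left, and Sinh~ can be cancelled by
    [pl_inj]. *)
Lemma rep_A_ha : rep A ha.
Proof.
have [A0 [An [S1 _]]] := hA; have rA := rep_hat_of A0.
have n0 : hat_of A [::] = 0 by rewrite /hat_of /= An mulr0.
apply: (rep_ext rA); apply: (@pl_inj hS _ _ _ n0 ha_nil) => [|l pl].
  by rewrite /hS /= mul1r.
have [-> _] := pl_sinh_cosh; apply/polyP => j.
rewrite -(rep_pleth rep_tSinh rA n0 (@hat_of_pos A)) // S1 //.
by have := @rep_Xp1 0 j l pl; rewrite expr0 hC1 mul1r.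
Qed.

Lemma rep_A_sqrt : rep (pleth A sqrt_t_p1) (Gam 'X ha).
Proof.
have [A0 [An _]] := hA; have rA := rep_hat_of A0.
have rs : rep sqrt_t_p1 hsp1 by have := rep_Xp1 1; rewrite expr1.
apply: (rep_ext (rep_pleth rA rs hsp1_nil hsp1_pos)) => l pl.
rewrite (pl_sp1 (@hat_of_sym A) (@hat_of_pos A)) /Gam; congr (_ * _).
by apply/polyP => j; rewrite -rA // rep_A_ha.
Qed.

Lemma rep_Xarg : rep (Xarg A) hx.
Proof.
move=> j l pl; rewrite /Xarg rep_A_sqrt // hx_a /Gam.
have [s0|s0] := posnP (sumn l); first by rewrite (sumn0 s0 (part_pos pl)) ha_nil !mulr0 !coef0.
by rewrite -{1}(prednK s0) exprS -mulrA coefXM.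
Qed.

Definition Zinner : series :=
  smul (sadd (sopp t_p1) (pleth (tilde CoshS) (pleth A sqrt_t_p1))) (pleth ExpS (Xarg A)).

Lemma rep_inner : rep Zinner hY.
Proof.
rewrite /hY [Gam _ _ - _]addrC; apply: rep_smul; last first.
  by rewrite -pl_exp; apply: rep_pleth rep_ExpS rep_Xarg hx_nil hx_pos.
apply: rep_sadd; first exact/rep_sopp/rep_Xp1.
have [_ <-] := pl_sinh_cosh; rewrite -pl_Gam; apply: rep_pleth rep_tCosh rep_A_sqrt _ _.
  by rewrite /Gam ha_nil mulr0.
by move=> l l0; rewrite /Gam ha_pos ?mulr0.
Qed.

Lemma formula_coef j l : is_part l ->
  (zz l)%:R * Zext_formula A j l = (hZ l)`_j + (~~ odd j)%:R * (l == [::])%:R.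
Proof.
move=> pl; pose inv' : series := fun i m => (geo j)`_i * (m == [::])%:R.
have ri : rep inv' (hC (geo j)).
  move=> i m pm; rewrite /inv' /hC; case: eqP => [->|_]; last by rewrite !mulr0 coef0.
  by rewrite !mulr1 mul1r.
have -> : Zext_formula A j l = smul inv' Zinner j l.
  apply: eq_bigr => i _; apply: eq_bigr => x _; congr (_ * _).
  rewrite /inv' /inv_one_minus_t geo_coef; last by rewrite -ltnS.
  by case: odd; case: eqP; rewrite ?mul0r ?mulr1 ?mulr0.
rewrite (rep_smul ri rep_inner) // hY_Z hCM hatDE hCM mulrDr coefD mulrA geoM; congr (_ + _).
  rewrite mulrBl mul1r coefB coefXnM.
  by rewrite (_ : (j < 2 * j.+1)%N) ?subr0 //; clear; lia.
rewrite hat1E; case: eqP => _; last by rewrite !mulr0 coef0.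
by rewrite !mulr1 geo_coef.
Qed.

End Formula.

(** * Homogeneous components and their constants *)

Definition hZk k : hat := fun l => if l == [::] then 0 else (chi4v k l)%:P.

(** The n!/z_l permutations of type l all have the same trace. *)
Lemma Zk_coef k l : is_part l -> l != [::] -> (zz l)%:R * Zk k 0%N l = chi4v k l.
Proof.
move=> pl ln; have s0 : (0 < sumn l)%N.
  by rewrite lt0n; apply: contra ln => /eqP s0; rewrite (sumn0 s0 (part_pos pl)).
rewrite /Zk s0 /=.
rewrite (eq_bigr (fun=> chi4v k l)); last first.
  move=> p /eqP ep; rewrite trLambdaE; have [xs [cx xE ex]] := ctype_sys p.
  rewrite -xE chi4v_sys ?ex ?ep //.
  by apply: contraNneq ln => x0; rewrite -ep -ex x0.
rewrite (eq_bigl (fun p => p \in [set q : 'S_(sumn l) | ctype q == l])) => [|q]; last by rewrite [RHS]inE.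
rewrite sumr_const; have c := count_ctype pl; rewrite -(mulr_natl (chi4v k l)).
have : ((#|[set q : 'S_(sumn l) | ctype q == l]| * zz l)%N)%:R = ((sumn l)`!)%:R :> rat by rewrite c.
rewrite natrM; move: (#|_|%:R) => n e.
transitivity ((n * (zz l)%:R) / ((sumn l)`!)%:R * chi4v k l); first by ring.
by rewrite e divff ?mul1r // pnatr_eq0 -lt0n fact_gt0.
Qed.

Lemma rep_Zk k : rep (Zk k) (hZk k).
Proof.
move=> j l pl; rewrite /hZk; case: eqP => [->|/eqP ln].
  by rewrite /Zk andbF mulr0 coef0.
rewrite coefC; case: eqP => [->|j0]; first exact: Zk_coef.
by rewrite /Zk; case: eqP j0 => // _ _; rewrite mulr0.
Qed.

Lemma rep_Z_Lambda : rep Z_Lambda hZ.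
Proof.
move=> j l pl; rewrite /Z_Lambda; have [->|ln] := eqVneq l [::].
  by rewrite /Zk andbF mulr0 if_same mulr0 coef0.
rewrite hZ_coef //; case: odd; first by rewrite mulr0.
by rewrite mulrCA Zk_coef.
Qed.

Definition hZc k c : hat := hZk k + hC c%:P.

Lemma rep_Zc k c : rep (smul (Zk_plus k c) ExpInv) (hZc k c * hEinv).
Proof.
apply: rep_smul rep_ExpInv; apply: rep_sadd (rep_Zk k) _.
by have := rep_sscale c rep_sone; rewrite mulr1.
Qed.

Lemma hEinvE l : hEinv l = ((0%N \notin l)%:R * (-1) ^+ size l)%:P.
Proof.
rewrite /hEinv /hexp; elim: l => [|a l IHl]; first by rewrite big_nil mulr1.
rewrite big_cons IHl -polyCM; congr (_%:P); rewrite in_cons negb_or lt0n eq_sym /=.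
by case: eqP => _ /=; rewrite ?oppr0 ?mul0r // mulN1r -mulrN exprS mulN1r.
Qed.

Lemma hZc_const k c l j : (0 < j)%N -> ((hZc k c * hEinv) l)`_j = 0.
Proof.
move=> j0; rewrite hatM_mk coef_sum big1 // => x _; rewrite hEinvE coefMC /hZc hatDE /hC /hZk.
case: eqP => _; rewrite ?mulr1 ?mulr0 ?add0r ?addr0 coefC; case: eqP j0 => [->|] //;
  by rewrite mul0r.
Qed.

(** (Z + 1/(1 - t)) Exp^(-1) is Y Exp^(-1) / (1 - t), whose coefficient of s^(2k) has degree at most
    3k by [val_YEinv]; the sign (-1)^k translates between t^k and (-t)^k. *)
Lemma hZc_vanish k l : (3 * k < sumn l)%N -> ((hZc k ((-1) ^+ k) * hEinv) l)`_0 = 0.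
Proof.
move=> kl.
have E : ((hZc k ((-1) ^+ k) * hEinv) l)`_0 = (-1) ^+ k * (((hZ + hC (geo (2 * k))) * hEinv) l)`_(2 * k).
  rewrite !hatM_mk !coef_sum mulr_sumr; apply: eq_bigr => x _.
  rewrite hEinvE !coefMC; rewrite [in RHS]mulrA; congr (_ * _).
  rewrite /hZc !hatDE !coefD mulrDr /hC; congr (_ + _).
    rewrite /hZk; case: eqP => [->|/eqP xn]; first by rewrite /hZ /= !coef0 mulr0.
    rewrite coefC /= hZ_coef // mul2n odd_double doubleK mulrA -expr2 -exprM mulnC exprM.
    by rewrite sqrrN !expr1n mul1r.
  case: eqP => _; last by rewrite !mulr0 !coef0 mulr0.
  by rewrite !mulr1 coefC /= geo_coef // mul2n odd_double mulr1.
(* The truncation of 1/(1 - t) leaves an error starting at s^(4k+2), beyond the coefficient of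
   s^(2k) that is used. *)
have Q : hC (geo (2 * k)) * (hY * hEinv) =
    (hZ + hC (geo (2 * k))) * hEinv - hC 'X^(2 * (2 * k).+1) * (hZ * hEinv).
  rewrite hY_Z; have := geoM (2 * k); set q := geo _ => qE.
  transitivity ((hC q * hC (1 - 'X^2)) * hZ * hEinv + hC q * hEinv); first by ring.
  by rewrite -hCM2 qE hCD hCN hC1; ring.
rewrite E; have -> : (((hZ + hC (geo (2 * k))) * hEinv) l)`_(2 * k) = ((hC (geo (2 * k)) * (hY * hEinv)) l)`_(2 * k).
  rewrite Q hatDE hatNE coefB hCM coefXnM.
  by rewrite (_ : (2 * k < 2 * (2 * k).+1)%N) ?subr0 //; clear; lia.
rewrite hCM coefM big1 ?mulr0 // => i _; rewrite val_YEinv ?mulr0 //.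
by rewrite addn0; move: (nat_of_ord i) (sumn l) kl; clear; move=> i' s; lia.
Qed.

Lemma spoly_Zc k : spoly (smul (Zk_plus k ((-1) ^+ k)) ExpInv).
Proof.
exists (3 * k)%N => j l pl h; rewrite (rep_eq _ (rep_Zc k _) pl).
case: (posnP j) h => [->|j0] h; last by rewrite hZc_const ?mul0r.
by rewrite hZc_vanish ?mul0r // -[sumn l]add0n.
Qed.

(** Two admissible constants would differ by a factor in front of Exp^(-1), which is not a
    polynomial; a power of p_1 beyond both degree bounds detects the factor. *)
Lemma spoly_uniq k c : spoly (smul (Zk_plus k c) ExpInv) -> c = (-1) ^+ k.
Proof.
case=> N HN; have [N' HN'] := spoly_Zc k.
pose l := nseq (N + N').+1 1%N.
have sl : sumn l = (N + N').+1 by rewrite /l sumn_nseq mul1n.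
have pl : is_part l.
  by rewrite /is_part all_nseq orbT andbT /l /=; elim: (N + N')%N => //= n ->.
have h1 := HN 0%N l pl; have h2 := HN' 0%N l pl.
rewrite add0n sl in h1 h2.
have e1 := rep_Zc k c 0%N pl; have e2 := rep_Zc k ((-1) ^+ k) 0%N pl.
rewrite h1 ?mulr0 in e1; last by rewrite ltnS leq_addr.
rewrite h2 ?mulr0 in e2; last by rewrite ltnS leq_addl.
have : (((hZc k c - hZc k ((-1) ^+ k)) * hEinv) l)`_0 = 0.
  by rewrite mulrBl hatDE hatNE coefB -e1 -e2 subrr.
have -> : hZc k c - hZc k ((-1) ^+ k) = hC (c - (-1) ^+ k)%:P.
  by rewrite /hZc polyCB hCD hCN; ring.
rewrite hCM hEinvE -polyCM coefC /=; case: (0%N \notin l) (part_pos pl) => // _.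
rewrite mul1r => /eqP; rewrite mulf_eq0 signr_eq0 orbF subr_eq0 => /eqP //.
Qed.

Theorem theorem5p4 :
  forall A : series, is_arcsinh_tilde A ->
    (forall k : nat, exists c : rat, spoly (smul (Zk_plus k c) ExpInv)) /\
    (forall c : nat -> rat,
       (forall k : nat, spoly (smul (Zk_plus k (c k)) ExpInv)) ->
       ser_eq (Zext c) (Zext_formula A) /\ ser_eq (C_Lambda c) inv_one_minus_t).
Proof.
move=> A hA; split=> [k|c hc]; first by exists ((-1) ^+ k); apply: spoly_Zc.
have CE j l : C_Lambda c j l = inv_one_minus_t j l.
  rewrite /C_Lambda /inv_one_minus_t (spoly_uniq (hc _)); case: odd => //=.
  by rewrite -expr2 -exprM mulnC exprM sqrrN !expr1n mul1r.
split=> [|j l _]; last exact: CE.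
move=> j l pl; apply: (mulfI (zz_part_neq0 pl)).
rewrite (formula_coef hA) // /Zext /sadd mulrDr rep_Z_Lambda // addrC CE /inv_one_minus_t.
congr (_ + _); case: (eqVneq l [::]) => [->|_]; last by rewrite andbF !mulr0.
by rewrite andbT mul1r mulr1.
Qed.
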